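(* Let $a>0$, let $K\in L^\infty(\Omega_0)$ be real-valued with $\|K\|_{L^\infty(\Omega_0)}\,a^2<\tfrac12$, and assume that $\operatorname{supp}(K)\cap\Omega_0$ is bounded. Assume that there exists a measurable function $\rho:\Omega_0\to(0,\infty)$ such that $$h_K[\psi]-E_1\|\psi\|_f^2\ \ge\ \int_{\Omega_0}\rho\,|\psi|^2\,f\,dx\qquad\text{for all }\psi\in H_0^1(\Omega_0).$$ Let $x\in\Omega_0$, $\delta>0$ and a measurable bounded subset $B\subset\Omega_0$ be given. Then there exists a constant $C_{B,\delta,x}>0$ such that for all $t\ge1$ $$\mathbb{P}_x\big(X_t\in B,\tau_{\Omega_0}>t\big)\le C_{B,\delta,x}\,e^{-E_1t}\,t^{-\frac32+\delta}.$$
   Context: $\Omega_0:=\mathbb{R}\times(-a,a)$, points are $x=(x_1,x_2)$. $K$ is represented by a measurable function with $|K|\le\|K\|_{L^\infty(\Omega_0)}$ everywhere. For each $x_1\in\mathbb{R}$, $f(x_1,\cdot)\in H^2((-a,a))$ is the solution of the Jacobi equation $\partial_2^2 f+Kf=0$ with $f(x_1,0)=1$, $\partial_2 f(x_1,0)=0$ (under the assumption $\|K\|_\infty a^2<1/2$, $f$ is bounded and uniformly positive on $\Omega_0$). $L^2_f(\Omega_0):=L^2(\Omega_0,f(x)\,dx)$ with norm $\|\cdot\|_f$. $H_K$ is the self-adjoint operator in $L^2_f(\Omega_0)$ associated with the closed quadratic form $h_K[\psi]:=\int_{\Omega_0}\big(f^{-1}|\partial_1\psi|^2+f|\partial_2\psi|^2\big)dx$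 with domain $H_0^1(\Omega_0)$. $E_1:=(\pi/(2a))^2$. Extend $f$ by $1$ to $\mathbb{R}^2$. $(X_t)_{t\ge0}$ is the conservative strong Markov process with continuous paths associated with the Dirichlet form $\int_{\mathbb{R}^2}(f^{-1}|\partial_1\psi|^2+f|\partial_2\psi|^2)dx$, $\psi\in H^1(\mathbb{R}^2)$, in $L^2(\mathbb{R}^2,f\,dx)$; $\mathbb{P}_x$ is the law started at $x$ and $\tau_{\Omega_0}$ is the first hitting time of $\partial\Omega_0$. For $x\in\Omega_0$ and $B\subset\Omega_0$ bounded measurable, $\mathbb{P}_x(X_t\in B,\tau_{\Omega_0}>t)$ is the value at $x$ of the continuous representative of $e^{-tH_K}\chi_B$. *)

(* Defs.v *)
From HB Require Import structures.
From mathcomp Require Import all_boot all_order all_algebra.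
From mathcomp Require Import all_classical all_reals all_analysis.

Set Implicit Arguments.
Unset Strict Implicit.
Unset Printing Implicit Defensive.

Import Order.TTheory GRing.Theory Num.Theory.
Import numFieldNormedType.Exports.

Local Open Scope classical_set_scope.
Local Open Scope ring_scope.

Notation plane R := (measurableTypeR R * measurableTypeR R)%type.

Section planar_strip.
Context {R : realType}.

Definition leb2 : {measure set (plane R) -> \bar R} :=
  (@lebesgue_measure R \x @lebesgue_measure R)%E.

Definition strip (a : R) : set (plane R) := [set x | - a < x.2 < a].

Definition frontier (A : set (plane R)) : set (plane R) := closure A `\` A°.

Definition E1 (a : R) : R := (pi / (2 * a)) ^+ 2.

Definition Linfty_norm (U : set (plane R)) (K : plane R -> R) : \bar R :=
  'N[leb2]_+oo[EFin \o patch (cst 0%R) U K]%E.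

(* Support of the class of K in L^oo(U): complement of the largest open set on
   which K vanishes almost everywhere. *)
Definition ess_support (U : set (plane R)) (K : plane R -> R) : set (plane R) :=
  [set x | forall V, open V -> V x ->
     (0 < leb2 (V `&` U `&` [set y | K y != 0%R]))%E].

End planar_strip.

(* Weighted L^2 spaces L^2(D, w dmu).  Elements are functions; classes are
   handled through almost everywhere equality. *)
Section weighted_L2.
Context d {T : measurableType d} {R : realType}.
Variables (mu : {measure set T -> \bar R}) (D : set T) (w : T -> R).

Definition sqnorm (u : T -> R) : \bar R :=
  (\int[mu]_(x in D) ((u x) ^+ 2 * w x)%:E)%E.

Definition inL2 (u : T -> R) : Prop :=
  measurable_fun D u /\ (sqnorm u < +oo)%E.

Definition dotL2 (u v : T -> R) : R := \int[mu]_(x in D) (u x * v x * w x).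

End weighted_L2.

(* The equation u'' + k u = 0 on (-a, a), u(0) = 1, u'(0) = 0, in H^2((-a, a)). *)
Section jacobi.
Context {R : realType}.
Variable a : R.

Definition sym_interval : set R := `](- a), a[%classic.

Definition test_function1 (phi : R -> R) : Prop :=
  (forall n s, derivable (derive1n n phi) s 1) /\
  exists2 C : set R, compact C /\ C `<=` sym_interval &
    forall s, ~ C s -> phi s = 0.

Definition weak_derivative1 (u g : R -> R) : Prop :=
  forall phi, test_function1 phi ->
    (\int[@lebesgue_measure R]_(s in sym_interval) (u s * derive1 phi s)) =
    - (\int[@lebesgue_measure R]_(s in sym_interval) (g s * phi s)).

Definition L2_interval (u : R -> R) : Prop :=
  inL2 (@lebesgue_measure R) sym_interval (cst 1) u.

Definition H2_interval (u g1 g2 : R -> R) : Prop :=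
  [/\ L2_interval u, L2_interval g1, L2_interval g2,
      weak_derivative1 u g1 & weak_derivative1 g1 g2].

(* H^2((-a, a)) embeds in C^1, and u is the C^1 representative, so that the
   conditions at 0 are meaningful. *)
Definition jacobi_solution (k u : R -> R) : Prop :=
  (exists g1 g2, H2_interval u g1 g2 /\
     (g2 \+ k \* u = cst 0 %[ae (@lebesgue_measure R) in sym_interval])) /\
  (forall s, sym_interval s ->
     derivable u s 1 /\ {for s, continuous (derive1 u)}) /\
  u 0 = 1 /\ derive1 u 0 = 0.

End jacobi.

Section sobolev.
Context {R : realType}.
Implicit Types (U : set (plane R)) (psi phi : plane R -> R).

Definition partial1 (phi : plane R -> R) : plane R -> R :=
  fun x => 'D_((1 : R), (0 : R)) phi x.
Definition partial2 (phi : plane R -> R) : plane R -> R :=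
  fun x => 'D_((0 : R), (1 : R)) phi x.

(* true stands for the derivative in the first variable *)
Definition iterated_partial (l : seq bool) phi : plane R -> R :=
  foldr (fun (b : bool) h => if b then partial1 h else partial2 h) phi l.

Definition smooth phi : Prop := forall l : seq bool,
  continuous (iterated_partial l phi) /\
  forall x : plane R,
    derivable (iterated_partial l phi) x ((1 : R), (0 : R)) /\
    derivable (iterated_partial l phi) x ((0 : R), (1 : R)).

Definition test_function U phi : Prop :=
  smooth phi /\
  exists2 C : set (plane R), compact C /\ C `<=` U &
    forall x, ~ C x -> phi x = 0.

Definition weak_gradient U psi (g1 g2 : plane R -> R) : Prop :=
  forall phi, test_function U phi ->
    (\int[leb2]_(x in U) (psi x * partial1 phi x)) =
      - (\int[leb2]_(x in U) (g1 x * phi x)) /\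
    (\int[leb2]_(x in U) (psi x * partial2 phi x)) =
      - (\int[leb2]_(x in U) (g2 x * phi x)).

Definition L2_space U : (plane R -> R) -> Prop := inL2 leb2 U (cst 1).

(* psi belongs to H^1(U) (resp. to H^1_0(U)) and its gradient is (g1, g2). *)
Definition H1_space U psi (g1 g2 : plane R -> R) : Prop :=
  [/\ L2_space U psi, L2_space U g1, L2_space U g2 & weak_gradient U psi g1 g2].

Definition H10_space U psi (g1 g2 : plane R -> R) : Prop :=
  H1_space U psi g1 g2 /\
  exists phi : nat -> plane R -> R,
    [/\ forall n, test_function U (phi n),
        sqnorm leb2 U (cst 1) (phi n \- psi) @[n --> \oo] --> 0%E,
        sqnorm leb2 U (cst 1) (partial1 (phi n) \- g1) @[n --> \oo] --> 0%E &
        sqnorm leb2 U (cst 1) (partial2 (phi n) \- g2) @[n --> \oo] --> 0%E].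

End sobolev.

Section form_and_semigroup.
Context {R : realType}.
Variables (U : set (plane R)) (f : plane R -> R).

(* Bilinear form of \int_U (f^-1 |d1 psi|^2 + f |d2 psi|^2), as a function of
   the gradients (g1, g2) and (p1, p2) of its two arguments. *)
Definition energy (g1 g2 p1 p2 : plane R -> R) : R :=
  \int[leb2]_(x in U) ((f x)^-1 * (g1 x * p1 x) + f x * (g2 x * p2 x)).

(* Graph of the self-adjoint operator H in L^2(U, f dx) associated with the
   form of domain dom: psi is in the domain of H and H psi = eta. *)
Definition form_operator
    (dom : (plane R -> R) -> (plane R -> R) -> (plane R -> R) -> Prop)
    (psi eta : plane R -> R) : Prop :=
  inL2 leb2 U f eta /\
  exists g1 g2, dom psi g1 g2 /\
    forall phi p1 p2, dom phi p1 p2 ->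
      energy g1 g2 p1 p2 = dotL2 leb2 U f eta phi.

(* T t = e^(-tH) on L^2(U, f dx): T is the strongly continuous semigroup of
   bounded linear operators whose generator is -H.  Values of T t outside
   L^2(U, f dx), and of the resulting functions outside U, are irrelevant. *)
Record exp_semigroup (H : (plane R -> R) -> (plane R -> R) -> Prop)
    (T : R -> (plane R -> R) -> plane R -> R) : Prop := {
  semigroup_L2 : forall t u, 0 <= t ->
    inL2 leb2 U f u -> inL2 leb2 U f (T t u) ;
  semigroup_linear : forall t c u v, 0 <= t ->
    inL2 leb2 U f u -> inL2 leb2 U f v ->
    T t (fun x => c * u x + v x) = (fun x => c * T t u x + T t v x)
      %[ae leb2 in U] ;
  semigroup_bounded : forall t, 0 <= t -> exists C : R, forall u,
    inL2 leb2 U f u ->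
    (sqnorm leb2 U f (T t u) <= C%:E * sqnorm leb2 U f u)%E ;
  semigroup0 : forall u, inL2 leb2 U f u -> T 0 u = u %[ae leb2 in U] ;
  semigroupD : forall s t u, 0 <= s -> 0 <= t -> inL2 leb2 U f u ->
    T (s + t) u = T s (T t u) %[ae leb2 in U] ;
  semigroup_continuous : forall u, inL2 leb2 U f u ->
    sqnorm leb2 U f (T t u \- u) @[t --> (0 : R)^'+] --> 0%E ;
  semigroup_generator : forall u v, inL2 leb2 U f u -> inL2 leb2 U f v ->
    ((sqnorm leb2 U f (fun x => (T t u x - u x) / t - v x)
        @[t --> (0 : R)^'+] --> 0%E) <-> H u (\- v)) }.

End form_and_semigroup.

Section operators.
Context {R : realType}.

(* Graph of H_K in L^2(strip a, f dx), where f is the solution of the Jacobi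
   equation determined by K. *)
Definition H_K (a : R) (f : plane R -> R) :=
  form_operator (strip a) f (H10_space (strip a)).

(* Graph of the operator of the form on H^1(R^2) with weight w. *)
Definition H_plane (w : plane R -> R) :=
  form_operator setT w (H1_space setT).

Definition extend_by_1 (a : R) (f : plane R -> R) : plane R -> R :=
  patch (cst 1) (strip a) f.

End operators.

Section diffusion.
Context {R : realType} d {Omega : measurableType d}.
Variables (P : plane R -> probability Omega R) (X : R -> Omega -> plane R).

(* Natural filtration of X and its right limits; X t is used for t >= 0 only. *)
Definition natural_filtration (t : R) : set (set Omega) :=
  <<s [set A | exists s, exists B : set (plane R),
        [/\ 0 <= s, s <= t, measurable B & A = X s @^-1` B]] >>.

Definition filtration_right (t : R) : set (set Omega) :=
  [set A | forall s, t < s -> natural_filtration s A].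

Definition stopping_time (sigma : Omega -> \bar R) : Prop :=
  (forall w, 0 <= sigma w)%E /\
  forall t, 0 <= t -> filtration_right t [set w | (sigma w <= t%:E)%E].

Definition stopped_event (sigma : Omega -> \bar R) (A : set Omega) : Prop :=
  forall t, 0 <= t -> filtration_right t (A `&` [set w | (sigma w <= t%:E)%E]).

Definition strong_markov : Prop :=
  forall (sigma : Omega -> \bar R) (A : set Omega) (s : R) (B : set (plane R))
         (x : plane R),
    stopping_time sigma -> stopped_event sigma A -> 0 <= s -> measurable B ->
    let A' := A `&` [set w | (sigma w < +oo)%E] in
    P x (A' `&` [set w | B (X (fine (sigma w) + s) w)]) =
    (\int[P x]_(w in A') P (X (fine (sigma w)) w) (X s @^-1` B))%E.

(* Conservative strong Markov process with continuous paths associated with the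
   Dirichlet form \int_(R^2) (w^-1 |d1 psi|^2 + w |d2 psi|^2) on H^1(R^2) in
   L^2(R^2, w dx).  It is conservative because it takes its values in R^2 at
   all times. *)
Record associated_diffusion (w : plane R -> R) : Prop := {
  diffusion_measurable : forall t, 0 <= t -> measurable_fun setT (X t) ;
  diffusion_continuous : forall om, {within `[0, +oo[, continuous (X ^~ om)} ;
  diffusion_start : forall x, P x [set om | X 0 om = x] = 1%E ;
  diffusion_kernel : forall t (B : set (plane R)), 0 <= t -> measurable B ->
    measurable_fun [set: plane R] (fun x => fine (P x (X t @^-1` B))) ;
  diffusion_markov : strong_markov ;
  diffusion_form : exists2 S, exp_semigroup setT w (H_plane w) S &
    forall t u, 0 <= t -> measurable_fun setT u -> inL2 leb2 setT w u ->
      (exists M : R, forall x, `|u x| <= M) ->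
      (fun x => \int[P x]_om u (X t om)) = S t u %[ae leb2 in setT] }.

Definition hitting_time (A : set (plane R)) (om : Omega) : \bar R :=
  ereal_inf [set s%:E | s in [set s : R | 0 < s /\ A (X s om)]].

(* P_x(X_t \in B, tau > t), where tau is the first hitting time of the boundary
   of the strip. *)
Definition survival_prob (a t : R) (B : set (plane R)) (x : plane R) : \bar R :=
  P x [set om | B (X t om) /\ (t%:E < hitting_time (frontier (strip a)) om)%E].

(* x |-> P_x(X_t \in B, tau > t) is the continuous representative of T t 1_B;
   at t = 0 the function 1_B need not have one. *)
Definition killed_semigroup_law (a : R)
    (T : R -> (plane R -> R) -> plane R -> R) : Prop :=
  forall t (B : set (plane R)), 0 < t ->
    measurable B -> bounded_set B -> B `<=` strip a ->
    (forall x, strip a x -> {for x, continuous (fine \o survival_prob a t B)}) /\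
    fine \o survival_prob a t B = T t (\1_B) %[ae leb2 in strip a].

End diffusion.

(* Main.v *)
(* Let Q = h_K - E_1.  Riccati and Poincare inequalities on slices together with
   Ladyzhenskaya's inequality turn the Hardy inequality, whatever rho is, into
   Q[phi] >= eta \int |phi|^2 / (1 + x_1^2).  Localizing away from the region where
   f <> 1, one gets for large tau
     Q[phi] + \int U_tau |phi|^2 f >= (3 - e) / (4 tau) \int |phi|^2 f,
   where U_tau is a bounded modification of x_1^2 / (16 tau^2): the inverse square
   term acts as a Dirichlet condition at x_1 = 0, and the ground state energy of the
   harmonic oscillator on a half line with this condition is three times the one on
   the whole line.  In the energy identity for the orbit multiplied by
   (1 + x_1^2 / (8 m (tau_0 + t)))^m this gives
     |e^(-tH) u|^2 <= C e^(-2 E_1 t) t^(-3/2 + e) |(1 + x_1^2)^m u|^2,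
   the weight x_1^2 being truncated as long as bounded multipliers are needed.
   By continuity the survival probability at x is bounded by the averages
   <phi_r, e^(-(1 + 2 p) H) 1_B> = <e^(-pH) e^(-H) phi_r, e^(-pH) 1_B> over squares
   shrinking to x.  The survival probability lies in [0, 1], so by symmetry e^(-tH) phi_r
   has mass at most 1, and Nash's inequality with a moment estimate bounds
   e^(-H) phi_r in the weighted space uniformly in r. *)
Require Import Defs.
From mathcomp Require Import all_boot all_order all_algebra.
From mathcomp Require Import all_classical all_reals all_analysis.
From mathcomp Require Import measurable_realfun ring lra zify.

Set Implicit Arguments.
Unset Strict Implicit.
Unset Printing Implicit Defensive.

Import Order.TTheory GRing.Theory Num.Theory.
Import numFieldNormedType.Exports.

Local Open Scope classical_set_scope.
Local Open Scope ring_scope.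

(** * Weighted square integrable functions *)

Section L2_forms.
Context d (T : measurableType d) (R : realType) (mu : {measure set T -> \bar R}).
Variables (D : set T) (mD : measurable D).
Implicit Types (u v w al be g h : T -> R).

(** The semigroup is given only through its generator, so contraction, symmetry and bounds uniform
    on bounded time intervals have to be derived. Orbits are differentiable in L^2 only for data in
    the domain. Every differential inequality is therefore proved for a dense set of time averages,
    which inherit the bounds 0 <= <e^(-tH) u, 1_B> <= 1, and is then extended by continuity. The
    constants come from the self-similar form of the heat equation: exp(x_1^2 / (4 t)) is the
    natural weight for |u|^2, and conjugation by its square root produces the potential x_1^2 / (16
    t^2). A power of 1 + x_1^2 / (8 m t) imitates that square root but asks only for polynomial
    moments of the data, which remain bounded for shrinking squares; the price is the loss e. Each
    of the two factors at half the time contributes t^(-3/4 + e/2), and their product is the claimed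
    power. Two further obstacles shape the file. The function f is given slice by slice, so its
    joint measurability must be proved. And rho has no positive lower bound, so the set where it is
    small is cut out and its contribution absorbed. *)

Definition rint (g : T -> R) : Prop := mu.-integrable D (EFin \o g).

Definition sqi u : Prop := measurable_fun D u /\ rint (fun x => u x ^+ 2).

Definition bdm al : Prop :=
  measurable_fun D al /\ exists M : R, forall x, D x -> `|al x| <= M.

(** The weight is any bounded function, of either sign: one form then covers inner products, both
    parts of the energy, potentials, and differences of such terms. *)
Definition ip al u v : R := \int[mu]_(x in D) (al x * (u x * v x)).

Lemma rintD g h : rint g -> rint h -> rint (fun x => g x + h x).
Proof. by move=> ig ih; have := integrableD mD ig ih. Qed.

Lemma rintZ c g : rint g -> rint (fun x => c * g x).
Proof. by move=> ig; have := integrableZl mD c ig. Qed.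

Lemma rint_le g h : measurable_fun D g -> (forall x, D x -> `|g x| <= h x) ->
  rint h -> rint g.
Proof.
move=> mg gh; apply: le_integrable => //; first exact/measurable_EFinP.
by move=> x Dx /=; rewrite lee_fin (le_trans (gh x Dx))// ler_norm.
Qed.

Lemma rint_measurable g : rint g -> measurable_fun D g.
Proof. by move=> ig; apply/measurable_EFinP; exact: measurable_int ig. Qed.

Lemma bdm_cst c : bdm (fun=> c).
Proof. by split; [exact: measurable_cst|exists `|c|]. Qed.

Lemma bdmD al be : bdm al -> bdm be -> bdm (fun x => al x + be x).
Proof.
move=> [ma [A hA]] [mb [B hB]]; split; first exact: measurable_funD.
exists (A + B) => x Dx; apply: (le_trans (ler_normD _ _)); apply: lerD; auto.
Qed.

Lemma bdmM al be : bdm al -> bdm be -> bdm (fun x => al x * be x).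
Proof.
move=> [ma [A hA]] [mb [B hB]]; split; first exact: measurable_funM.
by exists (A * B) => x Dx; rewrite normrM; apply: ler_pM; auto.
Qed.

Lemma bdmN al : bdm al -> bdm (fun x => - al x).
Proof.
move=> [ma [A hA]]; split; first exact: measurableT_comp.
by exists A => x Dx; rewrite normrN; auto.
Qed.

Lemma bdmB al be : bdm al -> bdm be -> bdm (fun x => al x - be x).
Proof. by move=> ha hb; apply: bdmD => //; exact: bdmN. Qed.

Lemma rint_ip al u v : bdm al -> sqi u -> sqi v -> rint (fun x => al x * (u x * v x)).
Proof.
move=> [ma [A hA]] [mu_ iu] [mv iv].
apply: (@rint_le _ (fun x => `|A| * (u x ^+ 2 + v x ^+ 2))).
- by apply: measurable_funM => //; exact: measurable_funM.
- move=> x Dx; rewrite normrM ler_pM// ?(le_trans (hA x Dx)) ?ler_norm//.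
  rewrite normrM -(ler_pM2l (_ : 0 < 2 :> R))//.
  have : 0 <= (`|u x| - `|v x|) ^+ 2 by exact: sqr_ge0.
  rewrite -(real_normK (num_real (u x))) -(real_normK (num_real (v x))).
  have : 0 <= `|u x| ^+ 2 by exact: sqr_ge0.
  have : 0 <= `|v x| ^+ 2 by exact: sqr_ge0.
  nra.
- by apply: rintZ; exact: rintD.
Qed.

Lemma sqiZ c u : sqi u -> sqi (fun x => c * u x).
Proof.
move=> [mu_ iu]; split; first exact: measurable_funM.
rewrite (_ : (fun x => _) = (fun x => c ^+ 2 * u x ^+ 2)); first exact: rintZ.
by apply/funext => x; rewrite exprMn.
Qed.

Lemma sqiM al u : bdm al -> sqi u -> sqi (fun x => al x * u x).
Proof.
move=> ha hu; split; first by case: ha hu => ? _ [? _]; exact: measurable_funM.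
have := rint_ip (bdmM ha ha) hu hu.
by congr rint; apply/funext => x; rewrite exprMn; ring.
Qed.

Lemma sqiD u v : sqi u -> sqi v -> sqi (fun x => u x + v x).
Proof.
move=> hu hv; split; first by case: hu hv => ? _ [? _]; exact: measurable_funD.
have := rintD (rint_ip (bdm_cst 1) hu hu)
  (rintD (rint_ip (bdm_cst 2) hu hv) (rint_ip (bdm_cst 1) hv hv)).
by congr rint; apply/funext => x; ring.
Qed.

Lemma sqiN u : sqi u -> sqi (fun x => - u x).
Proof.
move=> hu; have := sqiZ (-1) hu; congr sqi; apply/funext => x; ring.
Qed.

Lemma sqiB u v : sqi u -> sqi v -> sqi (fun x => u x - v x).
Proof. by move=> hu hv; apply: sqiD => //; exact: sqiN. Qed.

Lemma sqi0 : sqi (fun=> 0).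
Proof.
split; first exact: measurable_cst.
rewrite (_ : (fun x => _) = (fun=> 0)); last by apply/funext => x; rewrite expr0n.
exact: integrable0.
Qed.

Lemma ipC al u v : ip al u v = ip al v u.
Proof. by apply: eq_Rintegral => x _; rewrite [u x * v x]mulrC. Qed.

Lemma ipDl al u v w : bdm al -> sqi u -> sqi v -> sqi w ->
  ip al (fun x => u x + v x) w = ip al u w + ip al v w.
Proof.
move=> ha hu hv hw; rewrite /ip -RintegralD//; [|exact: rint_ip..].
by apply: eq_Rintegral => x _; ring.
Qed.

Lemma ipZl al c u w : bdm al -> sqi u -> sqi w ->
  ip al (fun x => c * u x) w = c * ip al u w.
Proof.
move=> ha hu hw; rewrite /ip -RintegralZl//; last exact: rint_ip.
by apply: eq_Rintegral => x _; ring.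
Qed.

Lemma ipDr al u v w : bdm al -> sqi u -> sqi v -> sqi w ->
  ip al u (fun x => v x + w x) = ip al u v + ip al u w.
Proof. by move=> *; rewrite ipC ipDl// !(ipC _ u). Qed.

Lemma ipZr al c u w : bdm al -> sqi u -> sqi w ->
  ip al u (fun x => c * w x) = c * ip al u w.
Proof. by move=> *; rewrite ipC ipZl// ipC. Qed.

Lemma ipNl al u w : bdm al -> sqi u -> sqi w ->
  ip al (fun x => - u x) w = - ip al u w.
Proof.
move=> ha hu hw; rewrite -mulN1r -ipZl//; congr ip; apply/funext => x; ring.
Qed.

Lemma ipBl al u v w : bdm al -> sqi u -> sqi v -> sqi w ->
  ip al (fun x => u x - v x) w = ip al u w - ip al v w.
Proof. by move=> *; rewrite ipDl ?ipNl//; exact: sqiN. Qed.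

Lemma ipBr al u v w : bdm al -> sqi u -> sqi v -> sqi w ->
  ip al u (fun x => v x - w x) = ip al u v - ip al u w.
Proof. by move=> *; rewrite ipC ipBl// !(ipC _ u). Qed.

Lemma ipwD al be u v : bdm al -> bdm be -> sqi u -> sqi v ->
  ip (fun x => al x + be x) u v = ip al u v + ip be u v.
Proof.
move=> ha hb hu hv; rewrite /ip -RintegralD//; [|exact: rint_ip..].
by apply: eq_Rintegral => x _; ring.
Qed.

Lemma ipwZ al c u v : bdm al -> sqi u -> sqi v ->
  ip (fun x => c * al x) u v = c * ip al u v.
Proof.
move=> ha hu hv; rewrite /ip -RintegralZl//; last exact: rint_ip.
by apply: eq_Rintegral => x _; ring.
Qed.

Lemma ip_ge0 al u : (forall x, D x -> 0 <= al x) -> 0 <= ip al u u.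
Proof.
by move=> ha; apply: Rintegral_ge0 => x Dx; rewrite mulr_ge0 ?ha// -expr2 sqr_ge0.
Qed.

Lemma ip_le al be u : bdm al -> bdm be -> sqi u ->
  (forall x, D x -> al x <= be x) -> ip al u u <= ip be u u.
Proof.
move=> ha hb hu h; apply: le_Rintegral => //; [exact: rint_ip..|].
by move=> x Dx; rewrite ler_wpM2r ?h// -expr2 sqr_ge0.
Qed.

Lemma ip_CS al u v : bdm al -> (forall x, D x -> 0 <= al x) -> sqi u -> sqi v ->
  (ip al u v) ^+ 2 <= ip al u u * ip al v v.
Proof.
move=> ha al0 hu hv.
set A := ip al u u; set B := ip al u v; set C := ip al v v.
have C0 : 0 <= C by exact: ip_ge0.
have A0 : 0 <= A by exact: ip_ge0.
have H t : 0 <= A + t * (2 * B) + t ^+ 2 * C.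
  have hv' := sqiZ t hv.
  have : 0 <= ip al (fun x => u x + t * v x) (fun x => u x + t * v x) by exact: ip_ge0.
  rewrite ipDl ?ipDr//; [|exact: sqiD..].
  rewrite !ipZl ?ipZr// (ipC _ v u) -/A -/B -/C; nra.
have [C00|Cn0] := eqVneq C 0.
  have [->|B0] := eqVneq B 0; first by rewrite expr0n mulr_ge0.
  (* For C = 0 the polynomial is affine in t, and at this t it equals -1. *)
  have := H (- (A + 1) / (2 * B)); rewrite C00 mulr0 addr0 divfK ?mulf_neq0//; lra.
have Cp : 0 < C by rewrite lt_neqAle eq_sym Cn0.
have := H (- B / C); rewrite -(ler_pM2r Cp) mul0r.
have -> : (A + - B / C * (2 * B) + (- B / C) ^+ 2 * C) * C = A * C - B ^+ 2 by field.
by rewrite subr_ge0.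
Qed.

Lemma ip_ae al u u' v : ae_eq mu D u u' ->
  measurable_fun D al -> measurable_fun D u -> measurable_fun D u' -> measurable_fun D v ->
  ip al u v = ip al u' v.
Proof.
move=> uu' ma mu_ mu' mv; congr fine; apply: ae_eq_integral => //.
- by apply/measurable_EFinP; do 2 apply: measurable_funM => //.
- by apply/measurable_EFinP; do 2 apply: measurable_funM => //.
- by apply: filterS uu' => x /[apply] /= ->.
Qed.

End L2_forms.

(** * Norm and completeness of weighted L^2 *)

Section L2_norm.
Context d (T : measurableType d) (R : realType) (mu : {measure set T -> \bar R}).
Variables (D : set T) (mD : measurable D).
Variables (w : T -> R) (c : R).
Hypotheses (hw : bdm D w) (c0 : 0 < c) (cw : forall x, D x -> c <= w x).
Implicit Types (u v : T -> R).
Local Notation sqi := (sqi mu D).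
Local Notation dot := (ip mu D w).

Let w0 x : D x -> 0 <= w x.
Proof. by move=> Dx; rewrite (le_trans (ltW c0))// cw. Qed.

Definition nrm u : R := Num.sqrt (dot u u).

Lemma dot_ge0 u : 0 <= dot u u. Proof. exact: ip_ge0. Qed.

Lemma nrm_ge0 u : 0 <= nrm u. Proof. exact: sqrtr_ge0. Qed.

Lemma nrm2 u : nrm u ^+ 2 = dot u u.
Proof. by rewrite sqr_sqrtr// dot_ge0. Qed.

Lemma dot_CS u v : sqi u -> sqi v -> `|dot u v| <= nrm u * nrm v.
Proof.
move=> hu hv; rewrite -(@ler_pXn2r _ 2)// ?nnegrE ?mulr_ge0 ?nrm_ge0//.
by rewrite real_normK ?num_real// exprMn !nrm2 ip_CS.
Qed.

Lemma dot_le u v : sqi u -> sqi v -> dot u v <= nrm u * nrm v.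
Proof. by move=> hu hv; rewrite (le_trans (ler_norm _))// dot_CS. Qed.

Lemma nrmD u v : sqi u -> sqi v -> nrm (fun x => u x + v x) <= nrm u + nrm v.
Proof.
move=> hu hv; rewrite -(@ler_pXn2r _ 2)// ?nnegrE ?addr_ge0 ?nrm_ge0//.
rewrite nrm2 ipDl ?ipDr//; try exact: sqiD.
rewrite sqrrD !nrm2 [ip _ _ _ v u]ipC.
have := dot_le hu hv; lra.
Qed.

Lemma nrmZ k u : sqi u -> nrm (fun x => k * u x) = `|k| * nrm u.
Proof.
move=> hu; rewrite /nrm ipZl ?ipZr//; last exact: sqiZ.
by rewrite mulrA -expr2 sqrtrM ?sqr_ge0// sqrtr_sqr.
Qed.

Lemma nrmN u : sqi u -> nrm (fun x => - u x) = nrm u.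
Proof.
move=> hu; rewrite -[RHS]mul1r -(normr1 R) -normrN -nrmZ//.
by congr nrm; apply/funext => x; ring.
Qed.

Lemma nrmB u v : sqi u -> sqi v -> nrm (fun x => u x - v x) <= nrm u + nrm v.
Proof. by move=> hu hv; rewrite -(nrmN hv) nrmD//; exact: sqiN. Qed.

Lemma nrmBC u v : sqi u -> sqi v -> nrm (fun x => u x - v x) = nrm (fun x => v x - u x).
Proof.
move=> hu hv; rewrite -nrmN; last exact: sqiB.
by congr nrm; apply/funext => x; ring.
Qed.

Lemma nrm_tri u v z : sqi u -> sqi v -> sqi z ->
  nrm (fun x => u x - z x) <= nrm (fun x => u x - v x) + nrm (fun x => v x - z x).
Proof.
move=> hu hv hz; have -> : (fun x => u x - z x) = fun x => (u x - v x) + (v x - z x).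
  by apply/funext => x; ring.
by apply: nrmD => //; exact: sqiB.
Qed.

Lemma nrm_lip u v : sqi u -> sqi v -> `|nrm u - nrm v| <= nrm (fun x => u x - v x).
Proof.
move=> hu hv; rewrite ler_norml; apply/andP; split.
  rewrite lerNl opprB lerBlDr nrmBC//.
  rewrite -[X in X <= _](_ : nrm (fun x => (v x - u x) + u x) = _); last first.
    by congr nrm; apply/funext => x; ring.
  by apply: nrmD => //; exact: sqiB.
rewrite lerBlDr -[X in X <= _](_ : nrm (fun x => (u x - v x) + v x) = _); last first.
  by congr nrm; apply/funext => x; ring.
by apply: nrmD => //; exact: sqiB.
Qed.

Lemma sqi_norm u : sqi u -> sqi (fun x => `|u x|).
Proof.
move=> [mu_ iu]; split; first exact: measurableT_comp.
by move: iu; congr rint; apply/funext => x; rewrite real_normK// num_real.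
Qed.

Lemma nrm_norm u : nrm (fun x => `|u x|) = nrm u.
Proof.
congr Num.sqrt; apply: eq_Rintegral => x _.
by rewrite -normrM ger0_norm// -expr2 sqr_ge0.
Qed.

Section fast.
Variable u : nat -> T -> R.
Hypothesis hu : forall n, sqi (u n).
Hypothesis fast : forall n, nrm (fun x => u n.+1 x - u n x) <= 2^-1 ^+ n.

Let G n : T -> R := fun x => \sum_(k < n) `|u k.+1 x - u k x|.

Let GS n x : G n.+1 x = G n x + `|u n.+1 x - u n x|.
Proof. by rewrite /G big_ord_recr. Qed.

Let G0 n x : 0 <= G n x. Proof. exact: sumr_ge0. Qed.

Let Gmono x : {homo G ^~ x : n m / (n <= m)%N >-> n <= m}.
Proof. by apply/nondecreasing_seqP => n; rewrite GS lerDl. Qed.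

Let hG n : sqi (G n).
Proof.
elim: n => [|n IH].
  by rewrite (_ : G 0 = fun=> 0); [exact: sqi0|apply/funext => x; rewrite /G big_ord0].
rewrite (_ : G n.+1 = fun x => G n x + `|u n.+1 x - u n x|); last exact/funext/GS.
by apply: sqiD => //; apply: sqi_norm; exact: sqiB.
Qed.

Let nG n : nrm (G n) <= 2 - 2^-1 ^+ n * 2.
Proof.
elim: n => [|n IH].
  rewrite (_ : G 0 = fun=> 0 * 0); last by apply/funext => x; rewrite /G big_ord0 mul0r.
  by rewrite nrmZ ?normr0 ?mul0r ?expr0 ?mul1r ?subrr//; exact: sqi0.
rewrite (_ : G n.+1 = fun x => G n x + `|u n.+1 x - u n x|); last exact/funext/GS.
apply: le_trans (nrmD (hG n) _) _; first by apply: sqi_norm; exact: sqiB.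
rewrite nrm_norm exprS; have := fast n; lra.
Qed.

Let g n : T -> \bar R := fun x => (w x * G n x ^+ 2)%:E.
Let H : T -> \bar R := fun x => limn (g ^~ x).

Let gmono x : D x -> {homo g ^~ x : n m / (n <= m)%N >-> (n <= m)%E}.
Proof.
move=> Dx n m nm; rewrite lee_fin ler_wpM2l ?w0//.
by rewrite ler_pXn2r ?nnegrE ?G0// Gmono.
Qed.

Let mg n : measurable_fun D (g n).
Proof.
apply/measurable_EFinP; apply: measurable_funM; first by case: hw.
by apply: measurable_funX; case: (hG n).
Qed.

Let g0 n x : D x -> (0 <= g n x)%E.
Proof. by move=> Dx; rewrite lee_fin mulr_ge0 ?w0 ?sqr_ge0. Qed.

Let mH : measurable_fun D H.
Proof.
apply: (emeasurable_fun_cvg g) => // x Dx.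
exact: ereal_nondecreasing_is_cvgn (gmono Dx).
Qed.

Let gH n x : D x -> (g n x <= H x)%E.
Proof.
move=> Dx; apply: lime_ge; first exact: ereal_nondecreasing_is_cvgn (gmono Dx).
by near=> m; apply: gmono => //; near: m; exact: nbhs_infty_ge.
Unshelve. all: by end_near. Qed.

Let HNy x : D x -> (-oo < H x)%E.
Proof. by move=> Dx; apply: lt_le_trans (gH 0 Dx); rewrite ltNyr. Qed.

Let iH : mu.-integrable D H.
Proof.
apply/integrableP; split => //.
rewrite (@eq_integral _ _ _ _ _ H); last first.
  move=> x /set_mem Dx; rewrite gee0_abs//; exact: le_trans (g0 0 Dx) (gH 0 Dx).
have : (\int[mu]_(x in D) H x <= 4%:E)%E.
  rewrite /H monotone_convergence//.
  apply: lime_le.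
    apply: ereal_nondecreasing_is_cvgn => n m nm.
    by apply: ge0_le_integral => //; try exact: g0; move=> x Dx; exact: gmono.
  near=> n; rewrite /g.
  have -> : (\int[mu]_(x in D) (w x * G n x ^+ 2)%:E)%E = (dot (G n) (G n))%:E.
    rewrite /ip /Rintegral fineK; last first.
      exact: (integrable_fin_num mD (rint_ip mD hw (hG n) (hG n))).
    by apply: eq_integral => x _; rewrite expr2.
  rewrite lee_fin -nrm2 (_ : 4 = 2 ^+ 2); last by rewrite expr2; ring.
  rewrite ler_pXn2r ?nnegrE ?nrm_ge0//.
  apply: le_trans (nG n) _; rewrite gerBl mulr_ge0// exprn_ge0//.
by move=> /le_lt_trans; apply; rewrite ltry.
Unshelve. all: by end_near. Qed.

Let A : set T := D `&` [set x | (H x < +oo)%E].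

Let mA : measurable A.
Proof.
have -> : A = D `&` (H @^-1` (~` [set +oo%E])).
  apply/seteqP; split => x [Dx] /=.
    by move=> h; split => // /= h'; move: h; rewrite h' ltxx.
  by move=> h; split => //=; rewrite ltey; exact/eqP.
by apply: mH => //; apply: measurableC; exact: emeasurable_set1.
Qed.

Let cvgA x : A x -> cvgn (u ^~ x).
Proof.
move=> [Dx Hx].
have Hfin : H x \is a fin_num.
  by rewrite fin_numElt Hx andbT; exact: HNy.
have GM n : G n x <= 1 + fine (H x) / c.
  have : G n x ^+ 2 <= fine (H x) / c.
    rewrite ler_pdivlMr// mulrC.
    have := gH n Dx; rewrite -(fineK Hfin) lee_fin; apply: le_trans.
    by rewrite ler_wpM2r ?sqr_ge0// cw.
  have := G0 n x; nra.
have : cvgn [normed series (fun k => u k.+1 x - u k x)].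
  rewrite (_ : [normed series _] = G ^~ x); last first.
    by apply/funext => n; rewrite /G /= /series /= big_mkord.
  apply: nondecreasing_is_cvgn; first exact: Gmono.
  by exists (1 + fine (H x) / c) => _ [n _ <-].
move=> /normed_cvg.
rewrite (_ : series _ = fun n => u n x - u 0 x); last first.
  by apply/funext => n; rewrite /series /= telescope_sumr.
move=> cv; rewrite (_ : u ^~ x = (fun n => u n x - u 0 x) \+ cst (u 0 x)).
  by apply: is_cvgD => //; exact: is_cvg_cst.
by apply/funext => n /=; rewrite subrK.
Qed.

(** The factor [\1_A] makes the sequence converge at every point, to 0 off [A], so that
    measurability of the limit is immediate. *)
Let U x := limn (fun n => u n x * \1_A x).

Let cvgU x : (fun n => u n x * \1_A x) @ \oo --> U x.
Proof.
have [Ax|nAx] := pselect (A x).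
  by apply: (@is_cvgM _ _ _ _ (u ^~ x) (cst (\1_A x))); [exact: cvgA|exact: is_cvg_cst].
rewrite /U; under eq_fun do rewrite indicE memNset// mulr0.
by rewrite lim_cst//; exact: cvg_cst.
Qed.

Let mU : measurable_fun D U.
Proof.
apply: (measurable_fun_cvg (h := fun n x => u n x * \1_A x)).
  by move=> n; apply: measurable_funM; [case: (hu n)|exact: measurable_indic].
by move=> x _; exact: cvgU.
Qed.

Let domin n x : A x -> w x * (U x - u n x) ^+ 2 <= fine (H x).
Proof.
move=> Ax; have [Dx Hx] := Ax.
have Hfin : H x \is a fin_num.
  by rewrite fin_numElt Hx andbT; exact: HNy.
have step m : (n <= m)%N -> `|u m x - u n x| <= G m x - G n x.
  elim: m => [|m IH].
    by rewrite leqn0 => /eqP ->; rewrite !subrr normr0.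
  rewrite leq_eqVlt => /orP[/eqP <-|]; first by rewrite !subrr normr0.
  rewrite ltnS => /IH {}IH; rewrite GS.
  rewrite (_ : u m.+1 x - u n x = (u m.+1 x - u m x) + (u m x - u n x)); last by ring.
  apply: le_trans (ler_normD _ _) _; lra.
have cw' : (fun m => w x * (u m x * \1_A x - u n x) ^+ 2) @ \oo --> w x * (U x - u n x) ^+ 2.
  apply: cvgM; first exact: cvg_cst.
  have h : (fun m => u m x * \1_A x - u n x) @ \oo --> U x - u n x.
    by apply: cvgB; [exact: cvgU|exact: cvg_cst].
  by rewrite expr2; under eq_fun do rewrite expr2; exact: cvgM.
rewrite -(cvg_lim _ cw')//; apply: limr_le; first by apply/cvg_ex; eexists; exact: cw'.
near=> m.
rewrite -lee_fin (fineK Hfin); apply: le_trans (gH m Dx); rewrite lee_fin ler_wpM2l ?w0//.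
rewrite indicE mem_set// mulr1 -(real_normK (num_real _)) ler_pXn2r ?nnegrE//.
apply: le_trans (step m _) _; first by near: m; exact: nbhs_infty_ge.
by rewrite gerBl.
Unshelve. all: by end_near. Qed.

Let wsq n x : D x -> 0 <= w x * (U x - u n x) ^+ 2.
Proof. by move=> Dx; apply: mulr_ge0; [exact: w0|exact: sqr_ge0]. Qed.

(** Riesz-Fischer. The sums [G n] of the increments have norm at most 2, so by monotone convergence
    the limit [H] of w G^2 is integrable. Where [H] is finite the sequence converges absolutely, and
    since |u m - u n| <= G m the same [H] dominates w (U - u n)^2. *)
Lemma L2_complete_fast : exists v, sqi v /\
  forall e : R, 0 < e -> exists N, forall n, (N <= n)%N -> nrm (fun x => v x - u n x) < e.
Proof.
have aeA : {ae mu, forall x, D x -> A x}.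
  have := integrable_ae mD iH; apply: filterS => x h Dx; split => //.
  by have := h Dx; rewrite fin_numElt => /andP[].
pose F n x : \bar R := (w x * (U x - u n x) ^+ 2)%:E.
have [] := @dominated_convergence _ _ _ mu D mD F (cst 0%E) H.
- move=> n; apply/measurable_EFinP; apply: measurable_funM; first by case: hw.
  by apply: measurable_funX; apply: measurable_funB => //; case: (hu n).
- exact: measurable_cst.
- apply: filterS aeA => x h /h Ax; apply: cvg_EFin; first exact: nearW.
  rewrite /F /= -[X in _ --> X](_ : w x * (U x - U x) ^+ 2 = _); last first.
    by rewrite subrr expr0n mulr0.
  apply: cvgM; first exact: cvg_cst.
  have h' : (fun m => U x - u m x) @ \oo --> U x - U x.
    apply: cvgB; first exact: cvg_cst.
    have := @cvgU x; under eq_fun do rewrite indicE mem_set// mulr1; exact.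
  by rewrite expr2; under eq_fun do rewrite expr2; exact: cvgM.
- exact: iH.
- apply: filterS aeA => x h n /h Ax; have [Dx Hx] := Ax.
  rewrite /F abse_EFin ger0_norm ?wsq//.
  rewrite -(@fineK _ (H x)) ?lee_fin ?domin//.
  by rewrite fin_numElt Hx andbT; exact: HNy.
move=> _ _ cvF.
have iF n : mu.-integrable D (F n).
  apply/integrableP; split.
    apply/measurable_EFinP; apply: measurable_funM; first by case: hw.
    by apply: measurable_funX; apply: measurable_funB => //; case: (hu n).
  have /integrableP[_] := iH; apply: le_lt_trans; apply: ae_ge0_le_integral => //.
  - apply: measurableT_comp => //.
    apply/measurable_EFinP; apply: measurable_funM; first by case: hw.
    by apply: measurable_funX; apply: measurable_funB => //; case: (hu n).
  - exact: measurableT_comp.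
  - apply: filterS aeA => x h Dx; have Ax := h Dx; have [_ Hx] := Ax.
    rewrite /F abse_EFin ger0_norm ?wsq//.
    apply: le_trans (lee_abs _); rewrite -(@fineK _ (H x)) ?lee_fin ?domin//.
    by rewrite fin_numElt Hx andbT; exact: HNy.
have sB n : sqi (fun x => U x - u n x).
  split; first by apply: measurable_funB => //; case: (hu n).
  apply: (@rint_le _ _ _ _ _ mD _ (fun x => c^-1 * (w x * (U x - u n x) ^+ 2))).
  - by apply: measurable_funX; apply: measurable_funB => //; case: (hu n).
  - move=> x Dx; rewrite ger0_norm ?sqr_ge0// mulrA ler_peMl ?sqr_ge0//.
    by rewrite ler_pdivlMl// mulr1 cw.
  - by apply: rintZ => //; exact: iF.
have hU : sqi U.
  rewrite (_ : U = fun x => (U x - u 0%N x) + u 0%N x); first exact: sqiD.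
  by apply/funext => x; rewrite subrK.
exists U; split => // e e0.
have nF n : (\int[mu]_(x in D) F n x)%E = (nrm (fun x => U x - u n x) ^+ 2)%:E.
  rewrite nrm2 /ip /Rintegral fineK; last first.
    exact: (integrable_fin_num mD (rint_ip mD hw (sB n) (sB n))).
  by apply: eq_integral => x _; rewrite /F expr2.
have : (fun n => nrm (fun x => U x - u n x) ^+ 2) @ \oo --> (0 : R).
  have -> : (fun n => nrm (fun x => U x - u n x) ^+ 2) =
            fine \o (fun n => \int[mu]_(x in D) F n x)%E.
    by apply/funext => n /=; rewrite nF.
  apply: fine_cvg; move: cvF; rewrite integral0; exact.
move=> /cvgrPdist_lt/(_ (e ^+ 2)); rewrite exprn_gt0// => /(_ isT)[N _ hN].
exists N => n Nn; have := hN n Nn; rewrite /= sub0r normrN ger0_norm ?sqr_ge0//.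
by rewrite ltr_pXn2r// nnegrE ?nrm_ge0// ltW.
Qed.

End fast.
End L2_norm.

Section L2_complete.
Context d (T : measurableType d) (R : realType) (mu : {measure set T -> \bar R}).
Variables (D : set T) (mD : measurable D).
Variables (w : T -> R) (c : R).
Hypotheses (hw : bdm D w) (c0 : 0 < c) (cw : forall x, D x -> c <= w x).
Local Notation sqi := (sqi mu D).
Local Notation nrm := (nrm mu D w).

Lemma L2_complete (u : nat -> T -> R) : (forall n, sqi (u n)) ->
  (forall e : R, 0 < e -> exists N, forall n m, (N <= n)%N -> (N <= m)%N ->
     nrm (fun x => u n x - u m x) < e) ->
  exists v, sqi v /\
  forall e : R, 0 < e -> exists N, forall n, (N <= n)%N -> nrm (fun x => v x - u n x) < e.
Proof.
move=> hu cau.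
have e0 k : 0 < (2^-1 : R) ^+ k by rewrite exprn_gt0.
have [N hN] : exists N : nat -> nat, forall k n m, (N k <= n)%N -> (N k <= m)%N ->
    nrm (fun x => u n x - u m x) < 2^-1 ^+ k.
  by have /choice[N hN] := fun k => cau _ (e0 k); exists N.
(* The maximum makes [p] nondecreasing, so that both [p k] and [p k.+1] lie beyond [N k]. *)
pose p k := \max_(i < k.+1) N i.
have pN k : (N k <= p k)%N by exact: (leq_bigmax (@ord_max k)).
have pS k : (p k <= p k.+1)%N by rewrite /p [X in (_ <= X)%N]big_ord_recr leq_maxl.
have [v [hv cv]] := L2_complete_fast mD hw c0 cw (u := fun k => u (p k)) (fun k => hu _)
  (fun k => ltW (hN k _ _ (leq_trans (pN k) (pS k)) (pN k))).
exists v; split => // e e_gt0.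
have e2 : 0 < e / 2 by rewrite divr_gt0.
have [M hM] := cv _ e2; have [K hK] := cau _ e2.
exists K => n Kn.
have [k Mk pkK] : exists2 k, (M <= k)%N & (nrm (fun x => u (p k) x - u n x) < e / 2).
  have [k [hk1 hk2]] : exists k, (M <= k)%N /\ (2^-1 : R) ^+ k < e / 2.
    have : (2^-1 : R) ^+ n @[n --> \oo] --> 0.
      by apply: cvg_expr; rewrite ger0_norm// invf_lt1// ltr1n.
    move=> /cvgrPdist_lt/(_ _ e2)[k _ hk]; exists (maxn M k); split; first exact: leq_maxl.
    by have := hk (maxn M k) (leq_maxr _ _); rewrite /= sub0r normrN ger0_norm ?exprn_ge0.
  exists k => //.
  have [nk|kn] := leqP (N k) n; first by apply: lt_trans hk2; exact: hN.
  by apply: hK => //; apply: leq_trans (pN k); exact: leq_trans Kn (ltnW kn).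
rewrite (splitr e); apply: le_lt_trans (ltrD (hM k Mk) pkK).
exact: (nrm_tri mD hw c0 cw).
Qed.

End L2_complete.

(** * Strongly continuous semigroups *)

(** The axioms of [exp_semigroup] except the one on the generator, with real norms and epsilon-delta
    limits. Equality of classes becomes vanishing of the norm of the difference. *)
Record L2_semigroup d (T : measurableType d) (R : realType)
    (mu : {measure set T -> \bar R}) (D : set T) (w : T -> R)
    (S : R -> (T -> R) -> T -> R) : Prop := {
  sg_L2 : forall t u, 0 <= t -> sqi mu D u -> sqi mu D (S t u) ;
  sg_linear : forall t k u v, 0 <= t -> sqi mu D u -> sqi mu D v ->
    nrm mu D w (fun x => S t (fun x => k * u x + v x) x - (k * S t u x + S t v x)) = 0 ;
  sg_bounded : forall t, 0 <= t ->
    exists C, forall u, sqi mu D u -> nrm mu D w (S t u) <= C * nrm mu D w u ;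
  sg_0 : forall u, sqi mu D u -> nrm mu D w (fun x => S 0 u x - u x) = 0 ;
  sg_D : forall s t u, 0 <= s -> 0 <= t -> sqi mu D u ->
    nrm mu D w (fun x => S (s + t) u x - S s (S t u) x) = 0 ;
  sg_continuous : forall u, sqi mu D u -> forall e : R, 0 < e -> exists2 del : R, 0 < del &
    forall t, 0 < t -> t < del -> nrm mu D w (fun x => S t u x - u x) < e }.

Section semigroup.
Context d (T : measurableType d) (R : realType) (mu : {measure set T -> \bar R}).
Variables (D : set T) (mD : measurable D).
Variables (w : T -> R) (c : R).
Hypotheses (hw : bdm D w) (c0 : 0 < c) (cw : forall x, D x -> c <= w x).
Implicit Types (u v z : T -> R) (s t h e : R).
Local Notation sqi := (sqi mu D).
Local Notation dot := (ip mu D w).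
Local Notation nrm := (nrm mu D w).

Variable S : R -> (T -> R) -> T -> R.
Hypothesis HS : L2_semigroup mu D w S.
Let S_L := sg_L2 HS.
Let S_lin := sg_linear HS.
Let S_bd := sg_bounded HS.
Let S_0 := sg_0 HS.
Let S_D := sg_D HS.
Let S_c := sg_continuous HS.

Definition eqv u v : Prop := [/\ sqi u, sqi v & nrm (fun x => u x - v x) = 0].

Lemma eqv_refl u : sqi u -> eqv u u.
Proof.
move=> hu; split => //; rewrite (_ : (fun x => _) = fun x => 0 * u x).
  by rewrite nrmZ// normr0 mul0r.
by apply/funext => x; ring.
Qed.

Lemma eqv_sym u v : eqv u v -> eqv v u.
Proof. by move=> [hu hv uv]; split => //; rewrite nrmBC. Qed.

Lemma eqv_trans v u z : eqv u v -> eqv v z -> eqv u z.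
Proof.
move=> [hu hv uv] [_ hz vz]; split => //; apply/le_anti; rewrite nrm_ge0 andbT.
by rewrite (le_trans (nrm_tri mD hw c0 cw hu hv hz))// uv vz addr0.
Qed.

Lemma eqvD u v u' v' : eqv u u' -> eqv v v' ->
  eqv (fun x => u x + v x) (fun x => u' x + v' x).
Proof.
move=> [hu hu' uu] [hv hv' vv]; split; try exact: sqiD.
apply/le_anti; rewrite nrm_ge0 andbT.
rewrite (_ : (fun x => _) = fun x => (u x - u' x) + (v x - v' x)); last first.
  by apply/funext => x; ring.
by rewrite (le_trans (nrmD mD hw c0 cw (sqiB mD hu hu') (sqiB mD hv hv')))// uu vv addr0.
Qed.

Lemma eqvZ k u v : eqv u v -> eqv (fun x => k * u x) (fun x => k * v x).
Proof.
move=> [hu hv uv]; split; try exact: sqiZ.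
rewrite (_ : (fun x => _) = fun x => k * (u x - v x)); last by apply/funext => x; ring.
by rewrite nrmZ ?uv ?mulr0//; exact: sqiB.
Qed.

Lemma eqvB u v u' v' : eqv u u' -> eqv v v' ->
  eqv (fun x => u x - v x) (fun x => u' x - v' x).
Proof.
move=> uu /(eqvZ (-1)) vv; have := eqvD uu vv.
by congr eqv; apply/funext => x; ring.
Qed.

Lemma eqv_nrm u v : eqv u v -> nrm u = nrm v.
Proof.
move=> [hu hv uv]; apply/eqP; rewrite -subr_eq0 -normr_le0 -uv.
exact: (nrm_lip mD hw c0 cw).
Qed.

Lemma eqv_dot u v z : sqi z -> eqv u v -> dot u z = dot v z.
Proof.
move=> hz [hu hv uv]; apply/eqP; rewrite -subr_eq0 -normr_le0 -ipBl//.
have := dot_CS mD hw c0 cw (sqiB mD hu hv) hz.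
by rewrite uv mul0r.
Qed.

Lemma S_linE t k u v : 0 <= t -> sqi u -> sqi v ->
  eqv (S t (fun x => k * u x + v x)) (fun x => k * S t u x + S t v x).
Proof.
move=> t0 hu hv; split; [|apply: sqiD => //; [apply: sqiZ => //|]|exact: S_lin]; apply: S_L => //.
by apply: sqiD => //; exact: sqiZ.
Qed.

Lemma S_subE t u v : 0 <= t -> sqi u -> sqi v ->
  eqv (S t (fun x => u x - v x)) (fun x => S t u x - S t v x).
Proof.
move=> t0 hu hv; have := S_linE (-1) t0 hv hu.
by congr eqv; [congr S|]; apply/funext => x; ring.
Qed.

Lemma S_scaleE t k u : 0 <= t -> sqi u ->
  eqv (S t (fun x => k * u x)) (fun x => k * S t u x).
Proof.
move=> t0 hu; have := S_linE (k - 1) t0 hu hu.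
by congr eqv; [congr S|]; apply/funext => x; ring.
Qed.

Lemma S_addE t u v : 0 <= t -> sqi u -> sqi v ->
  eqv (S t (fun x => u x + v x)) (fun x => S t u x + S t v x).
Proof.
move=> t0 hu hv; have := S_linE 1 t0 hu hv.
by congr eqv; [congr S|]; apply/funext => x; ring.
Qed.

Lemma S_DE s t u : 0 <= s -> 0 <= t -> sqi u -> eqv (S (s + t) u) (S s (S t u)).
Proof.
move=> s0 t0 hu; split; last exact: S_D.
  by apply: S_L => //; exact: addr_ge0.
by do 2 (apply: S_L => //).
Qed.

(** The near-maximizer at 9/10 of the operator norm serves the gliding hump below: any fraction
    above 1/2 leaves a positive margin. *)
Let opnorm t : 0 <= t -> exists M, [/\ 0 <= M, (forall u, sqi u -> nrm (S t u) <= M * nrm u) &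
  0 < M -> exists v, [/\ sqi v, nrm v <= 1 & 9 / 10 * M <= nrm (S t v)]].
Proof.
move=> t0; have [C hC] := S_bd t0.
pose E := [set r | exists v, [/\ sqi v, nrm v <= 1 & r = nrm (S t v)]].
have E0 : E (nrm (S t (fun=> 0))).
  exists (fun=> 0); split => //; first exact: sqi0.
  rewrite (_ : (fun=> 0) = fun x : T => 0 * 0); last by apply/funext => x; rewrite mul0r.
  by rewrite nrmZ// ?normr0 ?mul0r//; exact: sqi0.
have hE : has_sup E.
  split; first by eexists; exact: E0.
  exists `|C| => _ [v [hv v1 ->]]; apply: le_trans (hC _ hv) _.
  by apply: le_trans (ler_wpM2r (nrm_ge0 _ _ _ _) (ler_norm C)) _; rewrite ler_piMr.
have ub v : sqi v -> nrm v <= 1 -> nrm (S t v) <= sup E.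
  by move=> hv v1; apply: sup_upper_bound => //; exists v.
exists (sup E); split.
- exact: le_trans (nrm_ge0 _ _ _ _) (sup_upper_bound hE E0).
- move=> u hu; have [u0|un0] := eqVneq (nrm u) 0.
    by rewrite (le_trans (hC _ hu))// u0 !mulr0.
  have up : 0 < nrm u by rewrite lt_neqAle eq_sym un0 nrm_ge0.
  have hu' := sqiZ mD (nrm u)^-1 hu.
  have := ub _ hu'; rewrite nrmZ// ger0_norm ?invr_ge0 ?nrm_ge0// mulVf// => /(_ (lexx _)).
  rewrite (eqv_nrm (S_scaleE _ t0 hu)) nrmZ//; last exact: S_L.
  by rewrite ger0_norm ?invr_ge0 ?nrm_ge0// ler_pdivrMl// mulrC.
- move=> M0; have e0 : 0 < sup E / 10 by rewrite divr_gt0.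
  have [_ [v [hv v1 ->]] hh] := sup_adherent e0 hE.
  by exists v; split => //; lra.
Qed.

(* Uniform boundedness, by Sokal's gliding hump. *)
Lemma S_bound0 : exists del C, [/\ 0 < del, 0 <= C &
  forall t u, 0 <= t -> t <= del -> sqi u -> nrm (S t u) <= C * nrm u].
Proof.
apply: contrapT => H.
have /choice[t ht] : forall n : nat, exists t : R, [/\ 0 <= t, t <= 2^-1 ^+ n &
    exists u, sqi u /\ 4 ^+ n * nrm u < nrm (S t u)].
  move=> n; apply: contrapT => Hn; apply: H; exists (2^-1 ^+ n), (4 ^+ n).
  split; rewrite ?exprn_gt0 ?exprn_ge0// => t u t0 tn hu.
  rewrite leNgt; apply/negP => h; apply: Hn; exists t; split => //.
  by exists u.
have /choice[M hM] n : exists M, [/\ 0 <= M, (forall u, sqi u -> nrm (S (t n) u) <= M * nrm u) &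
    0 < M -> exists v, [/\ sqi v, nrm v <= 1 & 9 / 10 * M <= nrm (S (t n) v)]].
  by apply: opnorm; have [] := ht n.
have M4 n : 4 ^+ n < M n.
  have [t0 _ [u [hu h]]] := ht n; have [M0 h1 _] := hM n.
  have := lt_le_trans h (h1 u hu); have [->|un0] := eqVneq (nrm u) 0.
    by rewrite !mulr0 ltxx.
  by rewrite ltr_pM2r// lt_neqAle eq_sym un0 nrm_ge0.
have M0 n : 0 < M n by apply: lt_trans (M4 n); rewrite exprn_gt0.
have /choice[v hv] n : exists v, [/\ sqi v, nrm v <= 1 & 9 / 10 * M n <= nrm (S (t n) v)].
  by have [_ _] := hM n; apply.
have sv n : sqi (v n) by have [] := hv n.
pose xi n : T -> R := fun x => 3^-1 ^+ n * v n x.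
have sxi n : sqi (xi n) by exact: sqiZ.
(* Since 2 S xi = S (y + xi) - S (y - xi), at least one sign does not make the image smaller than
   that of xi alone. *)
pose nx n (y : T -> R) : T -> R := if nrm (S (t n) (xi n)) <= nrm (S (t n) (fun x => y x + xi n x))
  then fun x => y x + xi n x else fun x => y x - xi n x.
have nxs n y : sqi y -> sqi (nx n y).
  by move=> hy; rewrite /nx; case: ifP => _; [exact: sqiD|exact: sqiB].
have nxn n y : sqi y -> nrm (S (t n) (xi n)) <= nrm (S (t n) (nx n y)).
  move=> hy; rewrite /nx; case: ifPn => //; rewrite -ltNge => h.
  have t0 : 0 <= t n by have [] := ht n.
  have e1 := S_addE t0 hy (sxi n); have e2 := S_subE t0 hy (sxi n).
  have sy := S_L t0 hy; have sx := S_L t0 (sxi n).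
  have e3 : nrm (fun x => 2 * S (t n) (xi n) x) <=
     nrm (S (t n) (fun x => y x + xi n x)) + nrm (S (t n) (fun x => y x - xi n x)).
    rewrite (eqv_nrm e1) (eqv_nrm e2).
    apply: le_trans (nrmB mD hw c0 cw (sqiD mD sy sx) (sqiB mD sy sx)).
    by rewrite le_eqVlt; apply/orP; left; apply/eqP; congr nrm; apply/funext => x; ring.
  move: e3; rewrite nrmZ// ger0_norm//; lra.
have nxd n y : sqi y -> nrm (fun x => nx n y x - y x) <= 3^-1 ^+ n.
  move=> hy; have e : nrm (xi n) <= 3^-1 ^+ n.
    rewrite /xi nrmZ// ger0_norm ?exprn_ge0// ler_piMr ?exprn_ge0//.
    by have [] := hv n.
  rewrite /nx; case: ifP => _.
    by apply: le_trans e; rewrite le_eqVlt; apply/orP; left; apply/eqP; congr nrm;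
      apply/funext => x; ring.
  apply: le_trans e; rewrite -(nrmN mD hw (sxi n)) le_eqVlt.
  by apply/orP; left; apply/eqP; congr nrm; apply/funext => x; ring.
pose y := fix y n := if n is n'.+1 then nx n'.+1 (y n') else nx 0%N (fun=> 0).
have sy n : sqi (y n) by elim: n => [|n IH]; apply: nxs => //; exact: sqi0.
have yd n : nrm (fun x => y n.+1 x - y n x) <= 3^-1 ^+ n.+1 by exact: nxd.
have yn n : 9 / 10 * 3^-1 ^+ n * M n <= nrm (S (t n) (y n)).
  have t0 : 0 <= t n by have [] := ht n.
  have -> : y n = nx n (if n is n'.+1 then y n' else fun=> 0) by case: n {t0}.
  apply: le_trans (nxn n _ _); last by case: n {t0} => //; exact: sqi0.
  rewrite /xi (eqv_nrm (S_scaleE _ t0 (sv n))) nrmZ//; last exact: S_L.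
  rewrite ger0_norm ?exprn_ge0// [9 / 10 * _]mulrC -mulrA ler_wpM2l ?exprn_ge0//.
  by have [] := hv n.
have yt n m : nrm (fun x => y (n + m)%N x - y n x) <= 2^-1 * 3^-1 ^+ n * (1 - 3^-1 ^+ m).
  elim: m => [|m IH].
    rewrite addn0 expr0 subrr mulr0 (_ : (fun x => _) = fun x => 0 * y n x).
      by rewrite nrmZ// normr0 mul0r.
    by apply/funext => x; ring.
  rewrite addnS; apply: le_trans (nrm_tri mD hw c0 cw (sy _) (sy (n + m)%N) (sy _)) _.
  apply: le_trans (lerD (yd _) IH) _; rewrite !exprS exprD.
  rewrite le_eqVlt; apply/orP; left; apply/eqP; by field.
have fast n : nrm (fun x => y n.+1 x - y n x) <= 2^-1 ^+ n.
  apply: le_trans (yd n) _; rewrite exprS.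
  have h : (3^-1 : R) ^+ n <= 2^-1 ^+ n by rewrite lerXn2r ?nnegrE ?invr_ge0// lef_pV2 ?posrE// ler_nat.
  have : 0 <= (3^-1 : R) ^+ n by rewrite exprn_ge0.
  lra.
have [z [hz cz]] := L2_complete_fast mD hw c0 cw sy fast.
(* The tail of the geometric series: 3^-(n+1) + 3^-(n+2) + ... = 3^-n / 2. *)
have zy n : nrm (fun x => z x - y n x) <= 2^-1 * 3^-1 ^+ n.
  apply/ler_addgt0Pr => e e0; have [N hN] := cz e e0.
  apply: le_trans (nrm_tri mD hw c0 cw hz (sy (n + N)%N) (sy n)) _; rewrite addrC.
  apply: lerD; last by apply/ltW/hN; exact: leq_addl.
  apply: le_trans (yt n N) _; rewrite ler_piMr ?mulr_ge0 ?exprn_ge0// gerBl exprn_ge0//.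
(* The hump contributes 9/10 and the tail takes away at most 1/2 of 3^-n [M n]; what is left is 2/5,
   and [M n] exceeds 4^n. *)
have big n : 2 / 5 * (4 / 3) ^+ n <= nrm (S (t n) z).
  have t0 : 0 <= t n by have [] := ht n.
  have h1 : nrm (S (t n) (y n)) <= nrm (S (t n) z) + M n * (2^-1 * 3^-1 ^+ n).
    have := nrmB mD hw c0 cw (S_L t0 hz) (sqiB mD (S_L t0 hz) (S_L t0 (sy n))).
    rewrite (_ : (fun x => _) = S (t n) (y n)); last by apply/funext => x; ring.
    move=> /le_trans; apply; rewrite lerD2l -(eqv_nrm (S_subE t0 hz (sy n))).
    have [_ h _] := hM n; apply: le_trans (h _ (sqiB mD hz (sy n))) _.
    by rewrite ler_pM2l.
  have h2 : (4 / 3 : R) ^+ n = 3^-1 ^+ n * 4 ^+ n by rewrite -exprMn mulrC.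
  have h3 : 3^-1 ^+ n * 4 ^+ n <= 3^-1 ^+ n * M n by rewrite ler_pM2l ?exprn_gt0// ltW.
  have := yn n; rewrite h2; lra.
have [del del0 hdel] := S_c hz ltr01.
have [k hk1 hk2] : exists2 k, (2^-1 : R) ^+ k < del & 2 + nrm z < 2 / 5 * (4 / 3 : R) ^+ k.
  have c1 : (2^-1 : R) ^+ n @[n --> \oo] --> 0.
    by apply: cvg_expr; rewrite ger0_norm// invf_lt1// ltr1n.
  have c2 : (3 / 4 : R) ^+ n @[n --> \oo] --> 0.
    by apply: cvg_expr; rewrite ger0_norm//; lra.
  have z0 : 0 < 2 + nrm z by have := nrm_ge0 mu D w z; lra.
  have e0 : 0 < 2 / 5 * (2 + nrm z)^-1 by rewrite mulr_gt0 ?invr_gt0.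
  move/cvgrPdist_lt : c1 => /(_ _ del0)[k1 _ hk1].
  move/cvgrPdist_lt : c2 => /(_ _ e0)[k2 _ hk2].
  exists (maxn k1 k2).
    by have := hk1 _ (leq_maxl k1 k2); rewrite /= sub0r normrN ger0_norm ?exprn_ge0.
  have := hk2 _ (leq_maxr k1 k2); rewrite /= sub0r normrN ger0_norm ?exprn_ge0//.
  rewrite -[4 / 3]invrK exprVn invf_div ltr_pdivlMr// => h.
  by rewrite ltr_pdivlMr ?exprn_gt0// mulrC.
have [t0 tk _] := ht k.
have h1 : nrm (S (t k) z) <= nrm z + 1.
  have [tk0|tk0] := eqVneq (t k) 0.
    by rewrite tk0 (eqv_nrm (And3 (S_L (lexx 0) hz) hz (S_0 hz))) lerDl.
  have tp : 0 < t k by rewrite lt_neqAle eq_sym tk0.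
  have h := hdel _ tp (le_lt_trans tk hk1).
  have := nrmD mD hw c0 cw (sqiB mD (S_L t0 hz) hz) hz.
  rewrite (_ : (fun x => _) = S (t k) z); last by apply/funext => x; ring.
  lra.
have := big k; lra.
Qed.

(** Time b is cut into pieces of length at most [del]; the semigroup law multiplies the bounds.
    Replacing C by C + 1 >= 1 makes the powers monotone in the number of pieces. *)
Lemma S_bound b : 0 <= b -> exists C, 0 <= C /\
  forall t u, 0 <= t -> t <= b -> sqi u -> nrm (S t u) <= C * nrm u.
Proof.
move=> b0; have [del [C [del0 C0 hC]]] := S_bound0.
pose C1 := C + 1.
have C1_ge1 : 1 <= C1 by rewrite /C1 lerDr.
have H n t u : 0 <= t -> t <= n%:R * del -> sqi u -> nrm (S t u) <= C1 ^+ n * nrm u.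
  elim: n t u => [|n IH] t u t0 tn hu.
    have -> : t = 0 by apply/le_anti; rewrite t0 andbT (le_trans tn)// mul0r.
    rewrite expr0 mul1r (@eqv_nrm _ u)//.
    by split => //; [exact: S_L|exact: S_0].
  have [tdel|tdel] := leP t del.
    apply: le_trans (hC _ _ t0 tdel hu) _; apply: ler_wpM2r; first exact: nrm_ge0.
    apply: (@le_trans _ _ C1); first by rewrite /C1 lerDl.
    by rewrite exprS ler_peMr ?(le_trans _ C1_ge1)// exprn_ege1.
  have t1 : 0 <= t - del by rewrite subr_ge0 ltW.
  have -> : t = del + (t - del) by rewrite addrC subrK.
  rewrite (eqv_nrm (S_DE (ltW del0) t1 hu)).
  apply: le_trans (hC _ _ (ltW del0) (lexx _) (S_L t1 hu)) _.
  rewrite exprS -mulrA; apply: ler_pM => //; rewrite ?nrm_ge0//; first by rewrite /C1 lerDl.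
  by apply: IH => //; rewrite lerBlDr (le_trans tn)// mulrSr mulrDl mul1r.
exists (C1 ^+ (Num.truncn (b / del)).+1); split; first by rewrite exprn_ge0 ?(le_trans _ C1_ge1).
move=> t u t0 tb hu; apply: H => //; apply: (le_trans tb).
by rewrite -ler_pdivrMr// ltW// truncnS_gt// divr_ge0// ltW.
Qed.

(** For s <= t the increment is S_s (S_(t-s) u - u), so continuity at 0 from the right and the local
    bound give uniform two-sided continuity. *)
Lemma S_cont u b e : sqi u -> 0 <= b -> 0 < e -> exists2 del, 0 < del &
  forall s t, 0 <= s -> s <= b -> 0 <= t -> t <= b -> `|s - t| < del ->
    nrm (fun x => S s u x - S t u x) < e.
Proof.
move=> hu b0 e0; have [C [C0 hC]] := S_bound b0.
have e1 : 0 < e / (C + 1) by rewrite divr_gt0// ltr_wpDl.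
have [del del0 hdel] := S_c hu e1.
exists del => //.
have H s t : 0 <= s -> s <= t -> t <= b -> t - s < del ->
    nrm (fun x => S t u x - S s u x) < e.
  move=> s0 st tb dst; have ts0 : 0 <= t - s by rewrite subr_ge0.
  have t0 := le_trans s0 st.
  have h1 : nrm (fun x => S (t - s) u x - u x) < e / (C + 1).
    have [ts|ts] := eqVneq (t - s) 0; first by rewrite ts S_0.
    by apply: hdel => //; rewrite lt_neqAle eq_sym ts.
  have /eqv_nrm -> : eqv (fun x => S t u x - S s u x) (S s (fun x => S (t - s) u x - u x)).
    apply: eqv_trans (eqv_sym (S_subE s0 (S_L ts0 hu) hu)).
    apply: eqvB; last by apply: eqv_refl; exact: S_L.
    by have := S_DE s0 ts0 hu; rewrite addrC subrK.
  apply: le_lt_trans (hC _ _ s0 (le_trans st tb) (sqiB mD (S_L ts0 hu) hu)) _.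
  apply: (@le_lt_trans _ _ (C * (e / (C + 1)))); first by rewrite ler_wpM2l// ltW.
  by rewrite mulrCA gtr_pMr// ltr_pdivrMr ?mul1r ?ltrDl// ltr_wpDl.
move=> s t s0 sb t0 tb; have [st|ts] := leP s t => dst.
  rewrite nrmBC//; try exact: S_L.
  by apply: H => //; move: dst; rewrite ler0_norm ?subr_le0// opprB.
by apply: H => //; [exact: ltW|move: dst; rewrite ger0_norm// subr_ge0 ltW].
Qed.

Definition gen u v : Prop := forall e, 0 < e -> exists2 del, 0 < del &
  forall t, 0 < t -> t < del -> nrm (fun x => (S t u x - u x) / t - v x) < e.

Lemma gen_S u v t : sqi u -> sqi v -> gen u v -> 0 <= t -> gen (S t u) (S t v).
Proof.
move=> hu hv g t0 e e0; have [C [C0 hC]] := S_bound t0.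
have e1 : 0 < e / (C + 1) by rewrite divr_gt0// ltr_wpDl.
have [del del0 hdel] := g _ e1; exists del => // h h0 hd.
have hh := S_L (ltW h0) hu.
have /eqv_nrm -> : eqv (fun x => (S h (S t u) x - S t u x) / h - S t v x)
    (S t (fun x => (S h u x - u x) / h - v x)).
  have hq : sqi (fun x => h^-1 * (S h u x - u x)) by apply: sqiZ => //; exact: sqiB.
  have e3 : eqv (S t (fun x => (S h u x - u x) / h - v x))
      (fun x => S t (fun x => h^-1 * (S h u x - u x)) x - S t v x).
    have := S_subE t0 hq hv; congr eqv; congr S; apply/funext => x; ring.
  apply: eqv_trans (eqv_sym e3).
  apply: eqvB; last by apply: eqv_refl; exact: S_L.
  apply: eqv_trans (eqv_sym (S_scaleE _ t0 (sqiB mD hh hu))).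
  apply: (@eqv_trans (fun x => h^-1 * (S h (S t u) x - S t u x))).
    rewrite (_ : (fun x => _ / h) = (fun x => h^-1 * (S h (S t u) x - S t u x))).
      by apply: eqv_refl; apply: sqiZ => //; apply: sqiB => //; do ?apply: S_L => //; exact: ltW.
    by apply/funext => x; ring.
  apply: eqvZ; apply: eqv_trans (eqv_sym (S_subE t0 hh hu)).
  apply: eqvB; last by apply: eqv_refl; exact: S_L.
  apply: eqv_trans (S_DE t0 (ltW h0) hu); rewrite addrC.
  by apply: eqv_sym; apply: S_DE => //; exact: ltW.
have hs : sqi (fun x => (S h u x - u x) / h - v x).
  rewrite (_ : (fun x => _) = fun x => h^-1 * (S h u x - u x) - v x).
    by apply: sqiB => //; apply: sqiZ => //; exact: sqiB.
  by apply/funext => x; ring.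
apply: le_lt_trans (hC _ _ t0 (lexx _) hs) _.
apply: (@le_lt_trans _ _ (C * (e / (C + 1)))); first by rewrite ler_wpM2l// ltW// hdel.
by rewrite mulrCA gtr_pMr// ltr_pdivrMr ?mul1r ?ltrDl// ltr_wpDl.
Qed.

Definition cdiff (y : R -> T -> R) t (y' : T -> R) : Prop :=
  [/\ sqi (y t), sqi y' & forall e, 0 < e -> exists2 del, 0 < del &
    forall h, h != 0 -> `|h| < del ->
      sqi (y (t + h)) /\ nrm (fun x => (y (t + h) x - y t x) / h - y' x) < e].

(** The derivative from the right is [gen_S]. From the left, with k = -h, the quotient is S_(t-k)
    applied to (S_k u - u) / k: the local bound controls the error of the inner quotient, and
    continuity of the orbit of v moves t - k back to t. *)
Lemma gen_cdiff u v t : sqi u -> sqi v -> gen u v -> 0 < t ->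
  cdiff (fun s => S s u) t (S t v).
Proof.
move=> hu hv g t0; have t0' := ltW t0; split; [exact: S_L|exact: S_L|] => e e0.
have [C [C0 hC]] := S_bound t0'.
have e1 : 0 < e / 2 / (C + 1) by rewrite !divr_gt0// ltr_wpDl.
have e2 : 0 < e / 2 by rewrite divr_gt0.
have [d1 d10 hd1] := gen_S hu hv g t0' e0.
have [d2 d20 hd2] := g _ e1.
have [d3 d30 hd3] := S_cont hv t0' e2.
exists (Num.min (Num.min d1 d2) (Num.min d3 t)); first by rewrite !lt_min d10 d20 d30.
move=> h hn0; rewrite !lt_min => /andP[/andP[h1 h2] /andP[h3 h4]].
have th0 : 0 <= t + h by move: h4; rewrite ltr_norml => /andP[? _]; lra.
split; first exact: S_L.
have [hp|hm] := ltP 0 h.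
  rewrite gtr0_norm// in h1.
  have := hd1 h hp h1; congr (_ < _).
  apply: eqv_nrm; have hq : sqi (fun x => h^-1 * S t u x + S t v x).
    by apply: sqiD => //; [apply: sqiZ => //|]; exact: S_L.
  have := eqvB (eqvZ h^-1 (S_DE (ltW hp) t0' hu)) (eqv_refl hq).
  move=> /eqv_sym; rewrite [h + t]addrC; congr eqv; apply/funext => x; ring.
have hlt : h < 0 by rewrite lt_neqAle hn0.
pose k := - h; have k0 : 0 < k by rewrite oppr_gt0.
have hk : `|h| = k by rewrite ltr0_norm.
have hh := S_L (ltW k0) hu.
have hq : sqi (fun x => k^-1 * (S k u x - u x)) by apply: sqiZ => //; exact: sqiB.
have E : eqv (fun x => (S (t + h) u x - S t u x) / h - S t v x)
   (fun x => S (t + h) (fun x => k^-1 * (S k u x - u x) - v x) x + (S (t + h) v x - S t v x)).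
  have htE : eqv (S t u) (S (t + h) (S k u)).
    by have := S_DE th0 (ltW k0) hu; rewrite /k addrK.
  have hsv : eqv (fun x => S (t + h) v x - S t v x) (fun x => S (t + h) v x - S t v x).
    by apply: eqv_refl; apply: sqiB => //; exact: S_L.
  apply: eqv_trans (eqvD (eqv_sym (S_subE th0 hq hv)) hsv).
  have hsv' : eqv (fun x => S (t + h) v x) (fun x => S (t + h) v x).
    by apply: eqv_refl; exact: S_L.
  have h5 := eqvB (eqv_sym (S_scaleE k^-1 th0 (sqiB mD hh hu))) hsv'.
  apply: eqv_trans (eqvD h5 hsv).
  have h6 := eqvB (eqvZ k^-1 (eqv_sym (S_subE th0 hh hu))) hsv'.
  apply: eqv_trans (eqvD h6 hsv).
  have h7 := eqvD (eqvB (eqvZ k^-1 (eqvB htE (eqv_refl (S_L th0 hu)))) hsv') hsv.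
  apply: eqv_trans h7; rewrite (_ : (fun x => _ / h - _) = (fun x =>
    k^-1 * (S t u x - S (t + h) u x) - S (t + h) v x + (S (t + h) v x - S t v x))).
    apply: eqv_refl; apply: sqiD => //; apply: sqiB => //; try exact: S_L.
    by apply: sqiZ => //; apply: sqiB => //; exact: S_L.
  by apply/funext => x; rewrite /k invrN; ring.
rewrite (eqv_nrm E).
have hb : sqi (fun x => k^-1 * (S k u x - u x) - v x) by exact: sqiB.
apply: le_lt_trans (nrmD mD hw c0 cw (S_L th0 hb) (sqiB mD (S_L th0 hv) (S_L t0' hv))) _.
rewrite (splitr e); apply: ltrD; last first.
  by apply: hd3 => //; [lra|rewrite addrC addKr].
apply: le_lt_trans (hC _ _ th0 _ hb) _; first lra.
have hk2 : nrm (fun x => k^-1 * (S k u x - u x) - v x) < e / 2 / (C + 1).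
  rewrite hk in h2; have := hd2 k k0 h2; congr (nrm _ < _); apply/funext => x; ring.
apply: (@le_lt_trans _ _ (C * (e / 2 / (C + 1)))); first by rewrite ler_wpM2l// ltW.
by rewrite mulrCA gtr_pMr// ltr_pdivrMr ?mul1r ?ltrDl// ltr_wpDl.
Qed.
Let n2 u : nrm u ^+ 2 = dot u u. Proof. exact: nrm2 c0 cw _. Qed.

(** * Time averages of orbits *)

Lemma ip_sum (I : nat) (g : 'I_I -> T -> R) z : (forall k, sqi (g k)) -> sqi z ->
  sqi (fun x => \sum_(k < I) g k x) /\ dot (fun x => \sum_(k < I) g k x) z = \sum_(k < I) dot (g k) z.
Proof.
move=> hg hz; elim: I g hg => [|I IH] g hg.
  rewrite (_ : (fun x => _) = fun=> 0); last by apply/funext => x; rewrite big_ord0.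
  rewrite big_ord0; split; first exact: sqi0.
  have := ipZl mD 0 hw (sqi0 mu D) hz; rewrite [RHS]mul0r => E.
  by rewrite -[RHS]E; congr ip; apply/funext => x; ring.
rewrite (_ : (fun x => _) = fun x => \sum_(k < I) g (widen_ord (leqnSn I) k) x + g ord_max x).
  have [h1 h2] := IH (fun k => g (widen_ord (leqnSn I) k)) (fun k => hg _).
  by split; [exact: sqiD|rewrite ipDl// h2 big_ord_recr].
by apply/funext => x; rewrite big_ord_recr.
Qed.

Lemma S_sumE (I : nat) (g : 'I_I -> T -> R) t : 0 <= t -> (forall k, sqi (g k)) ->
  eqv (S t (fun x => \sum_(k < I) g k x)) (fun x => \sum_(k < I) S t (g k) x).
Proof.
move=> t0; elim: I g => [|I IH] g hg.
  rewrite (_ : (fun x => _) = fun x => 0 * 0); last by apply/funext => x; rewrite big_ord0 mul0r.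
  apply: eqv_trans (S_scaleE 0 t0 (sqi0 mu D)) _.
  rewrite (_ : (fun x => \sum_(k < 0) _) = fun x => 0 * S t (fun=> 0) x).
    by apply: eqv_refl; apply: sqiZ => //; apply: S_L => //; exact: sqi0.
  by apply/funext => x; rewrite big_ord0 mul0r.
rewrite (_ : (fun x => _) = fun x => \sum_(k < I) g (widen_ord (leqnSn I) k) x + g ord_max x).
  have h0 : sqi (fun x => \sum_(k < I) g (widen_ord (leqnSn I) k) x).
    by have [] := @ip_sum I (fun k => g (widen_ord (leqnSn I) k)) _ (fun k => hg _) (sqi0 mu D).
  apply: eqv_trans (S_addE t0 h0 (hg _)) _.
  rewrite (_ : (fun x => \sum_(k < I.+1) _) = (fun x =>
    \sum_(k < I) S t (g (widen_ord (leqnSn I) k)) x + S t (g ord_max) x)).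
    by apply: eqvD; [exact: IH|apply: eqv_refl; exact: S_L].
  by apply/funext => x; rewrite big_ord_recr.
by apply/funext => x; rewrite big_ord_recr.
Qed.

(** Scalar substitute for a vector-valued integral of the orbit. Freezing the orbit at negative
    times and integrating from -1 makes the derivative two-sided even at t = 0. *)
Lemma orbit_primitive u z : sqi u -> sqi z -> exists F : R -> R,
  forall t, 0 <= t -> is_derive t 1 F (dot (S t u) z).
Proof.
move=> hu hz; pose f t := dot (S (Num.max 0 t) u) z.
have m0 t : 0 <= Num.max 0 t by rewrite le_max lexx.
have fc : continuous f.
  move=> t; apply/cvgrPdist_lt => e e0.
  have e1 : 0 < e / (nrm z + 1) by rewrite divr_gt0// ltr_wpDl ?nrm_ge0.
  have [del del0 hdel] := S_cont hu (m0 (t + 1)) e1.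
  near=> s; rewrite -ipBl//; try exact: S_L.
  apply: le_lt_trans (dot_CS mD hw c0 cw (sqiB mD (S_L (m0 _) hu) (S_L (m0 _) hu)) hz) _.
  have tt : Num.max 0 t <= Num.max 0 (t + 1) by rewrite ge_max !le_max lexx lerDl ler01 orbT.
  have st : Num.max 0 s <= Num.max 0 (t + 1).
    rewrite ge_max !le_max lexx/=; apply/orP; right; near: s.
    by apply: nbhs_left_le || (exists 1 => //= y; rewrite /ball/= ltr_norml => /andP[? ?]; lra).
  have dd : `|Num.max 0 t - Num.max 0 s| < del.
    apply: (@le_lt_trans _ _ `|t - s|).
      by rewrite /Num.max; case: ltP => h1; case: ltP => h2; rewrite !ler_norml;
        apply/andP; split; have := ler_norm (t - s); have := ler_norm (s - t);
        rewrite [in `|s - t|]distrC; lra.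
    by near: s; exists del => //= y; rewrite /ball/=.
  have := hdel _ _ (m0 t) tt (m0 s) st dd => h.
  apply: (@le_lt_trans _ _ (e / (nrm z + 1) * nrm z)).
    by rewrite ler_wpM2r ?nrm_ge0// ltW.
  by rewrite mulrAC -mulrA gtr_pMr// ltr_pdivrMr ?mul1r ?ltrDl// ltr_wpDl// nrm_ge0.
have fi (u' : R) : -1 < u' -> lebesgue_measure.-integrable `[-1, u'] (EFin \o f).
  move=> _; apply: continuous_compact_integrable; first exact: segment_compact.
  by apply: continuous_subspaceT.
exists (fun t => \int[lebesgue_measure]_(x in `[-1, t]) f x) => t t0.
have t1 : t < t + 1 by rewrite ltrDl.
have t2 : -1 < t by apply: lt_le_trans t0; rewrite ltrN10.
have t3 : -1 < t + 1 by exact: lt_trans t1.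
have [h1 h2] := @continuous_FTC1 R f (BLeft (-1)) t (t + 1) t1 (fi _ t3) t2 (fc t).
have -> : dot (S t u) z = f t by rewrite /f max_r.
by rewrite -h2 derive1E; exact: DeriveDef.
Unshelve. all: by end_near. Qed.

Let MVTle (F : R -> R) (g : R -> R) a b : (forall t, 0 <= t -> is_derive t 1 F (g t)) ->
  0 <= a -> a < b -> exists2 xi, a < xi < b & F b - F a = g xi * (b - a).
Proof.
move=> dF a0 ab; have [||xi] := @MVT R F g a b ab.
- by move=> x; rewrite in_itv/= => /andP[ax _]; apply: dF; rewrite (le_trans a0)// ltW.
- apply: derivable_within_continuous => x; rewrite in_itv/= => /andP[ax _].
  by apply: ex_derive; apply: dF; exact: le_trans ax.
by rewrite in_itv/= => h ->; exists xi.
Qed.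

(** Left Riemann sum, with n + 1 cells, of the integral of S_s u over [0, e]. *)
Let Rs u e n : T -> R := fun x =>
  e / n.+1%:R * \sum_(k < n.+1) S (k%:R * (e / n.+1%:R)) u x.

Let kh_ge0 e n (k : nat) : 0 < e -> 0 <= k%:R * (e / n.+1%:R).
Proof. by move=> e0; rewrite mulr_ge0// divr_ge0// ltW. Qed.

Let sRs u e n : sqi u -> 0 < e -> sqi (Rs u e n).
Proof.
move=> hu e0; apply: sqiZ => //.
by have [] := @ip_sum n.+1 (fun k => S (k%:R * (e / n.+1%:R)) u) _
  (fun k => S_L (kh_ge0 n k e0) hu) (sqi0 mu D).
Qed.

(** On each cell the mean value theorem writes the increment of [F] as the value at a point within
    one step of the node, so the oscillation bound [eta] applies cell by cell. *)
Let dot_Rs u e n t z F eta : sqi u -> sqi z -> 0 < e -> 0 <= t ->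
  (forall s, 0 <= s -> is_derive s 1 F (dot (S s u) z)) ->
  (forall s s', 0 <= s -> s <= t + e -> 0 <= s' -> s' <= t + e -> `|s - s'| <= e / n.+1%:R ->
     nrm (fun x => S s u x - S s' u x) <= eta) ->
  `|dot (S t (Rs u e n)) z - (F (t + e) - F t)| <= e * (eta * nrm z).
Proof.
move=> hu hz e0 t0 dF osc; set h := e / n.+1%:R.
have h0 : 0 < h by rewrite divr_gt0.
have hk (k : nat) : 0 <= k%:R * h by rewrite mulr_ge0// ltW.
have tk (k : nat) : 0 <= t + k%:R * h by rewrite addr_ge0.
have sS : sqi (fun x => \sum_(k < n.+1) S (k%:R * h) u x).
  by have [] := @ip_sum n.+1 (fun k => S (k%:R * h) u) _ (fun k => S_L (hk k) hu) (sqi0 mu D).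
have -> : dot (S t (Rs u e n)) z = h * \sum_(k < n.+1) dot (S (t + k%:R * h) u) z.
  rewrite (eqv_dot hz (S_scaleE h t0 sS)) ipZl//; last exact: S_L.
  congr (_ * _); rewrite (eqv_dot hz (@S_sumE n.+1 (fun k => S (k%:R * h) u) _ t0 (fun k => S_L (hk k) hu))).
  have [_ ->] := @ip_sum n.+1 (fun k => S t (S (k%:R * h) u)) z
    (fun k => S_L t0 (S_L (hk k) hu)) hz.
  apply: eq_bigr => k _; apply: eqv_dot => //; apply: eqv_sym; exact: S_DE.
have nh : n.+1%:R * h = e by rewrite /h mulrC divfK// pnatr_eq0.
have -> : F (t + e) - F t = \sum_(k < n.+1) (F (t + k.+1%:R * h) - F (t + k%:R * h)).
  rewrite -(big_mkord predT (fun k => F (t + k.+1%:R * h) - F (t + k%:R * h))).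
  by rewrite telescope_sumr// nh mul0r addr0.
rewrite mulr_sumr -sumrB; apply: le_trans (ler_norm_sum _ _ _) _.
apply: (@le_trans _ _ (\sum_(k < n.+1) h * (eta * nrm z))); last first.
  by rewrite sumr_const card_ord -[_ *+ _]mulr_natl mulrA nh.
apply: ler_sum => k _.
have kk : t + k%:R * h < t + k.+1%:R * h by rewrite ltrD2l ltr_pM2r// ltr_nat.
have [xi /andP[x1 x2] ->] := MVTle dF (tk k) kk.
have -> : t + k.+1%:R * h - (t + k%:R * h) = h by rewrite mulrSr; ring.
have xi0 : 0 <= xi by exact: le_trans (tk k) (ltW x1).
rewrite [dot (S xi u) z * h]mulrC -mulrBr normrM (gtr0_norm h0) ler_pM2l// -ipBl//; try exact: S_L.
apply: le_trans (dot_CS mD hw c0 cw (sqiB mD (S_L (tk k) hu) (S_L xi0 hu)) hz) _.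
rewrite ler_wpM2r ?nrm_ge0//.
have kn : k.+1%:R * h <= e by rewrite -nh ler_pM2r// ler_nat.
apply: osc => //; try lra.
rewrite ler_norml; apply/andP; move: x1 x2 kn; rewrite mulrSr mulrDl mul1r -/h; split; lra.
Qed.

(** [A] is the integral of S_s u over [0, e], the L^2 limit of the Riemann sums. Norm estimates are
    reduced to scalar ones by pairing with [z] equal to the very difference to be estimated, which
    gives |z|^2 <= eta |z|. The last clause lets two-sided bounds on pairings survive the
    regularization. *)
Lemma average u e : sqi u -> 0 < e -> exists A, [/\ sqi A,
  gen A (fun x => S e u x - u x),
  (forall eta, (forall s, 0 <= s -> s <= e -> nrm (fun x => S s u x - u x) <= eta) ->
     nrm (fun x => A x / e - u x) <= eta) &
  forall t z M, 0 <= t -> sqi z -> (forall s, 0 <= s -> 0 <= dot (S s u) z <= M) ->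
    0 <= dot (S t A) z <= e * M].
Proof.
move=> hu e0.
have small b eta : 0 <= b -> 0 < eta -> exists N, forall n, (N <= n)%N ->
    forall s s', 0 <= s -> s <= b -> 0 <= s' -> s' <= b -> `|s - s'| <= e / n.+1%:R ->
     nrm (fun x => S s u x - S s' u x) <= eta.
  move=> b0 eta0; have [del del0 hdel] := S_cont hu b0 eta0.
  exists (Num.truncn (e / del)).+1 => n Nn s s' ? ? ? ? ss; apply/ltW/hdel => //.
  apply: le_lt_trans ss _; rewrite ltr_pdivrMr// -ltr_pdivrMl// mulrC.
  apply: (@lt_le_trans _ _ (Num.truncn (e / del)).+1%:R).
    by rewrite truncnS_gt// divr_ge0// ltW.
  by rewrite ler_nat (leq_trans Nn).
have S0 v z : sqi v -> sqi z -> dot (S 0 v) z = dot v z.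
  by move=> hv hz; apply: eqv_dot => //; split => //; [exact: S_L|exact: S_0].
have cau : forall eta : R, 0 < eta -> exists N, forall n m, (N <= n)%N -> (N <= m)%N ->
     nrm (fun x => Rs u e n x - Rs u e m x) < eta.
  move=> eta eta0; have eta1 : 0 < eta / (4 * e) by rewrite divr_gt0// mulr_gt0.
  have [N hN] := small (0 + e) _ (addr_ge0 (lexx 0) (ltW e0)) eta1.
  exists N => n m Nn Nm; set z := fun x => _.
  have hz : sqi z by apply: sqiB => //; exact: sRs.
  have [F dF] := orbit_primitive hu hz.
  have h1 := dot_Rs hu hz e0 (lexx 0) dF (hN n Nn).
  have h2 := dot_Rs hu hz e0 (lexx 0) dF (hN m Nm).
  rewrite S0// in h1; last exact: sRs.
  rewrite S0// in h2; last exact: sRs.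
  have : nrm z ^+ 2 <= eta / 2 * nrm z.
    rewrite n2 {1}/z ipBl//; [|exact: sRs|exact: sRs].
    move: h1 h2.
    have -> : e * (eta / (4 * e) * nrm z) = eta / 4 * nrm z by field; rewrite gt_eqF.
    rewrite !ler_norml => /andP[? ?] /andP[? ?]; lra.
  have := nrm_ge0 mu D w z; nra.
have [A [hA cA]] := L2_complete mD hw c0 cw (fun n => sRs n hu e0) cau.
have dotA t z F : 0 <= t -> sqi z ->
    (forall s, 0 <= s -> is_derive s 1 F (dot (S s u) z)) -> dot (S t A) z = F (t + e) - F t.
  move=> t0 hz dF; apply/eqP; rewrite -subr_eq0 -normr_le0; apply/ler_addgt0Pr => eta eta0.
  rewrite add0r; have [C [C0 hC]] := S_bound t0.
  have z1 : 0 < nrm z + 1 by rewrite ltr_wpDl ?nrm_ge0.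
  have C1 : 0 < C + 1 by rewrite ltr_wpDl.
  have eta1 : 0 < eta / 2 / (C + 1) / (nrm z + 1) by rewrite !divr_gt0.
  have eta2 : 0 < eta / 2 / (nrm z + 1) / e by rewrite !divr_gt0.
  have [N1 hN1] := cA _ eta1; have [N2 hN2] := small (t + e) _ (addr_ge0 t0 (ltW e0)) eta2.
  pose n := maxn N1 N2.
  have h1 := hN1 n (leq_maxl _ _).
  have h2 := dot_Rs hu hz e0 t0 dF (hN2 n (leq_maxr _ _)).
  have sR := sRs n hu e0.
  have h3 : `|dot (S t A) z - dot (S t (Rs u e n)) z| <= eta / 2.
    rewrite -ipBl//; [|exact: S_L|exact: S_L].
    rewrite -(eqv_dot hz (S_subE t0 hA sR)).
    apply: le_trans (dot_CS mD hw c0 cw (S_L t0 (sqiB mD hA sR)) hz) _.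
    apply: (@le_trans _ _ ((C * (eta / 2 / (C + 1) / (nrm z + 1))) * nrm z)).
      rewrite ler_wpM2r ?nrm_ge0//; apply: le_trans (hC _ _ t0 (lexx _) (sqiB mD hA sR)) _.
      by rewrite ler_wpM2l// ltW.
    have -> : C * (eta / 2 / (C + 1) / (nrm z + 1)) * nrm z =
      eta / 2 * (C / (C + 1)) * (nrm z / (nrm z + 1)).
      by field; rewrite !gt_eqF.
    have a1 : C / (C + 1) <= 1 by rewrite ler_pdivrMr// mul1r lerDl.
    have a2 : nrm z / (nrm z + 1) <= 1 by rewrite ler_pdivrMr// mul1r lerDl.
    rewrite -mulrA ger_pMr; last by rewrite divr_gt0.
    by apply: mulr_ile1 => //; rewrite divr_ge0 ?nrm_ge0// ltW.
  have h4 : e * (eta / 2 / (nrm z + 1) / e * nrm z) <= eta / 2.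
    have -> : e * (eta / 2 / (nrm z + 1) / e * nrm z) = eta / 2 * (nrm z / (nrm z + 1)).
      by field; rewrite !gt_eqF.
    have a2 : nrm z / (nrm z + 1) <= 1 by rewrite ler_pdivrMr// mul1r lerDl.
    by rewrite ger_pMr// divr_gt0.
  rewrite (splitr eta); apply: le_trans (lerD h3 (le_trans h2 h4)).
  apply: le_trans (ler_normD _ _); rewrite le_eqVlt; apply/orP; left; apply/eqP.
  by congr `|_|; ring.
exists A; split => //.
- move=> eta eta0; have eta1 : 0 < eta / 3 by rewrite divr_gt0.
  have [del del0 hdel] := S_cont hu (addr_ge0 (ltW e0) (@ler01 R)) eta1.
  exists (Num.min del 1); first by rewrite lt_min del0 ltr01.
  move=> h h0; rewrite lt_min => /andP[hd h1]; set z := fun x => _.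
  have h0' := ltW h0.
  have e0' := ltW e0.
  have hSA : sqi (S h A) by exact: S_L.
  have hSu : sqi (S e u) by exact: S_L.
  have zE : z = fun x => h^-1 * (S h A x - A x) - (S e u x - u x).
    by apply/funext => x; rewrite /z; ring.
  have hz : sqi z.
    by rewrite zE; apply: sqiB => //; [apply: sqiZ => //|]; exact: sqiB.
  have [F dF] := orbit_primitive hu hz.
  have eh : e < e + h by rewrite ltrDl.
  have [x1 /andP[x1a x1b] E1] := MVTle dF e0' eh.
  have [x2 /andP[x2a x2b] E2] := MVTle dF (lexx 0) h0.
  have x10 : 0 <= x1 by exact: le_trans (ltW x1a).
  have x20 : 0 <= x2 by exact: ltW.
  have : nrm z ^+ 2 <= (eta / 3 + eta / 3) * nrm z.
    rewrite n2 {1}zE ipBl//; [|by apply: sqiZ => //; exact: sqiB|exact: sqiB].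
    rewrite ipZl ?ipBl//; last exact: sqiB.
    rewrite -(S0 A z)// (dotA h z F)// (dotA 0 z F)// add0r.
    have -> : h^-1 * (F (h + e) - F h - (F e - F 0)) =
        h^-1 * ((F (e + h) - F e) - (F h - F 0)) by rewrite [h + e]addrC; ring.
    rewrite E1 E2 subr0 (addrC e h) addrK -mulrBl mulrC mulfK ?gt_eqF//.
    have -> : dot (S x1 u) z - dot (S x2 u) z - (dot (S e u) z - dot u z) =
      (dot (S x1 u) z - dot (S e u) z) - (dot (S x2 u) z - dot (S 0 u) z).
      by rewrite (S0 u z)//; ring.
    rewrite -(ipBl mD hw (S_L x10 hu) hSu hz) -(ipBl mD hw (S_L x20 hu) (S_L (lexx 0) hu) hz).
    have h1' := dot_le mD hw c0 cw (sqiB mD (S_L x10 hu) (S_L e0' hu)) hz.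
    have h2' := dot_CS mD hw c0 cw (sqiB mD (S_L x20 hu) (S_L (lexx 0) hu)) hz.
    have k1 : nrm (fun x => S x1 u x - S e u x) <= eta / 3.
      by apply/ltW/hdel => //; rewrite ?ger0_norm; lra.
    have k2 : nrm (fun x => S x2 u x - S 0 u x) <= eta / 3.
      by apply/ltW/hdel => //; rewrite ?ger0_norm; lra.
    have k1' := ler_wpM2r (nrm_ge0 mu D w z) k1.
    have k2' := ler_wpM2r (nrm_ge0 mu D w z) k2.
    move: h2'; rewrite ler_norml => /andP[? ?]; rewrite mulrDl; lra.
  have := nrm_ge0 mu D w z; nra.
- move=> eta hosc; have h0 : 0 <= eta by have := hosc 0 (lexx _) (ltW e0); exact: le_trans (nrm_ge0 _ _ _ _).
  have hAe : sqi (fun x => A x / e).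
    rewrite (_ : (fun x => _) = fun x => e^-1 * A x); first exact: sqiZ.
    by apply/funext => x; ring.
  set z := fun x => _; have hz : sqi z by exact: sqiB.
  have [F dF] := orbit_primitive hu hz.
  have [xi /andP[x1 x2] E] := MVTle dF (lexx 0) e0.
  have xi0 := ltW x1.
  have : nrm z ^+ 2 <= eta * nrm z.
    rewrite n2 {1}/z ipBl//.
    have -> : dot (fun x => A x / e) z = e^-1 * dot A z.
      by rewrite -ipZl//; congr ip; apply/funext => x; ring.
    rewrite -(S0 A z)// (dotA 0 z F)// add0r E subr0 mulrC mulfK ?gt_eqF//.
    rewrite -ipBl//; last exact: S_L.
    apply: le_trans (dot_le mD hw c0 cw (sqiB mD (S_L xi0 hu) hu) hz) _.
    by rewrite ler_wpM2r ?nrm_ge0// hosc// ltW.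
  have := nrm_ge0 mu D w z; nra.
- move=> t z M t0 hz hM; have [F dF] := orbit_primitive hu hz.
  rewrite (dotA t z F)//; have te : t < t + e by rewrite ltrDl.
  have [xi /andP[x1 x2] ->] := MVTle dF t0 te.
  have xi0 : 0 <= xi by exact: le_trans (ltW x1).
  have /andP[? ?] := hM xi xi0.
  have -> : t + e - t = e by ring.
  by rewrite mulr_ge0 ?(ltW e0)//= mulrC ler_pM2l.
Qed.
End semigroup.

(** * Differentiable curves in L^2 *)

Section curves.
Context d (T : measurableType d) (R : realType) (mu : {measure set T -> \bar R}).
Variables (D : set T) (mD : measurable D).
Variables (w : T -> R) (c : R).
Hypotheses (hw : bdm D w) (c0 : 0 < c) (cw : forall x, D x -> c <= w x).
Implicit Types (u v b : T -> R) (t : R).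
Local Notation sqi := (sqi mu D).
Local Notation dot := (ip mu D w).
Local Notation nrm := (nrm mu D w).
Local Notation cdiff := (cdiff mu D w).

Lemma is_derive_eps (f : R -> R) t (l : R) :
  (forall e : R, 0 < e -> exists2 del : R, 0 < del & forall h, h != 0 -> `|h| < del ->
     `|(f (t + h) - f t) / h - l| < e) -> is_derive t 1 f l.
Proof.
move=> H; have cv : (fun h => h^-1 *: ((f \o shift t) (h *: (1 : R)) - f t)) @ 0^' --> l.
  apply/cvgrPdist_lt => e e0; have [del del0 hdel] := H e e0.
  exists del => //= h; rewrite /ball/= sub0r normrN => hd hn0.
  have -> : h *: (1 : R) = h by rewrite /GRing.scale/= mulr1.
  by rewrite distrC /GRing.scale/= mulrC [h + t]addrC; exact: hdel.
have dv : derivable f t 1 by apply/cvg_ex; exists l.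
by apply: DeriveDef => //; apply/cvg_lim.
Qed.

Lemma decreasing_of_derive (f f' : R -> R) (s t : R) :
  (forall r : R, 0 < r -> is_derive r 1 f (f' r)) -> (forall r : R, 0 < r -> f' r <= 0) ->
  0 < s -> s <= t -> f t <= f s.
Proof.
move=> df f0 s0; rewrite le_eqVlt => /orP[/eqP -> //|st].
have [||xi] := @MVT R f f' s t st.
- by move=> r; rewrite in_itv/= => /andP[sr _]; apply: df; exact: lt_trans sr.
- apply: derivable_within_continuous => r; rewrite in_itv/= => /andP[sr _].
  by apply: ex_derive; apply: df; exact: lt_le_trans sr.
rewrite in_itv/= => /andP[sxi _] E.
have := f0 xi (lt_trans s0 sxi); have : 0 < t - s by rewrite subr_gt0.
move: E; nra.
Qed.

Lemma nrmM_le b M u : bdm D b -> 0 <= M -> (forall x, D x -> `|b x| <= M) -> sqi u ->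
  nrm (fun x => b x * u x) <= M * nrm u.
Proof.
move=> hb M0 bM hu; rewrite -(@ler_pXn2r _ 2)// ?nnegrE ?mulr_ge0 ?nrm_ge0//.
rewrite exprMn !(nrm2 _ c0 cw).
have -> : dot (fun x => b x * u x) (fun x => b x * u x) = ip mu D (fun x => (w x * (b x * b x))) u u.
  by apply: eq_Rintegral => x _; ring.
rewrite -ipwZ//; apply: ip_le => //.
- by do 2 apply: bdmM => //.
- by apply: bdmM => //; exact: bdm_cst.
- move=> x Dx; rewrite mulrC ler_wpM2r ?(le_trans (ltW c0)) ?cw//.
  rewrite -expr2 -(real_normK (num_real (b x))) ler_pXn2r ?nnegrE ?bM//.
Qed.

Lemma cdiff_continuous (y : R -> T -> R) t (y' : T -> R) : cdiff y t y' -> forall e : R, 0 < e ->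
  exists2 del : R, 0 < del & forall h, h != 0 -> `|h| < del ->
   sqi (y (t + h)) /\ nrm (fun x => y (t + h) x - y t x) < e.
Proof.
move=> [hy hy' H] e e0; have [del del0 hdel] := H 1 ltr01.
have k0 : 0 < nrm y' + 1 by rewrite ltr_wpDl ?nrm_ge0.
exists (Num.min del (e / (nrm y' + 1))); first by rewrite lt_min del0 divr_gt0.
move=> h hn0; rewrite lt_min => /andP[hd he]; have [hyh hn] := hdel h hn0 hd.
split => //; set q := fun x => (y (t + h) x - y t x) / h.
have hq : sqi q.
  rewrite (_ : q = fun x => h^-1 * (y (t + h) x - y t x)); last by apply/funext => x; rewrite /q mulrC.
  by apply: sqiZ => //; exact: sqiB.
rewrite (_ : (fun x => _) = fun x => h * q x); last first.
  by apply/funext => x; rewrite /q mulrC divfK.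
rewrite nrmZ//; have q1 : nrm q <= nrm y' + 1.
  have := nrmD mD hw c0 cw (sqiB mD hq hy') hy'.
  rewrite (_ : (fun x => _) = q); last by apply/funext => x; rewrite subrK.
  by move=> /le_trans; apply; rewrite addrC lerD2l ltW.
have h0 : 0 < `|h| by rewrite normr_gt0.
apply: (@le_lt_trans _ _ (`|h| * (nrm y' + 1))); first by rewrite ler_wpM2l.
by rewrite -ltr_pdivlMr.
Qed.

Lemma cdiff_dot (y z : R -> T -> R) t (y' z' : T -> R) : cdiff y t y' -> cdiff z t z' ->
  is_derive t 1 (fun s => dot (y s) (z s)) (dot y' (z t) + dot (y t) z').
Proof.
move=> dy dz; apply: is_derive_eps => e e0.
have [hy hy' Hy] := dy; have [hz hz' Hz] := dz.
have n0 := nrm_ge0 mu D w.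
have k1 : 0 < e / 3 / (nrm (z t) + 1 + 1) by rewrite !divr_gt0// addr_gt0// ltr_wpDl ?n0.
have k2 : 0 < e / 3 / (nrm y' + 1) by rewrite !divr_gt0// ltr_wpDl ?n0.
have k3 : 0 < e / 3 / (nrm (y t) + 1) by rewrite !divr_gt0// ltr_wpDl ?n0.
have [d1 d10 hd1] := Hy _ k1; have [d2 d20 hd2] := cdiff_continuous dz k2.
have [d3 d30 hd3] := Hz _ k3; have [d4 d40 hd4] := cdiff_continuous dz ltr01.
exists (Num.min (Num.min d1 d2) (Num.min d3 d4)); first by rewrite !lt_min d10 d20 d30.
move=> h hn0; rewrite !lt_min => /andP[/andP[h1 h2] /andP[h3 h4]].
have [hyh n1] := hd1 h hn0 h1; have [hzh n2] := hd2 h hn0 h2.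
have [_ n3] := hd3 h hn0 h3; have [_ n4] := hd4 h hn0 h4.
set qy := fun x => (y (t + h) x - y t x) / h; set qz := fun x => (z (t + h) x - z t x) / h.
have qyE : qy = fun x => h^-1 * (y (t + h) x - y t x) by apply/funext => x; rewrite /qy mulrC.
have qzE : qz = fun x => h^-1 * (z (t + h) x - z t x) by apply/funext => x; rewrite /qz mulrC.
have hqy : sqi qy by rewrite qyE; apply: sqiZ => //; exact: sqiB.
have hqz : sqi qz by rewrite qzE; apply: sqiZ => //; exact: sqiB.
have -> : (dot (y (t + h)) (z (t + h)) - dot (y t) (z t)) / h - (dot y' (z t) + dot (y t) z') =
  dot (fun x => qy x - y' x) (z (t + h)) + dot y' (fun x => z (t + h) x - z t x) +
  dot (y t) (fun x => qz x - z' x).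
  rewrite ipBl// ipBr// ipBr// qyE qzE ipZl ?ipZr ?ipBl ?ipBr//; try exact: sqiB.
  by field.
have b1 := dot_CS mD hw c0 cw (sqiB mD hqy hy') hzh.
have b2 := dot_CS mD hw c0 cw hy' (sqiB mD hzh hz).
have b3 := dot_CS mD hw c0 cw hy (sqiB mD hqz hz').
have zz : nrm (z (t + h)) <= nrm (z t) + 1.
  have := nrmD mD hw c0 cw (sqiB mD hzh hz) hz.
  rewrite (_ : (fun x => _) = z (t + h)); last by apply/funext => x; rewrite subrK.
  by move=> /le_trans; apply; rewrite addrC lerD2l ltW.
have c1 : nrm (fun x => qy x - y' x) * nrm (z (t + h)) < e / 3.
  apply: (@le_lt_trans _ _ (e / 3 / (nrm (z t) + 1 + 1) * (nrm (z t) + 1))).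
    by apply: ler_pM => //; exact: ltW.
  rewrite mulrAC -mulrA gtr_pMr ?divr_gt0// ltr_pdivrMr ?mul1r ?ltrDl//.
  by rewrite addr_gt0// ltr_wpDl.
have c2 : nrm y' * nrm (fun x => z (t + h) x - z t x) < e / 3.
  apply: (@le_lt_trans _ _ (nrm y' * (e / 3 / (nrm y' + 1)))).
    by rewrite ler_wpM2l// ltW.
  by rewrite mulrCA gtr_pMr ?divr_gt0// ltr_pdivrMr ?mul1r ?ltrDl// ltr_wpDl.
have c3 : nrm (y t) * nrm (fun x => qz x - z' x) < e / 3.
  apply: (@le_lt_trans _ _ (nrm (y t) * (e / 3 / (nrm (y t) + 1)))).
    by rewrite ler_wpM2l// ltW.
  by rewrite mulrCA gtr_pMr ?divr_gt0// ltr_pdivrMr ?mul1r ?ltrDl// ltr_wpDl.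
apply: le_lt_trans (ler_normD _ _) _.
apply: le_lt_trans (lerD (ler_normD _ _) (lexx _)) _.
have := le_lt_trans b1 c1; have := le_lt_trans b2 c2; have := le_lt_trans b3 c3.
clear; lra.
Qed.

Lemma cdiffM b (y : R -> T -> R) t (y' : T -> R) : bdm D b -> cdiff y t y' ->
  cdiff (fun s x => b x * y s x) t (fun x => b x * y' x).
Proof.
move=> hb [hy hy' H]; split; [exact: sqiM|exact: sqiM|] => e e0.
have [_ [M hM]] := hb; have M0 : 0 < `|M| + 1 by rewrite ltr_wpDl.
have e1 : 0 < e / (`|M| + 1) by rewrite divr_gt0.
have [del del0 hdel] := H _ e1; exists del => // h hn0 hd.
have [hyh hn] := hdel h hn0 hd; split; first exact: sqiM.
set q := fun x => (y (t + h) x - y t x) / h - y' x.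
have hq : sqi q.
  apply: sqiB => //.
  rewrite (_ : (fun x => _) = fun x => h^-1 * (y (t + h) x - y t x)).
    by apply: sqiZ => //; exact: sqiB.
  by apply/funext => x; rewrite mulrC.
rewrite (_ : (fun x => _) = fun x => b x * q x); last first.
  by apply/funext => x; rewrite /q; ring.
apply: le_lt_trans (nrmM_le hb (ltW M0) _ hq) _.
  by move=> x Dx; apply: le_trans (hM x Dx) _; rewrite (le_trans (ler_norm _))// lerDl.
by rewrite mulrC -ltr_pdivlMr.
Qed.

Lemma cdiffD (y z : R -> T -> R) t (y' z' : T -> R) : cdiff y t y' -> cdiff z t z' ->
  cdiff (fun s x => y s x + z s x) t (fun x => y' x + z' x).
Proof.
move=> [hy hy' Hy] [hz hz' Hz]; split; [exact: sqiD|exact: sqiD|] => e e0.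
have e2 : 0 < e / 2 by rewrite divr_gt0.
have [d1 d10 hd1] := Hy _ e2; have [d2 d20 hd2] := Hz _ e2.
exists (Num.min d1 d2); first by rewrite lt_min d10.
move=> h hn0; rewrite lt_min => /andP[h1 h2].
have [hyh n1] := hd1 h hn0 h1; have [hzh n2] := hd2 h hn0 h2.
split; first exact: sqiD.
have hq (g : T -> R) g' (k : T -> R) : sqi g -> sqi g' -> sqi k -> sqi (fun x => (g x - g' x) / h - k x).
  move=> ? ? ?; apply: sqiB => //.
  rewrite (_ : (fun x => _) = fun x => h^-1 * (g x - g' x)).
    by apply: sqiZ => //; exact: sqiB.
  by apply/funext => x; rewrite mulrC.
rewrite (splitr e); apply: le_lt_trans (ltrD n1 n2).
rewrite (_ : (fun x => _) = fun x => ((y (t + h) x - y t x) / h - y' x) +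
  ((z (t + h) x - z t x) / h - z' x)); last by apply/funext => x; ring.
exact: (nrmD mD hw c0 cw (hq _ _ _ hyh hy hy') (hq _ _ _ hzh hz hz')).
Qed.

Lemma cdiffZ (r : R -> R) (r' : R) (y : R -> T -> R) t (y' : T -> R) : is_derive t 1 r r' -> cdiff y t y' ->
  cdiff (fun s x => r s * y s x) t (fun x => r' * y t x + r t * y' x).
Proof.
move=> dr dy; have [hy hy' H] := dy.
split; [exact: sqiZ|by apply: sqiD => //; exact: sqiZ|] => e e0.
have n0 := nrm_ge0 mu D w.
have e1 : 0 < e / 3 / (nrm (y t) + 1) by rewrite !divr_gt0// ltr_wpDl.
have rM : 0 < `|r'| + 1 by rewrite ltr_wpDl.
have e2 : 0 < e / 3 / (`|r'| + 1) by rewrite !divr_gt0.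
have e3 : 0 < e / 3 / (`|r t| + 1) by rewrite !divr_gt0// ltr_wpDl.
have cr : (fun h => h^-1 *: ((r \o shift t) (h *: (1 : R)) - r t)) @ 0^' --> r'.
  have dv : derivable r t 1 by exact: ex_derive.
  by rewrite -[X in _ --> X](@derive_val _ _ _ _ _ _ _ dr); exact: dv.
have Hr (eta : R) : 0 < eta -> exists2 del : R, 0 < del & forall h, h != 0 -> `|h| < del ->
     `|(r (t + h) - r t) / h - r'| < eta.
  move=> eta0; move/cvgrPdist_lt : cr => /(_ _ eta0)[del /= del0 hdel].
  exists del => // h hn0 hd; have := hdel h; rewrite /ball/= sub0r normrN => /(_ hd hn0).
  have -> : h *: (1 : R) = h by rewrite /GRing.scale/= mulr1.
  by rewrite distrC /GRing.scale/= mulrC [h + t]addrC.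
have [d1 d10 hd1] := Hr _ e1; have [d2 d20 hd2] := Hr _ ltr01.
have [d3 d30 hd3] := H _ e3; have [d4 d40 hd4] := cdiff_continuous dy e2.
exists (Num.min (Num.min d1 d2) (Num.min d3 d4)); first by rewrite !lt_min d10 d20 d30.
move=> h hn0; rewrite !lt_min => /andP[/andP[h1 h2] /andP[h3 h4]].
have n1 := hd1 h hn0 h1; have n2 := hd2 h hn0 h2.
have [hyh n3] := hd3 h hn0 h3; have [_ n4] := hd4 h hn0 h4.
split; first exact: sqiZ.
set q := fun x => (y (t + h) x - y t x) / h - y' x.
have hq : sqi q.
  apply: sqiB => //; rewrite (_ : (fun x => _) = fun x => h^-1 * (y (t + h) x - y t x)).
    by apply: sqiZ => //; exact: sqiB.
  by apply/funext => x; rewrite mulrC.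
set k := (r (t + h) - r t) / h.
have hyy := sqiB mD hyh hy.
rewrite (_ : (fun x => _) = fun x => ((k - r') * y t x + k * (y (t + h) x - y t x)) + r t * q x); last first.
  by apply/funext => x; rewrite /q /k; field.
apply: le_lt_trans (nrmD mD hw c0 cw (sqiD mD (sqiZ mD _ hy) (sqiZ mD _ hyy)) (sqiZ mD _ hq)) _.
apply: le_lt_trans (lerD (nrmD mD hw c0 cw (sqiZ mD _ hy) (sqiZ mD _ hyy)) (lexx _)) _.
rewrite !nrmZ//.
have k1 : `|k| <= `|r'| + 1.
  rewrite -lerBlDl (le_trans (lerB_dist _ _))// ltW//.
have c1 : `|k - r'| * nrm (y t) < e / 3.
  apply: (@le_lt_trans _ _ (e / 3 / (nrm (y t) + 1) * nrm (y t))).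
    by rewrite ler_wpM2r// ltW.
  by rewrite mulrAC -mulrA gtr_pMr ?divr_gt0// ltr_pdivrMr ?mul1r ?ltrDl// ltr_wpDl.
have c2 : `|k| * nrm (fun x => y (t + h) x - y t x) < e / 3.
  apply: (@le_lt_trans _ _ ((`|r'| + 1) * nrm (fun x => y (t + h) x - y t x))).
    by rewrite ler_wpM2r.
  by rewrite mulrC -ltr_pdivlMr.
have c3 : `|r t| * nrm q < e / 3.
  apply: (@le_lt_trans _ _ (`|r t| * (e / 3 / (`|r t| + 1)))).
    by rewrite ler_wpM2l// ltW.
  by rewrite mulrCA gtr_pMr ?divr_gt0// ltr_pdivrMr ?mul1r ?ltrDl// ltr_wpDl.
move: c1 c2 c3; clear; lra.
Qed.

Lemma cdiff_rev (y : R -> T -> R) s t (y' : T -> R) : cdiff y (t - s) y' -> cdiff (fun r => y (t - r)) s (fun x => - y' x).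
Proof.
move=> [hy hy' H]; split; [by []|exact: sqiN|] => e e0.
have [del del0 hdel] := H e e0; exists del => // h hn0 hd.
have := hdel (- h); rewrite oppr_eq0 normrN => /(_ hn0 hd).
have -> : t - s - h = t - (s + h) by ring.
move=> [h1 h2]; split => //; rewrite -nrmN//; last first.
  apply: sqiB; [exact: mD| |exact: sqiN].
  rewrite (_ : (fun x => _) = fun x => h^-1 * (y (t - (s + h)) x - y (t - s) x)).
    by apply: sqiZ => //; exact: sqiB.
  by apply/funext => x; rewrite mulrC.
by move: h2; congr (nrm _ < _); apply/funext => x; rewrite invrN; ring.
Qed.

End curves.

(** * Contraction and symmetry from the generator *)

Section symmetric_semigroup.
Context d (T : measurableType d) (R : realType) (mu : {measure set T -> \bar R}).
Variables (D : set T) (mD : measurable D).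
Variables (w : T -> R) (c : R).
Hypotheses (hw : bdm D w) (c0 : 0 < c) (cw : forall x, D x -> c <= w x).
Implicit Types (u v z : T -> R) (s t h e : R).
Local Notation sqi := (sqi mu D).
Local Notation dot := (ip mu D w).
Local Notation nrm := (nrm mu D w).
Variable S : R -> (T -> R) -> T -> R.
Hypothesis HS : L2_semigroup mu D w S.
Local Notation gen := (gen mu D w S).
Hypothesis gen_le0 : forall u v, sqi u -> sqi v -> gen u v -> dot v u <= 0.
Hypothesis gen_sym : forall u v u' v', sqi u -> sqi v -> sqi u' -> sqi v' ->
  gen u v -> gen u' v' -> dot v u' = dot u v'.

(** The mean of the orbit over a short time interval lies in the domain of the generator, is close
    to [u], and keeps every bound on pairings that holds along the whole orbit of [u]. *)
Lemma dense_domain u e : sqi u -> 0 < e -> exists u' v', [/\ sqi u', sqi v', gen u' v',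
  nrm (fun x => u' x - u x) < e &
  forall t z M, 0 <= t -> sqi z -> (forall s, 0 <= s -> 0 <= dot (S s u) z <= M) ->
    0 <= dot (S t u') z <= M].
Proof.
move=> hu e0; have e2 : 0 < e / 2 by rewrite divr_gt0.
have [del del0 hdel] := S_cont mD hw c0 cw HS hu ler01 e2.
pose h := Num.min (del / 2) 1.
have h0 : 0 < h by rewrite lt_min divr_gt0//=.
have h1 : h <= 1 by rewrite ge_min lexx orbT.
have hd : h < del by rewrite gt_min; apply/orP; left; lra.
have [A [hA gA nA dA]] := average mD hw c0 cw HS hu h0.
have hA' : sqi (fun x => h^-1 * A x) by exact: sqiZ.
exists (fun x => h^-1 * A x), (fun x => h^-1 * (S h u x - u x)).
have hSu := sg_L2 HS (ltW h0) hu.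
have hv : sqi (fun x => S h u x - u x) by exact: sqiB.
split => //; first exact: sqiZ.
- move=> eta eta0; have eta1 : 0 < eta * h by rewrite mulr_gt0.
  have [d1 d10 hd1] := gA _ eta1; exists d1 => // t t0 td.
  have hSA := sg_L2 HS (ltW t0) hA.
  have hq : sqi (fun x => (S t A x - A x) / t - (S h u x - u x)).
    apply: sqiB => //; rewrite (_ : (fun x => _) = fun x => t^-1 * (S t A x - A x)).
      by apply: sqiZ => //; exact: sqiB.
    by apply/funext => x; rewrite mulrC.
  have E : eqv mu D w (fun x => (S t (fun x => h^-1 * A x) x - h^-1 * A x) / t - h^-1 * (S h u x - u x))
     (fun x => h^-1 * ((S t A x - A x) / t - (S h u x - u x))).
    have h5 := eqvB mD hw c0 cw (S_scaleE mD HS h^-1 (ltW t0) hA) (eqv_refl mD hw hA').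
    have h6 := eqvB mD hw c0 cw (eqvZ mD hw t^-1 h5) (eqv_refl mD hw (sqiZ mD h^-1 hv)).
    move: h6; congr eqv; apply/funext => x; ring.
  rewrite (eqv_nrm mD hw c0 cw E) nrmZ// gtr0_norm ?invr_gt0//.
  by rewrite mulrC ltr_pdivrMr//; exact: hd1.
- apply: (@le_lt_trans _ _ (e / 2)); last lra.
  rewrite (_ : (fun x => _) = fun x => A x / h - u x); last by apply/funext => x; ring.
  apply: nA => s s0 sh; apply: le_trans (ltW (hdel s 0 _ _ _ _ _)) => //; try lra.
    rewrite -(eqv_nrm mD hw c0 cw (u := fun x => S s u x - S 0 u x)) ?lexx//.
    apply: (eqvB mD hw c0 cw); first by apply: (eqv_refl mD hw); exact: (sg_L2 HS).
    by split => //; [exact: (sg_L2 HS)|exact: (sg_0 HS)].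
  by rewrite subr0 ger0_norm//; exact: le_lt_trans hd.
- move=> t z M t0 hz hM; have := dA t z M t0 hz hM.
  rewrite (eqv_dot mD hw c0 cw hz (S_scaleE mD HS h^-1 t0 hA)).
  rewrite ipZl//; last exact: (sg_L2 HS).
  move=> /andP[a1 a2]; rewrite mulr_ge0 ?invr_ge0 ?(ltW h0)//=.
  by rewrite ler_pdivrMl.
Qed.

Let orbit_near0 u e : sqi u -> 0 < e -> exists2 s0, 0 < s0 & forall s, 0 < s -> s < s0 ->
  nrm (fun x => S s u x - u x) < e.
Proof. by move=> hu e0; have [s0 ? ?] := sg_continuous HS hu e0; exists s0. Qed.

(** The derivative of |S_r u|^2 is 2 <S_r v, S_r u> <= 0, but only at r > 0; the value at 0 is
    reached through small positive times. *)
Let contraction_dom u v t : sqi u -> sqi v -> gen u v -> 0 <= t -> nrm (S t u) <= nrm u.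
Proof.
move=> hu hv g; rewrite le_eqVlt => /orP[/eqP <-|t0].
  rewrite le_eqVlt (eqv_nrm mD hw c0 cw (v := u)) ?eqxx//.
  by split => //; [exact: (sg_L2 HS)|exact: (sg_0 HS)].
apply/ler_addgt0Pr => e e0; have [s0 s00 hs0] := orbit_near0 hu e0.
pose s := Num.min (s0 / 2) t.
have sp : 0 < s by rewrite lt_min divr_gt0.
have st : s <= t by rewrite ge_min lexx orbT.
have ss : s < s0 by rewrite gt_min; apply/orP; left; lra.
apply: (@le_trans _ _ (nrm (S s u))); last first.
  have hSs := sg_L2 HS (ltW sp) hu.
  have := nrmD mD hw c0 cw (sqiB mD hSs hu) hu.
  rewrite (_ : (fun x => _) = S s u); last by apply/funext => x; rewrite subrK.
  by move=> /le_trans; apply; rewrite addrC lerD2l ltW// hs0.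
rewrite -(@ler_pXn2r _ 2)// ?nnegrE ?nrm_ge0// !(nrm2 _ c0 cw).
apply: (@decreasing_of_derive _ (fun r => dot (S r u) (S r u))
  (fun r => dot (S r v) (S r u) + dot (S r u) (S r v)) s t) => //.
  move=> r r0; have dd := gen_cdiff mD hw c0 cw HS hu hv g r0.
  exact: (cdiff_dot mD hw c0 cw dd dd).
move=> r r0; have r0' := ltW r0; rewrite [X in _ + X]ipC.
have := gen_le0 (sg_L2 HS r0' hu) (sg_L2 HS r0' hv) (gen_S mD hw c0 cw HS hu hv g r0'); lra.
Qed.

Lemma contraction u t : sqi u -> 0 <= t -> nrm (S t u) <= nrm u.
Proof.
move=> hu t0; apply/ler_addgt0Pr => e e0; have [C hC] := sg_bounded HS t0.
have k0 : 0 < e / 2 / (`|C| + 1) by rewrite !divr_gt0// ltr_wpDl.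
have k1 : 0 < Num.min (e / 2) (e / 2 / (`|C| + 1)) by rewrite lt_min k0 divr_gt0.
have [u' [v' [hu' hv' g nu _]]] := dense_domain hu k1.
move: nu; rewrite lt_min => /andP[n1 n2].
have h1 := contraction_dom hu' hv' g t0.
have hSu := sg_L2 HS t0 hu; have hSu' := sg_L2 HS t0 hu'.
have h2 : nrm (fun x => S t u' x - S t u x) <= e / 2.
  rewrite -(eqv_nrm mD hw c0 cw (S_subE mD HS t0 hu' hu)).
  apply: le_trans (hC _ (sqiB mD hu' hu)) _.
  apply: (@le_trans _ _ (`|C| * (e / 2 / (`|C| + 1)))).
    apply: le_trans (ler_wpM2r (nrm_ge0 _ _ _ _) (ler_norm C)) _.
    by rewrite ler_wpM2l// ltW.
  by rewrite mulrCA ger_pMr ?divr_gt0// ler_pdivrMr ?mul1r ?lerDl// ltr_wpDl.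
have h3 := nrmB mD hw c0 cw hSu' (sqiB mD hSu' hSu).
rewrite (_ : (fun x => S t u' x - _) = S t u) in h3; last by apply/funext => x; ring.
have h4 := nrmD mD hw c0 cw hu (sqiB mD hu' hu).
rewrite (_ : (fun x => u x + _) = u') in h4; last by apply/funext => x; ring.
lra.
Qed.

(** r |-> <S_r u, S_(t-r) u'> has derivative 0 on (0, t) because the generator is symmetric. It is
    compared at s and t - s for small s > 0, and both values are close to the two sides by
    continuity of the orbits. *)
Let symmetric_dom u v u' v' t : sqi u -> sqi v -> gen u v -> sqi u' -> sqi v' -> gen u' v' ->
  0 <= t -> dot (S t u) u' = dot u (S t u').
Proof.
move=> hu hv g hu' hv' g' t0.
have n0 := nrm_ge0 mu D w.
apply/eqP; rewrite -subr_eq0 -normr_le0; apply/ler_addgt0Pr => e e0; rewrite add0r.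
have k1 : 0 < nrm u + nrm u' + 1 by rewrite ltr_wpDl ?addr_ge0.
have e1 : 0 < e / 2 / 2 / (nrm u + nrm u' + 1) by rewrite !divr_gt0.
have [d1 d10 hd1] := S_cont mD hw c0 cw HS hu t0 e1.
have [d2 d20 hd2] := S_cont mD hw c0 cw HS hu' t0 e1.
have [tp|] := ltP 0 t; last first.
  move=> t0'; have tE : t = 0 by apply/le_anti; rewrite t0 t0'.
  rewrite tE (eqv_dot mD hw c0 cw (v := u))//; last first.
    by split => //; [exact: (sg_L2 HS)|exact: (sg_0 HS)].
  rewrite [X in _ - X]ipC (eqv_dot mD hw c0 cw (v := u') (z := u))//; last first.
    by split => //; [exact: (sg_L2 HS)|exact: (sg_0 HS)].
  by rewrite ipC subrr normr0 ltW.
pose s := Num.min (Num.min d1 d2 / 2) (t / 2).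
have sp : 0 < s by rewrite !lt_min !divr_gt0 ?lt_min ?d10.
have dmin1 : Num.min d1 d2 <= d1 by rewrite ge_min lexx.
have dmin2 : Num.min d1 d2 <= d2 by rewrite ge_min lexx orbT.
have dmin : 0 < Num.min d1 d2 by rewrite lt_min d10.
have s1 : s < d1.
  by rewrite gt_min; apply/orP; left; move: dmin1 dmin; lra.
have s2 : s < d2.
  by rewrite gt_min; apply/orP; left; move: dmin2 dmin; lra.
have s3 : s <= t / 2 by rewrite ge_min lexx orbT.
pose phi r := dot (S r u) (S (t - r) u').
have Ephi : phi s = phi (t - s).
  have [st|st] := eqVneq s (t - s); first by rewrite -st.
  have dphi r : 0 < r -> r < t -> is_derive r 1 phi 0.
    move=> r0 rt; have tr : 0 < t - r by rewrite subr_gt0.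
    have A := gen_cdiff mD hw c0 cw HS hu hv g r0.
    have B := cdiff_rev mD hw (gen_cdiff mD hw c0 cw HS hu' hv' g' tr).
    have := cdiff_dot mD hw c0 cw A B.
    have -> : dot (S r v) (S (t - r) u') + dot (S r u) (fun x => - S (t - r) v' x) = 0 => //.
    have hr := ltW r0; have htr := ltW tr.
    rewrite [X in _ + X]ipC ipNl//; [|exact: (sg_L2 HS)..].
    rewrite ipC (ipC _ _ _ (S (t - r) u')).
    rewrite (gen_sym (u := S r u) (v := S r v) (u' := S (t - r) u') (v' := S (t - r) v')).
    - by rewrite ipC subrr.
    - exact: (sg_L2 HS).
    - exact: (sg_L2 HS).
    - exact: (sg_L2 HS).
    - exact: (sg_L2 HS).
    - exact: (gen_S mD hw c0 cw HS).
    - exact: (gen_S mD hw c0 cw HS).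
  have sts : s < t - s by rewrite lt_neqAle st; lra.
  have [||xi _] := @MVT R phi (fun=> 0) s (t - s) sts.
  - by move=> r; rewrite in_itv/= => /andP[? ?]; apply: dphi; lra.
  - apply: derivable_within_continuous => r; rewrite in_itv/= => /andP[? ?].
    by apply: ex_derive; apply: dphi; lra.
  by rewrite mul0r => /eqP; rewrite subr_eq0 => /eqP ->.
have ts : 0 <= t - s by lra.
have S0u : nrm (fun x => S 0 u x - u x) = 0 by exact: (sg_0 HS).
have E1 : `|phi (t - s) - dot (S t u) u'| <= e / 2.
  have -> : phi (t - s) - dot (S t u) u' =
     dot (fun x => S (t - s) u x - S t u x) (S s u') + dot (S t u) (fun x => S s u' x - u' x).
    rewrite /phi ipBl ?ipBr//; try exact: (sg_L2 HS); try exact: (sg_L2 HS (ltW sp)).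
    have -> : t - (t - s) = s by ring.
    by ring.
  have hss := sg_L2 HS (ltW sp) hu'.
  have b1 := dot_CS mD hw c0 cw (sqiB mD (sg_L2 HS ts hu) (sg_L2 HS t0 hu)) hss.
  have b2 := dot_CS mD hw c0 cw (sg_L2 HS t0 hu) (sqiB mD hss hu').
  have q1 : nrm (fun x => S (t - s) u x - S t u x) <= e / 2 / 2 / (nrm u + nrm u' + 1).
    apply/ltW/hd1 => //; first by rewrite gerBl ltW.
    by rewrite addrAC subrr add0r normrN gtr0_norm.
  have q2 : nrm (fun x => S s u' x - u' x) <= e / 2 / 2 / (nrm u + nrm u' + 1).
    rewrite -(eqv_nrm mD hw c0 cw (u := fun x => S s u' x - S 0 u' x)).
      by apply/ltW/hd2 => //; [exact: ltW|lra|rewrite subr0 gtr0_norm].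
    apply: (eqvB mD hw c0 cw); first exact: (eqv_refl mD hw).
    by split => //; [exact: (sg_L2 HS)|exact: (sg_0 HS)].
  have p1 := contraction hu' (ltW sp).
  have p2 := contraction hu t0.
  apply: le_trans (ler_normD _ _) _; apply: le_trans (lerD b1 b2) _.
  apply: (@le_trans _ _ (e / 2 / 2 / (nrm u + nrm u' + 1) * (nrm u + nrm u' + 1))); last first.
    by rewrite divfK ?gt_eqF//; lra.
  have r1 := ler_pM (n0 _) (n0 _) q1 p1; have r2 := ler_pM (n0 _) (n0 _) p2 q2.
  move: (ltW e1) r1 r2; lra.
have E2 : `|phi s - dot u (S t u')| <= e / 2.
  have -> : phi s - dot u (S t u') =
     dot (fun x => S s u x - u x) (S (t - s) u') + dot u (fun x => S (t - s) u' x - S t u' x).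
    rewrite /phi ipBl ?ipBr//; try exact: (sg_L2 HS); try exact: (sg_L2 HS (ltW sp)).
    by ring.
  have hss := sg_L2 HS (ltW sp) hu.
  have b1 := dot_CS mD hw c0 cw (sqiB mD hss hu) (sg_L2 HS ts hu').
  have b2 := dot_CS mD hw c0 cw hu (sqiB mD (sg_L2 HS ts hu') (sg_L2 HS t0 hu')).
  have q1 : nrm (fun x => S s u x - u x) <= e / 2 / 2 / (nrm u + nrm u' + 1).
    rewrite -(eqv_nrm mD hw c0 cw (u := fun x => S s u x - S 0 u x)).
      by apply/ltW/hd1 => //; [exact: ltW|lra|rewrite subr0 gtr0_norm].
    apply: (eqvB mD hw c0 cw); first exact: (eqv_refl mD hw).
    by split => //; exact: (sg_L2 HS).
  have q2 : nrm (fun x => S (t - s) u' x - S t u' x) <= e / 2 / 2 / (nrm u + nrm u' + 1).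
    apply/ltW/hd2 => //; first by rewrite gerBl ltW.
    by rewrite addrAC subrr add0r normrN gtr0_norm.
  have p1 := contraction hu' ts.
  apply: le_trans (ler_normD _ _) _; apply: le_trans (lerD b1 b2) _.
  apply: (@le_trans _ _ (e / 2 / 2 / (nrm u + nrm u' + 1) * (nrm u + nrm u' + 1))); last first.
    by rewrite divfK ?gt_eqF//; lra.
  have r1 := ler_pM (n0 _) (n0 _) q1 p1; have r2 := ler_wpM2l (n0 u) q2.
  move: (ltW e1) r1 r2; lra.
rewrite (_ : _ - _ = (phi s - dot u (S t u')) - (phi (t - s) - dot (S t u) u')); last first.
  by rewrite Ephi; ring.
by apply: le_trans (ler_normB _ _) _; rewrite (splitr e) lerD.
Qed.

Lemma symmetric u u' t : sqi u -> sqi u' -> 0 <= t -> dot (S t u) u' = dot u (S t u').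
Proof.
move=> hu hu' t0; have n0 := nrm_ge0 mu D w.
apply/eqP; rewrite -subr_eq0 -normr_le0; apply/ler_addgt0Pr => e e0; rewrite add0r.
have k1 : 0 < nrm u + nrm u' + 2 by rewrite ltr_wpDl ?addr_ge0.
have e1 : 0 < Num.min 1 (e / 2 / (nrm u + nrm u' + 2)) by rewrite lt_min ltr01 !divr_gt0.
have [a [a' [ha ha' ga na _]]] := dense_domain hu e1.
have [b [b' [hb hb' gb nb _]]] := dense_domain hu' e1.
move: na nb; rewrite !lt_min => /andP[na1 na] /andP[nb1 nb].
have E := symmetric_dom ha ha' ga hb hb' gb t0.
have sa := sg_L2 HS t0 ha; have sb := sg_L2 HS t0 hb.
have su := sg_L2 HS t0 hu; have su' := sg_L2 HS t0 hu'.
have Ba := nrmB mD hw c0 cw ha hu; have dau := sqiB mD ha hu; have dbu := sqiB mD hb hu'.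
have H1 p q : sqi p -> sqi q -> nrm (fun x => S t p x - S t q x) <= nrm (fun x => p x - q x).
  move=> hx hy; rewrite -(eqv_nrm mD hw c0 cw (S_subE mD HS t0 hx hy)).
  by apply: contraction => //; exact: sqiB.
(* Telescoping through the domain vectors [a] and [b]: the middle terms cancel by [E], and every
   remaining term contains one small difference. *)
have -> : dot (S t u) u' - dot u (S t u') =
   - dot (fun x => S t a x - S t u x) u' - dot (S t a) (fun x => b x - u' x)
   + (dot (fun x => a x - u x) (S t u') + dot a (fun x => S t b x - S t u' x)).
  by rewrite !ipBl ?ipBr//; move: E; lra.
have c1 := dot_CS mD hw c0 cw (sqiB mD sa su) hu'.
have c2 := dot_CS mD hw c0 cw sa dbu.
have c3 := dot_CS mD hw c0 cw dau su'.
have c4 := dot_CS mD hw c0 cw ha (sqiB mD sb su').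
have na2 : nrm a <= nrm u + 1.
  have := nrmD mD hw c0 cw dau hu.
  rewrite (_ : (fun x => _) = a); last by apply/funext => x; rewrite subrK.
  by move=> /le_trans; apply; rewrite addrC lerD2l ltW.
have := ler_pM (n0 _) (n0 _) (le_trans (H1 a u ha hu) (ltW na)) (lexx (nrm u')).
have := ler_pM (n0 _) (n0 _) (le_trans (contraction ha t0) na2) (ltW nb).
have := ler_pM (n0 _) (n0 _) (ltW na) (contraction hu' t0).
have := ler_pM (n0 _) (n0 _) na2 (le_trans (H1 b u' hb hu') (ltW nb)).
have : e / 2 / (nrm u + nrm u' + 2) * (nrm u + nrm u' + 2) = e / 2 by rewrite divfK ?gt_eqF.
move: c1 c2 c3 c4; rewrite !ler_norml => /andP[? ?] /andP[? ?] /andP[? ?] /andP[? ?] ? ? ? ? ?.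
have : 0 < e / 2 / (nrm u + nrm u' + 2) by rewrite !divr_gt0.
by move=> ?; apply/andP; split; lra.
Qed.

End symmetric_semigroup.

(** * Smooth functions and planar topology *)

Section smooth_line.
Context {R : realType}.
Implicit Types (f g : R -> R) (n : nat) (s : R).

(** Class C^n, as a recursion on the derivative, so that stability under the algebraic operations
    and composition goes by induction on n. *)
Fixpoint ncont n g : Prop := continuous g /\
  if n is n'.+1 then (forall s, derivable g s 1) /\ ncont n' (derive1 g) else True.

Definition smooth1 g := forall n, ncont n g.

Lemma ncont_cont n g : ncont n g -> continuous g. Proof. by case: n => [|n] []. Qed.

Lemma ncontW n g : ncont n.+1 g -> ncont n g.
Proof.
elim: n g => [|n IH] g; first by move=> [? _]; split.
by move=> [cg [dg Dg]]; split => //; split => //; exact: IH.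
Qed.

Lemma ncontSP n f f' : (forall s : R, is_derive s 1 f (f' s)) -> ncont n f' -> ncont n.+1 f.
Proof.
move=> df nf; split; last split.
- move=> s; apply: differentiable_continuous; apply/derivable1_diffP.
  by have [] := df s.
- by move=> s; have [] := df s.
- rewrite (_ : derive1 f = f')//; apply/funext => s.
  by have h := df s; rewrite derive1E derive_val.
Qed.

Lemma ncont_is_derive n g s : ncont n.+1 g -> is_derive s 1 g (derive1 g s).
Proof. by move=> [_ [dg _]]; rewrite derive1E; apply: DeriveDef. Qed.

Lemma ncont_cst n (k : R) : ncont n (cst k).
Proof.
elim: n k => [|n IH] k; first by split => // s; exact: cvg_cst.
by apply: (ncontSP (f' := cst 0)).
Qed.

Lemma ncont_id n : ncont n (@id R).
Proof.
case: n => [|n]; first by split => // s; exact: cvg_id.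
by apply: (ncontSP (f' := cst 1)); exact: ncont_cst.
Qed.

Lemma ncontD n f g : ncont n f -> ncont n g -> ncont n (fun s => f s + g s).
Proof.
elim: n f g => [|n IH] f g hf hg.
  by split => // s; apply: cvgD; [exact: (ncont_cont hf)|exact: (ncont_cont hg)].
apply: (ncontSP (f' := fun s => derive1 f s + derive1 g s)).
  by move=> s; exact: (is_deriveD (ncont_is_derive s hf) (ncont_is_derive s hg)).
by apply: IH; [case: hf => _ []|case: hg => _ []].
Qed.

Lemma ncontM n f g : ncont n f -> ncont n g -> ncont n (fun s => f s * g s).
Proof.
elim: n f g => [|n IH] f g hf hg.
  by split => // s; apply: cvgM; [exact: (ncont_cont hf)|exact: (ncont_cont hg)].
apply: (ncontSP (f' := fun s => f s * derive1 g s + g s * derive1 f s)).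
  by move=> s; exact: (is_deriveM (ncont_is_derive s hf) (ncont_is_derive s hg)).
by apply: ncontD; apply: IH; try exact: ncontW; [case: hg => _ []|case: hf => _ []].
Qed.

Lemma ncontZ n (k : R) f : ncont n f -> ncont n (fun s => k * f s).
Proof. by move=> hf; apply: ncontM => //; exact: ncont_cst. Qed.

Lemma ncontN n f : ncont n f -> ncont n (fun s => - f s).
Proof.
by move=> hf; rewrite (_ : (fun s => _) = fun s => -1 * f s);
  [exact: ncontZ|apply/funext => s; rewrite mulN1r].
Qed.

Lemma ncontB n f g : ncont n f -> ncont n g -> ncont n (fun s => f s - g s).
Proof. by move=> hf hg; apply: ncontD => //; exact: ncontN. Qed.

Lemma ncontX n f k : ncont n f -> ncont n (fun s => f s ^+ k).
Proof.
move=> hf; elim: k => [|k IH].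
  by rewrite (_ : (fun s => _) = cst 1); [exact: ncont_cst|apply/funext => s; rewrite expr0].
by rewrite (_ : (fun s => _) = fun s => f s * f s ^+ k);
  [exact: ncontM|apply/funext => s; rewrite exprS].
Qed.

Lemma ncontV n f : (forall s, f s != 0) -> ncont n f -> ncont n (fun s => (f s)^-1).
Proof.
move=> f0; elim: n => [|n IH] hf.
  by split => // s; apply: cvgV => //; exact: (ncont_cont hf).
apply: (ncontSP (f' := fun s => - (((f s)^-1) ^+ 2 * derive1 f s))).
  move=> s; have := @is_deriveV _ f s _ 1 (f0 s) (ncont_is_derive s hf).
  by move=> hd; apply: (is_derive_eq hd); rewrite /GRing.scale/= exprVn mulNr.
apply: ncontN; apply: ncontM; last by case: hf => _ [].
by apply: ncontX; apply: IH; exact: ncontW.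
Qed.

Lemma ncont_comp n f g : ncont n g -> ncont n f -> ncont n (fun s => g (f s)).
Proof.
elim: n f g => [|n IH] f g hg hf.
  split => // s; apply: (@continuous_comp _ _ _ f g); first exact: (ncont_cont hf).
  exact: (ncont_cont hg).
apply: (ncontSP (f' := fun s => derive1 g (f s) * derive1 f s)).
  move=> s; exact: (@is_derive1_comp _ g f s _ _ (ncont_is_derive _ hg) (ncont_is_derive _ hf)).
apply: ncontM; last by case: hf => _ [].
by apply: (IH f); [case: hg => _ []|exact: ncontW].
Qed.

Lemma ncont_sin_cos n : ncont n (@sin R) /\ ncont n (@cos R).
Proof.
elim: n => [|n [IHs IHc]]; first by split; split => // s; [exact: continuous_sin|exact: continuous_cos].
split; first exact: (ncontSP (f' := cos)).
by apply: (ncontSP (f' := fun s => - sin s)); last exact: ncontN.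
Qed.

Lemma ncont_ln n f : (forall s, 0 < f s) -> ncont n f -> ncont n (fun s => ln (f s)).
Proof.
move=> f0; case: n => [|n] hf.
  split => // s; apply: (@continuous_comp _ _ _ f (@ln R)); first exact: (ncont_cont hf).
  exact: continuous_ln.
apply: (ncontSP (f' := fun s => (f s)^-1 * derive1 f s)).
  move=> s; exact: (@is_derive1_comp _ (@ln R) f s _ _ (is_derive1_ln (f0 s)) (ncont_is_derive _ hf)).
apply: ncontM; last by case: hf => _ [].
by apply: ncontV; [move=> s; rewrite gt_eqF|exact: ncontW].
Qed.

Lemma smooth1_derive1n g : smooth1 g -> forall n s, derivable (derive1n n g) s 1.
Proof.
move=> hg n; elim: n g hg => [|n IH] g hg s; first by have [_ []] := hg 1%N.
by rewrite derive1Sn; apply: IH => m; have [_ []] := hg m.+1.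
Qed.

Lemma smooth1_derive1 g : smooth1 g -> smooth1 (derive1 g).
Proof. by move=> hg n; have [_ []] := hg n.+1. Qed.

Lemma smooth1_is_derive g s : smooth1 g -> is_derive s 1 g (derive1 g s).
Proof. by move=> hg; exact: ncont_is_derive (hg 1%N). Qed.

Lemma smooth1_cont g : smooth1 g -> continuous g.
Proof. by move=> hg; exact: ncont_cont (hg 0%N). Qed.

(* The flat functions y^-m e^(-1/y), y > 0, are closed under differentiation up
   to linear combinations. *)
Definition flat (m : nat) (y : R) : R := if 0 < y then y ^- m * expR (- y^-1) else 0.

Lemma flat_ge0 m y : 0 <= flat m y.
Proof.
by rewrite /flat; case: ifP => // y0; rewrite mulr_ge0 ?expR_ge0 ?invr_ge0 ?exprn_ge0 ?ltW.
Qed.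

(** e^(1/y) >= y^-(m+1) / (m+1)! leaves one spare factor y. The difference quotient of [flat m] at 0
    is [flat m.+1], so this bound is exactly differentiability there with derivative 0. *)
Lemma flat_le m y : flat m y <= (m.+1)`!%:R * `|y|.
Proof.
rewrite /flat; case: ifP => [y0|_]; last by rewrite mulr_ge0.
rewrite gtr0_norm// expRN -exprVn.
have yi : 0 < y^-1 by rewrite invr_gt0.
have F0 : 0 < (m.+1)`!%:R :> R by rewrite ltr0n fact_gt0.
rewrite ler_pdivrMr ?expR_gt0//.
have := @expR_ge1Dxn R y^-1 m (ltW yi).
rewrite -(ler_pM2l F0) -(ler_pM2l y0) => h.
have : y^-1 ^+ m <= y * ((m.+1)`!%:R * (1 + y^-1 ^+ m.+1 / (m.+1)`!%:R)).
  have -> : y * ((m.+1)`!%:R * (1 + y^-1 ^+ m.+1 / (m.+1)`!%:R)) =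
    y * (m.+1)`!%:R + y^-1 ^+ m.
    by rewrite exprS; field; rewrite !gt_eqF.
  by rewrite lerDr mulr_ge0 ?ltW.
by move=> /le_trans; apply; apply: le_trans h _; rewrite mulrA [y * _]mulrC.
Qed.

Lemma flat_derive m s : is_derive s 1 (flat m) (- m%:R * flat m.+1 s + flat m.+2 s).
Proof.
have [s0|s0|s0] := ltgtP s 0.
- have -> : - m%:R * flat m.+1 s + flat m.+2 s = 0.
    by rewrite /flat ltNge (ltW s0)/= mulr0 addr0.
  apply: (@near_eq_is_derive R R R (cst 0)) => //.
  near=> t; rewrite /flat ltNge (_ : t <= 0)//; apply/ltW; near: t; exact: lt_nbhsl.
- have -> : - m%:R * flat m.+1 s + flat m.+2 s =
    s ^- m * (expR (- s^-1) * s^-1 ^+ 2) + expR (- s^-1) * (- (s^-1) ^+ m.+1 * m%:R).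
    rewrite /flat s0 -!exprVn !exprS; ring.
  apply: (@near_eq_is_derive R R R (fun y : R => y ^- m * expR (- y^-1))) => //.
    near=> t; rewrite /flat (_ : 0 < t)//; near: t; exact: lt_nbhsr.
  have sn0 : s != 0 by rewrite gt_eqF.
  have d1 : is_derive s 1 (fun y : R => - y^-1) (s^-1 ^+ 2).
    have := is_deriveN (is_deriveV sn0 (is_derive_id s 1)).
    by move=> hd; apply: (is_derive_eq hd); rewrite /GRing.scale/= mulr1 opprK exprVn.
  have d2 : is_derive s 1 (fun y : R => expR (- y^-1)) (expR (- s^-1) * s^-1 ^+ 2).
    exact: (@is_derive1_comp _ (@expR R) (fun y : R => - y^-1) s _ _ (is_derive_expR _) d1).
  have d3 : is_derive s 1 (fun y : R => y ^- m) (- (s^-1) ^+ m.+1 * m%:R).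
    have d4 : is_derive s 1 (fun y : R => y^-1) (- s^-1 ^+ 2).
      have := is_deriveV sn0 (is_derive_id s 1).
      by move=> hd; apply: (is_derive_eq hd); rewrite /GRing.scale/= mulr1 exprVn.
    case: m => [|m].
      rewrite mulr0 (_ : (fun y => _) = cst 1); first exact: is_derive_cst.
      by apply/funext => y; rewrite expr0 invr1.
    have -> : (fun y : R => y ^- m.+1) = (fun y : R => y^-1) ^+ m.+1.
      by apply/funext => y; rewrite exprfctE exprVn.
    apply: (is_derive_eq (@is_deriveX R R (fun y : R => y^-1) m.+1 s 1 _ d4)).
    by rewrite /GRing.scale/= -mulr_natl !exprS; ring.
  exact: (is_deriveM d3 d2).
- rewrite s0 /flat ltxx mulr0 addr0; apply: is_derive_eps => e e0.
  have F0 : 0 < (m.+2)`!%:R + 1 :> R by rewrite ltr_wpDl.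
  exists (e / ((m.+2)`!%:R + 1)); first by rewrite divr_gt0.
  move=> h hn0 hd; rewrite add0r ltxx !subr0.
  have -> : (if 0 < h then h ^- m * expR (- h^-1) else 0) / h = flat m.+1 h.
    rewrite /flat; case: ifP => [h0|]; last by rewrite mul0r.
    by rewrite -!exprVn exprS; ring.
  rewrite ger0_norm ?flat_ge0//; apply: le_lt_trans (flat_le _ _) _.
  apply: (@le_lt_trans _ _ (((m.+2)`!%:R + 1) * `|h|)).
    by rewrite ler_wpM2r// lerDl.
  by rewrite mulrC -ltr_pdivlMr.
Unshelve. all: by end_near. Qed.

Lemma smooth1_flat m : smooth1 (flat m).
Proof.
move=> n; elim: n m => [|n IH] m.
  split => // s; apply: differentiable_continuous; apply/derivable1_diffP.
  by have [] := flat_derive m s.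
apply: ncontSP (flat_derive m) _; apply: ncontD => //; exact: ncontZ.
Qed.

Definition step (y : R) : R := flat 0 y / (flat 0 y + flat 0 (1 - y)).

Let step_den y : 0 < flat 0 y + flat 0 (1 - y).
Proof.
have [y0|y0] := ltP 0 y.
  by rewrite ltr_wpDr ?flat_ge0// /flat y0 invr1 mul1r expR_gt0.
rewrite ltr_wpDl ?flat_ge0// /flat (_ : 0 < 1 - y); last lra.
by rewrite invr1 mul1r expR_gt0.
Qed.

Lemma smooth1_step : smooth1 step.
Proof.
move=> n; apply: ncontM; first exact: smooth1_flat.
apply: ncontV; first by move=> y; rewrite gt_eqF ?step_den.
apply: ncontD; first exact: smooth1_flat.
apply: (@ncont_comp n (fun s => 1 - s) (flat 0)); first exact: smooth1_flat.
by apply: ncontB; [exact: (ncont_cst n 1)|exact: ncont_id].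
Qed.

Lemma step0 y : y <= 0 -> step y = 0.
Proof. by move=> y0; rewrite /step {1}/flat ltNge y0 mul0r. Qed.

Lemma step1 y : 1 <= y -> step y = 1.
Proof.
move=> y1; rewrite /step [flat 0 (1 - y)]/flat ltNge (_ : 1 - y <= 0); last lra.
rewrite addr0 divff// /flat (_ : 0 < y); last lra.
by rewrite invr1 mul1r gt_eqF// expR_gt0.
Qed.

Lemma step_01 y : 0 <= step y <= 1.
Proof.
have p1 := flat_ge0 0 y; have p2 := flat_ge0 0 (1 - y); have p3 := step_den y.
apply/andP; split; first exact: divr_ge0 (ltW p3).
by rewrite /step ler_pdivrMr// mul1r lerDl.
Qed.

Lemma step_derive0 y : (y < 0) || (1 < y) -> derive1 step y = 0.
Proof.
have h (k : R) : (\forall z \near y, cst k z = step z) -> derive1 step y = 0.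
  by move=> hk; rewrite derive1E -(near_eq_derive _ hk)//; exact: derive_cst.
move=> /orP[y0|y1].
- apply: (h 0); near=> z; rewrite step0//; apply/ltW; near: z; exact: lt_nbhsl.
- apply: (h 1); near=> z; rewrite step1//; apply/ltW; near: z; exact: lt_nbhsr.
Unshelve. all: by end_near. Qed.

Lemma step_derive_bounded : exists2 M : R, 0 < M & forall y, `|derive1 step y| <= M.
Proof.
have cd : continuous (derive1 step) by exact: smooth1_cont (smooth1_derive1 smooth1_step).
have cn : {within `[0, 1], continuous (fun y : R => `|derive1 step y|)}.
  apply: continuous_subspaceT => y.
  by apply: (@continuous_comp _ _ _ (derive1 step) Num.norm); [exact: cd|exact: norm_continuous].
have [z _ hz] := EVT_max (@ler01 R) cn.
exists (`|derive1 step z| + 1) => [|y]; first by rewrite ltr_wpDl.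
have [y01|] := boolP ((0 <= y) && (y <= 1)).
  by apply: (le_trans (hz y _)); [rewrite in_itv|rewrite lerDl].
by rewrite negb_and -!ltNge => h; rewrite step_derive0// normr0 addr_ge0.
Qed.

End smooth_line.

(** * Open sets and measurability in the plane *)

Section plane_topology.
Context {R : realType}.
Implicit Types (A C : set (plane R)) (phi : plane R -> R).

Definition square (x : R * R) (r : R) : set (plane R) :=
  [set y | `|(y.1 : R) - x.1| < r /\ `|(y.2 : R) - x.2| < r].

Lemma square_measurable x r : measurable (square x r).
Proof.
have -> : square x r = `]x.1 - r, x.1 + r[%classic `*` `]x.2 - r, x.2 + r[%classic.
  apply/seteqP; split => [[y1 y2]|[y1 y2]] /=; rewrite /square/= !in_itv/= !ltr_norml.
    by move=> [/andP[? ?] /andP[? ?]]; split; apply/andP; split; lra.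
  by move=> [/andP[? ?] /andP[? ?]]; split; apply/andP; split; lra.
by apply: measurableX; exact: measurable_itv.
Qed.

Lemma nbhs_square (x : plane R) (A : set (plane R)) :
  nbhs x A -> exists2 r : R, 0 < r & square x r `<=` A.
Proof.
move=> [[Q1 Q2] /= [/nbhs_ballP[r1 /= r10 h1] /nbhs_ballP[r2 /= r20 h2]] h].
exists (Num.min r1 r2); first by rewrite lt_min r10.
move=> y [/= y1 y2]; apply: (h y); split => /=.
  by apply: h1; rewrite /ball/= distrC (lt_le_trans y1)// ge_min lexx.
by apply: h2; rewrite /ball/= distrC (lt_le_trans y2)// ge_min lexx orbT.
Qed.

Definition rational_square (p : rat * rat * nat) : set (plane R) :=
  square (ratr p.1.1, ratr p.1.2) (2^-1 ^+ p.2).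

Lemma square_rational (x : plane R) r : 0 < r ->
  exists p, rational_square p x /\ rational_square p `<=` square x r.
Proof.
move=> r0; have [n hn] : exists n : nat, (2^-1 : R) ^+ n < r / 2.
  have r2 : 0 < r / 2 by rewrite divr_gt0.
  have : (2^-1 : R) ^+ n @[n --> \oo] --> 0.
    by apply: cvg_expr; rewrite ger0_norm// invf_lt1// ltr1n.
  move=> /cvgrPdist_lt/(_ _ r2)[k _ hk]; exists k.
  by have := hk k (leqnn _); rewrite /= sub0r normrN ger0_norm ?exprn_ge0.
have e0 : 0 < (2^-1 : R) ^+ n by rewrite exprn_gt0.
have l1 : x.1 - 2^-1 ^+ n < x.1 + 2^-1 ^+ n by lra.
have l2 : x.2 - 2^-1 ^+ n < x.2 + 2^-1 ^+ n by lra.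
have [q1] := rat_in_itvoo l1; have [q2] := rat_in_itvoo l2.
rewrite !in_itv/= => /andP[a2 b2] /andP[a1 b1].
exists (q1, q2, n); split.
  by split => /=; rewrite ltr_norml; apply/andP; split; lra.
move=> y [/=]; rewrite !ltr_norml => /andP[? ?] /andP[? ?].
by split; rewrite ltr_norml; apply/andP; split; lra.
Qed.

(** Rational squares are countable, which ties the topology to the product sigma-algebra. Codes that
    decode to nothing, or to a square not inside [A], contribute the empty set. *)
Lemma open_bigcup_squares A : open A -> exists B : nat -> set (plane R),
  (forall n, B n = set0 \/ exists p, B n = rational_square p /\ B n `<=` A) /\ A = \bigcup_n B n.
Proof.
move=> oA; pose B n : set (plane R) := if @unpickle (rat * rat * nat)%type n is Some p
  then (if `[< rational_square p `<=` A >] then rational_square p else set0) else set0.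
exists B; split.
  move=> n; rewrite /B; case: unpickle => [p|]; last by left.
  by case: asboolP => h; [right; exists p|left].
apply/seteqP; split => [x Ax|x [n _]].
  have [r r0 hr] := nbhs_square (oA x Ax).
  have [p [px hp]] := square_rational x r0.
  exists (pickle p); [exact: I|]; rewrite /B pickleK asboolT//.
  exact: subset_trans hp hr.
rewrite /B; case: unpickle => [p|//]; case: asboolP => // h; exact: h.
Qed.

Lemma open_measurable_plane A : open A -> measurable A.
Proof.
move=> /open_bigcup_squares[B [hB ->]]; apply: bigcupT_measurable => n.
by have [->|[p [-> _]]] := hB n; [exact: measurable0|exact: square_measurable].
Qed.

Lemma continuous_measurable_plane phi : continuous phi -> measurable_fun setT phi.
Proof.
move=> cphi; apply: (measurability _ (RGenOpens.measurableE R)) => //.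
move=> _ [_ [x [y ->]] <-]; rewrite setTI; apply: open_measurable_plane.
by move/continuousP : cphi; apply; exact: itv_open.
Qed.

Lemma compact_box C : compact C -> exists2 L : R, 0 < L &
  forall x : plane R, C x -> `|x.1 : R| <= L /\ `|x.2 : R| <= L.
Proof.
move=> cC; have c1 : continuous (fun x : plane R => `|x.1 : R| + `|x.2 : R|).
  move=> x; apply: cvgD.
    by apply: (@continuous_comp (plane R) R R fst Num.norm); [exact: cvg_fst|exact: norm_continuous].
  by apply: (@continuous_comp (plane R) R R snd Num.norm); [exact: cvg_snd|exact: norm_continuous].
have [C0|/set0P C0] := eqVneq C set0.
  by exists 1 => // x; rewrite C0.
have [z _ hz] := compact_EVT_max C0 cC (continuous_subspaceT c1).
exists (`|z.1 : R| + `|z.2 : R| + 1); first by rewrite ltr_wpDl.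
move=> x /mem_set/hz h; have h1 := normr_ge0 (x.1 : R); have h2 := normr_ge0 (x.2 : R).
by split; lra.
Qed.

Definition box (L : R) : set (plane R) := [set x | `|x.1 : R| <= L /\ `|x.2 : R| <= L].

Lemma box_prod L : box L = `[- L, L]%classic `*` `[- L, L]%classic.
Proof. by apply/seteqP; split => [[? ?]|[? ?]]; rewrite /box/= !in_itv/= !ler_norml. Qed.

Lemma box_measurable L : measurable (box L).
Proof. by rewrite box_prod; apply: measurableX; exact: measurable_itv. Qed.

Lemma leb2X (A B : set (measurableTypeR R)) : measurable A -> measurable B ->
  leb2 (A `*` B) = (lebesgue_measure A * lebesgue_measure B)%E.
Proof. exact: product_measure1E. Qed.

Lemma leb2_box L : (leb2 (box L) < +oo)%E.
Proof.
rewrite box_prod leb2X; [|exact: measurable_itv|exact: measurable_itv].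
by rewrite !lebesgue_measure_itv; case: ifP => _; rewrite ?mule0 ?ltry// -!EFinM ltry.
Qed.

Lemma strip_prod (a : R) : strip a = setT `*` `]- a, a[%classic.
Proof.
apply/seteqP; split => [[x1 x2]|[x1 x2]]; rewrite /strip/= !in_itv/=; first by move=> h; split.
by move=> [].
Qed.

Lemma strip_measurable (a : R) : measurable (strip a).
Proof. by rewrite strip_prod; apply: measurableX; [exact: measurableT|exact: measurable_itv]. Qed.

End plane_topology.

(** * Smooth functions and test functions on the plane *)

Section smooth_plane.
Context {R : realType}.
Implicit Types (phi psi : plane R -> R) (x : plane R) (n : nat) (b : R -> R).

Let e1 : plane R := ((1 : R), (0 : R)).
Let e2 : plane R := ((0 : R), (1 : R)).

Lemma partial_slice1 phi x l :
  is_derive x e1 phi l <-> is_derive (x.1 : R) 1 (fun s : R => phi (s, x.2)) l.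
Proof.
have E : (fun h : R => h^-1 *: ((phi \o shift x) (h *: e1) - phi x)) =
  (fun h : R => h^-1 *: (((fun s : R => phi (s, x.2)) \o shift (x.1 : R)) (h *: (1 : R)) - phi (x.1, x.2))).
  apply/funext => h /=; congr (_ *: (phi _ - _)); last by case: x.
  by case: x => x1 x2 /=; rewrite /e1; congr pair; rewrite /= ?scaler0 ?add0r.
split => [] [dv dl].
  by split; [move: dv; rewrite /derivable E|move: dl; rewrite /derive E].
by split; [move: dv; rewrite /derivable -E|move: dl; rewrite /derive -E].
Qed.

Lemma partial_slice2 phi x l :
  is_derive x e2 phi l <-> is_derive (x.2 : R) 1 (fun s : R => phi (x.1, s)) l.
Proof.
have E : (fun h : R => h^-1 *: ((phi \o shift x) (h *: e2) - phi x)) =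
  (fun h : R => h^-1 *: (((fun s : R => phi (x.1, s)) \o shift (x.2 : R)) (h *: (1 : R)) - phi (x.1, x.2))).
  apply/funext => h /=; congr (_ *: (phi _ - _)); last by case: x.
  by case: x => x1 x2 /=; rewrite /e2; congr pair; rewrite /= ?scaler0 ?add0r.
split => [] [dv dl].
  by split; [move: dv; rewrite /derivable E|move: dl; rewrite /derive E].
by split; [move: dv; rewrite /derivable -E|move: dl; rewrite /derive -E].
Qed.

(** The recursion differentiates [phi] itself, that is, it peels off the last entry of the list in
    [iterated_partial]; this is why the equivalence with [smooth] runs over [rcons]. *)
Fixpoint ncont2 n phi : Prop := continuous phi /\
  if n is n'.+1 then (forall x, derivable phi x e1 /\ derivable phi x e2) /\
    ncont2 n' (partial1 phi) /\ ncont2 n' (partial2 phi) else True.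

Lemma smooth_ncont2 phi : smooth phi -> forall n, ncont2 n phi.
Proof.
move=> h n; elim: n phi h => [|n IH] phi h; first by split => //; case: (h [::]).
split; first by case: (h [::]).
split; first by case: (h [::]).
by split; apply: IH => l;
  [have := h (rcons l true)|have := h (rcons l false)]; rewrite /iterated_partial foldr_rcons.
Qed.

Lemma ncont2_smooth phi : (forall n, ncont2 n phi) -> smooth phi.
Proof.
move=> h l; elim/last_ind: l phi h => [|l b IH] phi h.
  by have [c [d _]] := h 1%N.
rewrite /iterated_partial foldr_rcons; apply: IH => n.
by have [_ [_ [? ?]]] := h n.+1; case: b.
Qed.

Lemma ncont2_cont n phi : ncont2 n phi -> continuous phi. Proof. by case: n => [|n] []. Qed.

Lemma ncont2W n phi : ncont2 n.+1 phi -> ncont2 n phi.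
Proof.
elim: n phi => [|n IH] phi; first by move=> [? _]; split.
by move=> [c [d [d1 d2]]]; exact: (conj c (conj d (conj (IH _ d1) (IH _ d2)))).
Qed.

Lemma ncont2_partial1 n phi x : ncont2 n.+1 phi -> is_derive x e1 phi (partial1 phi x).
Proof. by move=> [_ [/(_ x)[d _] _]]; exact: DeriveDef. Qed.

Lemma ncont2_partial2 n phi x : ncont2 n.+1 phi -> is_derive x e2 phi (partial2 phi x).
Proof. by move=> [_ [/(_ x)[_ d] _]]; exact: DeriveDef. Qed.

Lemma ncont2SP n phi (phi1 phi2 : plane R -> R) : continuous phi ->
  (forall x, is_derive x e1 phi (phi1 x)) -> (forall x, is_derive x e2 phi (phi2 x)) ->
  ncont2 n phi1 -> ncont2 n phi2 -> ncont2 n.+1 phi.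
Proof.
move=> c d1 d2 n1 n2; split => //; split.
  by move=> x; have [? _] := d1 x; have [? _] := d2 x.
have -> : partial1 phi = phi1 by apply/funext => x; have [_ <-] := d1 x.
by have -> : partial2 phi = phi2 by apply/funext => x; have [_ <-] := d2 x.
Qed.

Lemma ncont2D n phi psi : ncont2 n phi -> ncont2 n psi -> ncont2 n (fun x => phi x + psi x).
Proof.
elim: n phi psi => [|n IH] phi psi hf hg.
  by split => // s; apply: cvgD; [exact: (ncont2_cont hf)|exact: (ncont2_cont hg)].
apply: (@ncont2SP _ _ (fun x => partial1 phi x + partial1 psi x)
   (fun x => partial2 phi x + partial2 psi x)).
- by move=> s; apply: cvgD; [exact: (ncont2_cont hf)|exact: (ncont2_cont hg)].
- by move=> s; exact: (is_deriveD (ncont2_partial1 s hf) (ncont2_partial1 s hg)).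
- by move=> s; exact: (is_deriveD (ncont2_partial2 s hf) (ncont2_partial2 s hg)).
- by case: hf => _ [_ [? _]]; case: hg => _ [_ [? _]]; exact: IH.
- by case: hf => _ [_ [_ ?]]; case: hg => _ [_ [_ ?]]; exact: IH.
Qed.

Lemma ncont2M n phi psi : ncont2 n phi -> ncont2 n psi -> ncont2 n (fun x => phi x * psi x).
Proof.
elim: n phi psi => [|n IH] phi psi hf hg.
  by split => // s; apply: cvgM; [exact: (ncont2_cont hf)|exact: (ncont2_cont hg)].
apply: (@ncont2SP _ _ (fun x => phi x * partial1 psi x + psi x * partial1 phi x)
   (fun x => phi x * partial2 psi x + psi x * partial2 phi x)).
- by move=> s; apply: cvgM; [exact: (ncont2_cont hf)|exact: (ncont2_cont hg)].
- by move=> s; exact: (is_deriveM (ncont2_partial1 s hf) (ncont2_partial1 s hg)).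
- by move=> s; exact: (is_deriveM (ncont2_partial2 s hf) (ncont2_partial2 s hg)).
- case: (hf) => _ [_ [? _]]; case: (hg) => _ [_ [? _]].
  by apply: ncont2D; apply: IH => //; exact: ncont2W.
- case: (hf) => _ [_ [_ ?]]; case: (hg) => _ [_ [_ ?]].
  by apply: ncont2D; apply: IH => //; exact: ncont2W.
Qed.

Lemma ncont2_cst n (k : R) : ncont2 n (fun=> k).
Proof.
elim: n k => [|n IH] k; first by split => // s; exact: cvg_cst.
apply: (@ncont2SP _ _ (fun=> 0) (fun=> 0)) => //; by move=> s; exact: cvg_cst.
Qed.

Lemma lift_cont b : continuous b -> continuous (fun x : plane R => b x.1).
Proof. by move=> cb x; apply: (@continuous_comp (plane R) R R fst b); [exact: cvg_fst|exact: cb]. Qed.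

Lemma lift_derive1 b x : smooth1 b -> is_derive x e1 (fun x : plane R => b x.1) (derive1 b x.1).
Proof. by move=> sb; apply/partial_slice1; exact: smooth1_is_derive. Qed.

Lemma lift_derive2 b x : is_derive x e2 (fun x : plane R => b x.1) 0.
Proof. by apply/partial_slice2; exact: (is_derive_cst (b x.1 : R)). Qed.

Lemma ncont2_lift n b : smooth1 b -> ncont2 n (fun x => b x.1).
Proof.
elim: n b => [|n IH] b sb; first by split => //; apply: lift_cont; exact: smooth1_cont.
apply: (@ncont2SP _ _ (fun x => derive1 b x.1) (fun=> 0)).
- by apply: lift_cont; exact: smooth1_cont.
- by move=> x; exact: lift_derive1.
- by move=> x; exact: lift_derive2.
- by apply: IH; exact: smooth1_derive1.
- exact: ncont2_cst.
Qed.

Section test.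
Variables (U : set (plane R)) (phi : plane R -> R).
Hypothesis tphi : test_function U phi.

Lemma test_cont : continuous phi.
Proof. by case: tphi => /(_ [::])[]. Qed.

Lemma test_derive1 x : is_derive x e1 phi (partial1 phi x).
Proof. exact: ncont2_partial1 (smooth_ncont2 (proj1 tphi) 1%N). Qed.

Lemma test_derive2 x : is_derive x e2 phi (partial2 phi x).
Proof. exact: ncont2_partial2 (smooth_ncont2 (proj1 tphi) 1%N). Qed.

Lemma test_outside x : ~ U x -> phi x = 0.
Proof. by case: tphi => _ [C [_ CU] hC] nU; apply: hC => Cx; apply: nU; exact: CU. Qed.

Lemma test_box : exists2 L : R, 0 < L & forall x, ~ box L x -> phi x = 0.
Proof.
case: tphi => _ [C [cC CU] hC]; have [L L0 hL] := compact_box cC.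
by exists L => // x nx; apply: hC => Cx; apply: nx; exact: hL.
Qed.

Lemma test_partial : test_function U (partial1 phi) /\ test_function U (partial2 phi).
Proof.
have sm := smooth_ncont2 (proj1 tphi).
case: tphi => _ [C [cC CU] hC].
have clC : closed C by apply: compact_closed => //; exact: norm_hausdorff.
have z x : ~ C x -> \forall y \near x, cst 0 y = phi y.
  move=> nC; have : \forall y \near x, ~ C y by apply: open_nbhs_nbhs; split => //; exact: closed_openC.
  by apply: filterS => y ny /=; rewrite hC.
split; split.
- by apply: ncont2_smooth => n; have [_ [_ []]] := sm n.+1.
- exists C => // x /z h.
  by rewrite /partial1 -(near_eq_derive _ h); exact: derive_cst.
- by apply: ncont2_smooth => n; have [_ [_ []]] := sm n.+1.
- exists C => // x /z h.
  by rewrite /partial2 -(near_eq_derive _ h); exact: derive_cst.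
Qed.

Lemma test_mul b : smooth1 b -> test_function U (fun x => b x.1 * phi x).
Proof.
move=> sb; have sm := smooth_ncont2 (proj1 tphi).
split; first by apply: ncont2_smooth => n; apply: ncont2M; [exact: ncont2_lift|exact: sm].
case: tphi => _ [C [cC CU] hC]; exists C => // x nC.
by rewrite hC// mulr0.
Qed.

Lemma partial1_mul b : smooth1 b ->
  partial1 (fun x => b x.1 * phi x) = fun x => derive1 b x.1 * phi x + b x.1 * partial1 phi x.
Proof.
move=> sb; apply/funext => x.
have [_ E] := is_deriveM (lift_derive1 x sb) (test_derive1 x).
by rewrite addrC [_ * phi x]mulrC; exact: E.
Qed.

Lemma partial2_mul b : smooth1 b ->
  partial2 (fun x => b x.1 * phi x) = fun x => b x.1 * partial2 phi x.
Proof.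
move=> sb; apply/funext => x.
have [_ E] := is_deriveM (lift_derive2 b x) (test_derive2 x).
by rewrite -[RHS]addr0 -(scaler0 _ (phi x)); exact: E.
Qed.

Lemma test_slice1 (x2 s : R) : is_derive s 1 (fun s : R => phi (s, x2)) (partial1 phi (s, x2)).
Proof. by have /partial_slice1 := test_derive1 (s, x2). Qed.

Lemma test_slice2 (x1 s : R) : is_derive s 1 (fun s : R => phi (x1, s)) (partial2 phi (x1, s)).
Proof. by have /partial_slice2 := test_derive2 (x1, s). Qed.

End test.

Lemma slice1_cont phi (x2 : R) : continuous phi -> continuous (fun s : R => phi (s, x2)).
Proof.
move=> c s; apply: (@continuous_comp R (plane R) R (fun s : R => (s, x2)) phi); last exact: c.
exact: (@cvg_pair _ _ _ (nbhs s) (nbhs s) (nbhs x2) _ _ _ id (cst x2) cvg_id (cvg_cst _)).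
Qed.

Lemma slice2_cont phi (x1 : R) : continuous phi -> continuous (fun s : R => phi (x1, s)).
Proof.
move=> c s; apply: (@continuous_comp R (plane R) R (fun s : R => (x1, s)) phi); last exact: c.
exact: (@cvg_pair _ _ _ (nbhs s) (nbhs x1) (nbhs s) _ _ _ (cst x1) id (cvg_cst _) cvg_id).
Qed.

End smooth_plane.

(** * Inequalities for test functions *)

Section line_integrals.
Context {R : realType}.
Implicit Types (phi g F : R -> R) (p q s : R).
Local Notation lam := (@lebesgue_measure R).

Lemma ftc_segment F (F' : R -> R) p q : p < q ->
  (forall s : R, p <= s <= q -> is_derive s 1 F (F' s)) ->
  (forall s : R, p <= s <= q -> {for s, continuous F'}) ->
  (\int[lam]_(s in `[p, q]) (F' s)%:E)%E = (F q - F p)%:E.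
Proof.
move=> pq dF cF.
have cont s : p <= s <= q -> {for s, continuous F}.
  move=> h; apply: differentiable_continuous; apply/derivable1_diffP.
  by have [] := dF s h.
rewrite (@continuous_FTC2 R F' F p q pq)//.
- by apply: continuous_in_subspaceT => s; rewrite inE/= in_itv/= => h; exact: cF.
- split.
  + move=> s; rewrite in_itv/= => /andP[h1 h2]; have hs : p <= s <= q by rewrite !ltW.
    by have [] := dF s hs.
  + by apply: cvg_at_right_filter; apply: cont; rewrite lexx ltW.
  + by apply: cvg_at_left_filter; apply: cont; rewrite lexx ltW.
- move=> s; rewrite in_itv/= => /andP[h1 h2].
  have hs : p <= s <= q by rewrite !ltW.
  by rewrite derive1E; have [_ E] := dF s hs; exact: E.
Qed.

Lemma segment_integrable phi p q :
  (forall s : R, p <= s <= q -> {for s, continuous phi}) ->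
  lam.-integrable `[p, q] (EFin \o phi).
Proof.
move=> c; apply: continuous_compact_integrable; first exact: segment_compact.
by apply: continuous_in_subspaceT => s; rewrite inE/= in_itv/=; exact: c.
Qed.

(* [phi'^2 + (g' + g^2) phi^2 = (phi' - g phi)^2 + (g phi^2)'], and the last
   term integrates to 0. *)
Lemma riccati phi phi' g g' p q : p < q ->
  (forall s : R, is_derive s 1 phi (phi' s)) -> continuous phi' ->
  phi p = 0 -> phi q = 0 ->
  (forall s : R, p <= s <= q -> is_derive s 1 g (g' s)) ->
  (forall s : R, p <= s <= q -> {for s, continuous g'}) ->
  (0 <= \int[lam]_(s in `[p, q]) (phi' s ^+ 2 + (g' s + g s ^+ 2) * phi s ^+ 2)%:E)%E.
Proof.
move=> pq dphi cphi' phip phiq dg cg'.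
have cphi : continuous phi.
  by move=> s; apply: differentiable_continuous; apply/derivable1_diffP; have [] := dphi s.
have cg s : p <= s <= q -> {for s, continuous g}.
  move=> h; apply: differentiable_continuous; apply/derivable1_diffP.
  by have [] := dg s h.
pose G s := g' s * (phi s * phi s) + g s * (phi' s * phi s + phi' s * phi s).
pose H s := (phi' s - g s * phi s) * (phi' s - g s * phi s).
have cG s : p <= s <= q -> {for s, continuous G}.
  move=> h; apply: cvgD; apply: cvgM.
  - exact: cg'.
  - by apply: cvgM; exact: cphi.
  - exact: cg.
  - by apply: cvgD; apply: cvgM; [exact: cphi'|exact: cphi|exact: cphi'|exact: cphi].
have cH s : p <= s <= q -> {for s, continuous H}.
  have h0 : p <= s <= q -> (fun s => phi' s - g s * phi s) x @[x --> s] --> phi' s - g s * phi s.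
    move=> h; apply: cvgB; first exact: cphi'.
    by apply: cvgM; [exact: cg|exact: cphi].
  by move=> h; apply: cvgM; exact: h0.
have IG : (\int[lam]_(s in `[p, q]) (G s)%:E = 0)%E.
  have dG s : p <= s <= q -> is_derive s 1 (fun s => g s * (phi s * phi s)) (G s).
    move=> h; have h1 := is_deriveM (dphi s) (dphi s).
    apply: (is_derive_eq (is_deriveM (dg s h) h1)).
    by rewrite /GRing.scale/= mulrfctE /G; ring.
  by rewrite (ftc_segment pq dG cG) phip phiq !mulr0 subrr.
have -> : (\int[lam]_(s in `[p, q]) (phi' s ^+ 2 + (g' s + g s ^+ 2) * phi s ^+ 2)%:E =
    \int[lam]_(s in `[p, q]) ((H s)%:E + (G s)%:E))%E.
  by apply: eq_integral => s _; rewrite -EFinD; congr EFin; rewrite /H /G; ring.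
rewrite integralD//; [|exact: segment_integrable|exact: segment_integrable].
rewrite IG adde0; apply: integral_ge0 => s _.
by rewrite lee_fin /H -expr2 sqr_ge0.
Qed.

(** [riccati] with g = - c tan (c s), for which g' + g^2 = - c^2. At the critical c = pi / (2 a) the
    tangent blows up at the ends, so the inequality is proved for smaller c and passed to the
    limit. *)
Lemma poincare_interval phi phi' (a : R) : 0 < a ->
  (forall s : R, is_derive s 1 phi (phi' s)) -> continuous phi' ->
  phi (- a) = 0 -> phi a = 0 ->
  (0 <= \int[lam]_(s in `](- a)%R, a[) (phi' s ^+ 2 - E1 a * phi s ^+ 2)%:E)%E.
Proof.
move=> a0 dphi cphi' phip phiq.
have cphi : continuous phi.
  by move=> s; apply: differentiable_continuous; apply/derivable1_diffP; have [] := dphi s.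
have c2 (h : R -> R) : continuous h -> continuous (fun s => h s ^+ 2).
  by move=> ch s; exact: (cvgM (ch s) (ch s)).
have i2 (h : R -> R) : continuous h -> lam.-integrable `[(- a), a] (EFin \o (fun s => h s ^+ 2)).
  by move=> ch; apply: segment_integrable => s _; exact: c2.
have aa : - a < a by lra.
set A := \int[lam]_(s in `[(- a), a]) (phi' s ^+ 2); set B := \int[lam]_(s in `[(- a), a]) (phi s ^+ 2).
have IE k : (\int[lam]_(s in `[(- a)%R, a]) (phi' s ^+ 2 - k * phi s ^+ 2)%:E)%E = (A - k * B)%:E.
  rewrite (_ : A - k * B = \int[lam]_(s in `[(- a), a]) (phi' s ^+ 2 - k * phi s ^+ 2)).
    rewrite /Rintegral fineK//; apply: integrable_fin_num => //.
    by apply: segment_integrable => s _; apply: cvgB; [exact: c2|apply: cvgM; [exact: cvg_cst|exact: c2]].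
  rewrite RintegralB//; [|exact: i2|].
    by rewrite RintegralZl//; exact: i2.
  by apply: segment_integrable => s _; apply: cvgM; [exact: cvg_cst|exact: c2].
have B0 : 0 <= B by apply: Rintegral_ge0 => s _; exact: sqr_ge0.
pose c0 := pi / (2 * a); have c00 : 0 < c0 by rewrite divr_gt0 ?pi_gt0// mulr_gt0.
have small c : 0 < c -> c < c0 -> 0 <= A - c ^+ 2 * B.
  move=> cp cc; rewrite -lee_fin -IE.
  have cosp s : - a <= s <= a -> 0 < cos (c * s).
    move=> /andP[h1 h2]; apply: cos_gt0_pihalf.
    have ca : c * a < pi / 2.
      have -> : pi / 2 = c0 * a by rewrite /c0; field; rewrite gt_eqF.
      by rewrite ltr_pM2r.
    have := ler_wpM2l (ltW cp) h1; have := ler_wpM2l (ltW cp) h2; rewrite mulrN => ? ?.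
    by apply/andP; split; lra.
  have dg s : - a <= s <= a -> is_derive s 1 (fun s : R => - c * tan (c * s))
      (- c * (c * (cos (c * s)) ^- 2)).
    move=> h; have cn : cos (c * s) != 0 by rewrite gt_eqF ?cosp.
    have d1 : is_derive s 1 (fun s : R => c * s) c.
      apply: (is_derive_eq (is_deriveM (is_derive_cst c s (1 : R)) (is_derive_id s (1 : R)))).
      by rewrite /GRing.scale/= mulr1 mulr0 addr0.
    have d2 := @is_derive1_comp _ (@tan R) (fun s : R => c * s) s _ _ (is_derive_tan cn) d1.
    apply: (is_derive_eq (is_deriveM (is_derive_cst (- c) s (1 : R)) d2)).
    by rewrite /GRing.scale/= mulr0 addr0 [_ * c]mulrC.
  have cg' s : - a <= s <= a -> {for s, continuous (fun s : R => - c * (c * (cos (c * s)) ^- 2))}.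
    move=> h; have cn : cos (c * s) ^+ 2 != 0 by rewrite expf_neq0// gt_eqF ?cosp.
    apply: cvgM; first exact: cvg_cst.
    apply: cvgM; first exact: cvg_cst.
    apply: cvgV => //; apply: (c2 (fun s => cos (c * s))) => r.
    apply: (@continuous_comp _ _ _ (fun s : R => c * s) cos); last exact: continuous_cos.
    by apply: cvgM; [exact: cvg_cst|exact: cvg_id].
  have := riccati aa dphi cphi' phip phiq dg cg'.
  congr (0 <= _)%E; apply: eq_integral => s; rewrite inE/= in_itv/= => h.
  have cn : cos (c * s) != 0 by rewrite gt_eqF ?cosp.
  congr EFin; congr (_ + _); rewrite -mulNr; congr (_ * _).
  rewrite exprMn /tan exprMn sqrrN exprVn.
  have -> : sin (c * s) ^+ 2 = 1 - cos (c * s) ^+ 2 by rewrite -(cos2Dsin2 (c * s)); ring.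
  by field.
have EA : E1 a = c0 ^+ 2 by [].
have H : (0 <= \int[lam]_(s in `[(- a)%R, a]) (phi' s ^+ 2 - E1 a * phi s ^+ 2)%:E)%E.
  rewrite IE lee_fin EA; apply/ler_addgt0Pr => e e0; rewrite addrC.
  have B1 : 0 < B + 1 by lra.
  have K0 : 0 < 2 * c0 * (B + 1) by apply: mulr_gt0 => //; exact: mulr_gt0.
  have [d d0 hd] : exists2 d, 0 < d & d < c0 /\ (c0 ^+ 2 - (c0 - d) ^+ 2) * B <= e.
    (* The first entry keeps c0 - d positive; the second bounds (c0^2 - (c0 - d)^2) B <= 2 c0 d B by
       e. *)
    exists (Num.min (c0 / 2) (e / (2 * c0 * (B + 1)))).
      by rewrite lt_min divr_gt0//= divr_gt0.
    set d := Num.min _ _.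
    have d1 : d <= c0 / 2 by rewrite ge_min lexx.
    have d2 : d <= e / (2 * c0 * (B + 1)) by rewrite ge_min lexx orbT.
    have d0 : 0 < d by rewrite lt_min divr_gt0//= divr_gt0.
    split; first lra.
    have : d * (2 * c0 * (B + 1)) <= e by rewrite -ler_pdivlMr.
    have := mulr_ge0 (mulr_ge0 (ltW d0) (ltW c00)) B0; have := mulr_gt0 d0 c00.
    have := mulr_ge0 (sqr_ge0 d) B0.
    nra.
  have := small (c0 - d); rewrite subr_gt0 gtrBl => /(_ (proj1 hd) d0).
  have := proj2 hd; lra.
have mh : measurable_fun `](- a), a[ (fun s => (phi' s ^+ 2 - E1 a * phi s ^+ 2)%:E).
  apply: (@measurable_funS _ _ _ _ `[(- a), a]) => //.
    by apply: subset_itv; rewrite bnd_simp.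
  apply: (@measurable_int _ _ _ lam); apply: segment_integrable => s _.
  by apply: cvgB; [exact: c2|apply: cvgM; [exact: cvg_cst|exact: c2]].
by rewrite -(integral_itv_bndoo true false mh).
Qed.

End line_integrals.

(** * Slicing: Poincare, Riccati and Ladyzhenskaya inequalities on the strip *)

Section strip_integrals.
Context {R : realType} (a : R).
Hypothesis a0 : 0 < a.
Local Notation lam := (@lebesgue_measure R).
Local Notation D := (strip a).
Local Notation rint := (rint leb2 D).
Local Notation sqi := (sqi leb2 D).
Local Notation bdm := (bdm D).
Local Notation ip := (ip leb2 D).
Implicit Types (g phi : plane R -> R).

Let mD : measurable D := strip_measurable a.

Lemma rint_box g (L M : R) : measurable_fun D g -> (forall x, D x -> `|g x| <= M) ->
  (forall x, D x -> ~ box L x -> g x = 0) -> rint g.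
Proof.
move=> mg gM g0; apply/integrableP; split; first exact/measurable_EFinP.
have M0 : 0 <= `|M| by [].
have h1 : (\int[leb2]_(x in D) `|(EFin \o g) x| <= \int[leb2]_(x in D) (`|M|%:E * (\1_(box L) x)%:E))%E.
  apply: ge0_le_integral => //.
  - by apply: measurableT_comp => //; exact/measurable_EFinP.
  - apply: emeasurable_funM; first exact: measurable_cst.
    by apply/measurable_EFinP; apply: measurable_indic; exact: box_measurable.
  - move=> x Dx /=; rewrite -EFinM lee_fin indicE; have [bx|bx] := pselect (box L x).
      by rewrite mem_set// mulr1 (le_trans (gM x Dx))// ler_norm.
    by rewrite memNset// mulr0 g0// normr0.
apply: le_lt_trans h1 _; rewrite ge0_integralZl//; last first.
  by apply/measurable_EFinP; apply: measurable_indic; exact: box_measurable.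
rewrite integral_indic//; last exact: box_measurable.
apply: lte_mul_pinfty => //.
apply: le_lt_trans (leb2_box L); apply: le_measure => //; rewrite inE.
  by apply: measurableI => //; exact: box_measurable.
exact: box_measurable.
Qed.

Lemma continuous_box_bounded g (L : R) : continuous g -> (forall x, ~ box L x -> g x = 0) ->
  exists M : R, forall x, `|g x| <= M.
Proof.
move=> cg g0.
have cbox : compact (box L : set (plane R)).
  by rewrite box_prod; apply: compact_setX; exact: segment_compact.
have cn : continuous (fun x : plane R => `|g x|).
  by move=> x; apply: (@continuous_comp (plane R) R R g Num.norm); [exact: cg|exact: norm_continuous].
have [bx|bx] := eqVneq (box L : set (plane R)) set0.
  by exists 0 => x; rewrite g0 ?normr0// bx.
move/set0P in bx; have [z _ hz] := compact_EVT_max bx cbox (continuous_subspaceT cn).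
exists `|g z| => x; have [h|h] := pselect (box L x); first by apply: hz; rewrite inE.
by rewrite g0// normr0.
Qed.

Lemma continuous_measurable_strip g : continuous g -> measurable_fun D g.
Proof. by move=> cg; apply: measurable_funS (continuous_measurable_plane cg) => //; exact: measurableT. Qed.

Lemma sqi_box g (L : R) : continuous g -> (forall x, ~ box L x -> g x = 0) -> sqi g.
Proof.
move=> cg g0; have mg := continuous_measurable_strip cg.
split => //; have [M hM] := continuous_box_bounded cg g0.
apply: (@rint_box _ L (M ^+ 2)).
- exact: measurable_funX.
- move=> x _; rewrite normrX ler_pXn2r ?nnegrE// (le_trans _ (hM x))//.
- by move=> x _ h; rewrite g0// expr0n.
Qed.

Lemma test_sqi phi : test_function D phi -> sqi phi.
Proof. by move=> t; have [L L0 h] := test_box t; apply: (sqi_box (test_cont t) h). Qed.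

Lemma test_sqi1 phi : test_function D phi -> sqi (partial1 phi).
Proof. by move=> t; apply: test_sqi; have [] := test_partial t. Qed.

Lemma test_sqi2 phi : test_function D phi -> sqi (partial2 phi).
Proof. by move=> t; apply: test_sqi; have [] := test_partial t. Qed.

Lemma strip_fubini1 g : rint g ->
  (\int[leb2]_(x in D) (g x)%:E =
   \int[lam]_x1 \int[lam]_(x2 in `](- a)%R, a[) (g (x1, x2))%:E)%E.
Proof.
move=> ig; rewrite integral_mkcond.
have iG : leb2.-integrable setT ((EFin \o g) \_ D) by apply/(integrable_mkcond _ mD).
rewrite -[LHS](integral12_prod_meas1 iG); apply: eq_integral => x1 _.
rewrite [RHS]integral_mkcond; apply: eq_integral => x2 _.
by rewrite /patch; congr (if _ then _ else _).
Qed.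

Lemma strip_fubini2 g : rint g ->
  (\int[leb2]_(x in D) (g x)%:E =
   \int[lam]_(x2 in `](- a)%R, a[) \int[lam]_x1 (g (x1, x2))%:E)%E.
Proof.
move=> ig; rewrite integral_mkcond.
have iG : leb2.-integrable setT ((EFin \o g) \_ D) by apply/(integrable_mkcond _ mD).
rewrite -[LHS](integral21_prod_meas1 iG) [RHS]integral_mkcond; apply: eq_integral => x2 _.
rewrite /fubini_G /patch; case: ifPn => h.
  by apply: eq_integral => x1 _; rewrite /patch ifT.
have -> : point = 0%E :> \bar R by [].
rewrite -[RHS](@integral0 _ _ _ lam setT); apply: eq_integral => x1 _; rewrite /patch ifF//.
apply/negbTE; move: h; apply: contra => /set_mem h; apply/mem_set.
by rewrite /= in_itv; exact: h.
Qed.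

Lemma strip_ge0_1 g : rint g ->
  (forall x1 : R, (0 <= \int[lam]_(x2 in `](- a)%R, a[) (g (x1, x2))%:E)%E) ->
  0 <= \int[leb2]_(x in D) g x.
Proof. by move=> ig h; apply: fine_ge0; rewrite strip_fubini1//; apply: integral_ge0. Qed.

Lemma strip_ge0_2 g : rint g ->
  (forall x2 : R, (0 <= \int[lam]_x1 (g (x1, x2))%:E)%E) ->
  0 <= \int[leb2]_(x in D) g x.
Proof. by move=> ig h; apply: fine_ge0; rewrite strip_fubini2//; apply: integral_ge0. Qed.

Lemma out_of_strip (s : R) : ~ D (s, - a) /\ ~ D (s, a).
Proof. by rewrite /strip/=; split => /andP[]; rewrite ltxx. Qed.

Lemma bdm_lift (b : R -> R) (M : R) : measurable_fun setT b -> (forall s, `|b s| <= M) ->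
  bdm (fun x => b x.1).
Proof.
move=> mb hb; split; last by exists M => x _; exact: hb.
have mm : measurable_fun setT (fun x : plane R => b x.1).
  by apply: measurableT_comp => //; exact: measurable_fst.
by apply: measurable_funS mm => //; exact: measurableT.
Qed.

Lemma smooth1_bdm (b : R -> R) (M : R) : smooth1 b -> (forall s, `|b s| <= M) -> bdm (fun x => b x.1).
Proof. by move=> sb hb; apply: bdm_lift hb; apply: continuous_measurable_fun; exact: smooth1_cont. Qed.

Lemma poincare_strip phi (b : R -> R) (M : R) : test_function D phi ->
  measurable_fun setT b -> (forall s, 0 <= b s <= M) ->
  E1 a * ip (fun x => b x.1) phi phi <= ip (fun x => b x.1) (partial2 phi) (partial2 phi).
Proof.
move=> t mb hb; have hB : bdm (fun x => b x.1).
  by apply: (bdm_lift mb (M := M)) => s; have /andP[? ?] := hb s; rewrite ger0_norm.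
have s0 := test_sqi t; have s2 := test_sqi2 t; have [t1 t2] := test_partial t.
have hE : bdm (fun x => E1 a * b x.1) by exact: (bdmM (bdm_cst D (E1 a)) hB).
have i0 := rint_ip mD hE s0 s0; have i2 := rint_ip mD hB s2 s2.
rewrite -subr_ge0 -(ipwZ mD (E1 a) hB s0 s0) /ip -RintegralB//.
apply: strip_ge0_1; first exact: (integrableB mD i2 i0).
move=> x1; have c2 : continuous (fun s : R => partial2 phi (x1, s)) := slice2_cont (test_cont t2).
have := poincare_interval a0 (test_slice2 t x1) c2
  (test_outside t (proj1 (out_of_strip x1))) (test_outside t (proj2 (out_of_strip x1))).
move=> h; have c0 : continuous (fun s : R => phi (x1, s)) := slice2_cont (test_cont t).
have csq (k : R -> R) : continuous k -> continuous (fun s => k s ^+ 2).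
  by move=> ck s; exact: (cvgM (ck s) (ck s)).
have ii : lam.-integrable `](- a), a[ (fun x2 => (partial2 phi (x1, x2) ^+ 2 - E1 a * phi (x1, x2) ^+ 2)%:E).
  apply: (@integrableS _ _ _ lam `[(- a), a]) => //; first by apply: subset_itv; rewrite bnd_simp.
  apply: segment_integrable => s _; apply: cvgB; first exact: csq.
  by apply: cvgM; [exact: cvg_cst|exact: csq].
have -> : (\int[lam]_(x2 in `](- a)%R, a[)
    (b x1 * (partial2 phi (x1, x2) * partial2 phi (x1, x2)) -
     E1 a * b x1 * (phi (x1, x2) * phi (x1, x2)))%:E =
   \int[lam]_(x2 in `](- a)%R, a[) ((b x1)%:E *
     (partial2 phi (x1, x2) ^+ 2 - E1 a * phi (x1, x2) ^+ 2)%:E))%E.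
  by apply: eq_integral => x2 _; rewrite -EFinM; congr EFin; ring.
rewrite integralZl//; apply: mule_ge0 => //.
by rewrite lee_fin; have /andP[] := hb x1.
Qed.

(** The comparison of [W] with - g' - g^2 carries the factor phi^2, so it constrains only the points
    where [phi] is nonzero; this is what makes it applicable to localized functions. *)
Lemma riccati_strip phi (g g' W : R -> R) : test_function D phi ->
  (forall s : R, is_derive s 1 g (g' s)) -> continuous g' ->
  bdm (fun x => W x.1) ->
  (forall x, D x -> W x.1 * phi x ^+ 2 <= (- g' x.1 - g x.1 ^+ 2) * phi x ^+ 2) ->
  ip (fun x => W x.1) phi phi <= ip (cst 1) (partial1 phi) (partial1 phi).
Proof.
move=> t dg cg' hW Wle; have [t1 t2] := test_partial t.
have cg : continuous g.
  by move=> s; apply: differentiable_continuous; apply/derivable1_diffP; have [] := dg s.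
have s0 := test_sqi t; have s1 := test_sqi1 t; have h1 : bdm (cst (1 : R)) := bdm_cst D (1 : R).
have [L L0 hL] := test_box t.
have [L' L'0 hL'] := test_box t1.
pose P := Num.max L L' + 1.
have PL : L < P by rewrite /P ltr_pwDr// le_max lexx.
have PL' : L' < P by rewrite /P ltr_pwDr// le_max lexx orbT.
have P0 : - P < P by lra.
have out (psi : plane R -> R) l : l < P -> (forall x, ~ box l x -> psi x = 0) ->
    forall s y : R, P <= `|s| -> psi (s, y) = 0.
  move=> lP h s y Ps; apply: h => /= -[/= sl _]; lra.
pose q (x : plane R) := partial1 phi x ^+ 2 + (g' x.1 + g x.1 ^+ 2) * phi x ^+ 2.
have cq : continuous q.
  have csq (k : plane R -> R) : continuous k -> continuous (fun x => k x ^+ 2).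
    by move=> ck s; exact: (cvgM (ck s) (ck s)).
  move=> x; apply: cvgD; first exact: csq (test_cont t1) x.
  apply: cvgM; last exact: csq (test_cont t) x.
  by apply: cvgD; [exact: lift_cont|apply: csq; exact: lift_cont].
have q0 x : ~ box P x -> q x = 0.
  move=> nb; rewrite /q hL' ?hL; first by rewrite !expr0n mulr0 addr0.
    by move=> [? ?]; apply: nb; split; lra.
  by move=> [? ?]; apply: nb; split; lra.
have iq : rint q.
  have [M hM] := continuous_box_bounded cq q0.
  by apply: (rint_box (continuous_measurable_strip cq)) (fun x _ => hM x) (fun x _ => q0 x).
have q_ge0 : 0 <= \int[leb2]_(x in D) q x.
  apply: strip_ge0_2 => // x2.
  have := @riccati R (fun s => phi (s, x2)) (fun s => partial1 phi (s, x2)) g g' (- P) P P0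
    (test_slice1 t x2) (slice1_cont (test_cont t1)) _ _ (fun s _ => dg s) (fun s _ => cg' s).
  have e1 : phi (- P, x2) = 0 by apply: (out _ _ PL hL); rewrite normrN ler_norm.
  have e2 : phi (P, x2) = 0 by apply: (out _ _ PL hL); rewrite ler_norm.
  move=> /(_ e1 e2); rewrite [X in _ -> (_ <= X)%E](_ : _ =
    \int[lam]_(s in `[(- P)%R, P]) (q (s, x2))%:E)%E//.
  rewrite [RHS]integral_mkcond; apply: eq_integral => s _; rewrite /patch; case: ifPn => //.
  rewrite notin_setE/= in_itv/= => /negP; rewrite -ler_norml -ltNge => h.
  by rewrite q0// => -[/= ? _]; lra.
have i1 := rint_ip mD h1 s1 s1; have iW := rint_ip mD hW s0 s0.
rewrite -subr_ge0 /ip -RintegralB//; apply: le_trans q_ge0 _.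
apply: le_Rintegral => //; first exact: (integrableB mD i1 iW).
move=> x Dx; move: (Wle x Dx); rewrite /q /cst.
by move: (partial1 phi x) (phi x) (g x.1) (g' x.1) (W x.1) => p1 p2 r1 r2 r3; lra.
Qed.

(** phi^2 at (x1, x2) is at most [A x2], by integrating its derivative along the horizontal line,
    and at most [B x1] along the vertical one. The integral of the product factorizes, and
    Cauchy-Schwarz bounds each factor; 4 = 2 * 2 comes from the two derivatives of a square. *)
Lemma ladyzhenskaya phi : test_function D phi ->
  \int[leb2]_(x in D) (phi x ^+ 4) <= 4 * nrm leb2 D (cst 1) phi ^+ 2 *
    (nrm leb2 D (cst 1) (partial1 phi) * nrm leb2 D (cst 1) (partial2 phi)).
Proof.
move=> t; have [t1 t2] := test_partial t.
have s0 := test_sqi t; have s1 := test_sqi1 t; have s2 := test_sqi2 t.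
have h1 : bdm (cst (1 : R)) := bdm_cst D (1 : R).
have c0 := test_cont t; have c1 := test_cont t1; have c2 := test_cont t2.
pose A (x2 : R) := (\int[lam]_s (2 * `|phi (s, x2) * partial1 phi (s, x2)|)%:E)%E.
pose B (x1 : R) := (\int[lam]_s (2 * `|phi (x1, s) * partial2 phi (x1, s)|)%:E)%E.
pose al (x : plane R) := (2 * `|phi x * partial1 phi x|)%:E.
pose be (x : plane R) := (2 * `|phi x * partial2 phi x|)%:E.
have mal : measurable_fun setT al.
  apply/measurable_EFinP; apply: measurable_funM; first exact: measurable_cst.
  by apply: measurableT_comp => //; apply: measurable_funM; exact: continuous_measurable_plane.
have mbe : measurable_fun setT be.
  apply/measurable_EFinP; apply: measurable_funM; first exact: measurable_cst.
  by apply: measurableT_comp => //; apply: measurable_funM; exact: continuous_measurable_plane.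
have al0 x : (0 <= al x)%E by rewrite lee_fin mulr_ge0.
have be0 x : (0 <= be x)%E by rewrite lee_fin mulr_ge0.
have A0 x2 : (0 <= A x2)%E by apply: integral_ge0 => s _; exact: al0.
have B0 x1 : (0 <= B x1)%E by apply: integral_ge0 => s _; exact: be0.
have mA : measurable_fun setT A by exact: (@measurable_fun_fubini_tonelli_G _ _ _ _ R lam al mal al0).
have mB : measurable_fun setT B by exact: (@measurable_fun_fubini_tonelli_F _ _ _ _ R lam be mbe be0).
(* Integration starts at -L, where [u] vanishes; points to the left of -L are trivial. *)
have line (u u' : R -> R) (L r : R) : (forall s : R, is_derive s 1 u (u' s)) -> continuous u' ->
    0 < L -> (forall s : R, L <= `|s| -> u s = 0) ->
    ((u r ^+ 2)%:E <= \int[lam]_s (2 * `|u s * u' s|)%:E)%E.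
  move=> du cu' L0 hu.
  have cu : continuous u.
    by move=> s; apply: differentiable_continuous; apply/derivable1_diffP; have [] := du s.
  have mi : measurable_fun setT (fun s : R => (2 * `|u s * u' s|)%:E).
    apply/measurable_EFinP; apply: measurable_funM; first exact: measurable_cst.
    by apply: measurableT_comp => //; apply: measurable_funM; exact: continuous_measurable_fun.
  have [rL|rL] := leP r (- L).
    rewrite hu; last by rewrite ler_normr; apply/orP; right; lra.
    by rewrite expr0n; apply: integral_ge0 => s _; rewrite lee_fin mulr_ge0.
  have F s : - L <= s <= r -> is_derive s 1 (fun s : R => u s ^+ 2) (2 * (u s * u' s)).
    move=> _; apply: (is_derive_eq (is_deriveM (du s) (du s))).
    by rewrite /GRing.scale/=; ring.
  have cF s : - L <= s <= r -> {for s, continuous (fun s : R => 2 * (u s * u' s))}.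
    by move=> _; apply: cvgM; [exact: cvg_cst|apply: cvgM; [exact: cu|exact: cu']].
  have E := ftc_segment rL F cF.
  rewrite (hu (- L)) ?expr0n ?subr0 in E; last by rewrite normrN ler_norm.
  rewrite -E; apply: (@le_trans _ _ (\int[lam]_(s in `[(- L)%R, r]) (2 * `|u s * u' s|)%:E)%E).
    apply: le_integral => //.
    - exact: segment_integrable.
    - apply: segment_integrable => s _; apply: cvgM; first exact: cvg_cst.
      apply: (@continuous_comp _ _ _ (fun s => u s * u' s) Num.norm); last exact: norm_continuous.
      by apply: cvgM; [exact: cu|exact: cu'].
    - by move=> s _; rewrite lee_fin ler_pM2l// ler_norm.
  by apply: ge0_subset_integral.
have [L L0 hL] := test_box t.
have bA x1 x2 : ((phi (x1, x2) ^+ 2)%:E <= A x2)%E.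
  apply: (line (fun s => phi (s, x2)) (fun s => partial1 phi (s, x2)) (L + 1)).
  - exact: (test_slice1 t x2).
  - exact: (slice1_cont c1).
  - by rewrite addr_gt0.
  - by move=> s sL; apply: hL => -[/= ? _]; lra.
have bB x1 x2 : ((phi (x1, x2) ^+ 2)%:E <= B x1)%E.
  apply: (line (fun s => phi (x1, s)) (fun s => partial2 phi (x1, s)) (L + 1)).
  - exact: (test_slice2 t x1).
  - exact: (slice2_cont c2).
  - by rewrite addr_gt0.
  - by move=> s sL; apply: hL => -[/= _ ?]; lra.
have i4 : rint (fun x => phi x ^+ 4).
  have c4 : continuous (fun x : plane R => phi x ^+ 4).
    have csq (k : plane R -> R) : continuous k -> continuous (fun x => k x ^+ 2).
      by move=> ck s; exact: (cvgM (ck s) (ck s)).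
    have E : (fun x => (phi x ^+ 2) ^+ 2) = (fun x => phi x ^+ 4).
      by apply/funext => x; rewrite -exprM.
    by rewrite -E; exact: (csq _ (csq _ c0)).
  have z4 x : ~ box L x -> phi x ^+ 4 = 0 by move=> /hL ->; rewrite expr0n.
  have [M hM] := continuous_box_bounded c4 z4.
  exact: (rint_box (continuous_measurable_strip c4) (fun x _ => hM x) (fun x _ => z4 x)).
have nbound psi : sqi psi ->
    (\int[leb2]_x (2 * `|phi x * psi x|)%:E <=
     (2 * (nrm leb2 D (cst 1%R) phi * nrm leb2 D (cst 1%R) psi))%:E)%E.
  move=> hpsi; have i0 := rint_ip mD h1 (sqi_norm s0) (sqi_norm hpsi).
  have -> : (\int[leb2]_x (2 * `|phi x * psi x|)%:E =
      \int[leb2]_(x in D) (2 * (cst 1 x * (`|phi x| * `|psi x|)))%:E)%E.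
    rewrite [RHS]integral_mkcond; apply: eq_integral => x _; rewrite /patch; case: ifPn.
      by rewrite /cst mul1r normrM.
    by rewrite notin_setE => nD; rewrite (test_outside t nD) mul0r normr0 mulr0.
  have -> : (\int[leb2]_(x in D) (2 * (cst 1 x * (`|phi x| * `|psi x|)))%:E =
      (2 * ip (cst 1%R) (fun x => `|phi x|) (fun x => `|psi x|))%:E)%E.
    rewrite /ip -RintegralZl// /Rintegral fineK//; apply: integrable_fin_num => //.
    exact: (rintZ mD 2 i0).
  rewrite lee_fin ler_pM2l// -(nrm_norm leb2 D (cst 1) phi) -(nrm_norm leb2 D (cst 1) psi).
  by apply: (dot_le mD h1 ltr01) => //; exact: sqi_norm.
have IA : (\int[lam]_x2 A x2 <= (2 * (nrm leb2 D (cst 1%R) phi * nrm leb2 D (cst 1%R) (partial1 phi)))%:E)%E.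
  have -> : (\int[lam]_x2 A x2 = \int[leb2]_x al x)%E := esym (fubini_tonelli2 al mal al0).
  exact: nbound s1.
have IB : (\int[lam]_x1 B x1 <= (2 * (nrm leb2 D (cst 1%R) phi * nrm leb2 D (cst 1%R) (partial2 phi)))%:E)%E.
  have -> : (\int[lam]_x1 B x1 = \int[leb2]_x be x)%E := esym (fubini_tonelli1 be mbe be0).
  exact: nbound s2.
have main : ((\int[leb2]_(x in D) (phi x ^+ 4))%:E <= (\int[lam]_x2 A x2) * (\int[lam]_x1 B x1))%E.
  rewrite /Rintegral fineK; last exact: integrable_fin_num.
  apply: (@le_trans _ _ (\int[leb2]_x (phi x ^+ 4)%:E)%E).
    apply: ge0_subset_integral => //; last by move=> x _; rewrite lee_fin exprn_even_ge0.
    by apply/measurable_EFinP; apply: measurable_funX; exact: continuous_measurable_plane.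
  have -> : (\int[leb2]_x (phi x ^+ 4)%:E = \int[lam]_x1 \int[lam]_x2 (phi (x1, x2) ^+ 4)%:E)%E.
    apply: (@fubini_tonelli1 _ _ _ _ R lam lam (fun x => (phi x ^+ 4)%:E)).
      by apply/measurable_EFinP; apply: measurable_funX; exact: continuous_measurable_plane.
    by move=> x; rewrite lee_fin exprn_even_ge0.
  have IA0 : (0 <= \int[lam]_x2 A x2)%E := integral_ge0 lam (fun x _ => A0 x).
  rewrite -(@ge0_integralZl _ _ R lam setT (@measurableT _ _) B mB _ (fun x _ => B0 x) IA0).
  apply: (@ge0_le_integral _ _ _ lam setT (@measurableT _ _)).
  - by move=> x1 _; apply: integral_ge0 => x2 _; rewrite lee_fin exprn_even_ge0.
  - apply: (@measurable_fun_fubini_tonelli_F _ _ _ _ R lam (fun x => (phi x ^+ 4)%:E)).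
      by apply/measurable_EFinP; apply: measurable_funX; exact: continuous_measurable_plane.
    by move=> x; rewrite lee_fin exprn_even_ge0.
  - exact: (measurable_funeM _ mB).
  - move=> x1 _; rewrite muleC -(@ge0_integralZl _ _ R lam setT (@measurableT _ _) A mA _ (fun x _ => A0 x) (B0 x1)).
    apply: (@ge0_le_integral _ _ _ lam setT (@measurableT _ _)).
    + by move=> x2 _; rewrite lee_fin exprn_even_ge0.
    + apply/measurable_EFinP; apply: measurable_funX; apply: continuous_measurable_fun.
      exact: slice2_cont.
    + exact: (measurable_funeM _ mA).
    + move=> x2 _; rewrite (_ : phi (x1, x2) ^+ 4 = phi (x1, x2) ^+ 2 * phi (x1, x2) ^+ 2); last by rewrite -exprD.
      have p0 : (0 <= (phi (x1, x2) ^+ 2)%:E)%E by rewrite lee_fin sqr_ge0.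
      by rewrite EFinM; exact: (lee_pmul p0 p0 (bB x1 x2) (bA x1 x2)).
rewrite -lee_fin; apply: le_trans main _; apply: le_trans (lee_pmul _ _ IA IB) _.
- exact: (integral_ge0 lam (fun x _ => A0 x)).
- exact: (integral_ge0 lam (fun x _ => B0 x)).
move: (nrm leb2 D (cst 1) phi) (nrm leb2 D (cst 1) (partial1 phi))
  (nrm leb2 D (cst 1) (partial2 phi)) => n0 n1 n2.
by rewrite -EFinM lee_fin le_eqVlt; apply/orP; left; apply/eqP; ring.
Qed.

End strip_integrals.

Arguments smooth1_bdm {R a b M} _ _.

(** * The space H10 of the strip *)

Section weighted_equivalence.
Context d (T : measurableType d) (R : realType) (mu : {measure set T -> \bar R}).
Variables (D : set T) (mD : measurable D).
Variables (w : T -> R) (c : R).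
Hypotheses (hw : bdm D w) (c0 : 0 < c) (cw : forall x, D x -> c <= w x).
Implicit Types (u v : T -> R).

Let w0 x : D x -> 0 <= w x.
Proof. by move=> Dx; rewrite (le_trans (ltW c0))// cw. Qed.

(** A weight between two positive constants does not change the space. From here on all weighted
    spaces are the single class [sqi], and only the norms differ. *)
Lemma inL2_sqi u : inL2 mu D w u <-> sqi mu D u.
Proof.
split=> [[mu_ fin]|hu].
  split => //; apply: (@rint_le _ _ _ _ _ mD _ (fun x => c^-1 * (u x ^+ 2 * w x))).
  - exact: measurable_funX.
  - move=> x Dx; rewrite ger0_norm ?sqr_ge0// mulrCA ler_peMr ?sqr_ge0//.
    by rewrite ler_pdivlMl// mulr1 cw.
  - apply: rintZ => //; apply/integrableP; split.
      by apply/measurable_EFinP; apply: measurable_funM; [exact: measurable_funX|case: hw].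
    rewrite (@eq_integral _ _ _ _ _ (fun x => (u x ^+ 2 * w x)%:E))//.
    move=> x /set_mem Dx /=; rewrite ger0_norm//; apply: mulr_ge0; [exact: sqr_ge0|exact: w0].
have [mu_ _] := hu; split => //.
have := rint_ip mD hw hu hu; move=> /integrableP[_]; apply: le_lt_trans.
rewrite /sqnorm le_eqVlt; apply/orP; left; apply/eqP; apply: eq_integral => x /set_mem Dx.
rewrite /= ger0_norm; first by congr EFin; ring.
by apply: mulr_ge0; [exact: w0|rewrite -expr2 sqr_ge0].
Qed.

Lemma sqnormE u : sqi mu D u -> sqnorm mu D w u = (nrm mu D w u ^+ 2)%:E.
Proof.
move=> hu; rewrite (nrm2 _ c0 cw) /ip /Rintegral fineK; last first.
  exact: (integrable_fin_num mD (rint_ip mD hw hu hu)).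
by apply: eq_integral => x _; congr EFin; ring.
Qed.

Lemma dotL2E u v : dotL2 mu D w u v = ip mu D w u v.
Proof. by apply: eq_Rintegral => x _; ring. Qed.

Lemma ip_bound al M u v : bdm D al -> 0 <= M -> (forall x, D x -> `|al x| <= M * w x) ->
  sqi mu D u -> sqi mu D v -> `|ip mu D al u v| <= M * (nrm mu D w u * nrm mu D w v).
Proof.
move=> hal M0 alM hu hv.
have i1 := rint_ip mD hal hu hv.
have i2 := rint_ip mD hw (sqi_norm hu) (sqi_norm hv).
apply: le_trans (le_normr_Rintegral mD i1) _.
apply: (@le_trans _ _ (M * ip mu D w (fun x => `|u x|) (fun x => `|v x|))); last first.
  rewrite ler_wpM2l// -(nrm_norm mu D w u) -(nrm_norm mu D w v).
  by apply: (dot_le mD hw c0 cw); exact: sqi_norm.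
rewrite /ip -RintegralZl//; apply: le_Rintegral => //.
- exact: (integrable_abse i1).
- exact: (rintZ mD M i2).
- by move=> x Dx; rewrite normrM [leRHS]mulrA (normrM (u x)) ler_wpM2r ?mulr_ge0// alM.
Qed.

End weighted_equivalence.

Section sobolev_closure.
Context {R : realType} (a : R).
Hypothesis a0 : 0 < a.
Local Notation D := (strip a).
Local Notation sqi := (sqi leb2 D).
Local Notation bdm := (bdm D).
Local Notation ip := (ip leb2 D).
Local Notation nrm1 := (nrm leb2 D (cst (1 : R))).
Implicit Types (phi u : plane R -> R).

Let mD : measurable D := strip_measurable a.
Let h1 : bdm (cst (1 : R)) := bdm_cst D (1 : R).
Let c1 (x : plane R) (Dx : D x) : (1 : R) <= cst 1 x := lexx 1.

Lemma L2_sqi u : L2_space D u <-> sqi u.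
Proof. exact: (@inL2_sqi _ _ R leb2 D mD (cst 1) 1 h1 ltr01 c1 u). Qed.

Lemma sqnorm1E u : sqi u -> sqnorm leb2 D (cst 1) u = (nrm1 u ^+ 2)%:E.
Proof. exact: (sqnormE mD h1 ltr01 c1). Qed.

(** The fundamental theorem on slices. Applied to products of test functions it becomes integration
    by parts, hence the classical gradient is the weak one. *)
Lemma test_partial_int0 phi : test_function D phi ->
  \int[leb2]_(x in D) partial1 phi x = 0 /\ \int[leb2]_(x in D) partial2 phi x = 0.
Proof.
move=> t; have [t1 t2] := test_partial t.
have r1 (psi : plane R -> R) : test_function D psi -> rint leb2 D psi.
  move=> tp; have [L L0 hL] := test_box tp.
  have [M hM] := continuous_box_bounded (test_cont tp) hL.
  exact: (rint_box (continuous_measurable_strip (test_cont tp)) (fun x _ => hM x) (fun x _ => hL x)).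
have [L L0 hL] := test_box t; have [L' L'0 hL'] := test_box t1.
pose P := Num.max L L' + 1.
have PL : L < P by rewrite /P ltr_pwDr// le_max lexx.
have PL' : L' < P by rewrite /P ltr_pwDr// le_max lexx orbT.
have P0 : - P < P by lra.
have I1 (x2 : R) : (\int[lebesgue_measure]_x1 (partial1 phi (x1, x2))%:E = 0)%E.
  have := @ftc_segment R (fun s => phi (s, x2)) (fun s => partial1 phi (s, x2)) (- P) P P0
    (fun s _ => test_slice1 t x2 s) (fun s _ => (slice1_cont (test_cont t1) : continuous (fun s : R => partial1 phi (s, x2))) s).
  rewrite hL; last by move=> [/= + _]; rewrite ler_norml; lra.
  rewrite hL; last by move=> [/= + _]; rewrite ler_norml; lra.
  rewrite subrr => h; rewrite -[RHS]h [RHS]integral_mkcond; apply: eq_integral => s _.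
  rewrite /patch; case: ifPn => //.
  rewrite notin_setE/= in_itv/= => /negP; rewrite -ler_norml -ltNge => h'.
  by rewrite hL'// => -[/= h2 _]; have := lt_le_trans h' h2; rewrite ltNge (ltW PL').
have I2 (x1 : R) : (\int[lebesgue_measure]_(x2 in `](- a)%R, a[) (partial2 phi (x1, x2))%:E = 0)%E.
  have aa : - a < a by rewrite (lt_trans _ a0)// oppr_lt0.
  have := @ftc_segment R (fun s => phi (x1, s)) (fun s => partial2 phi (x1, s)) (- a) a aa
    (fun s _ => test_slice2 t x1 s) (fun s _ => (slice2_cont (test_cont t2) : continuous (fun s : R => partial2 phi (x1, s))) s).
  rewrite (test_outside t (proj1 (out_of_strip a x1))) (test_outside t (proj2 (out_of_strip a x1))).
  rewrite subrr => h; rewrite -[RHS]h -[LHS](integral_itv_bndoo true false)//.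
  apply/measurable_EFinP; apply: measurable_funTS.
  by apply: continuous_measurable_fun; exact: slice2_cont (test_cont t2).
split; rewrite /Rintegral.
  rewrite strip_fubini2; last exact: r1.
  by under eq_integral do rewrite I1; rewrite integral0.
rewrite strip_fubini1; last exact: r1.
by under eq_integral do rewrite I2; rewrite integral0.
Qed.

Lemma test_prod phi psi : test_function D phi -> test_function D psi ->
  [/\ test_function D (fun x => phi x * psi x),
    partial1 (fun x => phi x * psi x) = (fun x => phi x * partial1 psi x + psi x * partial1 phi x) &
    partial2 (fun x => phi x * psi x) = (fun x => phi x * partial2 psi x + psi x * partial2 phi x)].
Proof.
move=> t t'; split.
- split.
    apply: ncont2_smooth => n; apply: ncont2M; apply: smooth_ncont2.
      by case: t.
    by case: t'.
  case: t => _ [C [cC CD] hC]; exists C => // x nC; by rewrite hC// mul0r.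
- by apply/funext => x; have [_ E] := is_deriveM (test_derive1 t x) (test_derive1 t' x); exact: E.
- by apply/funext => x; have [_ E] := is_deriveM (test_derive2 t x) (test_derive2 t' x); exact: E.
Qed.

Let parts (p q r s : plane R -> R) : sqi p -> sqi q -> sqi r -> sqi s ->
  \int[leb2]_(x in D) (p x * q x + r x * s x) = 0 ->
  \int[leb2]_(x in D) (p x * q x) = - \int[leb2]_(x in D) (s x * r x).
Proof.
move=> hp hq hr hs.
have E (u v : plane R -> R) : sqi u -> sqi v -> rint leb2 D (fun x => u x * v x).
  move=> hu hv; have := rint_ip mD h1 hu hv; congr rint.
  by apply/funext => x; rewrite /cst mul1r.
rewrite RintegralD//; [|exact: E|exact: E] => /eqP; rewrite addr_eq0 => /eqP ->.
by congr (- _); apply: eq_Rintegral => x _; rewrite mulrC.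
Qed.

Lemma test_weak_gradient phi : test_function D phi ->
  weak_gradient D phi (partial1 phi) (partial2 phi).
Proof.
move=> t psi t'; have [tp E1 E2] := test_prod t t'.
have [I1 I2] := test_partial_int0 tp.
have s0 := test_sqi t; have s1 := test_sqi1 t; have s2 := test_sqi2 t.
have s0' := test_sqi t'; have s1' := test_sqi1 t'; have s2' := test_sqi2 t'.
split; apply: parts => //; first by rewrite -I1 E1.
by rewrite -I2 E2.
Qed.

Lemma H10_approx u g1 g2 : H10_space D u g1 g2 -> forall e : R, 0 < e ->
  exists phi, [/\ test_function D phi, nrm1 (fun x => phi x - u x) < e,
    nrm1 (fun x => partial1 phi x - g1 x) < e & nrm1 (fun x => partial2 phi x - g2 x) < e].
Proof.
move=> [[/L2_sqi hu /L2_sqi hg1 /L2_sqi hg2 _] [phi [tphi cv0 cv1 cv2]]] e e0.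
have H (v : nat -> plane R -> R) : (forall n, sqi (v n)) ->
    sqnorm leb2 D (cst 1) (v n) @[n --> \oo] --> 0%E -> \forall n \near \oo, nrm1 (v n) < e.
  move=> hv cv; have : (fun n => nrm1 (v n) ^+ 2) @ \oo --> (0 : R).
    rewrite (_ : (fun n => _) = fine \o (fun n => sqnorm leb2 D (cst 1) (v n))).
      exact: fine_cvg.
    by apply/funext => n /=; rewrite sqnorm1E.
  move=> /cvgrPdist_lt/(_ (e ^+ 2)); rewrite exprn_gt0// => /(_ isT).
  apply: filterS => n; rewrite sub0r normrN ger0_norm ?sqr_ge0//.
  by rewrite ltr_pXn2r// nnegrE ?nrm_ge0// ltW.
have [n [[n0 n1] n2]] : exists n, (nrm1 (phi n \- u) < e /\ nrm1 (partial1 (phi n) \- g1) < e) /\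
    nrm1 (partial2 (phi n) \- g2) < e.
  have F0 := H _ (fun n => sqiB mD (test_sqi (tphi n)) hu) cv0.
  have F1 := H _ (fun n => sqiB mD (test_sqi1 (tphi n)) hg1) cv1.
  have F2 := H _ (fun n => sqiB mD (test_sqi2 (tphi n)) hg2) cv2.
  by have [N _ hN] := filterI (filterI F0 F1) F2; exists N; apply: (hN N) => /=.
by exists (phi n).
Qed.

Lemma H10_intro u g1 g2 : sqi u -> sqi g1 -> sqi g2 -> weak_gradient D u g1 g2 ->
  (forall e : R, 0 < e ->
   exists phi, [/\ test_function D phi, nrm1 (fun x => phi x - u x) < e,
    nrm1 (fun x => partial1 phi x - g1 x) < e & nrm1 (fun x => partial2 phi x - g2 x) < e]) ->
  H10_space D u g1 g2.
Proof.
move=> hu hg1 hg2 wg H; split; first by split => //; exact/L2_sqi.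
have e0 n : 0 < (2^-1 : R) ^+ n by rewrite exprn_gt0.
have /choice[phi hphi] n := H _ (e0 n); exists phi.
have C (v : nat -> plane R -> R) : (forall n, sqi (v n)) -> (forall n, nrm1 (v n) < 2^-1 ^+ n) ->
    sqnorm leb2 D (cst 1) (v n) @[n --> \oo] --> 0%E.
  move=> hv hn; rewrite (_ : (fun n => _) = EFin \o (fun n => nrm1 (v n) ^+ 2)); last first.
    by apply/funext => n /=; rewrite sqnorm1E.
  apply: cvg_EFin; first exact: nearW.
  rewrite (_ : fine \o _ = (fun n => nrm1 (v n) ^+ 2)); last exact/funext.
  apply: (@squeeze_cvgr _ _ _ _ (cst 0) (fun n => 2^-1 ^+ n)).
  - apply: nearW => n; rewrite sqr_ge0/=; apply: (@le_trans _ _ (2^-1 ^+ n ^+ 2)).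
      by rewrite ler_pXn2r ?nnegrE ?nrm_ge0 ?exprn_ge0// ltW.
    by rewrite expr2 ler_piMr ?exprn_ge0// exprn_ile1// invf_le1// ler1n.
  - exact: cvg_cst.
  - by apply: cvg_expr; rewrite ger0_norm// invf_lt1// ltr1n.
split.
- by move=> n; have [] := hphi n.
- by apply: C => n; have [t ? _ _] := hphi n => //; apply: sqiB => //; exact: test_sqi.
- by apply: C => n; have [t _ ? _] := hphi n => //; apply: sqiB => //; exact: test_sqi1.
- by apply: C => n; have [t _ _ ?] := hphi n => //; apply: sqiB => //; exact: test_sqi2.
Qed.

Lemma test_H10 phi : test_function D phi -> H10_space D phi (partial1 phi) (partial2 phi).
Proof.
move=> t; apply: H10_intro; [exact: test_sqi|exact: test_sqi1|exact: test_sqi2|exact: test_weak_gradient|].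
move=> e e0; exists phi; have z (v : plane R -> R) : nrm1 (fun x => v x - v x) < e.
  rewrite (_ : (fun x => _) = fun x => 0 * 0); last by apply/funext => x; rewrite subrr mul0r.
  by rewrite nrmZ ?normr0 ?mul0r//; exact: sqi0.
by split.
Qed.

Lemma H10_sqi u g1 g2 : H10_space D u g1 g2 -> [/\ sqi u, sqi g1 & sqi g2].
Proof. by move=> [[? ? ? _] _]; split; apply/L2_sqi. Qed.

(** The weak gradient is tested with b psi, again a test function, and b phi approximates b u when
    phi approximates u. The bounds on b and b' make both operations continuous in L^2. *)
Lemma H10_mul u g1 g2 (b : R -> R) (M : R) : smooth1 b -> (forall s, `|b s| <= M) ->
  (forall s, `|derive1 b s| <= M) -> H10_space D u g1 g2 ->
  H10_space D (fun x => b x.1 * u x) (fun x => derive1 b x.1 * u x + b x.1 * g1 x)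
    (fun x => b x.1 * g2 x).
Proof.
move=> sb bM b'M hH; have [hu hg1 hg2] := H10_sqi hH.
have M0 : 0 <= M by exact: le_trans (bM 0).
have hb : bdm (fun x => b x.1).
  by apply: bdm_lift bM; apply: continuous_measurable_fun; exact: smooth1_cont.
have hb' : bdm (fun x => derive1 b x.1).
  by apply: bdm_lift b'M; apply: continuous_measurable_fun; apply: smooth1_cont; exact: smooth1_derive1.
have I (p q : plane R -> R) : sqi p -> sqi q -> rint leb2 D (fun x => p x * q x).
  move=> hp hq; have := rint_ip mD h1 hp hq; congr rint.
  by apply/funext => x; rewrite /cst mul1r.
apply: H10_intro.
- exact: sqiM.
- by apply: sqiD => //; exact: sqiM.
- exact: sqiM.
- move=> psi tpsi; have tb := test_mul tpsi sb.
  have [_ /(_ _ tb)[]] : H10_space D u g1 g2 /\ weak_gradient D u g1 g2.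
    by split => //; case: hH => [[]].
  have s0 := test_sqi tpsi; have s1 := test_sqi1 tpsi; have s2 := test_sqi2 tpsi.
  rewrite (partial1_mul tpsi sb) (partial2_mul tpsi sb) => W1 W2; split; last first.
    rewrite (_ : \int[leb2]_(x in D) (b x.1 * g2 x * psi x) = \int[leb2]_(x in D) (g2 x * (b x.1 * psi x))).
      by rewrite -W2; apply: eq_Rintegral => x _; ring.
    by apply: eq_Rintegral => x _; ring.
  have -> : \int[leb2]_(x in D) (b x.1 * u x * partial1 psi x) =
     \int[leb2]_(x in D) (u x * (derive1 b x.1 * psi x + b x.1 * partial1 psi x))
     - \int[leb2]_(x in D) (u x * (derive1 b x.1 * psi x)).
    rewrite -RintegralB//.
    - by apply: eq_Rintegral => x _; ring.
    - by apply: I => //; apply: sqiD => //; exact: sqiM.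
    - by apply: I => //; exact: sqiM.
  rewrite W1 -opprD; congr (- _); rewrite -RintegralD//.
  - by apply: eq_Rintegral => x _; ring.
  - by apply: I => //; exact: sqiM.
  - by apply: I => //; exact: sqiM.
- move=> e e0; have M1 : 0 < M + M + 1 by rewrite ltr_wpDl// addr_ge0.
  have e1 : 0 < e / (M + M + 1) by rewrite divr_gt0.
  have [phi [t n0 n1 n2]] := H10_approx hH e1.
  have s0 := test_sqi t; have s1 := test_sqi1 t; have s2 := test_sqi2 t.
  exists (fun x => b x.1 * phi x); rewrite (partial1_mul t sb) (partial2_mul t sb).
  have bn (k : R -> R) v : bdm (fun x => k x.1) -> (forall s, `|k s| <= M) -> sqi v ->
      nrm1 (fun x => k x.1 * v x) <= M * nrm1 v.
    by move=> hk kM hv; apply: (nrmM_le mD h1 ltr01 c1) => // x _; exact: kM.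
  have q (k : R -> R) v v' : bdm (fun x => k x.1) -> (forall s, `|k s| <= M) -> sqi v -> sqi v' ->
      nrm1 (fun x => v x - v' x) < e / (M + M + 1) ->
      nrm1 (fun x => k x.1 * v x - k x.1 * v' x) <= M * (e / (M + M + 1)).
    move=> hk kM hv hv' hn; rewrite (_ : (fun x => _) = fun x => k x.1 * (v x - v' x)).
      apply: le_trans (bn k _ hk kM (sqiB mD hv hv')) _.
      by rewrite ler_wpM2l// ltW.
    by apply/funext => x; ring.
  have eM : (M + M + 1) * (e / (M + M + 1)) = e by rewrite mulrCA divff ?mulr1// gt_eqF.
  split; first exact: test_mul.
  - apply: le_lt_trans (q b _ _ hb bM s0 hu n0) _.
    have := mulr_ge0 M0 (ltW e1); move: eM e1; lra.
  - rewrite (_ : (fun x => _) = fun x => (derive1 b x.1 * phi x - derive1 b x.1 * u x) +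
        (b x.1 * partial1 phi x - b x.1 * g1 x)); last by apply/funext => x; ring.
    have h2 : sqi (fun x => derive1 b x.1 * phi x - derive1 b x.1 * u x).
      by apply: sqiB => //; exact: sqiM.
    have h3 : sqi (fun x => b x.1 * partial1 phi x - b x.1 * g1 x).
      by apply: sqiB => //; exact: sqiM.
    apply: le_lt_trans (nrmD mD h1 ltr01 c1 h2 h3) _.
    have := q _ _ _ hb' b'M s0 hu n0; have := q b _ _ hb bM s1 hg1 n1.
    by move: eM e1; lra.
  - apply: le_lt_trans (q b _ _ hb bM s2 hg2 n2) _.
    have := mulr_ge0 M0 (ltW e1); move: eM e1; lra.
Qed.

Lemma ip_near al M u v : bdm al -> 0 <= M -> (forall x, D x -> `|al x| <= M) -> sqi u -> sqi v ->
  `|ip al v v - ip al u u| <= M * (nrm1 (fun x => v x - u x) ^+ 2 + 2 * nrm1 u * nrm1 (fun x => v x - u x)).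
Proof.
move=> hal M0 alM hu hv; have hd := sqiB mD hv hu.
have alM' x : D x -> `|al x| <= M * cst 1 x by move=> /alM; rewrite /cst mulr1.
have b1 := ip_bound mD h1 ltr01 c1 hal M0 alM' hd hd.
have b2 := ip_bound mD h1 ltr01 c1 hal M0 alM' hd hu.
have -> : ip al v v - ip al u u = ip al (fun x => v x - u x) (fun x => v x - u x) +
   2 * ip al (fun x => v x - u x) u.
  by rewrite !(ipBl mD hal)// !(ipBr mD hal)// (ipC leb2 D al u v); ring.
apply: le_trans (ler_normD _ _) _; rewrite normrM ger0_norm//.
by move: b1 b2; rewrite expr2; lra.
Qed.

(** Inequalities are proved for test functions and transferred here by continuity in L^2. With
    weights of either sign, a comparison of two quadratic forms is the nonnegativity of one. *)
Lemma H10_closure al be ga u g1 g2 : bdm al -> bdm be -> bdm ga ->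
  (forall phi, test_function D phi -> 0 <= ip al phi phi +
     (ip be (partial1 phi) (partial1 phi) + ip ga (partial2 phi) (partial2 phi))) ->
  H10_space D u g1 g2 -> 0 <= ip al u u + (ip be g1 g1 + ip ga g2 g2).
Proof.
move=> hal hbe hga H hH; have [hu hg1 hg2] := H10_sqi hH.
have [_ [A hA]] := hal; have [_ [B hB]] := hbe; have [_ [C hC]] := hga.
pose M := `|A| + `|B| + `|C|.
have M0 : 0 <= M by rewrite !addr_ge0.
have MA x : D x -> `|al x| <= M.
  move=> Dx; rewrite (le_trans (hA x Dx))// (le_trans (ler_norm A))// /M.
  have := normr_ge0 B; have := normr_ge0 C; lra.
have MB x : D x -> `|be x| <= M.
  move=> Dx; rewrite (le_trans (hB x Dx))// (le_trans (ler_norm B))// /M.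
  have := normr_ge0 A; have := normr_ge0 C; lra.
have MC x : D x -> `|ga x| <= M.
  move=> Dx; rewrite (le_trans (hC x Dx))// (le_trans (ler_norm C))// /M.
  have := normr_ge0 A; have := normr_ge0 B; lra.
(* For an approximation error q <= 1 this gives q^2 + 2 |v| q <= N q for each of the three functions
   v. *)
pose N := 1 + 2 * (nrm1 u + nrm1 g1 + nrm1 g2).
have n0 := nrm_ge0 leb2 D (cst (1 : R)).
have N1 : 1 <= N by rewrite /N lerDl mulr_ge0// !addr_ge0.
apply/ler_addgt0Pr => e e0; rewrite addrC.
have K0 : 0 < 3 * M * N + 1 by rewrite ltr_wpDl// !mulr_ge0// (le_trans _ N1).
have d0 : 0 < Num.min 1 (e / (3 * M * N + 1)) by rewrite lt_min ltr01 divr_gt0.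
have [phi [t e0' e1' e2']] := H10_approx hH d0.
have bound (p v : plane R -> R) (k : plane R -> R) : bdm k -> (forall x, D x -> `|k x| <= M) ->
    sqi p -> sqi v -> 2 * nrm1 v <= N - 1 ->
    nrm1 (fun x => p x - v x) < Num.min 1 (e / (3 * M * N + 1)) ->
    `|ip k p p - ip k v v| <= M * N * (e / (3 * M * N + 1)).
  move=> hk kM hp hv vN; rewrite lt_min => /andP[d1 d2].
  apply: le_trans (ip_near hk M0 kM hv hp) _; rewrite -[leRHS]mulrA; apply: ler_wpM2l => //.
  set q := nrm1 (fun x => p x - v x) in d1 d2 *.
  have q0 : 0 <= q by exact: n0.
  have : q ^+ 2 + 2 * nrm1 v * q <= N * q by nra.
  move=> /le_trans; apply; rewrite ler_wpM2l ?(le_trans _ N1)// ltW//.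
have nu := n0 u; have ng1 := n0 g1; have ng2 := n0 g2.
have B0 := bound phi u al hal MA (test_sqi t) hu ltac:(rewrite /N; lra) e0'.
have B1 := bound (partial1 phi) g1 be hbe MB (test_sqi1 t) hg1 ltac:(rewrite /N; lra) e1'.
have B2 := bound (partial2 phi) g2 ga hga MC (test_sqi2 t) hg2 ltac:(rewrite /N; lra) e2'.
have Ht := H phi t.
have : 3 * (M * N * (e / (3 * M * N + 1))) <= e.
  have d1 : 0 <= e / (3 * M * N + 1) by rewrite divr_ge0// ltW.
  have : (3 * M * N + 1) * (e / (3 * M * N + 1)) = e by rewrite mulrCA divff ?mulr1// gt_eqF.
  move: (e / _) d1 => p p0 E; have -> : 3 * (M * N * p) = (3 * M * N + 1) * p - p by ring.
  by rewrite E lerBlDr lerDl.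
move: B0 B1 B2 Ht; move: (M * N * _) (ip al _ _) (ip al _ _) (ip be _ _) (ip be _ _) (ip ga _ _) (ip ga _ _).
clear -e e0.
by move=> z p q p' q' p2 q2; rewrite !ler_norml => /andP[_ ?] /andP[_ ?] /andP[_ ?] ? ?; lra.
Qed.

End sobolev_closure.

(** * The Jacobi equation *)

Section segment_integrals.
Context {R : realType}.
Local Notation lam := (@lebesgue_measure R).
Implicit Types (g h F u : R -> R).

Lemma Rintegral_subset d (T : measurableType d) (mu : {measure set T -> \bar R}) (A D : set T)
  (g : T -> R) : A `<=` D -> (forall x, D x -> ~ A x -> g x = 0) ->
  \int[mu]_(x in D) g x = \int[mu]_(x in A) g x.
Proof.
move=> AD g0; congr fine; rewrite integral_mkcond [RHS]integral_mkcond.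
apply: eq_integral => x _; rewrite /patch; case: ifPn => [/set_mem Dx|nD].
  by case: ifPn => //; rewrite notin_setE => nA; rewrite g0.
by case: ifPn => // /set_mem /AD Dx; move: nD; rewrite notin_setE.
Qed.

Lemma segment_bounded g (p q : R) : p <= q -> (forall s, p <= s <= q -> {for s, continuous g}) ->
  exists2 B : R, 0 <= B & forall s, p <= s <= q -> `|g s| <= B.
Proof.
move=> pq cg; have c : {within `[p, q], continuous (fun s => `|g s|)}.
  apply: continuous_in_subspaceT => s; rewrite inE/= in_itv/= => hs.
  by apply: (@continuous_comp _ _ _ g Num.norm); [exact: cg|exact: norm_continuous].
by have [m _ hm] := EVT_max pq c; exists `|g m| => // s hs; apply: hm; rewrite in_itv.
Qed.

Lemma rint_segment g (p q B : R) : measurable_fun `[p, q] g -> (forall s, p <= s <= q -> `|g s| <= B) ->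
  rint lam `[p, q] g.
Proof.
move=> mg gB; apply: (@rint_le _ _ _ lam _ _ _ (cst B)) => //.
by apply: segment_integrable => s _; exact: cvg_cst.
Qed.

Lemma Rintegral_cst_segment (p q B : R) : p <= q -> \int[lam]_(s in `[p, q]) B = B * (q - p).
Proof.
move=> pq; rewrite Rintegral_cst//; congr (_ * _).
transitivity (fine (if p < q then (q - p)%:E else 0%E)).
  by congr fine; have := lebesgue_measure_itv `[p, q]; rewrite /= lte_fin -EFinB.
by case: ltgtP pq => [pq|pq|->] // _; rewrite subrr.
Qed.

Lemma Rintegral_segment_le g (p q B : R) : p <= q -> measurable_fun `[p, q] g ->
  (forall s, p <= s <= q -> `|g s| <= B) -> `|\int[lam]_(s in `[p, q]) g s| <= B * (q - p).
Proof.
move=> pq mg gB; have ig := rint_segment mg gB.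
apply: le_trans (le_normr_Rintegral _ ig) _ => //.
rewrite -Rintegral_cst_segment//; apply: le_Rintegral => //.
- exact: (integrable_abse ig).
- by apply: segment_integrable => s _; exact: cvg_cst.
Qed.

Lemma derive1_zero_on (V : set R) g : open V -> (forall s, V s -> g s = 0) ->
  forall s, V s -> derive1 g s = 0.
Proof.
move=> oV g0 s Vs; have E : \forall z \near s, (cst 0 : R -> R) z = g z.
  by have : nbhs s V by [exact: open_nbhs_nbhs]; apply: filterS => z Vz; rewrite g0.
by rewrite derive1E -(near_eq_derive _ E)//; exact: derive_cst.
Qed.

Definition bump (c h s : R) : R := step ((s - c) / h).

Lemma smooth1_bump (c h : R) : smooth1 (bump c h).
Proof.
move=> n; apply: ncont_comp; first exact: smooth1_step.
by apply: ncontM; [apply: ncontB; [exact: ncont_id|exact: ncont_cst]|exact: ncont_cst].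
Qed.

Lemma bump_derive (c h s : R) : derive1 (bump c h) s = derive1 step ((s - c) / h) / h.
Proof.
have d1 : is_derive s 1 (fun s : R => (s - c) / h) (h^-1).
  have : is_derive s 1 (fun s : R => (s - c) * h^-1) ((s - c) *: 0 + h^-1 *: (1 - 0)) by apply: is_deriveM.
  by move=> H; apply: (is_derive_eq H); rewrite scaler0 add0r subr0 /GRing.scale/= mulr1.
have [_ E] := @is_derive1_comp R step (fun s => (s - c) / h) s _ _ (smooth1_is_derive ((s - c) / h) smooth1_step) d1.
by rewrite derive1E; rewrite /bump; rewrite E /GRing.scale/= mulrC.
Qed.

Lemma bump0 (c h s : R) : 0 < h -> s <= c -> bump c h s = 0.
Proof. by move=> h0 sc; apply: step0; rewrite pmulr_lle0 ?invr_gt0// subr_le0. Qed.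

Lemma bump1 (c h s : R) : 0 < h -> c + h <= s -> bump c h s = 1.
Proof. by move=> h0 sc; apply: step1; rewrite ler_pdivlMr// mul1r lerBrDl. Qed.

Lemma bump_derive0 (c h s : R) : 0 < h -> (s < c) || (c + h < s) -> derive1 (bump c h) s = 0.
Proof.
move=> h0 hs; rewrite bump_derive step_derive0 ?mul0r//.
by rewrite pmulr_llt0 ?invr_gt0// subr_lt0 ltr_pdivlMr// mul1r ltrBrDl.
Qed.

(* [bump c h] increases from 0 to 1 on [[c, c + h]], so its derivative is an
   approximate identity at [c], possibly of varying sign. *)
Lemma bump_identity g (p q c h e M : R) : 0 < h -> p <= c -> c + h <= q ->
  (forall s, `|derive1 step s| <= M) ->
  (forall s, p <= s <= q -> {for s, continuous g}) ->
  (forall s, c <= s <= c + h -> `|g s - g c| <= e) ->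
  `|\int[lam]_(s in `[p, q]) (g s * derive1 (bump c h) s) - g c| <= M * e.
Proof.
move=> h0 pc cq hM cg ge; have sb := smooth1_bump c h.
have cb : continuous (derive1 (bump c h)) by apply: smooth1_cont; exact: smooth1_derive1.
have ch : c < c + h by rewrite ltrDl.
have cg' s : c <= s <= c + h -> {for s, continuous g}.
  by move=> /andP[? ?]; apply: cg; rewrite (le_trans pc)// (le_trans _ cq).
rewrite (@Rintegral_subset _ _ lam `[c, c + h]%classic `[p, q]%classic); first last.
- move=> s _ /=; rewrite in_itv/= => /negP; rewrite negb_and -!ltNge => h'.
  by rewrite bump_derive0 ?mulr0.
- by move=> s /=; rewrite !in_itv/= => /andP[? ?]; rewrite (le_trans pc)// (le_trans _ cq).
have I1 : \int[lam]_(s in `[c, c + h]) derive1 (bump c h) s = 1.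
  rewrite /Rintegral (ftc_segment ch (fun s _ => smooth1_is_derive s sb) (fun s _ => cb s))/=.
  by rewrite bump1// bump0// subr0.
have ib : rint lam `[c, c + h] (derive1 (bump c h)) by apply: segment_integrable => s _; exact: cb.
have igb : rint lam `[c, c + h] (fun s => g s * derive1 (bump c h) s).
  by apply: segment_integrable => s hs; apply: cvgM; [exact: cg'|exact: cb].
have -> : g c = \int[lam]_(s in `[c, c + h]) (g c * derive1 (bump c h) s).
  by rewrite RintegralZl// I1 mulr1.
rewrite -RintegralB//; last exact: rintZ.
have -> : M * e = (e * (M / h)) * (c + h - c) by rewrite addrAC subrr add0r mulrA divfK ?gt_eqF// mulrC.
apply: Rintegral_segment_le; first exact: ltW.
  by apply: measurable_funB; apply: (@rint_measurable _ _ _ lam) => //; exact: rintZ.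
move=> s hs; rewrite -mulrBl normrM ler_pM//; first exact: ge.
by rewrite bump_derive normrM (gtr0_norm (_ : 0 < h^-1)) ?invr_gt0// ler_wpM2r ?invr_ge0 ?(ltW h0).
Qed.

End segment_integrals.

(** * Pointwise form of the Jacobi equation *)

Section jacobi_equation.
Context {R : realType} (a : R).
Hypothesis a0 : 0 < a.
Local Notation lam := (@lebesgue_measure R).
Local Notation I := (sym_interval a).
Implicit Types (k u F : R -> R).

Lemma test_function1_derive phi : test_function1 a phi -> test_function1 a (derive1 phi).
Proof.
move=> [s0 [C [cC CI] hC]]; split.
  by move=> n s; rewrite -derive1Sn; exact: s0.
exists C => // s; apply: (@derive1_zero_on _ (~` C)) => //.
by apply: closed_openC; apply: compact_closed => //; exact: Rhausdorff.
Qed.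

Lemma test_bumps (s0 s1 h : R) : 0 < h -> - a < s0 -> s0 <= s1 -> s1 + h < a ->
  test_function1 a (fun s => bump s0 h s - bump s1 h s).
Proof.
move=> h0 as0 s01 s1a; split.
  by apply: smooth1_derive1n => n; apply: ncontB; exact: smooth1_bump.
exists `[s0, s1 + h]%classic.
  split; first exact: segment_compact.
  by move=> s /=; rewrite /sym_interval/= !in_itv/= => /andP[? ?]; rewrite (lt_le_trans as0)// (le_lt_trans _ s1a).
move=> s /=; rewrite in_itv/= => /negP; rewrite negb_and -!ltNge => /orP[h'|h'].
  by rewrite !bump0 ?subrr//; [exact: ltW (lt_le_trans h' s01)|exact: ltW].
rewrite !bump1 ?subrr//; first exact: ltW.
by rewrite (le_trans _ (ltW h'))// lerD2r.
Qed.

Lemma interval_exhaust (s : R) : I s -> exists2 b : R, `|s| < b & b < a.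
Proof.
rewrite /sym_interval/= in_itv/= => hs; have sa : `|s| < a by rewrite ltr_norml.
by exists ((`|s| + a) / 2); rewrite midf_lt.
Qed.

Let small_step (r0 r1 b s0 s1 e : R) : 0 < r0 -> 0 < r1 -> s1 < b -> s0 < s1 -> 0 < e ->
  exists2 h : R, 0 < h & [/\ h < r0, h < r1, s1 + h < b, s0 + h < s1 & h <= e].
Proof.
move=> r00 r10 b1 s01 e0.
exists (Num.min (Num.min r0 r1) (Num.min (Num.min (b - s1) (s1 - s0)) e) / 2).
  by rewrite divr_gt0// !lt_min r00 r10 e0 !subr_gt0 s01 b1.
set m := Num.min _ _; have m0 : 0 < m by rewrite /m !lt_min r00 r10 e0 !subr_gt0 s01 b1.
have : [/\ m <= r0, m <= r1, m <= b - s1, m <= s1 - s0 & m <= e].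
  by rewrite /m !ge_min !lexx !orbT; split.
by move: m0; move: m => m m0 [*]; split; lra.
Qed.

Let step_difference (p q : R) : 0 <= p <= 1 -> 0 <= q <= 1 ->
  [/\ `|p - q| <= 1, `|p - q - 0| <= 1, `|p - 0 - 1| <= 1 & `|1 - q - 0| <= 1].
Proof. by move=> /andP[? ?] /andP[? ?]; split; rewrite ler_norml; lra. Qed.

Let combine (p0 p1 q0 q1 z r M B e : R) : `|p0 - q0| <= M * e -> `|p1 - q1| <= M * e ->
  p0 - p1 = z + r -> `|r| <= 2 * B * e -> `|q0 - q1 - z| <= (2 * M + 2 * B) * e.
Proof. by rewrite !ler_norml => /andP[? ?] /andP[? ?] ? /andP[? ?]; lra. Qed.

(** The weak equation is tested with a smoothed indicator of [s0, s1]. After one integration by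
    parts its derivative acts on the continuous function u' as an approximate delta at s0 minus one
    at s1. *)
Lemma derive_difference u F (s0 s1 : R) :
  (forall s, I s -> derivable u s 1 /\ {for s, continuous (derive1 u)}) ->
  measurable_fun I F ->
  (forall b, b < a -> exists2 B : R, 0 <= B & forall s, `|s| <= b -> `|F s| <= B) ->
  (forall phi, test_function1 a phi ->
    \int[lam]_(s in I) (u s * derive1 (derive1 phi) s) = - \int[lam]_(s in I) (F s * phi s)) ->
  I s0 -> I s1 -> s0 < s1 ->
  derive1 u s0 - derive1 u s1 = \int[lam]_(s in `[s0, s1]) F s.
Proof.
move=> du mF bF weak Is0 Is1 s01.
have [b [b0 b1 ba]] : exists b : R, [/\ `|s0| < b, `|s1| < b & b < a].
  have [b0 ? ?] := interval_exhaust Is0; have [b1 ? ?] := interval_exhaust Is1.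
  by exists (Num.max b0 b1); rewrite !lt_max gt_max; split => //; [apply/orP; left|apply/orP; right|apply/andP].
have [B B0 hB] := bF b ba; have [M M0 hM] := @step_derive_bounded R.
have Ib s : - b <= s <= b -> I s.
  by rewrite /sym_interval/= in_itv/= -ler_norml -ltr_norml => /le_lt_trans; apply.
have cu' s : - b <= s <= b -> {for s, continuous (derive1 u)} by move=> /Ib/du[].
have b'0 : - b < s0 by move: b0; rewrite ltr_norml => /andP[].
have b'1 : s1 < b by move: b1; rewrite ltr_norml => /andP[].
have key (e : R) : 0 < e ->
    `|(derive1 u s0 - derive1 u s1) - \int[lam]_(s in `[s0, s1]) F s| <= (2 * M + 2 * B) * e.
  move=> e0.
  have [r0 r00 hr0] : exists2 r : R, 0 < r & forall s, `|s - s0| < r -> `|derive1 u s - derive1 u s0| <= e.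
    have [_ /cvgrPdist_le/(_ e e0)/nbhs_ballP[r /= rpos hr]] := du _ Is0; exists r => // s hs.
    by rewrite distrC; apply: hr; rewrite /ball/= distrC.
  have [r1 r10 hr1] : exists2 r : R, 0 < r & forall s, `|s - s1| < r -> `|derive1 u s - derive1 u s1| <= e.
    have [_ /cvgrPdist_le/(_ e e0)/nbhs_ballP[r /= rpos hr]] := du _ Is1; exists r => // s hs.
    by rewrite distrC; apply: hr; rewrite /ball/= distrC.
  have [h h0 [hr0' hr1' hb h01 he]] := small_step r00 r10 b'1 s01 e0.
  pose phi s := bump s0 h s - bump s1 h s.
  have tphi : test_function1 a phi.
    by apply: test_bumps => //; [rewrite (lt_trans _ b'0)// ltrN2|exact: ltW|exact: lt_trans hb ba].
  have sphi : smooth1 phi by move=> n; apply: ncontB; exact: smooth1_bump.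
  have dphi : derive1 phi = fun s => derive1 (bump s0 h) s - derive1 (bump s1 h) s.
    apply/funext => s; have [_ E] := is_deriveB (smooth1_is_derive s (smooth1_bump s0 h)) (smooth1_is_derive s (smooth1_bump s1 h)).
    by rewrite derive1E; exact: E.
  have sphi' := smooth1_derive1 sphi; have sphi'' := smooth1_derive1 sphi'.
  have z0 s : (s < s0) || (s1 + h < s) -> phi s = 0.
    rewrite /phi => /orP[hs|hs]; first by rewrite !bump0 ?subrr// ltW// (lt_trans hs).
    by rewrite !bump1 ?subrr ?(ltW hs)//; rewrite (le_trans _ (ltW hs))// lerD2r ltW.
  have oV : open [set s : R | (s < s0) || (s1 + h < s)].
    rewrite (_ : [set s : R | _] = `]-oo, s0[%classic `|` `]s1 + h, +oo[%classic).
      by apply: openU; [exact: lray_open|exact: rray_open].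
    by apply/seteqP; split => s /=; rewrite !in_itv/= andbT => /orP.
  have z1 := derive1_zero_on oV z0; have z2 := derive1_zero_on oV z1.
  have out s : ~ (- b <= s <= b) -> (s < s0) || (s1 + h < s).
    move=> /negP; rewrite negb_and -!ltNge => /orP[hs|hs]; first by rewrite (lt_trans hs b'0).
    by rewrite (lt_trans hb hs) orbT.
  have sI : `[- b, b]%classic `<=` I by move=> s /=; rewrite in_itv/=; exact: Ib.
  have bb : - b < b by exact: lt_trans b'0 (lt_trans s01 b'1).
  have := weak _ tphi.
  rewrite (@Rintegral_subset _ _ _ lam _ _ _ sI); last first.
    by move=> s _ /=; rewrite in_itv/= => /out hs; rewrite (z2 _ hs) mulr0.
  rewrite (@Rintegral_subset _ _ _ lam _ _ _ sI); last first.
    by move=> s _ /=; rewrite in_itv/= => /out hs; rewrite (z0 _ hs) mulr0.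
  have cu s : - b <= s <= b -> {for s, continuous u}.
    by move=> /Ib/du[] h' _; apply: differentiable_continuous; apply/derivable1_diffP.
  have parts : \int[lam]_(s in `[- b, b]) (u s * derive1 (derive1 phi) s + derive1 phi s * derive1 u s) = 0.
    have dd s : - b <= s <= b -> is_derive s 1 (fun s => u s * derive1 phi s)
        (u s * derive1 (derive1 phi) s + derive1 phi s * derive1 u s).
      move=> hs; apply: (@is_deriveM _ _ u (derive1 phi)); last exact: smooth1_is_derive.
      by have [h' _] := du s (Ib s hs); rewrite derive1E; exact: DeriveDef.
    rewrite /Rintegral (ftc_segment bb dd); last first.
      move=> s hs; apply: cvgD; apply: cvgM; [exact: cu|exact: smooth1_cont|exact: smooth1_cont|exact: cu'].
    rewrite (z1 b) /= ?hb ?orbT// (z1 (- b)) /= ?b'0//.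
    by rewrite !mulr0 subrr.
  move: parts; rewrite RintegralD//; first last.
  - by apply: segment_integrable => s hs; apply: cvgM; [exact: smooth1_cont|exact: cu'].
  - by apply: segment_integrable => s hs; apply: cvgM; [exact: cu|exact: smooth1_cont].
  move=> /eqP; rewrite addrC addr_eq0 => /eqP parts W; move: parts; rewrite {}W opprK.
  have A0 := bump_identity h0 (ltW b'0) (le_trans (ltW h01) (ltW b'1)) hM cu'
    (fun s hs => hr0 s ltac:(move: hs => /andP[? ?]; rewrite ltr_norml; lra)).
  have A1 := bump_identity h0 (ltW (lt_trans b'0 s01)) (ltW hb) hM cu'
    (fun s hs => hr1 s ltac:(move: hs => /andP[? ?]; rewrite ltr_norml; lra)).
  rewrite dphi.
  have -> : \int[lam]_(s in `[- b, b]) ((derive1 (bump s0 h) s - derive1 (bump s1 h) s) * derive1 u s) =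
     \int[lam]_(s in `[- b, b]) (derive1 u s * derive1 (bump s0 h) s) -
     \int[lam]_(s in `[- b, b]) (derive1 u s * derive1 (bump s1 h) s).
    rewrite -RintegralB//.
    - by apply: eq_Rintegral => s _; rewrite mulrBl; congr (_ - _); exact: mulrC.
    - by apply: segment_integrable => s hs; apply: cvgM; [exact: cu'|exact: smooth1_cont (smooth1_derive1 (smooth1_bump _ _)) _].
    - by apply: segment_integrable => s hs; apply: cvgM; [exact: cu'|exact: smooth1_cont (smooth1_derive1 (smooth1_bump _ _)) _].
  have mFb (p q : R) : - b <= p -> q <= b -> measurable_fun `[p, q] F.
    move=> bp qb; apply: (measurable_funS _ _ mF); first exact: measurable_itv.
    by move=> s /=; rewrite in_itv/= => /andP[? ?]; apply: Ib; rewrite (le_trans bp)// (le_trans _ qb).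
  have FB s : - b <= s <= b -> `|F s| <= B by rewrite -ler_norml; exact: hB.
  (* The smoothed and the sharp indicator differ only on two intervals of length h, and by at most 1
     there; hence the error 2 B h. *)
  pose r s := F s * phi s - F s * (\1_(`[s0, s1]%classic) s : R).
  have mphi : measurable_fun `[- b, b] phi.
    by apply: measurable_funTS; apply: continuous_measurable_fun; exact: smooth1_cont.
  have m1 : measurable_fun `[- b, b] (\1_(`[s0, s1]%classic) : R -> R).
    by apply: measurable_funTS; apply: measurable_indic; exact: measurable_itv.
  have phi1 s : `|phi s| <= 1.
    by have [] := step_difference (step_01 ((s - s0) / h)) (step_01 ((s - s1) / h)).
  have pb (p q : R) : `|p| <= B -> `|q| <= 1 -> `|p * q| <= B.
    by move=> hp hq; rewrite normrM -[leRHS]mulr1 ler_pM.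
  have i1 (A : set R) s : `|\1_A s : R| <= 1.
    by rewrite indicE; case: (_ \in _); rewrite ?normr1 ?normr0.
  have iF1 : rint lam `[- b, b] (fun s => F s * phi s).
    apply: (@rint_segment _ _ _ _ B); first by apply: measurable_funM => //; exact: mFb.
    by move=> s hs; apply: pb; [exact: FB|exact: phi1].
  have iF2 : rint lam `[- b, b] (fun s => F s * (\1_(`[s0, s1]%classic) s : R)).
    apply: (@rint_segment _ _ _ _ B); first by apply: measurable_funM => //; exact: mFb.
    by move=> s hs; apply: pb; [exact: FB|exact: i1].
  have E1 : \int[lam]_(s in `[s0, s1]) F s = \int[lam]_(s in `[- b, b]) (F s * (\1_(`[s0, s1]%classic) s : R)).
    rewrite [RHS](@Rintegral_subset _ _ _ lam `[s0, s1]%classic); first last.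
    - by move=> s _ ns; rewrite indicE memNset// mulr0.
    - by move=> s /=; rewrite !in_itv/= => /andP[? ?]; rewrite (le_trans (ltW b'0))// (le_trans _ (ltW b'1)).
    by apply: eq_Rintegral => s hs; rewrite indicE hs mulr1.
  have bnd : `|\int[lam]_(s in `[- b, b]) r s| <= 2 * B * h.
    have mr : measurable_fun `[- b, b] r by apply: measurable_funB; apply: (@rint_measurable _ _ _ lam).
    have rB s : - b <= s <= b -> `|r s| <= B.
      move=> hs; rewrite /r -mulrBr; apply: pb; first exact: FB.
      have [q1 q2 q3 q4] := step_difference (step_01 ((s - s0) / h)) (step_01 ((s - s1) / h)).
      rewrite indicE mem_setE in_itv/=; case: (boolP (s0 <= s)) => hs0 /=; last first.
        by rewrite z0 ?ltNge ?hs0// subr0 normr0.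
      case: (boolP (s <= s1)) => hs1 /=; rewrite /phi; first by rewrite (bump0 h0 hs1).
      rewrite -ltNge in hs1; rewrite (bump1 h0 (_ : s0 + h <= s))//.
      by rewrite ltW// (lt_trans h01).
    have rz s : ~ (s0 <= s <= s0 + h) -> ~ (s1 <= s <= s1 + h) -> r s = 0.
      move=> n0 n1; rewrite /r -mulrBr indicE mem_setE in_itv/=; apply/eqP; rewrite mulf_eq0; apply/orP; right.
      have [hs|hs] := ltP s s0; first by rewrite z0 ?hs// subrr.
      have hs' : s0 + h < s by rewrite ltNge; apply/negP => ?; apply: n0; rewrite hs.
      have [hs1|hs1] := leP s1 s.
        have hs2 : s1 + h < s by rewrite ltNge; apply/negP => ?; apply: n1; rewrite hs1.
        by rewrite z0 ?hs2 ?orbT// leNgt (lt_trans _ hs2) ?ltrDl// subrr.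
      by rewrite (ltW hs1) /phi (bump1 h0 (ltW hs')) (bump0 h0 (ltW hs1)) subr0 subrr.
    pose A c := `[c, c + h]%classic.
    have hA (c : R) : - b <= c -> c + h <= b -> `|\int[lam]_(s in `[- b, b]) (r s * (\1_(A c) s : R))| <= B * h.
      move=> bc cb; rewrite (@Rintegral_subset _ _ _ lam (A c)); first last.
      - by move=> s _ ns; rewrite indicE memNset// mulr0.
      - by move=> s /=; rewrite !in_itv/= => /andP[? ?]; rewrite (le_trans bc)// (le_trans _ cb).
      have -> : B * h = B * (c + h - c) by rewrite addrAC subrr add0r.
      apply: Rintegral_segment_le.
      - by rewrite lerDl ltW.
      - apply: measurable_funM; first apply: (measurable_funS _ _ mr) => //.
          by move=> s /=; rewrite !in_itv/= => /andP[? ?]; rewrite (le_trans bc)// (le_trans _ cb).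
        by apply: measurable_funTS; apply: measurable_indic; exact: measurable_itv.
      - move=> s /andP[? ?]; apply: pb; [apply: rB|exact: i1].
        by rewrite (le_trans bc)// (le_trans _ cb).
    have irA (c : R) : rint lam `[- b, b] (fun s => r s * (\1_(A c) s : R)).
      apply: (@rint_segment _ _ _ _ B).
        apply: measurable_funM => //; apply: measurable_funTS; apply: measurable_indic; exact: measurable_itv.
      by move=> s hs; apply: pb; [exact: rB|exact: i1].
    have -> : \int[lam]_(s in `[- b, b]) r s =
        \int[lam]_(s in `[- b, b]) (r s * (\1_(A s0) s : R)) + \int[lam]_(s in `[- b, b]) (r s * (\1_(A s1) s : R)).
      rewrite -RintegralD//; [|exact: irA|exact: irA]; apply: eq_Rintegral => s _; rewrite -mulrDr !indicE /A !mem_setE !in_itv/=.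
      case: (boolP (s0 <= s <= s0 + h)) => c0; case: (boolP (s1 <= s <= s1 + h)) => c1.
      - by move: c0 c1 => /andP[_ p1] /andP[p2 _]; have := le_lt_trans (le_trans p2 p1) h01; rewrite ltxx.
      - by rewrite addr0 mulr1.
      - by rewrite add0r mulr1.
      - by rewrite rz ?mul0r//; apply/negP.
    have H0 := hA s0 (ltW b'0) (le_trans (ltW h01) (ltW b'1)).
    have H1 := hA s1 (ltW (lt_trans b'0 s01)) (ltW hb).
    apply: le_trans (ler_normD _ _) _; apply: le_trans (lerD H0 H1) _.
    by rewrite -mulrA mulrC [2 * _]mulrC mulrDr mulr1 mulrC.
  have -> : \int[lam]_(s in `[- b, b]) (F s * phi s) = \int[lam]_(s in `[s0, s1]) F s + \int[lam]_(s in `[- b, b]) r s.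
    by rewrite E1 /r RintegralB// addrC subrK.
  have he' : 2 * B * h <= 2 * B * e by rewrite ler_wpM2l// mulr_ge0.
  by move=> parts; exact: combine A0 A1 parts (le_trans bnd he').
apply/eqP; rewrite -subr_eq0 -normr_le0; apply/ler_addgt0Pr => e e0; rewrite add0r.
have N0 : 0 < 2 * M + 2 * B by rewrite ltr_wpDr ?mulr_ge0// mulr_gt0.
by apply: le_trans (key (e / (2 * M + 2 * B)) _) _; rewrite ?divr_gt0// mulrC divfK ?gt_eqF.
Qed.

End jacobi_equation.

(** * Signed primitives and their joint measurability *)

Section primitive_integrals.
Context {R : realType}.
Local Notation lam := (@lebesgue_measure R).
Implicit Types (F G : R -> R).

Lemma RintegralN d (T : measurableType d) (mu : {measure set T -> \bar R}) (D : set T) (g : T -> R) :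
  \int[mu]_(x in D) (- g x) = - \int[mu]_(x in D) g x.
Proof.
rewrite /Rintegral integralE [in RHS]integralE.
have -> : (\int[mu]_(x in D) (fun x => (- g x)%:E)^\+ x = \int[mu]_(x in D) (fun x => (g x)%:E)^\- x)%E.
  by apply: eq_integral => x _; rewrite funeposE funenegE.
have -> : (\int[mu]_(x in D) (fun x => (- g x)%:E)^\- x = \int[mu]_(x in D) (fun x => (g x)%:E)^\+ x)%E.
  by apply: eq_integral => x _; rewrite funeposE funenegE/= opprK.
by case: (integral _ _ _) => [p| |]; case: (integral _ _ _) => [r| |] //=; rewrite ?oppr0 ?opprB.
Qed.

(** The oriented integral from 0 to s: for s of either sign one of the two segments is empty. *)
Definition prim F (s : R) : R := \int[lam]_(r in `[0, s]) F r - \int[lam]_(r in `[s, 0]) F r.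

Let empty_segment (p q : R) F : q < p -> \int[lam]_(r in `[p, q]) F r = 0.
Proof.
by move=> qp; rewrite (_ : `[p, q]%classic = set0) ?Rintegral_set0// set_itv_ge// bnd_simp -ltNge.
Qed.

Lemma prim_pos F s : 0 < s -> prim F s = \int[lam]_(r in `[0, s]) F r.
Proof. by move=> s0; rewrite /prim [X in _ - X]empty_segment ?subr0. Qed.

Lemma prim_neg F s : s < 0 -> prim F s = - \int[lam]_(r in `[s, 0]) F r.
Proof. by move=> s0; rewrite /prim [X in X - _]empty_segment ?sub0r. Qed.

Lemma prim0 F : prim F 0 = 0. Proof. exact: subrr. Qed.

Lemma eq_prim F G s : (forall r, `|r| <= `|s| -> F r = G r) -> prim F s = prim G s.
Proof.
move=> FG; congr (_ - _); apply: eq_Rintegral => r; rewrite inE/= in_itv/= => /andP[r0 r1]; apply: FG.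
  by rewrite !ger0_norm// (le_trans r0).
by rewrite !ler0_norm ?lerN2// (le_trans r0).
Qed.

Lemma primN F s : prim (fun r => - F r) s = - prim F s.
Proof. by rewrite /prim !RintegralN opprB opprK addrC. Qed.

Lemma prim_le F (B s : R) : measurable_fun `[- `|s|, `|s|] F -> (forall r, `|r| <= `|s| -> `|F r| <= B) ->
  `|prim F s| <= B * `|s|.
Proof.
move=> mF FB; have [s0|s0|->] := ltgtP s 0; last by rewrite prim0 normr0 mulr0.
  rewrite prim_neg// normrN (ltr0_norm s0) -(sub0r s); apply: Rintegral_segment_le; first exact: ltW.
    apply: (measurable_funS _ _ mF) => // r /=; rewrite !in_itv/= (ltr0_norm s0) opprK => /andP[-> r0].
    by rewrite (le_trans r0)// oppr_ge0 ltW.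
  by move=> r /andP[sr r0]; apply: FB; rewrite !ler0_norm ?lerN2// ltW.
rewrite prim_pos// (gtr0_norm s0) -[in leRHS](subr0 s); apply: Rintegral_segment_le; first exact: ltW.
  apply: (measurable_funS _ _ mF) => // r /=; rewrite !in_itv/= (gtr0_norm s0) => /andP[r0 ->].
  by rewrite (le_trans _ r0)// oppr_le0 ltW.
by move=> r /andP[r0 sr]; apply: FB; rewrite !ger0_norm// ltW.
Qed.

Lemma primB F G (B s : R) : measurable_fun `[- `|s|, `|s|] F -> measurable_fun `[- `|s|, `|s|] G ->
  (forall r, `|r| <= `|s| -> `|F r| <= B) -> (forall r, `|r| <= `|s| -> `|G r| <= B) ->
  prim (fun r => F r - G r) s = prim F s - prim G s.
Proof.
move=> mF mG FB GB.
have sub (p q : R) : - `|s| <= p -> q <= `|s| -> `[p, q]%classic `<=` `[- `|s|, `|s|]%classic.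
  by move=> h1 h2 r /=; rewrite !in_itv/= => /andP[h3 h4]; rewrite (le_trans h1)// (le_trans h4).
have i (H : R -> R) (p q : R) : - `|s| <= p -> q <= `|s| -> measurable_fun `[- `|s|, `|s|] H ->
    (forall r, `|r| <= `|s| -> `|H r| <= B) -> rint lam `[p, q] H.
  move=> h1 h2 mH HB; apply: (@rint_segment _ _ _ _ B); first exact: (measurable_funS _ (sub _ _ h1 h2) mH).
  by move=> r /andP[? ?]; apply: HB; rewrite ler_norml (le_trans h1)// (le_trans _ h2).
have s1 : s <= `|s| := ler_norm s.
have s2 : - `|s| <= s by rewrite lerNl -normrN ler_norm.
have s3 : - `|s| <= 0 by rewrite oppr_le0.
rewrite /prim !RintegralB//; do ?[exact: i]; first by rewrite !opprB; ring.
Qed.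

(** The moving endpoints are absorbed into the integrand, which is 0 outside the segment. Tonelli is
    then applied to the positive and negative parts separately, since [F] is only assumed
    measurable. *)
Lemma measurable_segment_integral (F p q : plane R -> R) : measurable_fun setT F ->
  measurable_fun setT p -> measurable_fun setT q ->
  measurable_fun setT (fun x : plane R => \int[lam]_(r in `[p x, q x]) F (x.1, r)).
Proof.
move=> mF mp mq.
pose G (z : plane R * measurableTypeR R) : \bar R :=
  (if (p z.1 <= z.2) && (z.2 <= q z.1) then F (z.1.1, z.2) else 0)%:E.
have m1 : measurable_fun setT (fun z : plane R * measurableTypeR R => z.1) by exact: measurable_fst.
have m2 : measurable_fun setT (fun z : plane R * measurableTypeR R => z.2 : R) by exact: measurable_snd.
have m11 : measurable_fun setT (fun z : plane R * measurableTypeR R => z.1.1).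
  by apply: (measurableT_comp (f := fst)) => //; exact: measurable_fst.
have mG : measurable_fun setT G.
  apply/measurable_EFinP; apply: measurable_fun_ifT; last exact: measurable_cst.
    apply: measurable_and; apply: measurable_fun_ler => //.
      by apply: (measurableT_comp mp).
    by apply: (measurableT_comp mq).
  apply: (measurableT_comp mF); exact: measurable_fun_pair.
have E (x : plane R) : \int[lam]_(r in `[p x, q x]) F (x.1, r) =
   fine (fubini_F lam (G^\+)%E x - fubini_F lam (G^\-)%E x)%E.
  transitivity (fine (\int[lam]_r G (x, r))%E).
    congr fine; rewrite integral_mkcond; apply: eq_integral => r _.
    by rewrite /patch /G/= mem_setE in_itv/=; case: ifP.
  rewrite integralE /fubini_F; congr (fine (_ - _)%E); apply: eq_integral => r _.
    by rewrite !funeposE.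
  by rewrite !funenegE.
under eq_fun do rewrite E.
apply: (measurableT_comp (@fine_measurable R setT measurableT)).
apply: emeasurable_funB; apply: measurable_fun_fubini_tonelli_F.
- exact: measurable_funepos.
- by move=> z; exact: funepos_ge0.
- exact: measurable_funeneg.
- by move=> z; exact: funeneg_ge0.
Qed.

Lemma measurable_prim (F : plane R -> R) : measurable_fun setT F ->
  measurable_fun setT (fun x : plane R => prim (fun r => F (x.1, r)) x.2).
Proof.
move=> mF; have m2 : measurable_fun setT (fun x : plane R => x.2 : R) by exact: measurable_snd.
apply: measurable_funB; apply: measurable_segment_integral => //; exact: measurable_cst.
Qed.

End primitive_integrals.

(** * Bounds and joint measurability of the Jacobi solutions *)

Section jacobi_bounds.
Context {R : realType} (a q : R).
Hypothesis a0 : 0 < a.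
Local Notation lam := (@lebesgue_measure R).
Local Notation I := (sym_interval a).
Implicit Types (k u : R -> R).

Let segI (s : R) : I s -> `[- `|s|, `|s|]%classic `<=` I.
Proof.
rewrite /sym_interval/= in_itv/= => hs r /=; rewrite !in_itv/= -!ltr_norml -ler_norml.
by move=> /le_lt_trans; apply; rewrite ltr_norml.
Qed.

Let inI (s r : R) : I s -> `|r| <= `|s| -> I r.
Proof. by move=> Is hr; apply: (segI Is); rewrite /= in_itv/= -ler_norml. Qed.

Let I0 : I 0. Proof. by rewrite /sym_interval/= in_itv/= oppr_lt0 a0. Qed.

Let Ia (s : R) : I s -> `|s| < a.
Proof. by rewrite /sym_interval/= in_itv/= -ltr_norml. Qed.

Section one_equation.
Variables (k u : R -> R) (kappa : R).
Hypotheses (mk : measurable_fun I k) (k_le : forall s, I s -> `|k s| <= kappa).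
Hypothesis (kappa0 : 0 <= kappa) (small : kappa * a ^+ 2 <= q) (q2 : q < 1 / 2).
Hypothesis hu : jacobi_solution a k u.

Lemma jacobi_cont s : I s -> {for s, continuous u}.
Proof.
have [_ [du _]] := hu; move=> /du[h _].
by apply: differentiable_continuous; apply/derivable1_diffP.
Qed.

Lemma jacobi_measurable : measurable_fun I u.
Proof.
apply: open_continuous_measurable_fun; first exact: itv_open.
by move=> s /set_mem; exact: jacobi_cont.
Qed.

Let bounded_on (s : R) : I s -> exists2 B : R, 0 <= B & forall r, `|r| <= `|s| -> `|u r| <= B.
Proof.
move=> Is; have ss : - `|s| <= `|s| by rewrite (le_trans _ (normr_ge0 s))// oppr_le0.
have [B B0 hB] : exists2 B : R, 0 <= B & forall r, - `|s| <= r <= `|s| -> `|u r| <= B.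
  apply: segment_bounded => // r hr; apply: jacobi_cont; apply: (inI Is).
  by rewrite ler_norml.
by exists B => // r hr; apply: hB; rewrite -ler_norml.
Qed.

(** The two weak derivatives combine into one identity tested with phi'', in which g2 = - k u almost
    everywhere. [derive_difference] between 0 and s and u'(0) = 0 give the formula. *)
Lemma jacobi_derive s : I s -> derive1 u s = - prim (fun r => k r * u r) s.
Proof.
have [[g1 [g2 [[hL hL1 hL2 w1 w2] E]]] [du [u0 u'0]]] := hu.
have mku : measurable_fun I (fun r => k r * u r) by apply: measurable_funM => //; exact: jacobi_measurable.
have weak phi : test_function1 a phi ->
    \int[lam]_(s in I) (u s * derive1 (derive1 phi) s) = - \int[lam]_(s in I) (k s * u s * phi s).
  move=> t; rewrite w1; last exact: test_function1_derive.
  rewrite w2// opprK.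
  have mphi : measurable_fun I phi.
    apply: measurable_funTS; apply: continuous_measurable_fun => r.
    by have [h _] := t; have := h 0%N r => /= h'; apply: differentiable_continuous; apply/derivable1_diffP.
  have mg2 : measurable_fun I g2 by case: hL2.
  rewrite -RintegralN.
  congr fine; apply: ae_eq_integral => //.
  - exact: measurable_itv.
  - by apply/measurable_EFinP; apply: measurable_funM.
  - apply/measurable_EFinP; apply: measurableT_comp => //; exact: measurable_funM.
  - move: E; apply: (@filterS _ _ (ae_filter_ringOfSetsType lam)) => r /= h Ir; have {}h := h Ir; congr EFin.
    by rewrite -mulNr; congr (_ * _); apply/eqP; rewrite -addr_eq0; apply/eqP.
have bF b : b < a -> exists2 B : R, 0 <= B & forall s, `|s| <= b -> `|k s * u s| <= B.
  move=> ba; have [b0|b0] := ltP b 0.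
    by exists 0 => // r hr; have := le_lt_trans (normr_ge0 r) (le_lt_trans hr b0); rewrite ltxx.
  have Ib : I b by rewrite /sym_interval/= in_itv/= ba andbT (lt_le_trans _ b0)// oppr_lt0.
  have [B B0 hB] := bounded_on Ib; exists (kappa * B); first exact: mulr_ge0.
  move=> r hr; rewrite normrM ler_pM//.
    by apply: k_le; apply: (inI Ib); rewrite (ger0_norm b0).
  by apply: hB; rewrite (ger0_norm b0).
have D := derive_difference du mku bF weak.
move=> Is; have [s0|s0|->] := ltgtP s 0; last by rewrite prim0 oppr0.
  by have := D _ _ Is I0 s0; rewrite u'0 subr0 => ->; rewrite prim_neg// opprK.
by have := D _ _ I0 Is s0; rewrite u'0 sub0r prim_pos// => <-; rewrite opprK.
Qed.

Lemma jacobi_primitive s : I s -> u s = 1 + prim (derive1 u) s.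
Proof.
have [_ [du [u0 _]]] := hu => Is.
have F (p r : R) : p < r -> I p -> I r -> \int[lam]_(t in `[p, r]) derive1 u t = u r - u p.
  move=> pr Ip Ir; have sub t : p <= t <= r -> I t.
    move: Ip Ir; rewrite /sym_interval/= !in_itv/= => /andP[ap _] /andP[_ ra] /andP[pt tr].
    by rewrite (lt_le_trans ap pt) (le_lt_trans tr ra).
  have d1 t : p <= t <= r -> is_derive t 1 u (derive1 u t).
    by move=> /sub /du[h _]; rewrite derive1E; exact: DeriveDef.
  have d2 t : p <= t <= r -> {for t, continuous (derive1 u)} by move=> /sub /du[].
  by rewrite /Rintegral (ftc_segment pr d1 d2).
have [s0|s0|->] := ltgtP s 0; last by rewrite prim0 u0 addr0.
  by rewrite prim_neg// F// u0 opprB addrC subrK.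
by rewrite prim_pos// F// u0 addrC subrK.
Qed.

Lemma jacobi_integral s : I s -> u s = 1 - prim (prim (fun r => k r * u r)) s.
Proof.
move=> Is; rewrite jacobi_primitive// (@eq_prim _ _ (fun r => - prim (fun r => k r * u r) r)); last first.
  by move=> r hr; apply: jacobi_derive; exact: inI hr.
by rewrite primN.
Qed.

Lemma jacobi_iterate (B s : R) : 0 <= B -> I s -> (forall r, `|r| <= `|s| -> `|u r| <= B) ->
  `|u s - 1| <= q * B.
Proof.
move=> B0 Is hB; rewrite (jacobi_primitive Is) addrAC subrr add0r.
have md : measurable_fun I (derive1 u).
  have [_ [du _]] := hu; apply: open_continuous_measurable_fun; first exact: itv_open.
  by move=> r /set_mem /du[].
have d_le r : `|r| <= `|s| -> `|derive1 u r| <= kappa * B * a.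
  move=> hr; have Ir := inI Is hr; rewrite jacobi_derive// normrN.
  apply: (@le_trans _ _ (kappa * B * `|r|)); last first.
    by rewrite ler_wpM2l ?mulr_ge0// ltW// Ia.
  have mku : measurable_fun I (fun r => k r * u r) by apply: measurable_funM => //; exact: jacobi_measurable.
  apply: prim_le; first by apply: (measurable_funS _ (segI Ir) mku); exact: measurable_itv.
  move=> t ht; rewrite normrM ler_pM//; first by apply: k_le; exact: inI ht.
  by apply: hB; exact: le_trans hr.
have := prim_le (measurable_funS _ (segI Is) md) d_le.
move=> /(_ (measurable_itv _))/le_trans; apply.
apply: (@le_trans _ _ (kappa * B * a * a)); first by rewrite ler_wpM2l ?(ltW (Ia Is))// mulr_ge0 ?(ltW a0)// mulr_ge0.
have -> : kappa * B * a * a = kappa * a ^+ 2 * B by ring.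
exact: ler_wpM2r.
Qed.

(** At a maximum point m of |u| on [-|s|, |s|] one iteration gives |u m| <= 1 + q |u m| with q <
    1/2, hence |u| <= 2; a second iteration with B = 2 bounds |u - 1| by 2 q < 1. *)
Lemma jacobi_bounds s : I s -> `|u s| <= 2 /\ `|u s - 1| <= 2 * q.
Proof.
move=> Is; have q0 : 0 <= q by apply: le_trans small; rewrite mulr_ge0// sqr_ge0.
suff H : forall r, I r -> `|u r| <= 2.
  split; first exact: H.
  by have := jacobi_iterate (ler0n _ 2) Is (fun r hr => H r (inI Is hr)); rewrite mulrC.
move=> {}s {}Is.
have ss : - `|s| <= `|s| by rewrite (le_trans _ (normr_ge0 s))// oppr_le0.
have c : {within `[- `|s|, `|s|], continuous (fun s => `|u s|)}.
  apply: continuous_in_subspaceT => r; rewrite inE => hr.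
  by apply: (@continuous_comp _ _ _ u Num.norm); [apply: jacobi_cont; exact: (segI Is)|exact: norm_continuous].
have [m hm max] := EVT_max ss c.
have hm' : `|m| <= `|s| by move: hm; rewrite in_itv/= -ler_norml.
have Im := inI Is hm'.
have umax r : `|r| <= `|s| -> `|u r| <= `|u m| by move=> hr; apply: max; rewrite in_itv/= -ler_norml.
have := jacobi_iterate (normr_ge0 _) Im (fun r hr => umax r (le_trans hr hm')).
have := ler_normD (u m - 1) 1; rewrite subrK normr1 => h1 h2.
have h3 : q * `|u m| <= 2^-1 * `|u m| by rewrite ler_wpM2r// ltW// -[2^-1]mul1r.
by apply: le_trans (umax s (lexx _)) _; move: h1 h2 h3; move: `|u m| `|u m - 1| (q * _) => x y z; lra.
Qed.

End one_equation.

Section family.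
Variables (K f : plane R -> R) (kappa : R).
Hypotheses (mK : measurable_fun (strip a) K) (K_le : forall x, strip a x -> `|K x| <= kappa).
Hypothesis (kappa0 : 0 <= kappa) (small : kappa * a ^+ 2 <= q) (q2 : q < 1 / 2).
Hypothesis hf : forall x1 : R, jacobi_solution a (fun s => K (x1, s)) (fun s => f (x1, s)).

Let D := strip a.
Let K0 := patch (cst 0) D K.

Let DI (x1 s : R) : D (x1, s) <-> I s.
Proof. by rewrite /D /strip /sym_interval/= in_itv. Qed.

Let mK0 : measurable_fun setT K0.
Proof. 
rewrite (_ : K0 = K \_ D); first by apply/(measurable_restrictT _ _).1; [exact: strip_measurable|exact: mK].
by apply/funext => x; rewrite /K0 /patch.
Qed.

Let slice_measurable (g : plane R -> R) (x1 : R) : measurable_fun setT g ->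
  measurable_fun setT (fun s : R => g (x1, s)).
Proof. by move=> mg; apply: (measurableT_comp mg); exact: pair1_measurable. Qed.

Let K0E (x1 s : R) : I s -> K0 (x1, s) = K (x1, s).
Proof. by move=> /(DI x1) h; rewrite /K0 patchT// inE. Qed.

Let mk (x1 : R) : measurable_fun I (fun s => K (x1, s)).
Proof.
apply: (eq_measurable_fun (fun s => K0 (x1, s))); first by move=> s /set_mem h; rewrite K0E.
by apply: measurable_funTS; exact: (slice_measurable x1 mK0).
Qed.

Let k_le (x1 s : R) : I s -> `|K (x1, s)| <= kappa.
Proof. by move=> Is; have := K_le ((DI x1 s).2 Is). Qed.

Let q0 : 0 <= q. Proof. by apply: le_trans small; rewrite mulr_ge0// sqr_ge0. Qed.

Lemma family_bounds x : D x -> `|f x| <= 2 /\ `|f x - 1| <= 2 * q.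
Proof.
case: x => x1 s /DI Is.
exact: (jacobi_bounds (mk x1) (k_le x1) kappa0 small q2 (hf x1) Is).
Qed.

(** [f] is known only slice by slice. These iterates are jointly measurable, because [K0], the
    extension of K by 0, is so on the whole plane; they converge to [f] at every point of the strip,
    which makes [f] measurable. *)
Fixpoint picard (n : nat) : plane R -> R :=
  if n is m.+1 then fun x => 1 - prim (fun r => prim (fun t => K0 (x.1, t) * picard m (x.1, t)) r) x.2
  else cst 1.

Let picard_measurable n : measurable_fun setT (picard n).
Proof.
elim: n => [|n IH]; first exact: measurable_cst.
apply: measurable_funB; first exact: measurable_cst.
have m1 : measurable_fun setT (fun x => K0 x * picard n x) by exact: measurable_funM.
exact: measurable_prim (measurable_prim m1).
Qed.

(** Two integrations over lengths below [a] and the factor kappa contract the error by kappa a^2 <=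
    q at each step; the initial error |1 - f| <= 2 q is below 2. *)
Let picard_close n x : D x -> `|picard n x - f x| <= 2 * q ^+ n.
Proof.
elim: n x => [|n IH] [x1 s] Dx.
  have [_ h] := family_bounds Dx; rewrite expr0 mulr1 distrC (le_trans h)//.
  by move: q2; move: (q) => p; lra.
have Is := (DI x1 s).1 Dx.
have mf : measurable_fun I (fun t => f (x1, t)) := jacobi_measurable (hf x1).
have mp : measurable_fun I (fun t => picard n (x1, t)).
  by apply: measurable_funTS; exact: slice_measurable.
pose F t := K (x1, t) * f (x1, t); pose G t := K (x1, t) * picard n (x1, t).
have mF : measurable_fun I F by exact: measurable_funM (mk x1) mf.
have mG : measurable_fun I G by exact: measurable_funM (mk x1) mp.
have qn0 : 0 <= q ^+ n by rewrite exprn_ge0.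
have mS (H : R -> R) r : measurable_fun I H -> I r -> measurable_fun `[- `|r|, `|r|] H.
  by move=> mH Ir; apply: (measurable_funS _ (segI Ir) mH); exact: measurable_itv.
have FG t : I t -> `|G t - F t| <= kappa * (2 * q ^+ n).
  by move=> It; rewrite -mulrBr normrM ler_pM// ?k_le//; apply: IH; apply/DI.
pose B := kappa * 2 + kappa * (2 * q ^+ n).
have FB t : I t -> `|F t| <= B.
  move=> It; rewrite (le_trans (_ : _ <= kappa * 2))//; last by rewrite lerDl !mulr_ge0.
  by rewrite normrM ler_pM ?k_le//; have [] := family_bounds ((DI x1 t).2 It).
have GB t : I t -> `|G t| <= B.
  move=> It; rewrite -(subrK (F t) (G t)) (le_trans (ler_normD _ _))// addrC lerD ?FG//.
  by rewrite normrM ler_pM ?k_le//; have [] := family_bounds ((DI x1 t).2 It).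
have primF r : I r -> `|prim G r - prim F r| <= kappa * (2 * q ^+ n) * a.
  move=> Ir; rewrite -(@primB _ _ _ B); first last.
  - by move=> t ht; apply: FB; exact: inI ht.
  - by move=> t ht; apply: GB; exact: inI ht.
  - exact: mS.
  - exact: mS.
  apply: le_trans (prim_le (B := kappa * (2 * q ^+ n)) _ _) _.
  - by apply: mS => //; exact: measurable_funB.
  - by move=> t ht; apply: FG; exact: inI ht.
  - by rewrite ler_wpM2l ?mulr_ge0// ltW// Ia.
have mpF : measurable_fun I (prim F).
  apply: (eq_measurable_fun (fun r => - derive1 (fun s => f (x1, s)) r)).
    move=> r /set_mem Ir.
    by rewrite (jacobi_derive (mk x1) (k_le x1) kappa0 (hf x1) Ir) opprK.
  apply: measurableT_comp => //; apply: open_continuous_measurable_fun; first exact: itv_open.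
  by move=> r /set_mem Ir; have [_ [du _]] := hf x1; have [] := du r Ir.
have mpG : measurable_fun I (prim G).
  apply: (eq_measurable_fun (fun r => prim (fun t => K0 (x1, t) * picard n (x1, t)) r)).
    by move=> r /set_mem Ir; apply: eq_prim => t ht; rewrite K0E//; exact: inI ht.
  apply: measurable_funTS.
  exact: (slice_measurable x1 (measurable_prim (measurable_funM mK0 (picard_measurable n)))).
have B2 r : I r -> `|prim F r| <= B * a /\ `|prim G r| <= B * a.
  move=> Ir; have B0 : 0 <= B by rewrite addr_ge0// !mulr_ge0.
  have h (H : R -> R) : measurable_fun I H -> (forall t, I t -> `|H t| <= B) -> `|prim H r| <= B * a.
    move=> mH HB; apply: le_trans (prim_le (B := B) _ _) _; first exact: mS.
      by move=> t ht; apply: HB; exact: inI ht.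
    by rewrite ler_wpM2l// ltW// Ia.
  by split; exact: h.
rewrite /= (jacobi_integral (mk x1) (k_le x1) kappa0 (hf x1) Is).
have E (p r : R) : 1 - p - (1 - r) = r - p by ring.
rewrite E distrC {E}.
have -> : prim (fun r => prim (fun t => K0 (x1, t) * picard n (x1, t)) r) s = prim (prim G) s.
  by apply: eq_prim => r hr; apply: eq_prim => t ht; rewrite K0E//; apply: (inI (inI Is hr)) ht.
rewrite -/F -(@primB _ _ _ (B * a)); first last.
- by move=> t ht; have [] := B2 t (inI Is ht).
- by move=> t ht; have [] := B2 t (inI Is ht).
- exact: mS.
- exact: mS.
apply: le_trans (prim_le (B := kappa * (2 * q ^+ n) * a) _ _) _.
- by apply: mS => //; exact: measurable_funB.
- by move=> t ht; apply: primF; exact: inI ht.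
apply: (@le_trans _ _ (kappa * (2 * q ^+ n) * a * a)).
  by rewrite ler_wpM2l ?(ltW (Ia Is))// mulr_ge0 ?(ltW a0)// !mulr_ge0.
rewrite (_ : _ * a = kappa * a ^+ 2 * (2 * q ^+ n)); last by ring.
by rewrite [q ^+ n.+1]exprS [leRHS]mulrCA ler_wpM2r// mulr_ge0.
Qed.

Lemma family_measurable : measurable_fun D f.
Proof.
apply: (measurable_fun_cvg (h := picard)); first by move=> m; apply: measurable_funTS.
move=> x Dx; apply/cvgrPdist_le => e e0.
have q1 : `|q| < 1 by rewrite ger0_norm// (lt_trans q2)// ltr_pdivrMr// mul1r ltr1n.
have := cvg_expr q1; move=> /cvgrPdist_le/(_ (e / 2)); rewrite divr_gt0// => /(_ isT).
apply: filterS => n; rewrite sub0r normrN ger0_norm ?exprn_ge0// => h.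
by rewrite distrC (le_trans (picard_close n Dx))// mulrC -ler_pdivlMr.
Qed.

Lemma family_trivial (x1 : R) : {ae lam, forall s, I s -> K (x1, s) = 0} ->
  forall s, I s -> f (x1, s) = 1.
Proof.
move=> K0ae; have z p r : `[p, r]%classic `<=` I -> \int[lam]_(t in `[p, r]) (K (x1, t) * f (x1, t)) = 0.
  move=> sub; rewrite /Rintegral (ae_eq_integral (cst 0%E)); first by rewrite integral0.
  - exact: measurable_itv.
  - apply/measurable_EFinP; apply: (measurable_funS _ sub); first exact: measurable_itv.
    by apply: measurable_funM; [exact: mk|exact: jacobi_measurable (hf x1)].
  - exact: measurable_cst.
  - move: K0ae; apply: (@filterS _ _ (ae_filter_ringOfSetsType lam)) => t h /sub It.
    by rewrite h// mul0r.
have zp s : I s -> prim (fun t => K (x1, t) * f (x1, t)) s = 0.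
  move=> Is; have sub p r : - `|s| <= p -> r <= `|s| -> `[p, r]%classic `<=` I.
    move=> h1 h2; apply: subset_trans (segI Is) => t /=; rewrite !in_itv/= => /andP[h3 h4].
    by rewrite (le_trans h1)// (le_trans h4).
  have s2 : - `|s| <= s by rewrite lerNl -normrN ler_norm.
  by rewrite /prim !z ?subrr//; apply: sub; rewrite ?oppr_le0 ?ler_norm.
move=> s Is; rewrite (jacobi_integral (mk x1) (k_le x1) kappa0 (hf x1) Is).
rewrite (@eq_prim _ _ (fun=> 0)); last by move=> r hr; apply: zp; exact: inI hr.
by rewrite /prim !Rintegral_cst// !mul0r subrr subr0.
Qed.

End family.

End jacobi_bounds.

(** * Essential support and null sets on slices *)

Section essential_support.
Context {R : realType} (a : R).
Local Notation lam := (@lebesgue_measure R).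
Local Notation D := (strip a).

Lemma bounded_box (A : set (plane R)) : bounded_set A ->
  exists2 L : R, 0 < L & forall x, A x -> `|x.1 : R| <= L /\ `|x.2 : R| <= L.
Proof.
move=> [M [_ hM]]; exists (`|M| + 1); first by rewrite ltr_wpDl.
have ML : M < `|M| + 1 by rewrite (le_lt_trans (ler_norm M))// ltrDl.
by move=> x /(hM _ ML); rewrite /= prod_normE ge_max => /andP[].
Qed.

(** A Lindelof argument: each point outside the essential support lies in a rational square on which
    K vanishes almost everywhere, and there are countably many such squares. *)
Lemma null_outside_support (K : plane R -> R) : measurable_fun D K ->
  bounded_set (ess_support D K `&` D) ->
  exists2 L : R, 0 < L & leb2 (D `&` [set x | L < `|x.1 : R| /\ K x != 0]) = 0%E.
Proof.
move=> mK /bounded_box[L L0 hL]; exists L => //.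
have mN : measurable (D `&` [set x | L < `|x.1 : R| /\ K x != 0]).
  have mD := strip_measurable a.
  have -> : D `&` [set x | L < `|x.1 : R| /\ K x != 0] =
    (D `&` K @^-1` (~` [set 0])) `&` (fun x : plane R => `|x.1 : R|) @^-1` `]L, +oo[%classic.
    apply/seteqP; split => x /=; rewrite in_itv/= andbT; first by move=> [? [? /eqP ?]].
    by move=> [[? /eqP ?] ?].
  apply: measurableI; first by apply: mK => //; apply: measurableC; exact: measurable_set1.
  rewrite -[X in measurable X]setTI.
  have m1 : measurable_fun setT (fun x : plane R => x.1 : R) by exact: measurable_fst.
  have m2 : measurable_fun setT (fun x : plane R => `|x.1 : R|) by apply: measurableT_comp.
  by apply: m2 => //; exact: measurable_itv.
apply: (@negligibleP _ _ _ leb2 _ mN).1.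
pose good p := leb2 (rational_square p `&` D `&` [set y | K y != 0]) = 0%E.
pose F n : set (plane R) := if @unpickle (rat * rat * nat)%type n is Some p
  then (if `[< good p >] then rational_square p `&` D `&` [set y | K y != 0] else set0) else set0.
have mK0 (A : set (plane R)) : measurable A -> measurable (A `&` D `&` [set y | K y != 0]).
  move=> mA; rewrite -setIA; apply: measurableI => //.
  have -> : D `&` [set y | K y != 0] = D `&` K @^-1` (~` [set 0]).
    by apply/seteqP; split => x [Dx /= /eqP ?].
  by apply: mK; [exact: strip_measurable|apply: measurableC; exact: measurable_set1].
apply: (@negligibleS _ _ _ leb2 (\bigcup_n F n)); last first.
  apply: negligible_bigcup => n; rewrite /F; case: unpickle => [p|]; last exact: negligible_set0.
  case: asboolP => h; last exact: negligible_set0.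
  apply/negligibleP => //; apply: mK0; exact: square_measurable.
move=> x [Dx [Lx Kx]]; have nx : ~ ess_support D K x.
  by move=> h; have [h1 _] := hL x (conj h Dx); move: Lx; rewrite ltNge h1.
have [V [oV Vx nV]] : exists V, [/\ open V, V x & ~ (0 < leb2 (V `&` D `&` [set y | K y != 0%R]))%E].
  apply: contrapT => h; apply: nx => V oV Vx; apply: contrapT => h'; apply: h; by exists V.
have : nbhs x V by exact: open_nbhs_nbhs.
move=> /nbhs_square[r r0 hr]; have [p [px hp]] := square_rational x r0.
have mV : measurable (V `&` D `&` [set y | K y != 0]) by apply: mK0; exact: open_measurable_plane.
have gp : good p.
  apply/eqP; rewrite eq_le measure_ge0 andbT; apply: (@le_trans _ _ (leb2 (V `&` D `&` [set y | K y != 0]))).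
    apply: le_measure; rewrite ?inE//; first by apply: mK0; exact: square_measurable.
    by move=> y [[hy Dy] Ky]; split => //; split => //; apply: hr; exact: hp.
  by rewrite leNgt; apply/negP.
exists (pickle p); first exact: Logic.I.
by rewrite /F pickleK; case: asboolP => [_|/(_ gp)[]]; exact: conj (conj px Dx) Kx.
Qed.

Lemma ae_slices (A : set (plane R)) : measurable A -> leb2 A = 0%E ->
  {ae lam, forall x1 : R, lam (xsection A x1) = 0%E}.
Proof.
move=> mA A0; have : (\int[lam]_x1 (lam \o xsection A) x1 = 0)%E by exact: A0.
have ms : measurable_fun setT (lam \o xsection A) by exact: measurable_fun_xsection.
move=> h; have : (\int[lam]_x1 `|(lam \o xsection A) x1| = 0)%E.
  by rewrite -[RHS]h; apply: eq_integral => x1 _; rewrite gee0_abs//; exact: measure_ge0.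
move=> /(ae_eq_integral_abs lam measurableT ms).1.
by apply: (@filterS _ _ (ae_filter_ringOfSetsType lam)) => x1 /(_ Logic.I).
Qed.

Lemma null_of_slices (A : set (plane R)) : measurable A ->
  {ae lam, forall x1 : R, lam (xsection A x1) = 0%E} -> leb2 A = 0%E.
Proof.
move=> mA h; have ms : measurable_fun setT (lam \o xsection A) by exact: measurable_fun_xsection.
have : (\int[lam]_x1 (lam \o xsection A) x1 = 0)%E.
  rewrite (ae_eq_integral (cst 0%E)) ?integral0//.
  by move: h; apply: (@filterS _ _ (ae_filter_ringOfSetsType lam)) => x1 /= h _.
by [].
Qed.

(* Where [K] vanishes the equation is [f'' = 0], so [f = 1]. *)
Lemma trivial_at_infinity (K f : plane R -> R) (kappa q : R) : 0 < a ->
  measurable_fun D K -> (forall x, D x -> `|K x| <= kappa) -> 0 <= kappa ->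
  kappa * a ^+ 2 <= q -> q < 1 / 2 ->
  (forall x1 : R, jacobi_solution a (fun s => K (x1, s)) (fun s => f (x1, s))) ->
  bounded_set (ess_support D K `&` D) ->
  exists2 L : R, 0 < L & {ae leb2, forall x : plane R, D x -> L < `|x.1 : R| -> f x = 1}.
Proof.
move=> a0 mK K_le k0 small q2 hf bK; have [L L0 h] := null_outside_support mK bK.
exists L => //; have mf := family_measurable a0 mK K_le k0 small q2 hf.
have mD := strip_measurable a.
have mA (g : plane R -> R) (c : R) : measurable_fun D g -> measurable (D `&` [set x | L < `|x.1 : R| /\ g x != c]).
  move=> mg; have -> : D `&` [set x | L < `|x.1 : R| /\ g x != c] =
    (D `&` g @^-1` (~` [set c])) `&` (fun x : plane R => `|x.1 : R|) @^-1` `]L, +oo[%classic.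
    apply/seteqP; split => x /=; rewrite in_itv/= andbT; first by move=> [? [? /eqP ?]].
    by move=> [[? /eqP ?] ?].
  apply: measurableI; first by apply: mg => //; apply: measurableC; exact: measurable_set1.
  rewrite -[X in measurable X]setTI.
  have m1 : measurable_fun setT (fun x : plane R => x.1 : R) by exact: measurable_fst.
  have m2 : measurable_fun setT (fun x : plane R => `|x.1 : R|) by apply: measurableT_comp.
  by apply: m2 => //; exact: measurable_itv.
have N0 : leb2 (D `&` [set x | L < `|x.1 : R| /\ f x != 1]) = 0%E.
  apply: null_of_slices; first exact: mA.
  have := ae_slices (mA _ 0 mK) h.
  apply: (@filterS _ _ (ae_filter_ringOfSetsType lam)) => x1 h1.
  rewrite (_ : xsection _ _ = set0) ?measure0//.
  apply/seteqP; split => // s; rewrite /xsection/= inE => -[Ds [Ls /eqP]]; apply.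
  have Is : sym_interval a s by rewrite /sym_interval/= in_itv.
  apply: (family_trivial a0 mK K_le k0 hf) => //.
  exists (xsection (D `&` [set x | L < `|x.1 : R| /\ K x != 0]) x1); split => //.
    by apply: measurable_xsection; exact: mA.
  move=> r /= nr; rewrite /xsection/= inE; apply: contrapT => h2; apply: nr => Ir; apply/eqP/negPn/negP => Kr.
  by apply: h2; split => //; rewrite /strip/=; move: Ir; rewrite /sym_interval/= in_itv.
exists (D `&` [set x | L < `|x.1 : R| /\ f x != 1]); split => //; first exact: mA.
move=> x /= nx; apply: contrapT => h2; apply: nx => Dx Lx; apply/eqP/negPn/negP => fx.
by apply: h2.
Qed.

End essential_support.

(** * The Hardy inequality with an inverse square weight *)

Section weight_comparison.
Context d (T : measurableType d) (R : realType) (mu : {measure set T -> \bar R}).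
Variables (D : set T) (mD : measurable D).
Implicit Types (u v w al be : T -> R).

Lemma bdmV w (c : R) : bdm D w -> 0 < c -> (forall x, D x -> c <= w x) -> bdm D (fun x => (w x)^-1).
Proof.
move=> [mw _] c0 cw; split.
  apply: (eq_measurable_fun (fun x => expR (- ln (w x)))).
    by move=> x /set_mem Dx; rewrite expRN lnK// posrE (lt_le_trans c0)// cw.
  apply: (measurableT_comp (@measurable_expR R)); apply: measurableT_comp => //.
  exact: (measurableT_comp (@measurable_ln R)).
exists c^-1 => x Dx; have wx := lt_le_trans c0 (cw x Dx).
by rewrite gtr0_norm ?invr_gt0// lef_pV2 ?posrE// cw.
Qed.

(** Replacing [al] by the minimum of the two weights changes it on a null set only and makes the
    comparison hold everywhere. *)
Lemma ip_le_ae al be u : bdm D al -> bdm D be -> sqi mu D u ->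
  {ae mu, forall x, D x -> al x <= be x} -> ip mu D al u u <= ip mu D be u u.
Proof.
move=> hal hbe hu h; have [mal _] := hal; have [mbe _] := hbe; have [mmu _] := hu.
have mm : measurable_fun D (fun x => Num.min (al x) (be x)) by exact: measurable_minr.
apply: (@le_trans _ _ (\int[mu]_(x in D) (Num.min (al x) (be x) * (u x * u x)))).
  rewrite le_eqVlt; apply/orP; left; apply/eqP; congr fine; apply: ae_eq_integral => //.
  - by apply/measurable_EFinP; apply: measurable_funM => //; exact: measurable_funM.
  - by apply/measurable_EFinP; apply: measurable_funM => //; exact: measurable_funM.
  - by apply: filterS h => x h Dx; rewrite min_l ?h.
have hm : bdm D (fun x => Num.min (al x) (be x)).
  have [_ [A hA]] := hal; have [_ [B hB]] := hbe; split => //; exists (Num.max A B) => x Dx.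
  by rewrite minEle le_max; case: ifP => _; rewrite ?hA ?hB ?orbT.
by apply: ip_le => // x _; rewrite ge_min lexx orbT.
Qed.

End weight_comparison.

Section rational_weights.
Context {R : realType}.
Implicit Types (k s : R).

(** It has two roles: k = 1 gives the inverse square weight of the Hardy inequality, while a small k
    truncates s^2 so that multipliers stay bounded. *)
Definition rat_weight k s : R := (1 + k * s ^+ 2)^-1.

Lemma rat_den_gt0 k s : 0 <= k -> 0 < 1 + k * s ^+ 2.
Proof. by move=> k0; rewrite ltr_wpDr// mulr_ge0// sqr_ge0. Qed.

Lemma rat_weight_gt0 k s : 0 <= k -> 0 < rat_weight k s.
Proof. by move=> k0; rewrite invr_gt0 rat_den_gt0. Qed.

Lemma rat_weight_le1 k s : 0 <= k -> rat_weight k s <= 1.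
Proof. by move=> k0; rewrite invf_le1 ?rat_den_gt0// lerDl mulr_ge0// sqr_ge0. Qed.

Lemma smooth1_sqr k : smooth1 (fun s : R => 1 + k * s ^+ 2).
Proof.
by move=> n; apply: ncontD; [exact: ncont_cst|apply: ncontZ; apply: ncontX; exact: ncont_id].
Qed.

Lemma smooth1_rat_weight k : 0 <= k -> smooth1 (rat_weight k).
Proof. by move=> k0 n; apply: ncontV; [move=> s; rewrite gt_eqF// rat_den_gt0|exact: smooth1_sqr]. Qed.

Lemma sqr_is_derive k s : is_derive s 1 (fun s : R => 1 + k * s ^+ 2) (2 * k * s).
Proof.
have d2 : is_derive s 1 (fun s : R => s * s) (s *: 1 + s *: 1) by apply: is_deriveM.
have d3 : is_derive s 1 (fun s : R => k * (s * s)) (k *: (s *: 1 + s *: 1)) by apply: is_deriveZ.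
have d4 : is_derive s 1 (fun s : R => 1 + k * (s * s)) (0 + k *: (s *: 1 + s *: 1)) by apply: is_deriveD.
have -> : (fun s : R => 1 + k * s ^+ 2) = (fun s : R => 1 + k * (s * s)) by apply/funext => t; rewrite expr2.
by apply: (is_derive_eq d4); rewrite /GRing.scale/=; ring.
Qed.

Lemma rat_weight_is_derive k s : 0 <= k ->
  is_derive s 1 (rat_weight k) (- (2 * k * s) * rat_weight k s ^+ 2).
Proof.
move=> k0; have n0 : 1 + k * s ^+ 2 != 0 by rewrite gt_eqF// rat_den_gt0.
have := @is_deriveV R (fun s : R => 1 + k * s ^+ 2) s _ 1 n0 (sqr_is_derive k s).
by move=> H; apply: (is_derive_eq H); rewrite /rat_weight /GRing.scale/= -exprVn; ring.
Qed.

Definition rat_slope k s : R := rat_weight k s - 2 * k * s ^+ 2 * rat_weight k s ^+ 2.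

Lemma rat_linear_is_derive k s : 0 <= k ->
  is_derive s 1 (fun s => s * rat_weight k s) (rat_slope k s).
Proof.
move=> k0; have := is_deriveM (is_derive_id s (1 : R)) (rat_weight_is_derive s k0).
by move=> H; apply: (is_derive_eq H); rewrite /rat_slope /GRing.scale/=; ring.
Qed.

Lemma rat_slope_cont k : 0 <= k -> continuous (rat_slope k).
Proof.
move=> k0; apply: smooth1_cont => n; have r := smooth1_rat_weight k0.
apply: ncontB; first exact: r.
apply: ncontM; last by apply: ncontX.
by apply: ncontZ; apply: ncontX; exact: ncont_id.
Qed.

End rational_weights.

Definition qform {R : realType} (a : R) (f phi : plane R -> R) : R :=
  ip leb2 (strip a) (fun x => (f x)^-1) (partial1 phi) (partial1 phi) +
  ip leb2 (strip a) f (partial2 phi) (partial2 phi) - E1 a * ip leb2 (strip a) f phi phi.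

(** * Absorbing the region where rho is small *)

Section global_hardy.
Context {R : realType} (a c L : R) (f rho : plane R -> R).
Local Notation D := (strip a).
Local Notation bdm := (bdm D).
Local Notation sqi := (sqi leb2 D).
Local Notation rint := (rint leb2 D).
Local Notation ip := (ip leb2 D).
Local Notation Q := (qform a f).
Hypotheses (a0 : 0 < a) (hf : bdm f) (c0 : 0 < c) (c1 : c <= 1) (cf : forall x, D x -> c <= f x).
Hypotheses (f2 : forall x, D x -> f x <= 2) (L3 : 3 <= L).
Hypothesis f1 : {ae leb2, forall x : plane R, D x -> L < `|x.1 : R| -> f x = 1}.
Hypotheses (mrho : measurable_fun D rho) (rho0 : forall x, D x -> 0 < rho x).
Hypothesis hardy : forall phi, test_function D phi ->
  (\int[leb2]_(x in D) (rho x * phi x ^+ 2 * f x)%:E <= (Q phi)%:E)%E.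

Let mD : measurable D := strip_measurable a.
Let E := E1 a.
Let E0 : 0 <= E. Proof. exact: sqr_ge0. Qed.
Let hfV : bdm (fun x => (f x)^-1) := bdmV hf c0 cf.

Let J (s : R) : R := \1_(`[- L, L]%classic) s.

Let JE s : J s = if `|s| <= L then 1 else 0.
Proof. by rewrite /J indicE mem_setE in_itv/= -ler_norml; case: ifP. Qed.

Let J01 s : 0 <= J s <= 1.
Proof. by rewrite JE; case: ifP; rewrite lexx ler01. Qed.

Let mJ : measurable_fun setT J.
Proof. by apply: measurable_indic; exact: measurable_itv. Qed.

Let lift (b : R -> R) : measurable_fun setT b -> (forall s, 0 <= b s <= 1) -> bdm (fun x => b x.1).
Proof. by move=> mb hb; apply: (bdm_lift _ mb (M := 1)) => s; have /andP[? ?] := hb s; rewrite ger0_norm. Qed.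

Let b s : R := rat_weight 1 s.
Let b0 s : 0 < b s := rat_weight_gt0 s ler01.
Let b1 s : b s <= 1 := rat_weight_le1 s ler01.
Let mb : measurable_fun setT b.
Proof. by apply: continuous_measurable_fun; exact: smooth1_cont (smooth1_rat_weight ler01). Qed.

Let J' s := 1 - J s.
Let J'01 s : 0 <= J' s <= 1.
Proof. by have := J01 s; rewrite /J' => /andP[? ?]; rewrite subr_ge0 lerBlDr lerDl; apply/andP. Qed.
Let mJ' : measurable_fun setT J'. Proof. by apply: measurable_funB. Qed.

Let hJ := lift mJ J01.
Let hJ' := lift mJ' J'01.

(** In the region |x1| <= L the coefficients are replaced by their extreme values c and 2. Outside,
    where f = 1, the transversal terms stay exact: there the Poincare inequality has to compensate
    E_1 without loss. *)
Lemma qform_lower phi : test_function D phi ->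
  1 / 2 * ip (cst 1) (partial1 phi) (partial1 phi) +
    (c * ip (fun x => J x.1) (partial2 phi) (partial2 phi) +
     ip (fun x => J' x.1) (partial2 phi) (partial2 phi)) -
    E * (ip (fun x => J' x.1) phi phi + 2 * ip (fun x => J x.1) phi phi) <= Q phi.
Proof.
move=> t; have s0 := test_sqi t; have s1 := test_sqi1 t; have s2 := test_sqi2 t.
have h2J := bdmM (bdm_cst D 2) hJ; have hcJ := bdmM (bdm_cst D c) hJ.
rewrite /qform; apply: lerB; first apply: lerD.
- rewrite -(ipwZ mD _ (bdm_cst D (1 : R)) s1 s1); apply: ip_le => //; first exact: bdmM (bdm_cst _ _) (bdm_cst _ _).
  by move=> x Dx; rewrite mulr1 mul1r lef_pV2 ?posrE ?ltr0n ?f2// (lt_le_trans c0)// cf.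
- rewrite -(ipwZ mD _ hJ s2 s2) -ipwD//; apply: ip_le_ae => //; first exact: bdmD.
  move: f1; apply: (@filterS _ _ (ae_filter_ringOfSetsType leb2)) => x h Dx.
  rewrite /J' JE; case: ifPn => [xL|]; first by rewrite mulr1 subrr addr0 cf.
  by rewrite -ltNge => /(h Dx) ->; rewrite mulr0 add0r subr0.
- rewrite ler_wpM2l// -(ipwZ mD _ hJ s0 s0) -ipwD//; apply: ip_le_ae => //; first exact: bdmD.
  move: f1; apply: (@filterS _ _ (ae_filter_ringOfSetsType leb2)) => x h Dx.
  rewrite /J' JE; case: ifPn => [xL|]; first by rewrite mulr1 subrr add0r f2.
  by rewrite -ltNge => /(h Dx) ->; rewrite mulr0 addr0 subr0.
Qed.

Let outer_poincare phi (k : R -> R) : test_function D phi -> measurable_fun setT k ->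
  (forall s, 0 <= k s <= 1) ->
  E * ip (fun x => J' x.1 * k x.1) phi phi <= ip (fun x => J' x.1 * k x.1) (partial2 phi) (partial2 phi).
Proof.
move=> t mk hk; apply: (poincare_strip a0 (b := fun s => J' s * k s) (M := 1)) => //.
  exact: measurable_funM.
by move=> s; have /andP[? ?] := hk s; have /andP[? ?] := J'01 s; rewrite mulr_ge0//= mulr_ile1.
Qed.

(** [riccati_strip] with g = s / (2 (1 + s^2)). In terms of r = 1 / (1 + s^2), - g' - g^2 = r / 4 -
    3 r^2 / 4, which is at least r / 8 once r <= 1/6; |s| > L >= 3 gives r <= 1/10. For |s| <= L the
    term - J covers the deficit. *)
Lemma hardy_riccati phi : test_function D phi ->
  ip (fun x => b x.1) phi phi <= 8 * ip (cst 1) (partial1 phi) (partial1 phi) +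
    8 * ip (fun x => J x.1) phi phi.
Proof.
move=> t; have s0 := test_sqi t.
have hb : bdm (fun x => b x.1) by apply: lift mb _ => s; rewrite ltW ?b0 ?b1.
pose W s := 8^-1 * b s + - 1 * J s.
have hW : bdm (fun x => W x.1) by exact: bdmD (bdmM (bdm_cst D _) hb) (bdmM (bdm_cst D _) hJ).
have d1 (s : R) : is_derive s 1 (fun s : R => 2^-1 * (s * b s)) (2^-1 * rat_slope 1 s).
  by apply: is_deriveZ; exact: rat_linear_is_derive.
have := @riccati_strip R a phi (fun s => 2^-1 * (s * b s)) (fun s => 2^-1 * rat_slope 1 s) W t d1.
have cs : continuous (fun s : R => 2^-1 * rat_slope 1 s).
  by move=> s; apply: cvgM; [exact: cvg_cst|exact: rat_slope_cont].
move=> /(_ cs hW) H.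
have {}H : ip (fun x => W x.1) phi phi <= ip (cst 1) (partial1 phi) (partial1 phi).
  apply: H => x _; rewrite ler_wpM2r ?sqr_ge0//; move: (x.1) => s {x}.
  rewrite /W /rat_slope /b JE; have n0 := rat_den_gt0 s (@ler01 R).
  have E1 : rat_weight 1 s * (1 + s ^+ 2) = 1 by rewrite /rat_weight mul1r mulVf// -[X in 1 + X]mul1r gt_eqF.
  move: (rat_weight 1 s) (b0 s) E1; rewrite /b => r r0 E1.
  have E2 : r * s ^+ 2 = 1 - r by move: E1; rewrite mulrDr mulr1 => <-; rewrite addrAC subrr add0r.
  have -> : - (2^-1 * (r - 2 * 1 * s ^+ 2 * r ^+ 2)) - (2^-1 * (s * r)) ^+ 2 =
    - (2^-1 * (r - 2 * (r * s ^+ 2) * r)) - 4^-1 * (r * (r * s ^+ 2)) by field.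
  rewrite E2; case: ifPn => hs.
    have r1 : r <= 1 by move: E2 (sqr_ge0 s) r0; nra.
    nra.
  have s9 : 9 <= s ^+ 2.
    have h3 : 3 <= `|s| by rewrite (le_trans L3)// ltW// ltNge.
    by rewrite -real_normK ?num_real//; move: (`|s|) h3 => z h3; nra.
  have r10 : r <= 10^-1 by rewrite -[X in X <= _](mulfK (_ : (10 : R) != 0))// ler_pdivrMr// mulVf//; nra.
  nra.
move: H; rewrite ipwD//; [|exact: bdmM (bdm_cst D _) hb|exact: bdmM (bdm_cst D _) hJ].
rewrite (ipwZ mD _ hb s0 s0) (ipwZ mD _ hJ s0 s0).
by move: (ip _ _ _) (ip _ _ _) (ip _ _ _) => x y z; lra.
Qed.

Let hb : bdm (fun x => b x.1).
Proof. by apply: lift mb _ => s; rewrite ltW ?b0 ?b1. Qed.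

Let b01 s : 0 <= b s <= 1. Proof. by rewrite ltW ?b0 ?b1. Qed.

Let bb s := b s ^+ 2.
Let bb01 s : 0 <= bb s <= 1.
Proof. by have /andP[? ?] := b01 s; rewrite sqr_ge0 /bb exprn_ile1. Qed.
Let mbb : measurable_fun setT bb. Proof. exact: measurable_funX. Qed.
Let hbb := lift mbb bb01.

(** Everything is measured against [Q phi + Y phi]: [A], [N] and [P] are bounded by multiples of it,
    so only the mass [Y] on |x1| <= L remains to be controlled by [Q]. *)
Let Y phi := ip (fun x => J x.1) phi phi.
Let A phi := ip (cst 1) (partial1 phi) (partial1 phi).
Let N phi := ip (fun x => b x.1) phi phi.
Let P phi := ip (fun x => bb x.1) (partial2 phi) (partial2 phi).

Let A_le phi : test_function D phi -> A phi <= 2 * Q phi + 4 * E * Y phi.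
Proof.
move=> t; have := qform_lower t; have h01 (s : R) : 0 <= (cst 1 s : R) <= 1 by rewrite /cst lexx ler01.
have := outer_poincare t (measurable_cst (1 : R)) h01.
rewrite (_ : (fun x : plane R => J' x.1 * cst 1 x.1) = fun x => J' x.1); last first.
  by apply/funext => x; rewrite /cst mulr1.
have H0 : 0 <= c * ip (fun x => J x.1) (partial2 phi) (partial2 phi).
  by rewrite mulr_ge0 ?(ltW c0)//; apply: ip_ge0 => x _; have /andP[] := J01 x.1.
have alg (x y z w p q : R) : E * p <= q -> 0 <= w ->
    1 / 2 * x + (w + q) - E * (p + 2 * y) <= z -> x <= 2 * z + 4 * E * y.
  by move: E => e; lra.
by move=> H1 H2; exact: alg H1 H0 H2.
Qed.

(** Outside, the transversal energy is split with the weights 1 - b^2 and b^2. The first part pays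
    for E_1 by Poincare; the second is kept, and its share of the mass is at most E N since b^2 <=
    b. *)
Let P_le phi : test_function D phi -> c * P phi <= Q phi + 2 * E * Y phi + E * N phi.
Proof.
move=> t; have s0 := test_sqi t; have s2 := test_sqi2 t.
pose k s := 1 - bb s.
have k01 s : 0 <= k s <= 1.
  by have /andP[? ?] := bb01 s; rewrite /k subr_ge0 lerBlDr lerDl; apply/andP.
have mk : measurable_fun setT k by apply: measurable_funB.
have hk := lift mk k01.
have hJk : bdm (fun x => J' x.1 * k x.1) by exact: bdmM.
have hJb : bdm (fun x => J' x.1 * bb x.1) by exact: bdmM.
have split u : sqi u -> ip (fun x => J' x.1) u u =
    ip (fun x => J' x.1 * k x.1) u u + ip (fun x => J' x.1 * bb x.1) u u.
  move=> hu; rewrite -ipwD//; congr (ip _ u u); apply/funext => x.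
  by rewrite -mulrDr /k subrK mulr1.
have := outer_poincare t mk k01; have := qform_lower t; rewrite !split//.
have A0 : 0 <= A phi by apply: ip_ge0 => x _; exact: ler01.
have h1 : E * ip (fun x => J' x.1 * bb x.1) phi phi <= E * N phi.
  rewrite ler_wpM2l//; apply: ip_le => // x _.
  have /andP[? ?] := J'01 x.1; have /andP[? ?] := b01 x.1; rewrite /bb expr2 mulrA -[leRHS]mul1r.
  by rewrite ler_wpM2r// mulr_ile1.
have h2 : c * P phi <= c * ip (fun x => J x.1) (partial2 phi) (partial2 phi) +
    ip (fun x => J' x.1 * bb x.1) (partial2 phi) (partial2 phi).
  have hcb : bdm (fun x => c * bb x.1) := bdmM (bdm_cst D c) hbb.
  have hcJ : bdm (fun x => c * J x.1) := bdmM (bdm_cst D c) hJ.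
  have <- := ipwZ mD c hbb s2 s2; have <- := ipwZ mD c hJ s2 s2; have <- := ipwD mD hcJ hJb s2 s2.
  apply: (ip_le mD hcb (bdmD hcJ hJb) s2).
  move=> x _; have /andP[? ?] := bb01 x.1; rewrite /J' JE; case: ifP => _.
    by rewrite subrr mul0r addr0 ler_wpM2l// ltW.
  by rewrite mulr0 add0r subr0 mul1r ler_piMl.
have alg (x y z w r1 r2 r3 p4 r5 u v : R) : 0 <= x -> E * r1 <= v -> w <= p4 + r2 ->
    1 / 2 * x + (p4 + (r3 + r2)) - E * (r5 + r1 + 2 * y) <= z -> E * r5 <= r3 -> w <= z + 2 * E * y + v.
  by move: E => e; lra.
by move=> H1 H2; exact: alg A0 h1 h2 H1 H2.
Qed.

Let psi phi : plane R -> R := fun x => b x.1 * phi x.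

(** [ladyzhenskaya] is applied to b phi, since the norm of phi itself is not controlled by Q + Y
    while its b-weighted mass is. *)
Let quartic phi : test_function D phi ->
  \int[leb2]_(x in D) psi phi x ^+ 4 <= 4 * N phi * ((2 * N phi + 2 * A phi + P phi) / 2).
Proof.
move=> t; have s0 := test_sqi t; have s1 := test_sqi1 t; have s2 := test_sqi2 t.
have sb := smooth1_rat_weight (@ler01 R); have tp := test_mul t sb.
apply: le_trans (ladyzhenskaya tp) _.
have h1 := bdm_cst D (1 : R); have cst1 x : D x -> (1 : R) <= cst 1 x by [].
rewrite (nrm2 _ ltr01 cst1) (partial1_mul t sb) (partial2_mul t sb).
have E0' : ip (cst 1) (fun x => rat_weight 1 x.1 * phi x) (fun x => rat_weight 1 x.1 * phi x) <= N phi.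
  rewrite (_ : ip _ _ _ = ip (fun x => bb x.1) phi phi); last first.
    by apply: eq_Rintegral => x _; rewrite /bb /b /cst; ring.
  by apply: ip_le => // x _; rewrite /bb expr2 ler_piMr ?b1// ltW ?b0.
have E2' : nrm leb2 D (cst 1) (fun x => rat_weight 1 x.1 * partial2 phi x) ^+ 2 = P phi.
  by rewrite (nrm2 _ ltr01 cst1); apply: eq_Rintegral => x _; rewrite /bb /b /cst; ring.
have E1' : nrm leb2 D (cst 1) (fun x => derive1 (rat_weight 1) x.1 * phi x + rat_weight 1 x.1 * partial1 phi x) ^+ 2
    <= 2 * N phi + 2 * A phi.
  have db (s : R) : derive1 (rat_weight 1) s = - (2 * 1 * s) * b s ^+ 2.
    by have [_ h] := rat_weight_is_derive s (@ler01 R); rewrite derive1E.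
  have sm : sqi (fun x => derive1 (rat_weight 1) x.1 * phi x + rat_weight 1 x.1 * partial1 phi x).
    by rewrite -(partial1_mul t sb); exact: test_sqi1.
  rewrite (nrm2 _ ltr01 cst1) -(ipwZ mD _ hb s0 s0) -(ipwZ mD _ h1 s1 s1).
  rewrite /ip -RintegralD//; last first.
  - by apply: (rint_ip mD _ s1 s1); exact: bdmM (bdm_cst _ _) h1.
  - by apply: (rint_ip mD _ s0 s0); exact: bdmM (bdm_cst _ _) hb.
  apply: le_Rintegral => //.
  - by apply: (rint_ip mD h1 sm sm).
  - apply: rintD => //; [apply: (rint_ip mD _ s0 s0)|apply: (rint_ip mD _ s1 s1)].
      exact: bdmM (bdm_cst _ _) hb.
    exact: bdmM (bdm_cst _ _) h1.
  - move=> x _; rewrite db /cst -/(b x.1); move: (x.1 : R) (phi x) (partial1 phi x) => s p p1.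
    have := b0 s; have := b1 s; have n0 := rat_den_gt0 s (@ler01 R).
    have : b s * (1 + s ^+ 2) = 1 by rewrite /b /rat_weight mul1r mulVf// -[X in 1 + X]mul1r gt_eqF.
    move: (b s) => r e1 r1 r0.
    have e2 : r * s ^+ 2 = 1 - r by move: e1; rewrite mulrDr mulr1 => <-; rewrite addrAC subrr add0r.
    set z1 := - (2 * 1 * s) * r ^+ 2 * p; set z2 := r * p1.
    (* b'^2 = 4 s^2 r^4 = 4 (1 - r) r^3 is at most r, because 4 (1 - r) r^2 <= 16/27. *)
    have q1 : z1 ^+ 2 <= r * (p * p).
      have -> : z1 ^+ 2 = (4 * (r * s ^+ 2) * r ^+ 2) * (r * (p * p)) by rewrite /z1; ring.
      have z0 : 4 * (r * s ^+ 2) * r ^+ 2 <= 1 by rewrite e2; nra.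
      by rewrite ler_piMl// mulr_ge0 ?(ltW r0)// -expr2 sqr_ge0.
    have q2 : z2 ^+ 2 <= p1 * p1.
      by rewrite /z2 exprMn -[p1 * p1]expr2 ler_piMl ?sqr_ge0// exprn_ile1 ?(ltW r0).
    have q3 : (z1 + z2) ^+ 2 <= 2 * z1 ^+ 2 + 2 * z2 ^+ 2 by have := sqr_ge0 (z1 - z2); nra.
    rewrite mul1r -expr2; apply: le_trans q3 _.
    by rewrite mulr1 -[2 * r * _]mulrA; apply: lerD; rewrite ler_wpM2l.
have n1 := nrm_ge0 leb2 D (cst (1 : R)) (fun x => derive1 (rat_weight 1) x.1 * phi x + rat_weight 1 x.1 * partial1 phi x).
have n2 := nrm_ge0 leb2 D (cst (1 : R)) (fun x => rat_weight 1 x.1 * partial2 phi x).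
have N0 : 0 <= N phi by apply: ip_ge0 => x _; rewrite ltW ?b0.
apply: ler_pM.
- by rewrite mulr_ge0//; apply: ip_ge0 => x _; exact: ler01.
- exact: mulr_ge0.
- by rewrite ler_wpM2l.
move: n1 n2 E1' E2'; move: (nrm _ _ _ _) (nrm _ _ _ _) (N phi) (A phi) (P phi) => x y z w p x0 y0 h <-.
have := sqr_ge0 (x - y); nra.
Qed.

(** On |x1| <= L the Hardy inequality is worth c / (n + 1) times the mass off [B n]. These sets
    decrease to the empty set inside a set of finite measure, so their measure tends to 0. *)
Let B (n : nat) : set (plane R) := D `&` [set x | `|x.1 : R| <= L /\ rho x < n.+1%:R^-1].

Let mB n : measurable (B n).
Proof.
have -> : B n = (D `&` rho @^-1` `]-oo, n.+1%:R^-1[%classic) `&` (fun x : plane R => `|x.1 : R|) @^-1` `]-oo, L]%classic.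
  by apply/seteqP; split => x /=; rewrite !in_itv/=; [move=> [? [? ?]]|move=> [[? ?] ?]].
apply: measurableI; first by apply: mrho => //; exact: measurable_itv.
rewrite -[X in measurable X]setTI.
have m1 : measurable_fun setT (fun x : plane R => x.1 : R) by exact: measurable_fst.
have m2 : measurable_fun setT (fun x : plane R => `|x.1 : R|) by apply: measurableT_comp.
by apply: m2 => //; exact: measurable_itv.
Qed.

Let Bbox n : B n `<=` box (Num.max L a).
Proof.
move=> x [Dx [xL _]]; split; first by rewrite (le_trans xL)// le_max lexx.
by rewrite le_max; apply/orP; right; move: Dx; rewrite /strip/= -ltr_norml => /ltW.
Qed.

Let B_small (e : R) : 0 < e -> exists n, fine (leb2 (B n)) <= e.
Proof.
move=> e0; have Bcap : \bigcap_n B n = set0.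
  apply/seteqP; split => // x hx; have [Dx _] := hx 0%N Logic.I.
  have [m _ /(_ m)/(_ (leqnn _)) hm] := near_infty_natSinv_lt (PosNum (rho0 Dx)).
  by have [_ [_ /(lt_trans hm)]] := hx m Logic.I; rewrite ltxx.
have fin0 : (leb2 (B 0%N) < +oo)%E.
  apply: le_lt_trans (leb2_box (Num.max L a)); apply: le_measure; rewrite ?inE//.
  exact: box_measurable.
have cv : leb2 (B n) @[n --> \oo] --> 0%E.
  rewrite -(@measure0 _ _ _ (leb2 : {measure set (plane R) -> \bar R})) -Bcap.
  apply: nonincreasing_cvg_mu => //; first by rewrite Bcap; exact: measurable0.
  move=> n m nm; apply/subsetPset => x [Dx [xL hx]]; split => //; split => //.
  by rewrite (lt_le_trans hx)// lef_pV2 ?posrE ?ltr0n// ler_nat.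
have /cvgrPdist_lt/(_ e e0)[m _ /(_ m)/(_ (leqnn _))] : fine (leb2 (B n)) @[n --> \oo] --> (0 : R) by exact: fine_cvg cv.
rewrite sub0r normrN => h; exists m; apply: ltW; apply: le_lt_trans h.
exact: ler_norm.
Qed.

Let Q_ge0 phi : test_function D phi -> 0 <= Q phi.
Proof.
move=> t; rewrite -lee_fin; apply: le_trans (hardy t); apply: (integral_ge0 leb2) => x Dx.
by rewrite lee_fin; apply: mulr_ge0; [rewrite mulr_ge0 ?sqr_ge0 ?(ltW (rho0 Dx))|rewrite (le_trans (ltW c0))// cf].
Qed.

Let hardy_weight (r : plane R -> R) phi : bdm r -> (forall x, D x -> 0 <= r x <= rho x * f x) ->
  test_function D phi -> ip r phi phi <= Q phi.
Proof.
move=> hr r_le t; have s0 := test_sqi t; rewrite -lee_fin; apply: le_trans (hardy t).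
have ir := rint_ip mD hr s0 s0; have [mr _] := hr; have [mphi _] := s0; have [mf _] := hf.
rewrite /ip /Rintegral fineK; last exact: (integrable_fin_num mD ir).
apply: (@ge0_le_integral _ _ R leb2 D mD).
- by move=> x Dx; rewrite lee_fin mulr_ge0 -?expr2 ?sqr_ge0//; have /andP[] := r_le x Dx.
- by apply/measurable_EFinP; exact: rint_measurable ir.
- by apply/measurable_EFinP; apply: measurable_funM => //; apply: measurable_funM => //; exact: measurable_funX.
- move=> x Dx; rewrite lee_fin mulrAC -expr2 ler_wpM2r ?sqr_ge0//.
  by have /andP[] := r_le x Dx.
Qed.

Let oneB (n : nat) : plane R -> R := \1_(B n).
Let oneBE n x : oneB n x = (x \in B n)%:R.
Proof. exact: indicE. Qed.

Let h1B n : bdm (oneB n).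
Proof.
split; first by apply: measurable_funTS; exact: measurable_indic.
by exists 1 => x _; rewrite oneBE; case: (_ \in _); rewrite ?normr1 ?normr0.
Qed.

Let s1B n : sqi (oneB n).
Proof.
have [m1 _] := h1B n; split => //; apply: (@rint_box _ _ _ (Num.max L a) 1).
- exact: measurable_funX.
- by move=> x _; rewrite oneBE; case: (_ \in _); rewrite ?expr1n ?expr0n ?normr1 ?normr0.
- by move=> x _ nb; rewrite oneBE memNset ?expr0n// => /Bbox.
Qed.

Let sqi_psi2 phi : test_function D phi -> sqi (fun x => psi phi x ^+ 2).
Proof.
move=> t; have tp := test_mul t (smooth1_rat_weight (@ler01 R)).
have [P' _ hP] := test_box tp; have cp := test_cont tp.
rewrite (_ : (fun x => _) = fun x => psi phi x * psi phi x); last by apply/funext => x; rewrite expr2.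
apply: (@sqi_box R a _ P') => [x|x nx]; first by apply: cvgM; exact: cp.
by rewrite /psi /b (hP x nx) mul0r.
Qed.

Let B_part n phi : test_function D phi ->
  ip (oneB n) phi phi <= (1 + L ^+ 2) ^+ 2 * ip (cst 1) (oneB n) (fun x => psi phi x ^+ 2).
Proof.
move=> t; have s0 := test_sqi t; have sp := sqi_psi2 t.
have i1 := rint_ip mD (bdm_cst D (1 : R)) (s1B n) sp.
rewrite /ip -RintegralZl//; apply: le_Rintegral => //.
- exact: (rint_ip mD (h1B n) s0 s0).
- exact: rintZ.
move=> x Dx; rewrite oneBE /psi /cst mul1r; case: (boolP (x \in B n)) => [/set_mem[_ [xL _]]|_].
  rewrite !mul1r exprMn mulrA -[phi x * _]expr2 ler_peMl ?sqr_ge0// -exprMn exprn_ege1//.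
  rewrite /b /rat_weight mul1r ler_pdivlMr ?mul1r; last by rewrite ltr_wpDr// sqr_ge0.
  rewrite lerD2l -[x.1 ^+ 2]real_normK ?num_real// ler_pXn2r// nnegrE//.
  exact: le_trans xL.
by rewrite !mul0r mulr0.
Qed.

(** Cauchy-Schwarz against the indicator: smallness of the measure turns the quartic bound into
    smallness of the mass on [B n]. *)
Let B_quartic n phi : test_function D phi ->
  ip (cst 1) (oneB n) (fun x => psi phi x ^+ 2) ^+ 2 <=
  fine (leb2 (B n)) * \int[leb2]_(x in D) psi phi x ^+ 4.
Proof.
move=> t; have := ip_CS mD (bdm_cst D (1 : R)) (fun x _ => ler01) (s1B n) (sqi_psi2 t).
have -> : ip (fun=> 1) (oneB n) (oneB n) = fine (leb2 (B n)).
  rewrite /ip /Rintegral -[in RHS](setIidl (_ : B n `<=` D)); last by move=> x [].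
  rewrite -integral_indic//; congr fine; apply: eq_integral => x _; congr EFin.
  by rewrite mul1r oneBE indicE; case: (_ \in _); rewrite ?mul1r ?mul0r.
congr (_ <= _ * _); apply: eq_Rintegral => x _.
by rewrite mul1r -exprD.
Qed.

(** With S = Q + Y, the mass on [B n] is at most S / 2 once n is large, and the mass off [B n] is at
    most (n + 1) / c times Q. Absorbing Y / 2 bounds Y, and then N, by a multiple of Q alone. *)
Lemma global_hardy : exists2 eta : R, 0 < eta & forall phi, test_function D phi ->
  eta * ip (fun x => rat_weight 1 x.1) phi phi <= Q phi.
Proof.
pose a1 := 2 + 4 * E; pose n1 := 8 * a1 + 8; pose p1 := (1 + 2 * E + E * n1) / c.
pose C1 := 2 * (n1 + a1 + p1); pose k := (1 + L ^+ 2) ^+ 2.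
have a10 : 0 < a1 by rewrite ltr_wpDr// mulr_ge0.
have n10 : 0 < n1 by rewrite addr_gt0// mulr_gt0.
have p10 : 0 < p1.
  rewrite divr_gt0//; apply: ltr_wpDr; first by rewrite mulr_ge0 ?(ltW n10).
  by apply: ltr_wpDr; [exact: mulr_ge0|exact: ltr01].
have C10 : 0 < C1 by rewrite mulr_gt0 ?ltr0n// (addr_gt0 (addr_gt0 n10 a10) p10).
have k0 : 0 < k by rewrite exprn_gt0// ltr_wpDr// sqr_ge0.
have C2 : 0 < 2 * C1 * k := mulr_gt0 (mulr_gt0 (ltr0Sn _ _) C10) k0.
(* With this bound on the measure, Z^2 <= (2 C1 k)^-2 (C1 S)^2 = (S / (2 k))^2. The factor k = (1 +
   L^2)^2 is the cost of passing from b phi back to phi on |x1| <= L. *)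
have e0 : 0 < (2 * C1 * k) ^- 2 by rewrite invr_gt0 exprn_gt0.
have [n hn] := B_small e0.
pose y1 := 2 * (n.+1%:R / c) + 1.
have y10 : 0 < y1 by rewrite ltr_wpDl// mulr_ge0// divr_ge0// (ltW c0).
have n1y : 0 < n1 * (1 + y1) := mulr_gt0 n10 (addr_gt0 ltr01 y10).
exists (n1 * (1 + y1))^-1; first by rewrite invr_gt0.
move=> phi t; have Q0 := Q_ge0 t.
have Y0 : 0 <= Y phi by apply: ip_ge0 => x _; have /andP[] := J01 x.1.
have N0 : 0 <= N phi by apply: ip_ge0 => x _; rewrite ltW ?b0.
pose S := Q phi + Y phi; have S0 : 0 <= S by exact: addr_ge0.
have hA : A phi <= a1 * S.
  have alg (e q y : R) : 0 <= y -> 0 <= e * q -> 2 * q + 4 * e * y <= (2 + 4 * e) * (q + y) by lra.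
  by apply: le_trans (A_le t) _; exact: alg Y0 (mulr_ge0 E0 Q0).
have hN : N phi <= n1 * S.
  have alg (x y s p : R) : x <= p * s -> y <= s -> 8 * x + 8 * y <= (8 * p + 8) * s by lra.
  by apply: le_trans (hardy_riccati t) _; apply: alg hA _; rewrite /S lerDr.
have hP : P phi <= p1 * S.
  have : c * P phi <= (1 + 2 * E + E * n1) * S.
    have alg (e m q y z : R) : 0 <= y -> 0 <= e * q -> e * z <= e * (m * (q + y)) ->
      q + 2 * e * y + e * z <= (1 + 2 * e + e * m) * (q + y) by lra.
    by apply: le_trans (P_le t) _; exact: alg Y0 (mulr_ge0 E0 Q0) (ler_wpM2l E0 hN).
  move=> h; rewrite (_ : p1 * S = c^-1 * ((1 + 2 * E + E * n1) * S)); first by rewrite ler_pdivlMl.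
  by rewrite /p1 mulrAC mulrC.
pose Z := ip (cst 1) (oneB n) (fun x => psi phi x ^+ 2).
have Z_le : Z <= S / (2 * k).
  have Zsq : Z ^+ 2 <= (S / (2 * k)) ^+ 2.
    apply: le_trans (B_quartic n t) _.
    have q4 : \int[leb2]_(x in D) psi phi x ^+ 4 <= (C1 * S) ^+ 2.
      apply: le_trans (quartic t) _.
      have -> : (C1 * S) ^+ 2 = 4 * ((n1 + a1 + p1) * S) * ((n1 + a1 + p1) * S) by rewrite /C1; ring.
      have P0 : 0 <= P phi by apply: ip_ge0 => x _; rewrite sqr_ge0.
      have A0 : 0 <= A phi by apply: ip_ge0 => x _; exact: ler01.
      have h1 := mulr_ge0 (ltW a10) S0; have h2 := mulr_ge0 (ltW p10) S0; have h3 := mulr_ge0 (ltW n10) S0.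
      have alg1 (x u v w : R) : x <= u -> 0 <= v -> 0 <= w -> 4 * x <= 4 * (u + v + w) by lra.
      have alg2 (x y z u v w : R) : x <= u -> y <= v -> z <= w -> 0 <= w ->
        (2 * x + 2 * y + z) / 2 <= u + v + w by lra.
      have two0 : 0 <= 2 :> R by [].
      rewrite (mulrDl (n1 + a1) p1 S) (mulrDl n1 a1 S); apply: ler_pM.
      - exact: mulr_ge0.
      - by apply: divr_ge0 => //; exact: addr_ge0 (addr_ge0 (mulr_ge0 two0 N0) (mulr_ge0 two0 A0)) P0.
      - exact: alg1 hN h1 h2.
      - exact: alg2 hN hA hP h2.
    have q40 : 0 <= \int[leb2]_(x in D) psi phi x ^+ 4.
      by apply: Rintegral_ge0 => x _; rewrite (exprM _ 2 2) sqr_ge0.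
    apply: le_trans (ler_pM (fine_ge0 (measure_ge0 _ _)) q40 hn q4) _.
    rewrite le_eqVlt; apply/orP; left; apply/eqP.
      by field; rewrite !gt_eqF.
  rewrite leNgt; apply/negP => h; have w0 : 0 <= S / (2 * k) by rewrite divr_ge0// mulr_ge0// ltW.
  have : (S / (2 * k)) ^+ 2 < Z ^+ 2 by rewrite ltr_pXn2r ?nnegrE// (le_trans w0 (ltW h)).
  by rewrite ltNge Zsq.
pose r x := c / n.+1%:R * (J x.1 * (1 - oneB n x)).
have hr : bdm r by apply: bdmM (bdm_cst _ _) _; apply: bdmM hJ _; exact: bdmB (bdm_cst D _) (h1B n).
have rQ : ip r phi phi <= Q phi.
  apply: hardy_weight => // x Dx; rewrite /r JE oneBE; have cn0 : 0 <= c / n.+1%:R by rewrite divr_ge0// ltW.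
  have rf0 : 0 <= rho x * f x by rewrite mulr_ge0 ?(ltW (rho0 Dx))// (le_trans (ltW c0))// cf.
  case: ifPn => xL; last by rewrite mul0r mulr0 lexx.
  case: (boolP (x \in B n)) => [_|]; first by rewrite subrr !mulr0 lexx.
  rewrite notin_setE => nB; rewrite subr0 !mulr1 cn0/= mulrC ler_pM ?cf// ?(ltW c0)//.
  by rewrite leNgt; apply/negP => h'; apply: nB; split => //; split.
have YX : Y phi <= n.+1%:R / c * Q phi + k * Z.
  have h1 : Y phi <= n.+1%:R / c * ip r phi phi + ip (oneB n) phi phi.
    have s0 := test_sqi t; have <- := ipwZ mD (n.+1%:R / c) hr s0 s0.
    have hcr : bdm (fun x => n.+1%:R / c * r x) := bdmM (bdm_cst D _) hr.
    have <- := ipwD mD hcr (h1B n) s0 s0; apply: (ip_le mD hJ (bdmD hcr (h1B n)) s0) => x _.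
    have nc : n.+1%:R / c * (c / n.+1%:R) = 1 by rewrite mulrA divfK ?divff ?pnatr_eq0 ?(gt_eqF c0).
    rewrite /r [_ * (c / _ * _)]mulrA nc mul1r.
    have /andP[j0 j1] := J01 x.1; rewrite oneBE; case: (_ \in _).
      by rewrite subrr mulr0 add0r.
    by rewrite subr0 mulr1 addr0.
  apply: le_trans h1 _; apply: lerD; first by rewrite ler_wpM2l// divr_ge0// (ltW c0).
  exact: B_part.
have kZ : k * Z <= S / 2.
  have -> : S / 2 = k * (S / (2 * k)) by field; rewrite gt_eqF.
  by rewrite (ler_pM2l k0).
have hY : Y phi <= y1 * Q phi.
  have alg (y u z p v : R) : y <= p * v + z -> z <= (v + y) / 2 -> y <= (2 * p + 1) * v by lra.
  exact: alg YX kZ.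
rewrite ler_pdivrMl//; apply: le_trans hN _; rewrite -mulrA ler_wpM2l ?(ltW n10)//.
by rewrite /S mulrDl mul1r lerD2l.
Qed.

End global_hardy.

(** * The confined lower bound *)

Section ip_support.
Context d (T : measurableType d) (R : realType) (mu : {measure set T -> \bar R}).
Variables (D : set T) (mD : measurable D).
Implicit Types (u al be : T -> R).

Lemma ip_le_support al be u : bdm D al -> bdm D be -> sqi mu D u ->
  {ae mu, forall x, D x -> u x != 0 -> al x <= be x} -> ip mu D al u u <= ip mu D be u u.
Proof.
move=> hal hbe hu h; have i1 := rint_ip mD hal hu hu; have i2 := rint_ip mD hbe hu hu.
have m1 := rint_measurable i1; have m2 := rint_measurable i2.
pose g x := Num.min (al x * (u x * u x)) (be x * (u x * u x)).
have mg : measurable_fun D g by exact: measurable_minr.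
have ig : rint mu D g.
  apply: (rint_le mD mg _ (rintD mD (integrable_abse i1) (integrable_abse i2))) => x Dx.
  by rewrite /g minEle; case: ifP => _; rewrite ?lerDl ?lerDr.
apply: (@le_trans _ _ (\int[mu]_(x in D) g x)); last first.
  by apply: le_Rintegral => // x _; rewrite /g ge_min lexx orbT.
rewrite le_eqVlt; apply/orP; left; apply/eqP; congr fine; apply: ae_eq_integral => //.
- exact/measurable_EFinP.
- exact/measurable_EFinP.
- apply: filterS h => x h Dx; rewrite /g; have [->|u0] := eqVneq (u x) 0.
    by rewrite !mul0r !mulr0 minxx.
  by rewrite min_l// ler_wpM2r -?expr2 ?sqr_ge0// h.
Qed.

End ip_support.

Section outer_riccati.
Context {R : realType}.
Implicit Types (s e tau : R).

(** The oscillator potential s^2 / (16 tau^2), truncated so that it never exceeds m / (4 tau). The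
    truncation scale 4 m tau is matched to the weight (1 + s^2 / (8 m tau))^m of the decay
    argument. *)
Definition confinement (m : nat) tau s : R :=
  s ^+ 2 / (16 * tau ^+ 2) * rat_weight (4 * m%:R * tau)^-1 s.

Lemma confinement_ge0 m tau s : 0 < tau -> 0 <= confinement m tau s.
Proof.
move=> t0; apply: mulr_ge0; first by rewrite divr_ge0 ?sqr_ge0// mulr_ge0// sqr_ge0.
by rewrite ltW// rat_weight_gt0// invr_ge0; apply: mulr_ge0 (ltW t0); exact: mulr_ge0.
Qed.

Lemma rat_weight_id k s : 0 <= k -> k * s ^+ 2 * rat_weight k s = 1 - rat_weight k s.
Proof.
move=> k0; have n0 := rat_den_gt0 s k0.
by apply/eqP; rewrite eq_sym subr_eq -[X in _ + X]mul1r -mulrDl addrC /rat_weight divff// gt_eqF.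
Qed.

(* With [r = (1 + s^2)^-1], [p = (1 + K s^2)^-1] every term of [- g' - g^2] is a
   polynomial in [r] and [p]. *)
Lemma outer_riccati_bound (e tau q : R) (m : nat) : 0 < e -> e < 1 -> 0 < tau ->
  40 / e <= m%:R -> 0 <= q -> q <= e / 64 ->
  let K := (4 * m%:R * tau)^-1 in let be := (1 - e / 8) / (4 * tau) in
  let g' s := (1 - e / 16) * rat_slope 1 s - be * rat_slope K s in
  let g s := (1 - e / 16) * (s * rat_weight 1 s) - be * (s * rat_weight K s) in
  forall s, rat_weight 1 s <= e / 64 ->
    (3 - e) / (4 * tau) + q * rat_weight 1 s - confinement m tau s <= - g' s - g s ^+ 2.
Proof.
(* [g] regularizes 1/s - s / (4 tau), the logarithmic derivative of s e^(- s^2 / (8 tau)), which is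
   the ground state of the half-line oscillator, with energy 3 / (4 tau). The factors 1 - e/16 and 1
   - e/8 create the room for the errors. *)
move=> e0 e1 t0 me q0 qe K be g' g s re.
have m0 : 0 < m%:R :> R by apply: lt_le_trans me; rewrite divr_gt0.
have K0 : 0 < K by rewrite invr_gt0 !mulr_gt0.
have r0 := rat_weight_gt0 s (@ler01 R); have p0 := rat_weight_gt0 s (ltW K0).
have p1 := rat_weight_le1 s (ltW K0).
have rI := rat_weight_id s (@ler01 R); have pI := rat_weight_id s (ltW K0).
have b0 : 0 < 1 - e / 8 by lra.
have be0 : 0 < be by rewrite divr_gt0// mulr_gt0.
rewrite /confinement -/K /g' /g /rat_slope.
move: (rat_weight 1 s) (rat_weight K s) r0 p0 p1 rI pI re => r p r0 p0 p1 rI pI re.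
pose b := 1 - e / 8; pose sg := 1 - e / 16.
have mb0 : 0 < m%:R * b by rewrite mulr_gt0.
have b1 : b != 0 by rewrite gt_eqF.
have m1 : (m%:R : R) != 0 by rewrite gt_eqF.
have t1 : tau != 0 by rewrite gt_eqF.
have beE : be = b / (4 * tau) by [].
have Ebe : K = (m%:R * b)^-1 * be by rewrite /K beE; field; rewrite ?b1 ?m1 ?t1.
have rs : s ^+ 2 * r = 1 - r by rewrite -rI mul1r.
have U : s ^+ 2 / (16 * tau ^+ 2) * p = be * (m%:R / b) * (1 - p).
  by rewrite -pI /K beE; field; rewrite ?b1 ?m1 ?t1.
have G2 : (be * (s * p)) ^+ 2 = be * (m%:R * b) * (p * (1 - p)).
  by rewrite -pI Ebe; field; rewrite ?b1 ?m1 ?t1.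
have three : (3 - e) / (4 * tau) = be * ((3 - e) / b) by rewrite beE; field; rewrite ?b1 ?t1.
have G : (sg * (s * r) - be * (s * p)) ^+ 2 =
    sg ^+ 2 * (r * (1 - r)) - 2 * sg * be * ((1 - r) * p) + be * (m%:R * b) * (p * (1 - p)).
  by rewrite -G2 -rs; ring.
rewrite U three G.
have -> : r - 2 * 1 * s ^+ 2 * r ^+ 2 = r - 2 * (1 - r) * r by rewrite -rs; ring.
have -> : p - 2 * K * s ^+ 2 * p ^+ 2 = p - 2 * (1 - p) * p by rewrite -pI; ring.
rewrite -subr_ge0.
have -> : - (sg * (r - 2 * (1 - r) * r) - be * (p - 2 * (1 - p) * p)) -
    (sg ^+ 2 * (r * (1 - r)) - 2 * sg * be * ((1 - r) * p) + be * (m%:R * b) * (p * (1 - p))) -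
    (be * ((3 - e) / b) + q * r - be * (m%:R / b) * (1 - p)) =
  r * (sg - sg ^+ 2 - q - r * (2 * sg - sg ^+ 2)) +
  be * ((1 + 2 * sg * (1 - r) - (3 - e) / b) +
        (1 - p) * (m%:R / b - m%:R * b - 3 - 2 * sg * (1 - r)) +
        (1 - p) ^+ 2 * (2 + m%:R * b)) by ring.
apply: addr_ge0; apply: mulr_ge0; rewrite ?(ltW r0) ?(ltW be0)//.
  have h1 : 0 <= r * (1 - (2 * sg - sg ^+ 2)).
    by rewrite mulr_ge0 ?(ltW r0)// /sg; have := sqr_ge0 (e / 16); lra.
  have h2 : 15 / 256 * e <= sg - sg ^+ 2 by rewrite /sg; have := mulr_gt0 e0 e0; nra.
  by move: h1 h2 qe re; clear -r0; lra.
have p10 : 0 <= 1 - p by rewrite subr_ge0.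
apply: addr_ge0; first apply: addr_ge0.
- rewrite subr_ge0 ler_pdivrMr// /sg /b.
  have h1 : 1 - e / 64 <= 1 - r by rewrite lerB.
  have h2 : (1 - e / 16) * (1 - e / 64) <= (1 - e / 16) * (1 - r) by rewrite ler_wpM2l//; lra.
  have h3 : (3 - e) <= (1 + 2 * ((1 - e / 16) * (1 - e / 64))) * (1 - e / 8).
    by have := mulr_gt0 e0 e0; have := mulr_gt0 (mulr_gt0 e0 e0) e0; nra.
  by apply: le_trans h3 _; rewrite ler_wpM2r ?(ltW b0)// lerD2l -mulrA ler_wpM2l.
- apply: mulr_ge0 => //.
  (* The difference is m (1 - b^2) / b >= m e / 8 >= 5, by the lower bound 40 / e on m; it must beat
     3 + 2 sg (1 - r) <= 5. *)
  have h1 : 5 <= m%:R / b - m%:R * b.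
    have -> : m%:R / b - m%:R * b = m%:R * ((1 - b ^+ 2) / b) by field.
    have h : e / 8 <= (1 - b ^+ 2) / b by rewrite ler_pdivlMr// /b; nra.
    apply: (@le_trans _ _ (40 / e * (e / 8))); last by apply: ler_pM => //; rewrite divr_ge0// ltW.
    by rewrite le_eqVlt; apply/orP; left; apply/eqP; field; rewrite ?gt_eqF.
  have h2 : sg * (1 - r) <= 1 by rewrite mulr_ile1 /sg; lra.
  by move: h1 h2; clear; lra.
- by rewrite mulr_ge0 ?sqr_ge0// addr_ge0// ltW.
Qed.

End outer_riccati.

(** * Localization into an inner and an outer region *)

Section localization.
Context {R : realType} (a c L eta : R) (f : plane R -> R).
Local Notation D := (strip a).
Local Notation bdm := (bdm D).
Local Notation sqi := (sqi leb2 D).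
Local Notation ip := (ip leb2 D).
Local Notation Q := (qform a f).
Hypotheses (a0 : 0 < a) (hf : bdm f) (c0 : 0 < c) (cf : forall x, D x -> c <= f x).
Hypotheses (f2 : forall x, D x -> f x <= 2) (L0 : 0 < L).
Hypothesis f1 : {ae leb2, forall x : plane R, D x -> L < `|x.1 : R| -> f x = 1}.
Hypotheses (eta0 : 0 < eta) (hardy : forall phi, test_function D phi ->
  eta * ip (fun x => rat_weight 1 x.1) phi phi <= Q phi).

Let mD : measurable D := strip_measurable a.
Let hfV : bdm (fun x => (f x)^-1) := bdmV hf c0 cf.
Let h1 : bdm (fun=> 1) := bdm_cst D (1 : R).

Let hrat (k : R) : 0 <= k -> bdm (fun x => rat_weight k x.1).
Proof.
move=> k0; apply: (smooth1_bdm (smooth1_rat_weight k0) (M := 1)) => s.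
by rewrite ger0_norm ?rat_weight_le1// ltW// rat_weight_gt0.
Qed.

Let confinement_bounded m (tau : R) : 0 < tau -> (0 < m)%N -> bdm (fun x => confinement m tau x.1).
Proof.
move=> t0 m0; pose k := (4 * m%:R * tau)^-1; have mt : 0 < 4 * m%:R * tau by rewrite !mulr_gt0// ltr0n.
have k0 : 0 <= k by rewrite invr_ge0 ltW.
have E s : confinement m tau s = m%:R / (4 * tau) * (1 - rat_weight k s).
  rewrite -rat_weight_id// /confinement -/k; move: (rat_weight k s) => p.
  have t1 : tau != 0 by rewrite gt_eqF.
  have m1 : (m%:R : R) != 0 by rewrite pnatr_eq0 -lt0n.
  by rewrite /k; field; rewrite ?t1 ?m1.
have -> : (fun x : plane R => confinement m tau x.1) = fun x => m%:R / (4 * tau) * (1 + - 1 * rat_weight k x.1).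
  by apply/funext => x; rewrite E mulN1r.
by apply: bdmM (bdm_cst _ _) _; apply: bdmD h1 _; apply: bdmM (bdm_cst _ _) _; exact: hrat.
Qed.

Section angle.
Variable th : R -> R.
Hypothesis sth : smooth1 th.
Variable phi : plane R -> R.
Hypothesis t : test_function D phi.

Let C s := cos (th s).
Let S s := sin (th s).
Let sC : smooth1 C. Proof. by move=> n; apply: ncont_comp; [exact: (ncont_sin_cos n).2|exact: sth]. Qed.
Let sS : smooth1 S. Proof. by move=> n; apply: ncont_comp; [exact: (ncont_sin_cos n).1|exact: sth]. Qed.
Let dC s : derive1 C s = - S s * derive1 th s.
Proof.
have [_ E] := @is_derive1_comp R cos th s _ _ (is_derive_cos (th s)) (smooth1_is_derive s sth).
by rewrite derive1E; exact: E.
Qed.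
Let dS s : derive1 S s = C s * derive1 th s.
Proof.
have [_ E] := @is_derive1_comp R sin th s _ _ (is_derive_sin (th s)) (smooth1_is_derive s sth).
by rewrite derive1E; exact: E.
Qed.

Let chi x := C x.1 * phi x.
Let omega x := S x.1 * phi x.
Let tchi : test_function D chi := test_mul t sC.
Let tomega : test_function D omega := test_mul t sS.
Let CS s : C s ^+ 2 + S s ^+ 2 = 1. Proof. exact: cos2Dsin2. Qed.

Let ip_sum (w u v u' v' z z' : plane R -> R) : bdm w -> sqi u -> sqi v -> sqi u' ->
  sqi v' -> (forall x, D x -> u x ^+ 2 + v x ^+ 2 = u' x ^+ 2 + v' x ^+ 2) ->
  ip w u u + ip w v v = ip w u' u' + ip w v' v'.
Proof.
move=> hw hu hv hu' hv' E.
have i (k : plane R -> R) : sqi k -> rint leb2 D (fun x => w x * (k x * k x)) by move=> hk; exact: rint_ip.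
rewrite /ip -!RintegralD//; do ?[exact: i]; apply: eq_Rintegral => x /set_mem Dx.
by rewrite -!mulrDr -!expr2 E.
Qed.

Let ip0 (w : plane R -> R) : ip w (fun=> 0) (fun=> 0) = 0.
Proof.
rewrite /ip (_ : (fun x => _) = fun=> 0); first by rewrite Rintegral_cst// mul0r.
by apply/funext => x; rewrite !mulr0.
Qed.

Lemma localize_mass w : bdm w -> ip w phi phi = ip w chi chi + ip w omega omega.
Proof.
move=> hw; have s0 := test_sqi t.
have z0 := ip0 w.
rewrite -[LHS]addr0 -{1}z0; apply/esym; apply: (ip_sum phi phi) => //.
- exact: test_sqi tchi.
- exact: test_sqi tomega.
- exact: sqi0.
- by move=> x _; rewrite /chi /omega !exprMn -mulrDl CS mul1r expr0n addr0.
Qed.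

(** The IMS localization formula for the partition cos^2 + sin^2 = 1. Writing the partition through
    one angle makes the error simply f^-1 th'^2 phi^2. *)
Lemma localize_energy (M : R) : (forall s, `|derive1 th s| <= M) ->
  Q phi + ip (fun x => (f x)^-1 * derive1 th x.1 ^+ 2) phi phi = Q chi + Q omega.
Proof.
move=> thM; have s0 := test_sqi t; have s1 := test_sqi1 t; have s2 := test_sqi2 t.
have hth : bdm (fun x => derive1 th x.1) by exact: smooth1_bdm (smooth1_derive1 sth) thM.
have st : sqi (fun x => derive1 th x.1 * phi x) by exact: sqiM.
have F1 : ip (fun x => (f x)^-1) (partial1 chi) (partial1 chi) +
    ip (fun x => (f x)^-1) (partial1 omega) (partial1 omega) =
    ip (fun x => (f x)^-1) (partial1 phi) (partial1 phi) +
    ip (fun x => (f x)^-1) (fun x => derive1 th x.1 * phi x) (fun x => derive1 th x.1 * phi x).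
  apply: (ip_sum phi phi) => //; [exact: test_sqi1 tchi|exact: test_sqi1 tomega|move=> x _].
  rewrite (partial1_mul t sC) (partial1_mul t sS) dC dS -[in RHS](mul1r (partial1 phi x ^+ 2)).
  by rewrite -[in RHS](mul1r ((_ * _) ^+ 2)) -(CS x.1); ring.
have F2 : ip f (partial2 chi) (partial2 chi) + ip f (partial2 omega) (partial2 omega) =
    ip f (partial2 phi) (partial2 phi) + ip f (fun=> 0) (fun=> 0).
  apply: (ip_sum phi phi) => //; [exact: test_sqi2 tchi|exact: test_sqi2 tomega|exact: sqi0|move=> x _].
  rewrite (partial2_mul t sC) (partial2_mul t sS) !exprMn -mulrDl CS; ring.
have z0 := ip0 f.
have E3 : ip (fun x => (f x)^-1 * derive1 th x.1 ^+ 2) phi phi =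
    ip (fun x => (f x)^-1) (fun x => derive1 th x.1 * phi x) (fun x => derive1 th x.1 * phi x).
  by apply: eq_Rintegral => x _; ring.
rewrite E3 /qform (localize_mass hf); move: F1 F2; rewrite z0.
have alg (p q r s u v w z x y e : R) : p + q = r + s -> u + v = w + 0 ->
  r + w - e * (x + y) + s = p + u - e * x + (q + v - e * y) by lra.
exact: alg.
Qed.

(* On the support of [omega] the weight is 1 and the energy is bounded below
   by the longitudinal one. *)
Lemma outer_energy : (forall s, `|s| <= L -> S s = 0) -> (forall s, `|s| <= L -> derive1 th s = 0) ->
  ip (fun=> 1) (partial1 omega) (partial1 omega) <= Q omega.
Proof.
have alg (p q r z : R) : p <= q -> z <= r -> p <= q + r - z by lra.
move=> SL thL; have s0 := test_sqi tomega; have s1 := test_sqi1 tomega; have s2 := test_sqi2 tomega.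
have P1 : E1 a * ip (fun=> 1) omega omega <= ip (fun=> 1) (partial2 omega) (partial2 omega).
  have h01 (s : R) : 0 <= (cst 1 s : R) <= 1 by rewrite /cst lexx ler01.
  exact: (poincare_strip a0 tomega (measurable_cst (1 : R)) h01).
have out (u : plane R -> R) : (forall x, `|x.1 : R| <= L -> u x = 0) ->
    {ae leb2, forall x, D x -> u x != 0 -> f x = 1}.
  move=> uL; move: f1; apply: (@filterS _ _ (ae_filter_ringOfSetsType leb2)) => x h Dx u0.
  by apply: h => //; rewrite ltNge; apply: contraNN u0 => /uL ->.
have le (w w' : plane R -> R) u : bdm w -> bdm w' -> sqi u -> (forall x, `|x.1 : R| <= L -> u x = 0) ->
    (forall x, f x = 1 -> w x <= w' x) -> ip w u u <= ip w' u u.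
  move=> hw hw' hu uL ww; apply: ip_le_support => //.
  by move: (out u uL); apply: (@filterS _ _ (ae_filter_ringOfSetsType leb2)) => x h Dx u0; exact: ww (h Dx u0).
have uL0 x : `|x.1 : R| <= L -> omega x = 0 by move=> xL; rewrite /omega SL// mul0r.
have uL1 x : `|x.1 : R| <= L -> partial1 omega x = 0.
  by move=> xL; rewrite (partial1_mul t sS) dS thL// SL// mulr0 !mul0r addr0.
have uL2 x : `|x.1 : R| <= L -> partial2 omega x = 0.
  by move=> xL; rewrite (partial2_mul t sS) SL// mul0r.
have B1 : ip (fun=> 1) (partial1 omega) (partial1 omega) <= ip (fun x => (f x)^-1) (partial1 omega) (partial1 omega).
  by apply: le => // x ->; rewrite invr1.
have B2 : ip (fun=> 1) (partial2 omega) (partial2 omega) <= ip f (partial2 omega) (partial2 omega).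
  by apply: le => // x ->.
have B0 : E1 a * ip f omega omega <= E1 a * ip (fun=> 1) omega omega.
  by rewrite ler_wpM2l ?sqr_ge0//; apply: le => // x ->.
exact: alg B1 (le_trans B0 (le_trans P1 B2)).
Qed.

End angle.

(** The angle turns on a logarithmic scale, so th'^2 is at most a small multiple of 1 / (1 + s^2),
    the same shape as the Hardy weight. Hence the localization error is absorbed on both sides: by
    part of the Hardy term in the inner region, and by the slack of the Riccati bound in the outer
    one. *)
Lemma confined_lower_bound (e : R) : 0 < e -> e < 1 ->
  exists (m : nat) (tau0 : R), [/\ (0 < m)%N, 1 <= tau0 & forall tau, tau0 <= tau ->
    forall phi, test_function D phi -> (3 - e) / (4 * tau) * ip f phi phi <=
      Q phi + ip (fun x => f x * confinement m tau x.1) phi phi].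
Proof.
have alg1 (u v w z p2 : R) : u <= v -> v <= w -> w <= eta / 2 * z -> p2 <= eta / 2 * z -> u + p2 <= eta * z by lra.
have alg2 (A Bc Bo rc ro qp qc qo er uc uo : R) : A * Bc + rc <= qc -> A * Bo + ro <= qo + uo ->
  0 <= uc -> er <= rc + ro -> qp + er = qc + qo -> A * (Bc + Bo) <= qp + (uc + uo) by lra.
have alg3 (p M q s r z : R) : p != 0 -> M != 0 -> (p / 2 * (z * (q / (p * M) * (2 * 1 * s * r)))) ^+ 2 =
  (z / M) ^+ 2 * (q ^+ 2 * (1 * s ^+ 2 * r) * r).
  by move=> p1 M1; field; rewrite p1 M1.
(* eta / 2 leaves half of the Hardy term to the inner region; e / 64 is the slack of
   [outer_riccati_bound]. *)
move=> e0 e1; pose q := Num.min (eta / 2) (e / 64).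
have q0 : 0 < q by rewrite lt_min !divr_gt0.
have qe : q <= e / 64 by rewrite ge_min lexx orbT.
have qeta : q <= eta / 2 by rewrite ge_min lexx.
have q1 : q <= 1 by apply: le_trans qe _; rewrite ler_pdivrMr// mul1r (le_trans (ltW e1))// ler1n.
(* Beyond this radius f = 1, and 1 + s^2 >= Ra >= 64 / e, as the outer Riccati bound requires. *)
pose Ra := L + 1 + 64 / e; have e64 : 0 < 64 / e by rewrite divr_gt0.
have [M M0 hM] := @step_derive_bounded R.
have pi0 : 0 < pi :> R := pi_gt0 R.
have M1 : M != 0 by rewrite gt_eqF.
have pi1 : (pi : R) != 0 by rewrite gt_eqF.
(* With |step'| <= M this slope gives th'^2 <= q^2 s^2 / (1 + s^2)^2 <= q / (1 + s^2). *)
pose ep := q / (pi * M); have ep0 : 0 < ep by rewrite divr_gt0// mulr_gt0.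
pose y (s : R) := ep * (ln (1 + 1 * s ^+ 2) - ln (1 + Ra ^+ 2)).
pose th (s : R) := pi / 2 * step (y s).
have den s : 0 < 1 + 1 * s ^+ 2 := rat_den_gt0 s (@ler01 R).
have Rden : 0 < 1 + Ra ^+ 2 by rewrite ltr_wpDr// sqr_ge0.
have Ra0 : 0 < Ra by rewrite !addr_gt0.
have sy : smooth1 y.
  by move=> n; apply: ncontZ; apply: ncontB; [exact: (ncont_ln den (smooth1_sqr 1 n))|exact: ncont_cst].
have sth : smooth1 th by move=> n; apply: ncontZ; apply: ncont_comp; [exact: smooth1_step|exact: sy].
have dy (s : R) : is_derive s 1 y (ep * (2 * 1 * s * rat_weight 1 s)).
  have dl : is_derive s 1 (fun s : R => ln (1 + 1 * s ^+ 2)) ((1 + 1 * s ^+ 2)^-1 * (2 * 1 * s)).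
    have := @is_derive1_comp R (@ln R) (fun s => 1 + 1 * s ^+ 2) s _ _ (is_derive1_ln (den s)) (sqr_is_derive 1 s).
    by move=> H; apply: (is_derive_eq H).
  have db : is_derive s 1 (fun s : R => ln (1 + 1 * s ^+ 2) - ln (1 + Ra ^+ 2))
     ((1 + 1 * s ^+ 2)^-1 * (2 * 1 * s) - 0) by apply: is_deriveB.
  have dz := is_deriveZ ep db.
  by apply: (is_derive_eq dz); rewrite /GRing.scale/= subr0 [(_)^-1 * _]mulrC.
have dth (s : R) : derive1 th s = pi / 2 * (derive1 step (y s) * (ep * (2 * 1 * s * rat_weight 1 s))).
  have dc := @is_derive1_comp R step y s _ _ (smooth1_is_derive (y s) smooth1_step) (dy s).
  by have [_ E] := is_deriveZ (pi / 2) dc; rewrite derive1E; exact: E.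
have y_neg (s : R) : `|s| < Ra -> y s < 0.
  move=> sR; rewrite /y pmulr_rlt0// subr_lt0 ltr_ln ?posrE// mul1r ltrD2l.
  by rewrite -[s ^+ 2]real_normK ?num_real// ltr_pXn2r// nnegrE// ltW.
have th0 (s : R) : `|s| < Ra -> th s = 0 by move=> /y_neg/ltW ys; rewrite /th step0// mulr0.
have dth0 (s : R) : `|s| < Ra -> derive1 th s = 0.
  by move=> /y_neg ys; rewrite dth step_derive0 ?ys// mul0r mulr0.
have LRa : L < Ra by rewrite /Ra -addrA ltrDl addr_gt0.
have dth2 (s : R) : derive1 th s ^+ 2 <= q * rat_weight 1 s.
  have r0 := rat_weight_gt0 s (@ler01 R); have rI := rat_weight_id s (@ler01 R).
  have -> : derive1 th s ^+ 2 = (derive1 step (y s) / M) ^+ 2 * (q ^+ 2 * (1 * s ^+ 2 * rat_weight 1 s) * rat_weight 1 s).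
    by rewrite dth /ep; exact: alg3 pi1 M1.
  have h1' : (derive1 step (y s) / M) ^+ 2 <= 1.
    rewrite -real_normK ?num_real// exprn_ile1// normrM [`|M^-1|]gtr0_norm ?invr_gt0//.
    by rewrite ler_pdivrMr// mul1r.
  have h2' : q ^+ 2 * (1 * s ^+ 2 * rat_weight 1 s) * rat_weight 1 s <= q * rat_weight 1 s.
    rewrite ler_wpM2r ?(ltW r0)// rI -[leRHS]mulr1 expr2 -mulrA ler_wpM2l ?(ltW q0)//.
    by rewrite mulr_ile1 ?(ltW q0)// ?subr_ge0 ?rat_weight_le1// gerBl ltW.
  apply: le_trans h2'; rewrite ler_piMl// rI mulr_ge0 ?(ltW r0)// mulr_ge0 ?sqr_ge0//.
  by rewrite subr_ge0 rat_weight_le1.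
have dth1 (s : R) : `|derive1 th s| <= 1.
  rewrite -(ler_pXn2r (_ : 0 < 2)%N) ?nnegrE// expr1n real_normK ?num_real//.
  apply: le_trans (dth2 s) _; rewrite mulr_ile1 ?(ltW q0) ?rat_weight_le1//.
  by rewrite ltW// rat_weight_gt0.
(* Where 1 + s^2 exceeds this value the argument of [step] is at least 1, so th = pi / 2 and the
   inner part vanishes. *)
pose Z1 := (1 + Ra ^+ 2) * expR ep^-1; have Z10 : 0 < Z1 by rewrite mulr_gt0 ?expR_gt0.
have cos0 (s : R) : cos (th s) != 0 -> Z1^-1 <= rat_weight 1 s.
  move=> c_neq0; rewrite /rat_weight lef_pV2 ?posrE//; apply: contraNT c_neq0.
  rewrite -ltNge => Zs; rewrite /th step1 ?mulr1 ?cos_pihalf//.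
  rewrite /y -ler_pdivrMl// mulr1 lerBrDl -(expRK ep^-1) -lnM ?posrE ?expR_gt0//.
  by rewrite ler_ln ?posrE// ltW.
have sin0L (s : R) : `|s| <= L -> sin (th s) = 0.
  by move=> /le_lt_trans/(_ LRa)/th0 ->; rewrite sin0.
have dthL (s : R) : `|s| <= L -> derive1 th s = 0.
  by move=> /le_lt_trans/(_ LRa)/dth0 ->.
pose m := Num.Def.archi_bound (40 / e).
have me : 40 / e <= m%:R by rewrite ltW// archi_boundP// divr_ge0// ltW.
have m0 : (0 < m)%N by rewrite -(ltr0n R); apply: lt_le_trans me; rewrite divr_gt0.
exists m, (1 + 3 * Z1 / eta); split => //.
  by rewrite lerDl divr_ge0 ?(ltW eta0)// mulr_ge0// ltW.
move=> tau tau_ge phi t.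
have tau0 : 0 < tau.
  by apply: lt_le_trans tau_ge; rewrite ltr_wpDr// divr_ge0 ?(ltW eta0)// mulr_ge0// ltW.
have three : 0 <= (3 - e) / (4 * tau).
  by rewrite divr_ge0 ?mulr_ge0 ?(ltW tau0)// subr_ge0 (le_trans (ltW e1))// ler1n.
pose chi x := cos (th x.1) * phi x; pose omega x := sin (th x.1) * phi x.
have sC : smooth1 (fun s => cos (th s)) by move=> n; apply: ncont_comp; [exact: (ncont_sin_cos n).2|exact: sth].
have sS : smooth1 (fun s => sin (th s)) by move=> n; apply: ncont_comp; [exact: (ncont_sin_cos n).1|exact: sth].
have tchi : test_function D chi := test_mul t sC.
have tomega : test_function D omega := test_mul t sS.
have s0 := test_sqi t; have sc := test_sqi tchi; have so := test_sqi tomega.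
have hU := confinement_bounded tau0 m0; have hfU : bdm (fun x => f x * confinement m tau x.1) := bdmM hf hU.
have hr := hrat (@ler01 R).
have hqr : bdm (fun x => q * rat_weight 1 x.1) := bdmM (bdm_cst D q) hr.
have hdth : bdm (fun x => derive1 th x.1) := smooth1_bdm (smooth1_derive1 sth) dth1.
have hfd : bdm (fun x => (f x)^-1 * derive1 th x.1 ^+ 2).
  have -> : (fun x => (f x)^-1 * derive1 th x.1 ^+ 2) = fun x => (f x)^-1 * (derive1 th x.1 * derive1 th x.1).
    by apply/funext => x; rewrite expr2.
  exact: bdmM hfV (bdmM hdth hdth).
have h3f : bdm (fun x => (3 - e) / (4 * tau) * f x) := bdmM (bdm_cst D _) hf.
have error : ip (fun x => (f x)^-1 * derive1 th x.1 ^+ 2) phi phi <= q * ip (fun x => rat_weight 1 x.1) phi phi.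
  have <- := ipwZ mD q hr s0 s0; apply: ip_le_ae => //.
  move: f1; apply: (@filterS _ _ (ae_filter_ringOfSetsType leb2)) => x h Dx.
  have [xR|xR] := ltP `|x.1 : R| Ra.
    by rewrite dth0// expr0n/= mulr0 mulr_ge0 ?(ltW q0)// ltW// rat_weight_gt0.
  by rewrite h ?(lt_le_trans LRa)// invr1 mul1r.
have inner : (3 - e) / (4 * tau) * ip f chi chi + q * ip (fun x => rat_weight 1 x.1) chi chi <= Q chi.
  apply: le_trans (hardy tchi).
  have <- := ipwZ mD q hr sc sc; have <- := ipwZ mD ((3 - e) / (4 * tau)) hf sc sc.
  have <- := ipwZ mD eta hr sc sc; have <- := ipwD mD h3f hqr sc sc.
  apply: ip_le_support => //; [exact: bdmD|exact: bdmM (bdm_cst D eta) hr|].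
  apply: aeW => x Dx chi0.
  have c_neq0 : cos (th x.1) != 0 by apply: contraNN chi0 => /eqP h; rewrite /chi h mul0r.
  have rZ := cos0 _ c_neq0; move: (rat_weight 1 x.1) rZ => r rZ.
  have k1 : (3 - e) / (4 * tau) * f x <= 3 / (2 * tau).
    have -> : 3 / (2 * tau) = 3 / (4 * tau) * 2 by field; rewrite gt_eqF.
    apply: ler_pM => //; [exact: le_trans (ltW c0) (cf Dx)| |exact: f2].
    by rewrite ler_wpM2r ?invr_ge0 ?mulr_ge0 ?(ltW tau0)// gerBl ltW.
  (* The choice of the threshold for tau: on the support of the inner part the Hardy weight is at
     least 1 / Z1, and half of the Hardy term dominates 3 / (2 tau) when tau >= 3 Z1 / eta. *)
  have k2 : 3 / (2 * tau) <= eta / 2 * Z1^-1.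
    have h3 : 3 * Z1 / eta <= tau by apply: le_trans tau_ge; rewrite lerDr.
    rewrite ler_pdivrMr ?mulr_gt0//.
    have -> : eta / 2 * Z1^-1 * (2 * tau) = tau / (Z1 / eta) by field; rewrite !gt_eqF.
    by rewrite ler_pdivlMr ?divr_gt0// mulrA.
  have k3 : eta / 2 * Z1^-1 <= eta / 2 * r by rewrite ler_wpM2l// divr_ge0// ltW.
  have k4 : q * r <= eta / 2 * r by rewrite ler_wpM2r// (le_trans _ rZ)// invr_ge0 ltW.
  exact: alg1 k1 k2 k3 k4.
have outer : (3 - e) / (4 * tau) * ip f omega omega + q * ip (fun x => rat_weight 1 x.1) omega omega <=
    Q omega + ip (fun x => f x * confinement m tau x.1) omega omega.
  pose W s := (3 - e) / (4 * tau) + q * rat_weight 1 s - confinement m tau s.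
  have hW : bdm (fun x => W x.1) by apply: bdmB => //; apply: bdmD => //; exact: bdm_cst.
  have K0 : 0 <= (4 * m%:R * tau)^-1 by rewrite invr_ge0 !mulr_ge0// ltW.
  pose be := (1 - e / 8) / (4 * tau).
  pose g s := (1 - e / 16) * (s * rat_weight 1 s) - be * (s * rat_weight (4 * m%:R * tau)^-1 s).
  pose g' s := (1 - e / 16) * rat_slope 1 s - be * rat_slope (4 * m%:R * tau)^-1 s.
  have dg (s : R) : is_derive s 1 g (g' s).
    have dg1 := is_deriveZ (1 - e / 16) (rat_linear_is_derive s (@ler01 R)).
    have dg2 := is_deriveZ be (rat_linear_is_derive s K0).
    exact: (is_deriveB dg1 dg2).
  have cg' : continuous g'.
    move=> s; apply: cvgB; (apply: cvgM; [exact: cvg_cst|exact: rat_slope_cont]).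
  have ric : ip (fun x => W x.1) omega omega <= ip (fun=> 1) (partial1 omega) (partial1 omega).
    apply: (riccati_strip tomega dg cg' hW) => x Dx.
    have [xR|xR] := ltP `|x.1 : R| Ra; first by rewrite /omega th0// sin0 mul0r expr0n/= !mulr0.
    rewrite ler_wpM2r ?sqr_ge0//; apply: (outer_riccati_bound e0 e1 tau0 me (ltW q0) qe).
    rewrite /rat_weight invf_ple ?posrE ?divr_gt0// invf_div.
    have h64 : 1 <= Ra by rewrite /Ra -addrA addrCA lerDl addr_ge0// ltW.
    apply: (@le_trans _ _ Ra); first by rewrite /Ra lerDr addr_ge0// ltW.
    apply: (@le_trans _ _ (Ra ^+ 2)); first by rewrite expr2 ler_peMr// ltW.
    rewrite mul1r -[x.1 ^+ 2]real_normK ?num_real//.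
    apply: (@le_trans _ _ (`|x.1 : R| ^+ 2)); last by rewrite lerDr.
    by rewrite ler_pXn2r// nnegrE// ltW.
  apply: le_trans (lerD (le_trans ric (outer_energy sth t sin0L dthL)) (lexx _)).
  have <- := ipwZ mD q hr so so; have <- := ipwZ mD ((3 - e) / (4 * tau)) hf so so.
  have <- := ipwD mD h3f hqr so so; have <- := ipwD mD hW hfU so so.
  apply: ip_le_support => //; [exact: bdmD|exact: bdmD|].
  move: f1; apply: (@filterS _ _ (ae_filter_ringOfSetsType leb2)) => x h Dx o0.
  have xR : L < `|x.1 : R|.
    by rewrite ltNge; apply: contraNN o0 => /sin0L h'; rewrite /omega h' mul0r.
  by rewrite (h Dx xR) mulr1 mul1r /W subrK.
have nn : 0 <= ip (fun x => f x * confinement m tau x.1) chi chi.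
  by apply: ip_ge0 => x Dx; rewrite mulr_ge0 ?confinement_ge0// (le_trans (ltW c0))// cf.
have loc := localize_energy sth t dth1.
rewrite (localize_mass sth t hf) (localize_mass sth t hfU).
move: error; rewrite (localize_mass sth t hr) mulrDr => error.
exact: alg2 inner outer nn error loc.
Qed.

End localization.

(** * Weighted decay of the semigroup *)

Section strip_semigroup.
Context {R : realType} (a c : R) (f : plane R -> R) (S : R -> (plane R -> R) -> plane R -> R).
Local Notation D := (strip a).
Local Notation bdm := (bdm D).
Local Notation sqi := (sqi leb2 D).
Local Notation ip := (ip leb2 D).
Local Notation dot := (ip f).
Local Notation nrm := (nrm leb2 D f).
Local Notation gen := (gen leb2 D f S).
Hypotheses (hf : bdm f) (c0 : 0 < c) (cf : forall x, D x -> c <= f x).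
Hypothesis HT : exp_semigroup D f (H_K a f) S.
Implicit Types (u v z : plane R -> R).

Let mD : measurable D := strip_measurable a.
Let hfV : bdm (fun x => (f x)^-1) := bdmV hf c0 cf.

Let to_sqi u : inL2 leb2 D f u <-> sqi u.
Proof. exact: (@inL2_sqi _ _ R leb2 D mD f c hf c0 cf u). Qed.

Lemma nrm_ae0 z : measurable_fun D z -> ae_eq leb2 D z (fun=> 0) -> nrm z = 0.
Proof.
move=> mz z0; have [mf _] := hf; apply/eqP; rewrite -sqrf_eq0 (nrm2 _ c0 cf).
rewrite (ip_ae mD z0 mf mz (measurable_cst _) mz) /ip (_ : (fun x => _) = fun=> 0).
  by rewrite Rintegral_cst// mul0r.
by apply/funext => x; rewrite mul0r mulr0.
Qed.

Let nrm_ae u v : sqi u -> sqi v -> ae_eq leb2 D u v -> nrm (fun x => u x - v x) = 0.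
Proof.
move=> hu hv uv; apply: nrm_ae0; first by have [? _] := sqiB mD hu hv.
by move: uv; apply: (@filterS _ _ (ae_filter_ringOfSetsType leb2)) => x h Dx; rewrite h// subrr.
Qed.

Let right_nbhs (g : R -> R) : (g t @[t --> (0 : R)^'+] --> (0 : R)) <->
  (forall e, 0 < e -> exists2 del : R, 0 < del & forall t, 0 < t -> t < del -> `|g t| < e).
Proof.
split=> [/cvgrPdist_lt h e e0|h].
  have /nbhs_ballP[del /= del0 hd] := h e e0; exists del => // t t0 td.
  by have := hd t; rewrite /ball/= sub0r normrN gtr0_norm// => /(_ td t0); rewrite sub0r normrN.
apply/cvgrPdist_lt => e e0; have [del del0 hd] := h e e0.
apply/nbhs_ballP; exists del => //= t; rewrite /ball/= sub0r normrN => td t0.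
by rewrite sub0r normrN hd//; move: td; rewrite gtr0_norm.
Qed.

Let sqnorm_cvg (z : R -> plane R -> R) : (forall t, 0 < t -> sqi (z t)) ->
  (sqnorm leb2 D f (z t) @[t --> (0 : R)^'+] --> 0%E) <->
  (forall e, 0 < e -> exists2 del : R, 0 < del & forall t, 0 < t -> t < del -> nrm (z t) < e).
Proof.
move=> hz; have E t : 0 < t -> sqnorm leb2 D f (z t) = (nrm (z t) ^+ 2)%:E.
  by move=> t0; apply: (sqnormE mD hf c0 cf); exact: hz.
have n0 t := nrm_ge0 leb2 D f (z t).
split=> [cv e e0|h].
  have /right_nbhs/(_ (e ^+ 2)) : fine (sqnorm leb2 D f (z t)) @[t --> (0 : R)^'+] --> (0 : R) by exact: fine_cvg cv.
  rewrite exprn_gt0// => /(_ isT)[del del0 hd]; exists del => // t t0 td.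
  have := hd t t0 td; rewrite E//= ger0_norm ?sqr_ge0//.
  by rewrite ltr_pXn2r// nnegrE// ltW.
apply/fine_cvgP; split.
  by near=> t; rewrite E//; near: t; exact: nbhs_right_gt.
apply/right_nbhs => e e0; have e1 : 0 < Num.min 1 e by rewrite lt_min ltr01.
have [del del0 hd] := h _ e1; exists del => // t t0 td.
have := hd t t0 td; rewrite lt_min => /andP[h1 h2] /=; rewrite E//= ger0_norm ?sqr_ge0//.
by apply: le_lt_trans h2; rewrite expr2 ler_piMr// ltW.
Unshelve. all: by end_near. Qed.

Lemma strip_L2_semigroup : L2_semigroup leb2 D f S.
Proof.
have L t u : 0 <= t -> sqi u -> sqi (S t u).
  by move=> t0 /to_sqi hu; apply/to_sqi; exact: (semigroup_L2 HT).
split=> //.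
- move=> t k u v t0 hu hv; apply: nrm_ae.
  + by apply: L => //; apply: sqiD => //; exact: sqiZ.
  + by apply: sqiD => //; [apply: sqiZ => //|]; exact: L.
  + by apply: (semigroup_linear HT) => //; exact/to_sqi.
- move=> t t0; have [C hC] := semigroup_bounded HT t0; exists (Num.sqrt `|C|) => u hu.
  have := hC u ((to_sqi u).2 hu); rewrite !(sqnormE mD hf c0 cf)//; last exact: L.
  rewrite -EFinM lee_fin => h; rewrite -(@ler_pXn2r _ 2)// ?nnegrE ?mulr_ge0 ?nrm_ge0 ?sqrtr_ge0//.
  apply: le_trans h _; rewrite exprMn (sqr_sqrtr (normr_ge0 C)) ler_wpM2r ?sqr_ge0//; exact: ler_norm.
- by move=> u hu; apply: nrm_ae => //; [exact: L|apply: (semigroup0 HT); exact/to_sqi].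
- move=> s t u s0 t0 hu; apply: nrm_ae.
  + by apply: L => //; exact: addr_ge0.
  + by apply: (L) => //; exact: L.
  + by apply: (semigroupD HT) => //; exact/to_sqi.
- move=> u hu; apply: (sqnorm_cvg (z := fun t x => S t u x - u x) _).1.
    by move=> t t0; exact: sqiB (L t u (ltW t0) hu) hu.
  by apply: (semigroup_continuous HT); exact/to_sqi.
Qed.

Lemma energyE g1 g2 p1 p2 : sqi g1 -> sqi g2 -> sqi p1 -> sqi p2 ->
  energy D f g1 g2 p1 p2 = ip (fun x => (f x)^-1) g1 p1 + ip f g2 p2.
Proof. by move=> h1 h2 k1 k2; rewrite /energy RintegralD//; exact: rint_ip. Qed.

(** The generator is -H, so [gen u v] means H u = - v; this is the source of the minus sign in the
    form identity. *)
Lemma gen_form u v : sqi u -> sqi v -> gen u v -> exists g1 g2, H10_space D u g1 g2 /\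
  forall phi p1 p2, H10_space D phi p1 p2 ->
    dot v phi = - (ip (fun x => (f x)^-1) g1 p1 + ip f g2 p2).
Proof.
move=> hu hv g; have L t : 0 < t -> sqi (S t u).
  by move=> t0; apply/to_sqi; apply: (semigroup_L2 HT); [exact: ltW|exact/to_sqi].
have hq t : 0 < t -> sqi (fun x => (S t u x - u x) / t - v x).
  move=> t0; apply: sqiB => //; rewrite (_ : (fun x => _) = fun x => t^-1 * (S t u x - u x)).
    by apply: sqiZ => //; exact: sqiB (L t t0) hu.
  by apply/funext => x; rewrite mulrC.
have : H_K a f u (\- v).
  by apply/(semigroup_generator HT); [exact/to_sqi|exact/to_sqi|apply/(sqnorm_cvg hq)].
move=> [_ [g1 [g2 [hH E]]]]; exists g1, g2; split => // phi p1 p2 hphi.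
have [_ h1 h2] := H10_sqi hH; have [hp k1 k2] := H10_sqi hphi.
have := E phi p1 p2 hphi; rewrite energyE// (dotL2E leb2 D f) => ->.
by rewrite (ipNl mD hf hv hp) opprK.
Qed.

Lemma gen_le0 u v : sqi u -> sqi v -> gen u v -> dot v u <= 0.
Proof.
move=> hu hv g; have [g1 [g2 [hH E]]] := gen_form hu hv g.
rewrite (E _ _ _ hH) oppr_le0; apply: addr_ge0; apply: ip_ge0 => x Dx.
  by rewrite invr_ge0 (le_trans (ltW c0))// cf.
by rewrite (le_trans (ltW c0))// cf.
Qed.

Lemma gen_sym u v u' v' : sqi u -> sqi v -> sqi u' -> sqi v' ->
  gen u v -> gen u' v' -> dot v u' = dot u v'.
Proof.
move=> hu hv hu' hv' g g'; have [g1 [g2 [hH E]]] := gen_form hu hv g.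
have [k1 [k2 [hH' E']]] := gen_form hu' hv' g'.
by rewrite (E _ _ _ hH') [RHS]ipC (E' _ _ _ hH) [X in X + _]ipC [X in _ + X]ipC.
Qed.

(* Testing the equation with [b^2 u] gives the energy of [b u] up to a term in [b'^2]. *)
Lemma weighted_energy u v (b : R -> R) (M : R) : sqi u -> sqi v -> gen u v -> smooth1 b ->
  (forall s, `|b s| <= M) -> (forall s, `|derive1 b s| <= M) ->
  exists g1 g2, H10_space D (fun x => b x.1 * u x) g1 g2 /\
    dot v (fun x => b x.1 * (b x.1 * u x)) =
    ip (fun x => (f x)^-1 * derive1 b x.1 ^+ 2) u u - (ip (fun x => (f x)^-1) g1 g1 + ip f g2 g2).
Proof.
move=> hu hv g sb bM b'M; have [g1 [g2 [hH E]]] := gen_form hu hv g.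
have hH1 := H10_mul sb bM b'M hH; have hH2 := H10_mul sb bM b'M hH1.
have [_ h1 h2] := H10_sqi hH; have [_ k1 k2] := H10_sqi hH1; have [_ l1 l2] := H10_sqi hH2.
exists (fun x => derive1 b x.1 * u x + b x.1 * g1 x), (fun x => b x.1 * g2 x); split => //.
rewrite (E _ _ _ hH2).
have hb' : bdm (fun x => derive1 b x.1).
  by apply: bdm_lift b'M; apply: continuous_measurable_fun; apply: smooth1_cont; exact: smooth1_derive1.
have hb'2 : bdm (fun x => (f x)^-1 * derive1 b x.1 ^+ 2).
  rewrite (_ : (fun x => _) = fun x => (f x)^-1 * (derive1 b x.1 * derive1 b x.1)).
    exact: bdmM hfV (bdmM hb' hb').
  by apply/funext => x; rewrite expr2.
have E1 : ip (fun x => (f x)^-1) g1 (fun x => derive1 b x.1 * (b x.1 * u x) + b x.1 * (derive1 b x.1 * u x + b x.1 * g1 x)) +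
    ip (fun x => (f x)^-1 * derive1 b x.1 ^+ 2) u u =
    ip (fun x => (f x)^-1) (fun x => derive1 b x.1 * u x + b x.1 * g1 x) (fun x => derive1 b x.1 * u x + b x.1 * g1 x).
  rewrite /ip -RintegralD//; [|exact: (rint_ip mD hfV h1 l1)|exact: (rint_ip mD hb'2 hu hu)].
  by apply: eq_Rintegral => x _; move: (f x)^-1 (derive1 b x.1) (b x.1) => p q r; ring.
have E2 : ip f g2 (fun x => b x.1 * (b x.1 * g2 x)) = ip f (fun x => b x.1 * g2 x) (fun x => b x.1 * g2 x).
  by apply: eq_Rintegral => x _; move: (b x.1) => r; ring.
have alg (p q r s : R) : p + q = r -> - (p + s) = q - (r + s) by lra.
by rewrite E2; exact: alg E1.
Qed.

End strip_semigroup.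

(** * The truncated square *)

Section truncated_square.
Context {R : realType}.
Implicit Types (k s : R).

(** Bounded by 1 / k, it keeps the relation between s^2 and its derivative in the form (tsq')^2 <= 4
    tsq, uniformly in k. *)
Definition tsq k s : R := s ^+ 2 * rat_weight k s.

Lemma tsq_ge0 k s : 0 <= k -> 0 <= tsq k s.
Proof. by move=> k0; rewrite mulr_ge0 ?sqr_ge0// ltW// rat_weight_gt0. Qed.

Lemma tsq_le_sqr k s : 0 <= k -> tsq k s <= s ^+ 2.
Proof. by move=> k0; rewrite ler_piMr ?sqr_ge0// rat_weight_le1. Qed.

Lemma tsq_le k s : 0 < k -> tsq k s <= k^-1.
Proof.
move=> k0; rewrite -[leRHS]mul1r ler_pdivlMr// mulrC mulrA rat_weight_id ?(ltW k0)//.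
by rewrite gerBl ltW// rat_weight_gt0// ltW.
Qed.

Lemma smooth1_tsq k : 0 <= k -> smooth1 (tsq k).
Proof.
by move=> k0 n; apply: ncontM; [apply: ncontX; exact: ncont_id|exact: smooth1_rat_weight].
Qed.

Lemma tsq_derive k s : 0 <= k -> derive1 (tsq k) s = 2 * s * rat_weight k s ^+ 2.
Proof.
move=> k0; have d2 : is_derive s 1 (fun s : R => s * s) (s *: 1 + s *: 1) by apply: is_deriveM.
have d := is_deriveM d2 (rat_weight_is_derive s k0).
have -> : tsq k = (fun s : R => s * s * rat_weight k s) by apply/funext => t; rewrite /tsq expr2.
have [_ E] := d; rewrite derive1E E /GRing.scale/=.
have I := rat_weight_id s k0.
have -> : s * s * (- (2 * k * s) * rat_weight k s ^+ 2) + rat_weight k s * (s * 1 + s * 1) =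
  2 * s * rat_weight k s * (1 - k * s ^+ 2 * rat_weight k s) by ring.
by rewrite I; ring.
Qed.

Lemma tsq_derive_sqr k s : 0 <= k -> derive1 (tsq k) s ^+ 2 <= 4 * tsq k s.
Proof.
move=> k0; rewrite tsq_derive// /tsq; have r0 := rat_weight_gt0 s k0; have r1 := rat_weight_le1 s k0.
have -> : (2 * s * rat_weight k s ^+ 2) ^+ 2 = 4 * (s ^+ 2 * rat_weight k s) * rat_weight k s ^+ 3 by ring.
by rewrite ler_piMr ?exprn_ile1 ?(ltW r0)// mulr_ge0// mulr_ge0 ?sqr_ge0// ltW.
Qed.

Lemma decreasing_on_segment (F F' : R -> R) (s t : R) : s <= t ->
  (forall r : R, s <= r <= t -> is_derive r 1 F (F' r)) -> (forall r : R, s <= r <= t -> F' r <= 0) ->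
  F t <= F s.
Proof.
rewrite le_eqVlt => /orP[/eqP -> //|st] dF F0.
have [||xi] := @MVT R F F' s t st.
- by move=> r; rewrite in_itv/= => /andP[sr rt]; apply: dF; rewrite !ltW.
- by apply: derivable_within_continuous => r; rewrite in_itv/= => hr; apply: ex_derive; exact: dF.
rewrite in_itv/= => /andP[sxi xit] E.
have := F0 xi; rewrite (ltW sxi) (ltW xit) => /(_ isT) h.
by rewrite -subr_le0 E mulr_le0_ge0// subr_ge0 ltW.
Qed.

Lemma right_limitP (g : R -> R) (l : R) : (g t @[t --> (0 : R)^'+] --> l) <->
  (forall e, 0 < e -> exists2 del : R, 0 < del & forall t, 0 < t -> t < del -> `|g t - l| < e).
Proof.
split=> [/cvgrPdist_lt h e e0|h].
  have /nbhs_ballP[del /= del0 hd] := h e e0; exists del => // t t0 td.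
  by have := hd t; rewrite /ball/= sub0r normrN gtr0_norm// => /(_ td t0); rewrite distrC.
apply/cvgrPdist_lt => e e0; have [del del0 hd] := h e e0.
apply/nbhs_ballP; exists del => //= t; rewrite /ball/= sub0r normrN => td t0.
by rewrite distrC hd//; move: td; rewrite gtr0_norm.
Qed.

End truncated_square.

Section orbit_limits.
Context d (T : measurableType d) (R : realType) (mu : {measure set T -> \bar R}).
Variables (D : set T) (mD : measurable D) (w : T -> R) (c : R).
Hypotheses (hw : bdm D w) (c0 : 0 < c) (cw : forall x, D x -> c <= w x).
Implicit Types (u v b : T -> R) (t : R).
Local Notation sqi := (sqi mu D).
Local Notation nrm := (nrm mu D w).
Variable S : R -> (T -> R) -> T -> R.
Hypothesis HS : L2_semigroup mu D w S.
Hypothesis contr : forall t u, 0 <= t -> sqi u -> nrm (S t u) <= nrm u.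

Let weight_bound b : bdm D b -> exists2 B : R, 0 < B & forall u, sqi u -> nrm (fun x => b x * u x) <= B * nrm u.
Proof.
move=> hb; have [_ [M hM]] := hb; exists (`|M| + 1); first by rewrite ltr_wpDl.
move=> u hu; apply: (nrmM_le mD hw c0 cw) => // x Dx.
by rewrite (le_trans (hM x Dx))// (le_trans (ler_norm M))// lerDl.
Qed.

Let weight_diff b u v : sqi u -> sqi v -> bdm D b ->
  `|nrm (fun x => b x * u x) - nrm (fun x => b x * v x)| <= nrm (fun x => b x * (u x - v x)).
Proof.
move=> hu hv hb; have := nrm_lip mD hw c0 cw (sqiM mD hb hu) (sqiM mD hb hv).
by congr (_ <= nrm _); apply/funext => x; rewrite mulrBr.
Qed.

Lemma orbit_weight_limit b u : bdm D b -> sqi u ->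
  nrm (fun x => b x * S t u x) @[t --> (0 : R)^'+] --> nrm (fun x => b x * u x).
Proof.
move=> hb hu; have [B B0 hB] := weight_bound hb.
apply/right_limitP => e e0; have [del del0 hd] := sg_continuous HS hu (divr_gt0 e0 B0).
exists del => // t t0 td; have hS := sg_L2 HS (ltW t0) hu.
apply: le_lt_trans (weight_diff hS hu hb) _; apply: le_lt_trans (hB _ (sqiB mD hS hu)) _.
by rewrite mulrC -ltr_pdivlMr// hd.
Qed.

(** Both weighted norms are continuous on L^2, because the multipliers are bounded and the semigroup
    is contractive. An estimate on arbitrarily close domain vectors therefore extends to [psi]. *)
Lemma orbit_density_bound b b1 t psi (A C : R) : bdm D b -> bdm D b1 -> sqi psi -> 0 <= t -> 0 <= A ->
  (forall e, 0 < e -> exists u, [/\ sqi u, nrm (fun x => u x - psi x) < e &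
     nrm (fun x => b1 x * S t u x) ^+ 2 <= A * nrm (fun x => b x * u x) ^+ 2 + C]) ->
  nrm (fun x => b1 x * S t psi x) ^+ 2 <= A * nrm (fun x => b x * psi x) ^+ 2 + C.
Proof.
have alg (x x' y y' k A' C' : R) : 0 <= x -> 0 <= y -> 0 <= x' -> 0 <= y' -> 0 <= k -> k <= 1 -> 0 <= A' ->
    `|x - x'| <= k -> `|y - y'| <= k -> x' ^+ 2 <= A' * y' ^+ 2 + C' ->
    x ^+ 2 <= A' * y ^+ 2 + C' + k * (A' * (2 * y + 1) + (2 * x + 1)).
  move=> x0 y0 x'0 y'0 k0 k1 A0 /ler_normlP[x1 x2] /ler_normlP[y1 y2] h.
  have h1 : x ^+ 2 <= x' ^+ 2 + k * (2 * x + 1) by nra.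
  have h2 : y' ^+ 2 <= y ^+ 2 + k * (2 * y + 1) by nra.
  have h3 := ler_wpM2l A0 h2; move: h h1 h3; rewrite !mulrDr !mulrA; lra.
move=> hb hb1 hpsi t0 A0 H; have [B B0 hB] := weight_bound hb; have [B1 B10 hB1] := weight_bound hb1.
set x := nrm (fun x => b1 x * S t psi x); set y := nrm (fun x => b x * psi x).
have x0 : 0 <= x by exact: nrm_ge0. have y0 : 0 <= y by exact: nrm_ge0.
apply/ler_addgt0Pr => e e0; pose Z := A * (2 * y + 1) + (2 * x + 1).
have Z0 : 0 < Z by rewrite ltr_wpDl ?mulr_ge0 ?addr_ge0 ?mulr_ge0// ltr_wpDl// mulr_ge0.
pose k := Num.min 1 (e / Z); have k0 : 0 < k by rewrite lt_min ltr01 divr_gt0.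
have [u [hu nu hu2]] := H (k / (B + B1)) (divr_gt0 k0 (addr_gt0 B0 B10)).
have kk : (B + B1) * (k / (B + B1)) = k by rewrite mulrCA divff ?mulr1// gt_eqF// addr_gt0.
have kp : 0 <= k / (B + B1) by rewrite divr_ge0 ?addr_ge0// ltW.
have hS := sg_L2 HS t0 hu; have hSp := sg_L2 HS t0 hpsi.
have dx : `|x - nrm (fun x => b1 x * S t u x)| <= k.
  rewrite distrC; apply: le_trans (weight_diff hS hSp hb1) _.
  apply: le_trans (hB1 _ (sqiB mD hS hSp)) _.
  rewrite -(eqv_nrm mD hw c0 cw (S_subE mD HS t0 hu hpsi)).
  apply: (@le_trans _ _ (B1 * (k / (B + B1)))).
    by rewrite (ler_pM2l B10) (le_trans (contr t0 (sqiB mD hu hpsi)))// ltW.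
  by rewrite -[leRHS]kk ler_wpM2r// lerDr ltW.
have dy : `|y - nrm (fun x => b x * u x)| <= k.
  rewrite distrC; apply: le_trans (weight_diff hu hpsi hb) _.
  apply: le_trans (hB _ (sqiB mD hu hpsi)) _.
  apply: (@le_trans _ _ (B * (k / (B + B1)))); first by rewrite (ler_pM2l B0) ltW.
  by rewrite -[leRHS]kk ler_wpM2r// lerDl ltW.
have k1 : k <= 1 by rewrite ge_min lexx.
have := alg _ _ _ _ _ _ _ x0 y0 (nrm_ge0 _ _ _ _) (nrm_ge0 _ _ _ _) (ltW k0) k1 A0 dx dy hu2.
move=> /le_trans; apply; rewrite lerD2l -ler_pdivlMr//.
by rewrite /k ge_min lexx orbT.
Qed.

End orbit_limits.

(** * Differential inequality for the weighted norm *)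

Section main_decay.
Context {R : realType} (a c L e tau0 : R) (f : plane R -> R) (m : nat).
Variable S : R -> (plane R -> R) -> plane R -> R.
Local Notation D := (strip a).
Local Notation bdm := (bdm D).
Local Notation sqi := (sqi leb2 D).
Local Notation ip := (ip leb2 D).
Local Notation dot := (ip f).
Local Notation nrm := (nrm leb2 D f).
Local Notation gen := (gen leb2 D f S).
Hypotheses (hf : bdm f) (c0 : 0 < c) (cf : forall x, D x -> c <= f x) (L0 : 0 < L).
Hypothesis f1 : {ae leb2, forall x : plane R, D x -> L < `|x.1 : R| -> f x = 1}.
Hypothesis HT : exp_semigroup D f (H_K a f) S.
Hypotheses (e0 : 0 < e) (m0 : (0 < m)%N) (tau1 : 1 <= tau0) (tauL : L ^+ 2 / (4 * c ^+ 2 * e) <= tau0).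
Hypothesis lower : forall tau, tau0 <= tau -> forall phi, test_function D phi ->
  (3 - e) / (4 * tau) * ip f phi phi <= qform a f phi + ip (fun x => f x * confinement m tau x.1) phi phi.
Implicit Types (u v psi : plane R -> R).

Let mD : measurable D := strip_measurable a.
Let hfV : bdm (fun x => (f x)^-1) := bdmV hf c0 cf.
Let HS := strip_L2_semigroup hf c0 cf HT.
Let contr t u : 0 <= t -> sqi u -> nrm (S t u) <= nrm u.
Proof.
move=> t0 hu; exact: (contraction mD hf c0 cf HS (gen_le0 hf c0 cf HT) hu t0).
Qed.

Let tau_gt0 tau : tau0 <= tau -> 0 < tau.
Proof. by apply: lt_le_trans; rewrite (lt_le_trans ltr01). Qed.

Let confinement_bdm tau : tau0 <= tau -> bdm (fun x => confinement m tau x.1).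
Proof.
move=> /tau_gt0 t0; have mt : 0 < 4 * m%:R * tau by rewrite !mulr_gt0// ltr0n.
have k0 : 0 < (4 * m%:R * tau)^-1 by rewrite invr_gt0.
have s1 := smooth1_tsq (ltW k0).
have -> : (fun x : plane R => confinement m tau x.1) =
    fun x => (16 * tau ^+ 2)^-1 * tsq (4 * m%:R * tau)^-1 x.1.
  by apply/funext => x; rewrite /confinement /tsq mulrAC mulrC.
apply: bdmM (bdm_cst _ _) _; apply: (smooth1_bdm s1) => s.
by rewrite ger0_norm ?tsq_ge0 ?(ltW k0)//; exact: tsq_le.
Qed.

Lemma confined_lower_bound_H10 tau u g1 g2 : tau0 <= tau -> H10_space D u g1 g2 ->
  ((3 - e) / (4 * tau) + E1 a) * dot u u <=
  ip (fun x => (f x)^-1) g1 g1 + dot g2 g2 + ip (fun x => f x * confinement m tau x.1) u u.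
Proof.
have alg (A B E q r s z : R) : A * B <= q + r - E * B + z -> 0 <= z - (A + E) * B + (q + r) by lra.
have alg' (x y z w : R) : 0 <= x - y + (z + w) -> y <= z + w + x by lra.
move=> tt hH; have hU := confinement_bdm tt.
have hfU : bdm (fun x => f x * confinement m tau x.1) := bdmM hf hU.
pose K := (3 - e) / (4 * tau) + E1 a.
have hK : bdm (fun x => - K * f x) := bdmM (bdm_cst D _) hf.
have hal : bdm (fun x => f x * confinement m tau x.1 + - K * f x) := bdmD hfU hK.
have split p : sqi p -> ip (fun x => f x * confinement m tau x.1 + - K * f x) p p =
    ip (fun x => f x * confinement m tau x.1) p p - K * dot p p.
  by move=> hp; rewrite (ipwD mD hfU hK hp hp) (ipwZ mD _ hf hp hp) mulNr.
have [hu _ _] := H10_sqi hH.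
have := H10_closure hal hfV hf _ hH; rewrite split// => H; apply: alg'; apply: H => phi t.
by rewrite (split _ (test_sqi t)); have := lower tt t; rewrite /qform; exact: alg.
Qed.

(** The integrand comparison behind the decay, with F = f, g the truncated square, G = g', A = 1 + l
    g, B0 = A^(m-1) and U the confinement. The commutator term F^-1 b'^2 costs one unit of (B0 / (4
    tau))^2 g, and the decrease of the weight in time yields two. Where f differs from 1, g <= L^2
    is bounded, and the e-term pays because tau >= L^2 / (4 c^2 e). *)
Let pointwise (F g G A U B0 tau : R) : tau0 <= tau -> 0 <= g -> G ^+ 2 <= 4 * g -> 1 <= A ->
  U * A <= g / (16 * tau ^+ 2) -> c <= F -> (F = 1 \/ g <= L ^+ 2) ->
  F^-1 * ((8 * tau)^-1 * B0 * G) ^+ 2 + - 8 * (8 * tau)^-1 ^+ 2 * (F * (g * (B0 * (A * B0)))) <=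
  (- (F * U) + e / (4 * tau) * F) * (A * B0) ^+ 2.
Proof.
have alg (x y z : R) : x <= y + z -> x + - 2 * y <= - y + z by lra.
move=> tt g0 Gg A1 UA cF FL; have t0 := tau_gt0 tt; have F0 : 0 < F by exact: lt_le_trans cF.
have tn : tau != 0 by rewrite gt_eqF.
have p4 : 0 <= 4 * tau * e := mulr_ge0 (mulr_ge0 (ler0n _ 4) (ltW t0)) (ltW e0).
have A0 : 0 <= A := le_trans ler01 A1.
have core : F^-1 * g <= F * g * A + 4 * tau * e * F * A ^+ 2.
  have A2 : 1 <= A ^+ 2 by rewrite exprn_ege1.
  case: FL => [->|gL].
    rewrite invr1 !mul1r mulr1; have := mulr_ge0 p4 (sqr_ge0 A).
    by have := ler_peMr g0 A1; move: (4 * tau * e * A ^+ 2) (g * A) => x y; lra.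
  have h1 : F^-1 * g <= c^-1 * L ^+ 2.
    by apply: ler_pM; rewrite ?invr_ge0 ?(ltW F0)// lef_pV2 ?posrE.
  have h2 : c^-1 * L ^+ 2 <= 4 * tau * e * c.
    have := le_trans tauL tt; rewrite ler_pdivrMr ?mulr_gt0 ?exprn_gt0// => h.
    rewrite mulrC ler_pdivrMr//; apply: le_trans h _; rewrite le_eqVlt; apply/orP; left; apply/eqP; ring.
  have h3 : 4 * tau * e * c <= 4 * tau * e * F * A ^+ 2.
    rewrite -[leLHS]mulr1; apply: ler_pM => //; first exact: mulr_ge0 p4 (ltW c0).
    exact: ler_wpM2l p4 _ _ cF.
  have h4 : 0 <= F * g * A := mulr_ge0 (mulr_ge0 (ltW F0) g0) A0.
  by apply: le_trans h1 _; apply: le_trans h2 _; apply: le_trans h3 _; rewrite lerDr.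
have q1 : F^-1 * ((8 * tau)^-1 * B0 * G) ^+ 2 <= (B0 / (4 * tau)) ^+ 2 * (F^-1 * g).
  have -> : F^-1 * ((8 * tau)^-1 * B0 * G) ^+ 2 = (B0 / (4 * tau)) ^+ 2 * (F^-1 * (G ^+ 2 / 4)).
    by field; rewrite tn gt_eqF.
  rewrite ler_wpM2l ?sqr_ge0// ler_wpM2l ?invr_ge0 ?(ltW F0)// ler_pdivrMr// mulrC.
  exact: Gg.
have q2 : - 8 * (8 * tau)^-1 ^+ 2 * (F * (g * (B0 * (A * B0)))) =
    (B0 / (4 * tau)) ^+ 2 * (- 2 * (F * g * A)) by field.
have q3 : (B0 / (4 * tau)) ^+ 2 * (- (F * g * A) + 4 * tau * e * F * A ^+ 2) <=
    (- (F * U) + e / (4 * tau) * F) * (A * B0) ^+ 2.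
  have -> : (B0 / (4 * tau)) ^+ 2 * (- (F * g * A) + 4 * tau * e * F * A ^+ 2) =
    - (g / (16 * tau ^+ 2) * (F * A * B0 ^+ 2)) + e / (4 * tau) * F * (A * B0) ^+ 2 by field.
  rewrite [leRHS]mulrDl lerD2r mulNr lerN2.
  have -> : F * U * (A * B0) ^+ 2 = U * A * (F * A * B0 ^+ 2) by ring.
  by rewrite ler_wpM2r// (mulr_ge0 (mulr_ge0 (ltW F0) A0) (sqr_ge0 B0)).
apply: le_trans q3; rewrite q2; apply: le_trans (lerD q1 (lexx _)) _.
rewrite -mulrDr ler_wpM2l ?sqr_ge0//.
exact: alg core.
Qed.

Section one_orbit.
Variables (kap : R) (u v : plane R -> R).
Hypotheses (kap0 : 0 < kap) (hu : sqi u) (hv : sqi v) (guv : gen u v).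
Let g (x1 : R) := tsq kap x1.
Let g0 x1 : 0 <= g x1 := tsq_ge0 x1 (ltW kap0).
Let sg : smooth1 g := smooth1_tsq (ltW kap0).
Let hg : bdm (fun x => g x.1).
Proof. by apply: (smooth1_bdm sg (M := kap^-1)) => s; rewrite ger0_norm ?g0// tsq_le. Qed.

(** (1 + rate g)^m imitates exp(x1^2 / (8 tau)) with tau = tau0 + s. The factor m in the denominator
    makes m rate = 1 / (8 tau) independent of m. *)
Definition rate (s : R) : R := (8 * m%:R * (tau0 + s))^-1.

Let m1 : (m%:R : R) != 0. Proof. by rewrite pnatr_eq0 -lt0n. Qed.
Let ts0 s : 0 <= s -> 0 < tau0 + s.
Proof. by move=> s0; rewrite (lt_le_trans ltr01)// (le_trans tau1)// lerDl. Qed.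
Let rate_gt0 s : 0 <= s -> 0 < rate s.
Proof. by move=> /ts0 h; rewrite invr_gt0 !mulr_gt0// ltr0n. Qed.

Let rate_is_derive (s : R) : 0 <= s -> is_derive s 1 rate (- 8 * m%:R * rate s ^+ 2).
Proof.
move=> s0; have n0 : 8 * m%:R * (tau0 + s) != 0 by rewrite gt_eqF// !mulr_gt0 ?ts0// ltr0n.
have d1 : is_derive s 1 (fun s : R => 8 * m%:R * (tau0 + s)) (8 * m%:R * (0 + 1)).
  by apply: is_deriveZ; apply: is_deriveD.
have := @is_deriveV R (fun s : R => 8 * m%:R * (tau0 + s)) s _ 1 n0 d1.
by move=> H; apply: (is_derive_eq H); rewrite /rate /GRing.scale/= exprVn; ring.
Qed.

Definition growth (l x1 : R) : R := (1 + l * g x1) ^+ m.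

Let A1 l x1 : 0 <= l -> 1 <= 1 + l * g x1.
Proof. by move=> l0; rewrite lerDl mulr_ge0. Qed.

Let smooth1_growth l : smooth1 (growth l).
Proof.
by move=> n; apply: ncontX; apply: ncontD; [exact: ncont_cst|apply: ncontZ; exact: sg].
Qed.

Let growth_le l x1 : 0 <= l -> `|growth l x1| <= (1 + l / kap) ^+ m.
Proof.
move=> l0; have h := A1 x1 l0; rewrite ger0_norm ?exprn_ge0 ?(le_trans ler01)//.
rewrite ler_pXn2r ?nnegrE ?(le_trans ler01)//; last by rewrite lerDl divr_ge0// ltW.
by rewrite lerD2l ler_wpM2l// tsq_le.
Qed.

Let growth_derive l x1 : derive1 (growth l) x1 = m%:R * (l * derive1 g x1 * (1 + l * g x1) ^+ m.-1).
Proof.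
have d1 : is_derive x1 1 (fun s : R => 1 + l * g s) (0 + l * derive1 g x1).
  by apply: is_deriveD; apply: is_deriveZ; exact: smooth1_is_derive.
have H (n : nat) : is_derive x1 1 (fun s : R => (1 + l * g s) ^+ n) (n%:R * (l * derive1 g x1 * (1 + l * g x1) ^+ n.-1)).
  elim: n => [|n IH].
    by rewrite mul0r (_ : (fun s => _) = cst 1); [exact: is_derive_cst|apply/funext => s; rewrite expr0].
  rewrite (_ : (fun s => _) = fun s => (1 + l * g s) * (1 + l * g s) ^+ n); last by apply/funext => s; rewrite exprS.
  have := is_deriveM d1 IH => H; apply: (is_derive_eq H); rewrite /GRing.scale/= add0r.
  case: n {IH H} => [|n]; first by rewrite /= !expr0; ring.
  by rewrite -[in RHS]natr1 /= [in LHS]exprS [in RHS]exprS; ring.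
by have [_ E] := H m; rewrite derive1E.
Qed.

Let g'_le x1 : `|derive1 g x1| <= 1 + 4 / kap.
Proof.
have h := tsq_derive_sqr x1 (ltW kap0); have h' := tsq_le x1 kap0.
have k0 : 0 <= 4 / kap by rewrite divr_ge0// ltW.
rewrite -(@ler_pXn2r _ 2)// ?nnegrE ?addr_ge0// real_normK ?num_real//.
apply: le_trans h _; apply: (@le_trans _ _ (4 / kap)); first by rewrite ler_wpM2l.
by move: (4 / kap) k0 => z z0; nra.
Qed.

Let growth'_le l x1 : 0 <= l -> `|derive1 (growth l) x1| <= m%:R * (l * (1 + 4 / kap) * (1 + l / kap) ^+ m.-1).
Proof.
move=> l0; rewrite growth_derive normrM ger0_norm// ler_wpM2l// normrM; apply: ler_pM => //.
  by rewrite normrM ger0_norm// ler_wpM2l.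
have h := A1 x1 l0; rewrite ger0_norm ?exprn_ge0 ?(le_trans ler01)//.
apply: lerXn2r; rewrite ?nnegrE ?(le_trans ler01)//; first by rewrite lerDl divr_ge0// ltW.
by rewrite lerD2l ler_wpM2l// tsq_le.
Qed.

Let curve (j : nat) (s : R) : plane R -> R := fun x => (1 + rate s * g x.1) ^+ j * S s u x.

(** Induction on the exponent: one more factor 1 + rate g adds to the curve its product with a real
    function of time and a bounded multiplier. *)
Let curve_cdiff j s : 0 < s -> cdiff leb2 D f (curve j) s
  (fun x => (1 + rate s * g x.1) ^+ j * S s v x +
     j%:R * (- 8 * m%:R * rate s ^+ 2 * g x.1 * (1 + rate s * g x.1) ^+ j.-1) * S s u x).
Proof.
move=> s0; elim: j => [|j IH].
  have := gen_cdiff mD hf c0 cf HS hu hv guv s0.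
  congr cdiff; first by apply/funext => r; apply/funext => x; rewrite /curve expr0 mul1r.
  by apply/funext => x; rewrite expr0 mul1r !mul0r addr0.
have := cdiffD mD hf c0 cf IH (cdiffZ mD hf c0 cf (rate_is_derive (ltW s0)) (cdiffM mD hf c0 cf hg IH)).
congr cdiff; first by apply/funext => r; apply/funext => x; rewrite /curve exprS; ring.
apply/funext => x; rewrite /curve; move: (S s u x) (S s v x) (g x.1) => y y' z.
case: j {IH} => [|j]; first by rewrite !expr0 expr1; ring.
by rewrite -[in RHS]natr1 /= !exprS; ring.
Qed.

Let growth_mass s : R := dot (curve m s) (curve m s).
Let curve' s : plane R -> R := fun x => growth (rate s) x.1 * S s v x +
  m%:R * (- 8 * m%:R * rate s ^+ 2 * g x.1 * (1 + rate s * g x.1) ^+ m.-1) * S s u x.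

Let mass_is_derive (s : R) : 0 < s -> is_derive s 1 growth_mass (2 * dot (curve' s) (curve m s)).
Proof.
move=> s0; have dz := curve_cdiff m s0; have H := cdiff_dot mD hf c0 cf dz dz.
by apply: (is_derive_eq H); rewrite [X in _ + X]ipC -mulr2n mulr_natl.
Qed.

(** (4 m tau)^-1 is twice the rate, so the truncation of the confinement absorbs the factor 1 + rate
    g, provided that the truncation [kap] of g is no stronger than the rate. *)
Let confinement_growth s x1 : 0 <= s -> kap <= rate s ->
  confinement m (tau0 + s) x1 * (1 + rate s * g x1) <= g x1 / (16 * (tau0 + s) ^+ 2).
Proof.
move=> s0 kr; have l0 := rate_gt0 s0; have t0 := ts0 s0.
have E : (4 * m%:R * (tau0 + s))^-1 = 2 * rate s.
  by rewrite /rate; field; rewrite m1 gt_eqF.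
have n0 := rat_den_gt0 x1 (ltW kap0); have n1 := rat_den_gt0 x1 (mulr_ge0 (ler0n R 2) (ltW l0)).
have core : rat_weight (2 * rate s) x1 * (1 + rate s * g x1) <= rat_weight kap x1.
  have r0 := rat_weight_gt0 x1 (ltW kap0).
  rewrite /rat_weight ler_pdivrMl// -/(rat_weight kap x1) /g /tsq.
  have {1}-> : 1 = rat_weight kap x1 * (1 + kap * x1 ^+ 2) by rewrite /rat_weight mulVf ?gt_eqF.
  rewrite mulrA -[rat_weight kap x1 * _]mulrC -mulrDl ler_wpM2r ?(ltW r0)//.
  have := ler_wpM2r (sqr_ge0 x1) kr; move: (rate s) => l; lra.
rewrite /confinement E -mulrA (_ : g x1 / _ = x1 ^+ 2 / (16 * (tau0 + s) ^+ 2) * rat_weight kap x1).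
  by rewrite ler_wpM2l// (divr_ge0 (sqr_ge0 _) (mulr_ge0 (ler0n _ 16) (sqr_ge0 _))).
by rewrite /g /tsq mulrAC.
Qed.

(** Twice the spectral bound (3 - e) / (4 tau) + E_1, less twice the error e / (4 tau), is 2 E_1 +
    (3/2 - e) / tau. *)
Let mass_derive_le s : 0 < s -> kap <= rate s ->
  2 * dot (curve' s) (curve m s) <= - (2 * E1 a + (3 / 2 - e) / (tau0 + s)) * growth_mass s.
Proof.
have alg (dzz q w En V M E tau : R) : dzz = q - En + w -> q + w <= - V + e / (4 * tau) * M ->
  ((3 - e) / (4 * tau) + E) * M <= En + V -> tau != 0 -> 2 * dzz <= - (2 * E + (3 / 2 - e) / tau) * M.
  move=> -> h1 h2 t1; have -> : - (2 * E + (3 / 2 - e) / tau) * M =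
    2 * (e / (4 * tau) * M) - 2 * (((3 - e) / (4 * tau) + E) * M) by field.
  lra.
move=> s0 kr; have s0' := ltW s0; have tt : tau0 <= tau0 + s by rewrite lerDl.
have hSu := sg_L2 HS s0' hu; have hSv := sg_L2 HS s0' hv.
have gS := gen_S mD hf c0 cf HS hu hv guv s0'.
have l0 := ltW (rate_gt0 s0'); pose l := rate s; pose b := growth l; pose b' := derive1 b.
have sb : smooth1 b := smooth1_growth l.
have b_le := fun x1 => growth_le x1 l0; have b'_le := fun x1 => growth'_le x1 l0.
set M1 := (1 + l / kap) ^+ m in b_le; set M2 := m%:R * _ in b'_le.
have hb : bdm (fun x => b x.1) := smooth1_bdm sb b_le.
have hb' : bdm (fun x => b' x.1) := smooth1_bdm (smooth1_derive1 sb) b'_le.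
have bM x1 : `|b x1| <= M1 + M2 by rewrite (le_trans (b_le x1))// lerDl (le_trans _ (b'_le 0)).
have b'M x1 : `|derive1 b x1| <= M1 + M2 by rewrite (le_trans (b'_le x1))// lerDr (le_trans _ (b_le 0)).
have [g1 [g2 [hH E]]] := weighted_energy hf c0 cf HT hSu hSv gS sb bM b'M.
pose B0 x1 := (1 + l * g x1) ^+ m.-1.
pose k (x : plane R) := m%:R * (- 8 * m%:R * l ^+ 2 * g x.1 * B0 x.1).
have hB0 : bdm (fun x => B0 x.1).
  apply: (smooth1_bdm (M := (1 + l / kap) ^+ m.-1)).
    by move=> n; apply: ncontX; apply: ncontD; [exact: ncont_cst|apply: ncontZ; exact: sg].
  move=> x1; have h := A1 x1 l0; rewrite ger0_norm ?exprn_ge0 ?(le_trans ler01)//.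
  apply: lerXn2r; rewrite ?nnegrE ?(le_trans ler01)//; first by rewrite lerDl divr_ge0// ltW.
  by rewrite lerD2l ler_wpM2l// tsq_le.
have hk : bdm k.
  have h1 := bdmM (bdm_cst D m%:R) (bdmM (bdmM (bdm_cst D (- 8 * m%:R * l ^+ 2)) hg) hB0).
  exact: h1.
have hkb : bdm (fun x => f x * (k x * b x.1)) := bdmM hf (bdmM hk hb).
have hbS := sqiM mD hb hSu; have hbS' := sqiM mD hb hbS; have hkS := sqiM mD hk hSu.
have zE : curve m s = (fun x => b x.1 * S s u x) by [].
have E0 : dot (curve' s) (curve m s) = dot (S s v) (fun x => b x.1 * (b x.1 * S s u x)) +
    ip (fun x => f x * (k x * b x.1)) (S s u) (S s u).
  have hbv := sqiM mD hb hSv.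
  have -> : dot (curve' s) (curve m s) = dot (fun x => b x.1 * S s v x) (fun x => b x.1 * S s u x) +
      dot (fun x => k x * S s u x) (fun x => b x.1 * S s u x).
    by rewrite -(ipDl mD hf hbv hkS hbS).
  by congr (_ + _); apply: eq_Rintegral => x _; move: (b x.1) (k x) => p q; ring.
have hfb' : bdm (fun x => (f x)^-1 * b' x.1 ^+ 2).
  rewrite (_ : (fun x => _) = fun x => (f x)^-1 * (b' x.1 * b' x.1)).
    exact: bdmM hfV (bdmM hb' hb').
  by apply/funext => x; rewrite expr2.
have hU := confinement_bdm tt; have hfU : bdm (fun x => f x * confinement m (tau0 + s) x.1) := bdmM hf hU.
have hfe : bdm (fun x => e / (4 * (tau0 + s)) * f x) := bdmM (bdm_cst D _) hf.
have hr : bdm (fun x => (- 1 * (f x * confinement m (tau0 + s) x.1) + e / (4 * (tau0 + s)) * f x) * (b x.1 * b x.1)).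
  exact: bdmM (bdmD (bdmM (bdm_cst D _) hfU) hfe) (bdmM hb hb).
have Q : ip (fun x => (f x)^-1 * b' x.1 ^+ 2) (S s u) (S s u) + ip (fun x => f x * (k x * b x.1)) (S s u) (S s u) <=
    - ip (fun x => f x * confinement m (tau0 + s) x.1) (curve m s) (curve m s) +
    e / (4 * (tau0 + s)) * growth_mass s.
  have <- := ipwD mD hfb' hkb hSu hSu.
  have -> : - ip (fun x => f x * confinement m (tau0 + s) x.1) (curve m s) (curve m s) +
      e / (4 * (tau0 + s)) * growth_mass s =
      ip (fun x => (- 1 * (f x * confinement m (tau0 + s) x.1) + e / (4 * (tau0 + s)) * f x) * (b x.1 * b x.1)) (S s u) (S s u).
    rewrite /growth_mass zE -(ipwZ mD _ hf hbS hbS) -[X in X + _]mulN1r -(ipwZ mD _ hfU hbS hbS).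
    rewrite -(ipwD mD (bdmM (bdm_cst D _) hfU) hfe hbS hbS).
    by apply: eq_Rintegral => x _; move: (b x.1) (confinement _ _ _) => p q; ring.
  apply: ip_le_ae => //; first exact: bdmD.
  move: f1; apply: (@filterS _ _ (ae_filter_ringOfSetsType leb2)) => x fx Dx.
  (* b' = m l g' B0; the product m l becomes the 1 / (8 tau) of [pointwise]. *)
  have mk : m%:R * l = (8 * (tau0 + s))^-1 by rewrite /l /rate; field; rewrite m1 gt_eqF// ts0.
  have bE : b x.1 = (1 + l * g x.1) * B0 x.1 by rewrite /b /growth /B0 -exprS prednK.
  have FL : f x = 1 \/ g x.1 <= L ^+ 2.
    have [xL|xL] := leP `|x.1 : R| L; last by left; exact: fx.
    right; apply: le_trans (tsq_le_sqr _ (ltW kap0)) _.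
    by rewrite -[x.1 ^+ 2]real_normK ?num_real// ler_pXn2r ?nnegrE// ltW.
  have := pointwise (B0 x.1) tt (g0 x.1) (tsq_derive_sqr x.1 (ltW kap0)) (A1 x.1 l0)
    (confinement_growth x.1 s0' kr) (cf Dx) FL.
  rewrite -/l -mk -bE /k /b' growth_derive -/(B0 x.1) bE -/l -/g; congr (_ <= _); last by ring.
  by congr (_ * _ + _); ring.
have LB := confined_lower_bound_H10 tt hH.
have tn : tau0 + s != 0 by rewrite gt_eqF// ts0.
rewrite E in E0; exact: alg E0 Q LB tn.
Qed.

(** e^(2 E_1 s) (tau0 + s)^(3/2 - e), the integrating factor for [mass_derive_le]. *)
Definition gauge (s : R) : R := expR (2 * E1 a * s + (3 / 2 - e) * ln (tau0 + s)).

Let gauge_is_derive (s : R) : 0 <= s ->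
  is_derive s 1 gauge (gauge s * (2 * E1 a + (3 / 2 - e) / (tau0 + s))).
Proof.
move=> s0; have d1 : is_derive s 1 (fun s : R => tau0 + s) (0 + 1) by apply: is_deriveD.
have d2 := @is_derive1_comp R (@ln R) (fun s => tau0 + s) s _ _ (is_derive1_ln (ts0 s0)) d1.
have d3 : is_derive s 1 (fun s : R => 2 * E1 a * s) (2 * E1 a * 1) by apply: is_deriveZ.
have d4 : is_derive s 1 (fun s : R => (3 / 2 - e) * ln (tau0 + s)) ((3 / 2 - e) * ((tau0 + s)^-1 * (0 + 1))).
  by apply: (is_deriveZ (3 / 2 - e) d2).
have := @is_derive1_comp R (@expR R) (fun s => 2 * E1 a * s + (3 / 2 - e) * ln (tau0 + s)) s _ _ (is_derive_expR _) (is_deriveD d3 d4).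
by move=> H; apply: (is_derive_eq H); rewrite add0r !mulr1.
Qed.

Let rate_le r s : 0 <= r -> r <= s -> rate s <= rate r.
Proof.
move=> r0 rs; have m8 : 0 < 8 * m%:R :> R by rewrite mulr_gt0// ltr0n.
have rt := ts0 r0; have st := ts0 (le_trans r0 rs).
by rewrite /rate lef_pV2 ?posrE ?(mulr_gt0 m8)// (ler_pM2l m8) lerD2l.
Qed.

Lemma growth_bdm l : 0 <= l -> bdm (fun x => growth l x.1).
Proof. by move=> l0; apply: (smooth1_bdm (smooth1_growth l)) => s; exact: growth_le. Qed.

Let growth_mono (l l' : R) y : 0 <= l -> l <= l' -> sqi y ->
  nrm (fun x => growth l x.1 * y x) ^+ 2 <= nrm (fun x => growth l' x.1 * y x) ^+ 2.
Proof.
move=> l0 ll hy; have l'0 := le_trans l0 ll; have h := growth_bdm l0; have h' := growth_bdm l'0.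
have E (k : R) : nrm (fun x => growth k x.1 * y x) ^+ 2 = ip (fun x => f x * (growth k x.1 * growth k x.1)) y y.
  by rewrite (nrm2 _ c0 cf); apply: eq_Rintegral => x _; ring.
rewrite !E; apply: ip_le => //; [exact: bdmM hf (bdmM h h)|exact: bdmM hf (bdmM h' h')|move=> x Dx].
rewrite ler_wpM2l ?(le_trans (ltW c0) (cf Dx))//.
have a0 := le_trans ler01 (A1 x.1 l0).
have g_ge0 : 0 <= growth l x.1 by rewrite exprn_ge0.
have gg : growth l x.1 <= growth l' x.1.
  apply: lerXn2r; rewrite ?nnegrE ?a0 ?(le_trans ler01 (A1 x.1 l'0))//.
  by rewrite lerD2l ler_wpM2r.
exact: ler_pM.
Qed.

(** Weighted mass times gauge is nonincreasing on (0, p]. At p the weight is bounded below by 1;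
    near 0 it is enlarged to the weight at time 0, which no longer moves, and the right limit is
    taken. *)
Lemma orbit_decay (p : R) : 0 < p -> kap <= rate p ->
  nrm (S p u) ^+ 2 * gauge p <= nrm (fun x => growth (rate 0) x.1 * u x) ^+ 2 * gauge 0.
Proof.
have alg (M G Z W : R) : G * Z <= G * (- W * M) -> M * (G * W) + G * Z <= 0 by lra.
move=> p0 kp; have G0 s : 0 < gauge s := expR_gt0 _.
have massE s : growth_mass s = nrm (fun x => growth (rate s) x.1 * S s u x) ^+ 2.
  by rewrite (nrm2 _ c0 cf).
have step s : 0 < s -> s <= p -> nrm (S p u) ^+ 2 * gauge p <=
    nrm (fun x => growth (rate 0) x.1 * S s u x) ^+ 2 * gauge s.
  move=> s0 sp; have hp := sg_L2 HS (ltW p0) hu; have hs := sg_L2 HS (ltW s0) hu.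
  apply: (@le_trans _ _ (growth_mass p * gauge p)).
    rewrite ler_wpM2r ?(ltW (G0 p))// massE.
    have := growth_mono (lexx 0) (ltW (rate_gt0 (ltW p0))) hp; congr (nrm _ ^+ 2 <= _).
    by apply/funext => x; rewrite /growth mul0r addr0 expr1n mul1r.
  apply: (@le_trans _ _ (growth_mass s * gauge s)); last first.
    rewrite ler_wpM2r ?(ltW (G0 s))// massE; apply: growth_mono => //; first exact: ltW (rate_gt0 (ltW s0)).
    by apply: rate_le => //; exact: ltW.
  pose F' r := growth_mass r * (gauge r * (2 * E1 a + (3 / 2 - e) / (tau0 + r))) +
     gauge r * (2 * dot (curve' r) (curve m r)).
  apply: (@decreasing_on_segment R (fun r => growth_mass r * gauge r) F' _ _ sp) => r /andP[sr rp].
    have r0 := lt_le_trans s0 sr.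
    by have := is_deriveM (mass_is_derive r0) (gauge_is_derive (ltW r0)).
  have r0 := lt_le_trans s0 sr.
  have := mass_derive_le r0 (le_trans kp (rate_le (ltW r0) rp)).
  move=> /(ler_wpM2l (ltW (G0 r))); rewrite /F'.
  exact: alg.
have b0 := growth_bdm (ltW (rate_gt0 (lexx 0))).
have lim : nrm (fun x => growth (rate 0) x.1 * S s u x) ^+ 2 * gauge s @[s --> (0 : R)^'+] -->
    nrm (fun x => growth (rate 0) x.1 * u x) ^+ 2 * gauge 0.
  apply: cvgM.
    have h := orbit_weight_limit mD hf c0 cf HS b0 hu.
    by apply: (cvgM h h).
  apply: cvg_at_right_filter; apply: differentiable_continuous; apply/derivable1_diffP.
  by have [] := gauge_is_derive (lexx 0).
apply: (cvgr_to_ge lim); near=> s; apply: step; near: s; first exact: nbhs_right_gt.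
exact: nbhs_right_le.
Unshelve. all: by end_near. Qed.

End one_orbit.

(** The truncation [kap] may depend on the final time p: the constants do not involve it, and the
    truncated weight on the right is at most the untruncated one. *)
Lemma semigroup_decay (kap p : R) psi : 0 < kap -> sqi psi -> 0 < p -> kap <= rate p ->
  nrm (S p psi) ^+ 2 * gauge p <= nrm (fun x => growth kap (rate 0) x.1 * psi x) ^+ 2 * gauge 0.
Proof.
move=> k0 hpsi p0 kp; have G0 s : 0 < gauge s := expR_gt0 _.
have r0 : 0 <= rate 0 by rewrite invr_ge0 mulr_ge0// addr0 ltW// (lt_le_trans ltr01).
have hb : bdm (fun x => growth kap (rate 0) x.1) := growth_bdm k0 r0.
have h1 := bdm_cst D (1 : R).
have one p' : nrm (fun x => 1 * S p' psi x) = nrm (S p' psi).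
  by congr nrm; apply/funext => x; rewrite mul1r.
rewrite -ler_pdivlMr// mulrAC -mulrA mulrC -[leRHS]addr0 -one.
apply: (orbit_density_bound mD hf c0 cf HS contr hb h1 hpsi (ltW p0)); first by rewrite mulr_ge0 ?invr_ge0 ?ltW.
move=> e' e'0; have [u [v [hu hv g nu _]]] := dense_domain mD hf c0 cf HS hpsi e'0.
exists u; split => //; rewrite addr0 -mulrA ler_pdivlMl// mulrC [leRHS]mulrC.
rewrite (_ : (fun x => 1 * S p u x) = S p u); last by apply/funext => x; rewrite mul1r.
by have := orbit_decay k0 hu hv g p0 kp.
Qed.

End main_decay.

Arguments growth_bdm {R a m} _ {kap} _ {l} _.

(** * Nash's inequality and moments *)

Section nash.
Context {R : realType} (a c : R) (f : plane R -> R).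
Local Notation D := (strip a).
Local Notation bdm := (bdm D).
Local Notation sqi := (sqi leb2 D).
Local Notation rint := (rint leb2 D).
Local Notation ip := (ip leb2 D).
Local Notation dot := (ip f).
Local Notation nrm1 := (nrm leb2 D (cst 1)).
Hypotheses (a0 : 0 < a) (hf : bdm f) (c0 : 0 < c) (c1 : c <= 1).
Hypotheses (cf : forall x, D x -> c <= f x) (f2 : forall x, D x -> f x <= 2).
Implicit Types (u v phi : plane R -> R) (B : set (plane R)) (L : R).

Let mD : measurable D := strip_measurable a.
Let hfV : bdm (fun x => (f x)^-1) := bdmV hf c0 cf.
Let f0 x : D x -> 0 <= f x. Proof. by move=> /cf; apply: le_trans (ltW c0). Qed.

Lemma bdm_indic B : measurable B -> bdm (\1_B : plane R -> R).
Proof.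
move=> mB; split; first exact: measurable_indic.
by exists 1 => x _; rewrite indicE; case: (_ \in _); rewrite ?normr1 ?normr0.
Qed.

Lemma sqi_indic B L : measurable B -> B `<=` box L -> sqi (\1_B : plane R -> R).
Proof.
move=> mB BL; have [m _] := bdm_indic mB; split => //.
apply: (@rint_box R a _ L 1); first exact: measurable_funX.
  by move=> x _; rewrite indicE; case: (_ \in _); rewrite ?expr1n ?normr1// expr0n normr0.
by move=> x _ nb; rewrite indicE memNset ?expr0n// => /BL.
Qed.

(** It expresses that f u dx is a positive measure of mass at most 1, in terms of pairings with
    bounded sets; this form passes to time averages. *)
Definition subprob u := forall B L, measurable B -> B `<=` D `&` box L -> 0 <= dot u (\1_B : plane R -> R) <= 1.

Lemma rint_M u v : sqi u -> sqi v -> rint (fun x => u x * v x).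
Proof.
by move=> hu hv; have := rint_ip mD (bdm_cst D 1) hu hv; congr rint; apply/funext => x; rewrite mul1r.
Qed.

(** The integral of f |u| is the pairing with the set u >= 0 minus the pairing with the set u < 0,
    and both pairings lie in [0, 1]. *)
Lemma subprob_mass u L : sqi u -> subprob u ->
  dot (fun x => `|u x|) (\1_(D `&` box L) : plane R -> R) <= 1.
Proof.
have alg (p q r : R) : 0 <= p <= 1 -> 0 <= q <= 1 -> r = p - q -> r <= 1.
  by move=> /andP[? ?] /andP[? ?] ->; lra.
move=> hu U; have [mu _] := hu; set Q := D `&` box L.
have mQ : measurable Q by apply: measurableI => //; exact: box_measurable.
pose P1 := Q `&` (D `&` u @^-1` `[0, +oo[); pose P2 := Q `&` (D `&` u @^-1` `]-oo, 0[).
have m1 : measurable P1 by apply: measurableI => //; apply: mu => //; exact: measurable_itv.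
have m2 : measurable P2 by apply: measurableI => //; apply: mu => //; exact: measurable_itv.
have s1 : P1 `<=` D `&` box L by move=> x [].
have s2 : P2 `<=` D `&` box L by move=> x [].
apply: alg (U _ _ m1 s1) (U _ _ m2 s2) _.
have i1 := sqi_indic m1 (subset_trans s1 (@subIsetr _ _ _)).
have i2 := sqi_indic m2 (subset_trans s2 (@subIsetr _ _ _)).
rewrite -(ipBr mD hf hu i1 i2); apply: eq_Rintegral => x /set_mem Dx; congr (_ * _).
rewrite !indicE; have [Qx|Qx] := boolP (x \in Q); last first.
  by rewrite !memNset ?subrr ?mulr0// => [[/mem_set]|[/mem_set]]; rewrite (negPf Qx).
have Qx' := set_mem Qx; have [u0|u0] := leP 0 (u x).
  have h2 : ~ P2 x by move=> [_ [_ /=]]; rewrite in_itv/= ltNge u0.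
  have h1 : P1 x by split => //; split => //=; rewrite in_itv/= u0.
  by rewrite ger0_norm// (memNset h2) (mem_set h1) /= subr0.
have h1 : ~ P1 x by move=> [_ [_ /=]]; rewrite in_itv/= leNgt u0.
have h2 : P2 x by split => //; split => //=; rewrite in_itv/= u0.
by rewrite ltr0_norm// (memNset h1) (mem_set h2) /= sub0r mulrN1 mulr1.
Qed.

(* The bound [\int f |u| <= 1] enters through Cauchy-Schwarz for the functions
   [sqrt |u|] and [sqrt |u| phi]. *)
Lemma nash_test u phi : sqi u -> subprob u -> test_function D phi -> 0 <= dot u phi ->
  dot u phi ^+ 4 <= 8 * dot u u * (nrm1 phi ^+ 2 * (nrm1 (partial1 phi) * nrm1 (partial2 phi))).
Proof.
move=> hu U t p0; have [L L0 hL] := test_box t.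
have cp := test_cont t; have hphi := test_sqi t; have [mu _] := hu.
set Q := D `&` box L; have mQ : measurable Q by apply: measurableI => //; exact: box_measurable.
have hQ := sqi_indic mQ (@subIsetr _ D (box L)); have bQ := bdm_indic mQ.
set one := (\1_Q : plane R -> R) in hQ bQ.
have oneE x : one x = 0 \/ one x = 1 by rewrite /one indicE; case: (_ \in _); [right|left].
have hs0 := sqi_norm hu; have hs := sqiM mD bQ hs0.
pose s := fun x => one x * `|u x|; pose r := fun x => Num.sqrt (s x).
have s0 x : 0 <= s x by rewrite mulr_ge0//; case: (oneE x) => ->.
have hr : sqi r.
  split; first by apply: measurableT_comp; [apply: continuous_measurable_fun; exact: sqrt_continuous|case: hs].
  have := rint_M hQ hs0; congr rint; apply/funext => x; rewrite /r sqr_sqrtr//.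
have [M hM] := continuous_box_bounded cp hL.
have bphi : bdm phi by split; [case: hphi|exists M => x _; exact: hM].
have hq : sqi (fun x => phi x * phi x) := sqiM mD bphi hphi.
have hrp : sqi (fun x => `|phi x| * r x).
  apply: sqiM => //; split; first by apply: measurableT_comp => //; case: hphi.
  by exists M => x _; rewrite normr_id; exact: hM.
set A := dot r (fun x => `|phi x| * r x).
have pA : dot u phi <= A.
  apply: le_Rintegral => //; [exact: rint_ip|exact: rint_ip|move=> x Dx].
  rewrite ler_wpM2l ?f0// mulrCA -expr2 sqr_sqrtr// /s.
  have [bx|/hL ->] := pselect (box L x); last by rewrite mulr0 normr0 mul0r.
  by rewrite /one indicE mem_set// mul1r -normrM mulrC ler_norm.
have A1 : A ^+ 2 <= dot r r * dot (fun x => `|phi x| * r x) (fun x => `|phi x| * r x) by exact: ip_CS.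
have rr : dot r r <= 1.
  have := subprob_mass L hu U; congr (_ <= _); apply: eq_Rintegral => x _.
  by rewrite -expr2 sqr_sqrtr// /s mulrC -[RHS]mulrC; congr (_ * _); rewrite mulrC.
have A2 : dot (fun x => `|phi x| * r x) (fun x => `|phi x| * r x) = dot s (fun x => phi x * phi x).
  apply: eq_Rintegral => x _; congr (_ * _).
  by rewrite mulrACA -normrM ger0_norm -?expr2 ?sqr_ge0// (sqr_sqrtr (s0 x)) mulrC.
have A3 : dot s (fun x => phi x * phi x) ^+ 2 <= dot s s * dot (fun x => phi x * phi x) (fun x => phi x * phi x).
  exact: ip_CS.
have A4 : dot s s <= dot u u.
  apply: le_Rintegral => //; [exact: rint_ip|exact: rint_ip|move=> x Dx].
  rewrite ler_wpM2l ?f0// /s -!expr2 exprMn real_normK ?num_real//.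
  by case: (oneE x) => ->; rewrite ?expr1n ?mul1r// expr0n mul0r sqr_ge0.
have A5 : dot (fun x => phi x * phi x) (fun x => phi x * phi x) <=
    8 * (nrm1 phi ^+ 2 * (nrm1 (partial1 phi) * nrm1 (partial2 phi))).
  have H := ladyzhenskaya t.
  have h2 : ip (cst 2) (fun x => phi x * phi x) (fun x => phi x * phi x) = 2 * \int[leb2]_(x in D) (phi x ^+ 4).
    rewrite -RintegralZl//; last by have := rint_M hq hq; congr rint; apply/funext => x; ring.
    by apply: eq_Rintegral => x _; rewrite /cst; ring.
  apply: (@le_trans _ _ (ip (cst 2) (fun x => phi x * phi x) (fun x => phi x * phi x))).
    by apply: ip_le => //; exact: bdm_cst.
  rewrite h2 (_ : 8 = 2 * 4 :> R); last by ring.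
  by rewrite -mulrA ler_pM2l// mulrA.
have rr0 : 0 <= dot r r by apply: ip_ge0.
have ss0 : 0 <= dot s s by apply: ip_ge0.
have sq0 : 0 <= dot s (fun x => phi x * phi x) by rewrite -A2; apply: ip_ge0.
have qq0 : 0 <= dot (fun x => phi x * phi x) (fun x => phi x * phi x) by apply: ip_ge0.
have B1 : dot u phi ^+ 2 <= dot s (fun x => phi x * phi x).
  apply: (@le_trans _ _ (A ^+ 2)); first by rewrite ler_pXn2r ?nnegrE// (le_trans p0).
  by apply: le_trans A1 _; rewrite A2 -[leRHS]mul1r ler_wpM2r.
rewrite (exprM _ 2 2).
apply: (@le_trans _ _ (dot s (fun x => phi x * phi x) ^+ 2)); first by rewrite ler_pXn2r ?nnegrE ?sqr_ge0.
apply: le_trans A3 _; rewrite [8 * _]mulrC -mulrA; exact: ler_pM.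
Qed.

(** [nash_test] is applied to test functions approaching [u] itself, so that both sides become
    powers of Y = |u|^2. The limit Y^4 <= 8 Y V^2 X Z, with c V^2 <= Y and 2 X Z <= X^2 + Z^2, gives
    the claim after division. *)
Lemma nash u g1 g2 : H10_space D u g1 g2 -> subprob u ->
  dot u u ^+ 2 <= 8 / c ^+ 2 * (ip (fun x => (f x)^-1) g1 g1 + dot g2 g2).
Proof.
have fin (y v x z k en : R) : 0 < y -> 0 <= x -> 0 <= z -> 0 < k -> k * v ^+ 2 <= y ->
    k / 2 * (x ^+ 2 + z ^+ 2) <= en -> y ^+ 4 <= 8 * y * (v ^+ 2 * (x * z)) -> y ^+ 2 <= 8 / k ^+ 2 * en.
  move=> y0 x0 z0 k0 vy H1 H2.
  have kn : k != 0 by rewrite gt_eqF.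
  have h1 : y ^+ 4 * k <= 8 * y ^+ 2 * (x * z).
    apply: (@le_trans _ _ (8 * y * (v ^+ 2 * (x * z)) * k)); first by rewrite ler_wpM2r// ltW.
    have -> : 8 * y * (v ^+ 2 * (x * z)) * k = 8 * y * (x * z) * (k * v ^+ 2) by ring.
    have -> : 8 * y ^+ 2 * (x * z) = 8 * y * (x * z) * y by ring.
    by rewrite ler_wpM2l// mulr_ge0 ?mulr_ge0// ltW.
  have h2 : y ^+ 2 * k <= 8 * (x * z).
    by rewrite -(ler_pM2l (exprn_gt0 2 y0)); apply: le_trans (le_trans _ h1) _; rewrite le_eqVlt; apply/orP; left; apply/eqP; ring.
  have h3 : 2 * (x * z) <= x ^+ 2 + z ^+ 2 by have := sqr_ge0 (x - z); rewrite sqrrB; lra.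
  have h4 : y ^+ 2 * k <= 8 / k * en.
    have -> : y ^+ 2 * k = 8 / k * (k / 8 * (y ^+ 2 * k)) by field.
    rewrite ler_wpM2l ?divr_ge0 ?(ltW k0)//; apply: le_trans H1.
    have -> : k / 8 * (y ^+ 2 * k) = k * (y ^+ 2 * k / 8) by ring.
    have -> : k / 2 * (x ^+ 2 + z ^+ 2) = k * ((x ^+ 2 + z ^+ 2) / 2) by ring.
    by rewrite ler_pM2l// ler_pdivrMr// (le_trans h2)//; lra.
  rewrite -(ler_pM2r k0) (le_trans h4)// le_eqVlt; apply/orP; left; apply/eqP; field.
  by rewrite kn.
have mono (v x z v' x' z' : R) : 0 <= v -> 0 <= x -> 0 <= z -> v <= v' -> x <= x' -> z <= z' ->
    v ^+ 2 * (x * z) <= v' ^+ 2 * (x' * z').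
  move=> v0 x0 z0 vv xx zz; apply: ler_pM (sqr_ge0 _) (mulr_ge0 x0 z0) _ (ler_pM x0 z0 xx zz).
  by rewrite ler_pXn2r ?nnegrE// (le_trans v0).
have n0 v : 0 <= nrm1 v by exact: nrm_ge0.
have n2 v : nrm1 v ^+ 2 = ip (cst 1) v v.
  by apply: (@nrm2 _ _ _ _ _ _ 1).
move=> hH U; have [hu hg1 hg2] := H10_sqi hH.
set Y := dot u u; have Y0 : 0 <= Y by apply: ip_ge0.
set X := nrm1 g1; set Z := nrm1 g2; set V := nrm1 u.
have cV : c * V ^+ 2 <= Y.
  rewrite n2 -(ipwZ mD c (bdm_cst D 1) hu hu); apply: ip_le => //.
    exact: bdmM (bdm_cst D c) (bdm_cst D 1).
  by move=> x Dx; rewrite mulr1 cf.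
have En : c / 2 * (X ^+ 2 + Z ^+ 2) <= ip (fun x => (f x)^-1) g1 g1 + dot g2 g2.
  rewrite mulrDr; apply: lerD.
    rewrite n2 -(ipwZ mD _ (bdm_cst D 1) hg1 hg1); apply: ip_le => //.
      exact: bdmM (bdm_cst D _) (bdm_cst D 1).
    move=> x Dx; rewrite mulr1; apply: (@le_trans _ _ (2^-1)); first by rewrite ler_piMl.
    by rewrite lef_pV2 ?posrE// ?f2// (lt_le_trans c0)// cf.
  rewrite n2 -(ipwZ mD _ (bdm_cst D 1) hg2 hg2); apply: ip_le => //.
    exact: bdmM (bdm_cst D _) (bdm_cst D 1).
  by move=> x Dx; rewrite mulr1; apply: le_trans (cf Dx); rewrite ler_pdivrMr// mulr2n mulrDr mulr1 lerDl ltW.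
have main : Y ^+ 4 <= 8 * Y * (V ^+ 2 * (X * Z)).
  have [->|Yn] := eqVneq Y 0; first by rewrite expr0n mulr0 mul0r.
  have Yp : 0 < Y by rewrite lt_neqAle eq_sym Yn.
  (* Since f <= 2, the pairing of u with phi is at least Y - 2 V e; the added 1 keeps the constant
     positive. *)
  pose C := 2 * V + 1; have C0 : 0 < C by rewrite ltr_wpDl// mulr_ge0// n0.
  pose h (e : R) := 8 * Y * ((V + e) ^+ 2 * ((X + e) * (Z + e))) - (Y - C * e) ^+ 4.
  have ch : h e @[e --> (0 : R)^'+] --> h 0.
    apply: cvg_at_right_filter; rewrite /h.
    have ci : e @[e --> (0 : R)] --> (0 : R) by exact: cvg_id.
    have cD k : k + e @[e --> (0 : R)] --> k + 0 by apply: cvgD => //; exact: cvg_cst.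
    apply: cvgB.
      by apply: cvgM; [exact: cvg_cst|apply: cvgM; [apply: cvgM|apply: cvgM]].
    have c4 : Y - C * e @[e --> (0 : R)] --> Y - C * 0.
      by apply: cvgB; [exact: cvg_cst|apply: cvgM => //; exact: cvg_cst].
    by do 3 (apply: (cvgM c4)).
  suff : 0 <= h 0 by rewrite /h mulr0 !addr0 subr0 subr_ge0.
  apply: (cvgr_to_ge ch); near=> e.
  have e0 : 0 < e by near: e; exact: nbhs_right_gt.
  have eY : e <= Y / C by near: e; apply: nbhs_right_le; rewrite divr_gt0.
  have [phi [t d0 d1 d2]] := H10_approx hH e0.
  have hp := test_sqi t; have hd := sqiB mD hp hu.
  have h1 := bdm_cst D (1 : R).
  have tri v w : sqi v -> sqi w -> nrm1 (fun x => v x - w x) < e -> nrm1 v <= nrm1 w + e.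
    move=> hv hw vw; have := nrm_lip mD h1 ltr01 (fun x _ => lexx _) hv hw => /ler_normlP[_ q].
    by rewrite addrC -lerBlDr (le_trans q)// ltW.
  have q0 := tri _ _ hp hu d0.
  have q1 := tri _ _ (test_sqi1 t) hg1 d1; have q2 := tri _ _ (test_sqi2 t) hg2 d2.
  have lo : Y - C * e <= dot u phi.
    rewrite lerBlDr -lerBlDl.
    have -> : Y - dot u phi = - dot u (fun x => phi x - u x).
      by rewrite (ipBr mD hf hu hp hu) opprB.
    have B : `|dot u (fun x => phi x - u x)| <= 2 * (V * nrm1 (fun x => phi x - u x)).
      apply: (ip_bound mD h1 ltr01) => // x Dx; rewrite ?mulr1 ?ger0_norm ?f0 ?f2//.
    apply: le_trans (ler_norm _) _; rewrite normrN; apply: le_trans B _.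
    rewrite mulrA; apply: ler_pM; [exact: mulr_ge0 (ler0n _ 2) (n0 _)|exact: n0|by rewrite lerDl|exact: ltW].
  have Ce : 0 <= Y - C * e by rewrite subr_ge0 mulrC -ler_pdivlMr.
  have Vn := n0 phi; have Xn := n0 (partial1 phi); have Zn := n0 (partial2 phi).
  have H := nash_test hu U t (le_trans Ce lo); rewrite /h subr_ge0.
  apply: (@le_trans _ _ (dot u phi ^+ 4)).
    by rewrite ler_pXn2r ?nnegrE// (le_trans Ce).
  apply: le_trans H _; rewrite ler_wpM2l ?mulr_ge0//.
  exact: mono Vn Xn Zn q0 q1 q2.
have [Y00|Yn] := eqVneq Y 0.
  rewrite Y00 expr0n; apply: mulr_ge0; first by rewrite divr_ge0// exprn_ge0// ltW.
  by apply: le_trans En; exact: mulr_ge0 (divr_ge0 (ltW c0) (ler0n _ 2)) (addr_ge0 (sqr_ge0 _) (sqr_ge0 _)).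
have Yp : 0 < Y by rewrite lt_neqAle eq_sym Yn.
exact: fin Yp (n0 _) (n0 _) c0 cV En main.
Unshelve. all: by end_near. Qed.
End nash.

(** * Decay and moments of orbits of mass at most one *)

Section smoothing.
Context {R : realType} (a c : R) (f : plane R -> R).
Variable S : R -> (plane R -> R) -> plane R -> R.
Local Notation D := (strip a).
Local Notation bdm := (bdm D).
Local Notation sqi := (sqi leb2 D).
Local Notation ip := (ip leb2 D).
Local Notation dot := (ip f).
Local Notation nrm := (nrm leb2 D f).
Local Notation gen := (gen leb2 D f S).
Hypotheses (hf : bdm f) (c0 : 0 < c) (c1 : c <= 1).
Hypotheses (cf : forall x, D x -> c <= f x) (f2 : forall x, D x -> f x <= 2).
Hypothesis HT : exp_semigroup D f (H_K a f) S.
Implicit Types (u v psi : plane R -> R).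

Let mD : measurable D := strip_measurable a.
Let hfV : bdm (fun x => (f x)^-1) := bdmV hf c0 cf.
Let HS := strip_L2_semigroup hf c0 cf HT.
Let contr t u : 0 <= t -> sqi u -> nrm (S t u) <= nrm u.
Proof.
move=> t0 hu; exact: (contraction mD hf c0 cf HS (gen_le0 hf c0 cf HT) hu t0).
Qed.

Definition subprob_orbit u := forall t : R, 0 <= t -> subprob a f (S t u).

(** The bounds on pairings carried by [dense_domain], taken with z = 1_B and M = 1, show that
    regularization keeps the orbit subprobabilistic. *)
Lemma subprob_dense psi (e : R) : sqi psi -> subprob_orbit psi -> 0 < e -> exists u v,
  [/\ sqi u, sqi v, gen u v, nrm (fun x => u x - psi x) < e & subprob_orbit u].
Proof.
move=> hpsi U e0; have [u [v [hu hv g nu P]]] := dense_domain mD hf c0 cf HS hpsi e0.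
exists u, v; split => // t t0 B L mB BQ; apply: P => //.
  by apply: (@sqi_indic _ a _ L) => //; exact: subset_trans BQ (@subIsetr _ _ _).
by move=> s s0; exact: U BQ.
Qed.

(** For y = |S_s u|^2, Nash's inequality reads (1 / y)' >= 2 kap. Integrating from t / 2 to t, away
    from the time 0 where the orbit is not differentiated, gives 1 / y(t) >= kap t. *)
Lemma nash_decay psi (t : R) : sqi psi -> subprob_orbit psi -> 0 < t ->
  nrm (S t psi) ^+ 2 <= (c ^+ 2 / 8 * t)^-1.
Proof.
pose kap := c ^+ 2 / 8; have k0 : 0 < kap by rewrite divr_gt0// exprn_gt0.
have alg (y en : R) : y ^+ 2 <= 8 / c ^+ 2 * en -> 0 < y -> 2 * kap - 2 * en / y ^+ 2 <= 0.
  move=> h y0; rewrite subr_le0 -mulrA ler_pM2l// ler_pdivlMr ?exprn_gt0// /kap.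
  rewrite -ler_pdivlMl ?divr_gt0 ?exprn_gt0// invfM invrK mulrC [_^-1 * 8]mulrC mulrC //.
move=> hpsi U t0; have h1 := bdm_cst D (1 : R).
have one v : (fun x => 1 * v x) = v by apply/funext => x; rewrite mul1r.
rewrite -[X in nrm X]one -[leRHS]add0r -[X in X + _](mul0r (nrm (fun x => 1 * psi x) ^+ 2)).
apply: (orbit_density_bound mD hf c0 cf HS contr h1 h1 hpsi (ltW t0) (lexx 0)) => e e0.
have [u [v [hu hv g nu Uu]]] := subprob_dense hpsi U e0.
exists u; split => //; rewrite !one mul0r add0r (nrm2 _ c0 cf).
pose y (s : R) := dot (S s u) (S s u); pose y' (s : R) := dot (S s v) (S s u).
have y0 s : 0 <= y s by apply: ip_ge0 => x Dx; rewrite (le_trans (ltW c0))// cf.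
have dy (s : R) : 0 < s -> is_derive s 1 y (2 * y' s).
  move=> s0; have dz := gen_cdiff mD hf c0 cf HS hu hv g s0; have H := cdiff_dot mD hf c0 cf dz dz.
  by apply: (is_derive_eq H); rewrite [X in _ + X]ipC -mulr2n mulr_natl.
have en (s : R) : 0 < s -> exists2 E, y' s = - E & y s ^+ 2 <= 8 / c ^+ 2 * E.
  move=> /ltW s0; have hSu := sg_L2 HS s0 hu; have hSv := sg_L2 HS s0 hv.
  have [g1 [g2 [hH E]]] := gen_form hf c0 cf HT hSu hSv (gen_S mD hf c0 cf HS hu hv g s0).
  by eexists; [exact: E hH|have H := nash hf c0 c1 cf f2 hH (Uu _ s0); exact: H].
have [z0|yn] := eqVneq (y t) 0; first by rewrite -/(y t) z0 invr_ge0 mulr_ge0 ?ltW.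
have yt : 0 < y t by rewrite lt_neqAle eq_sym yn y0.
have ymono (r s : R) : 0 < r -> r <= s -> y s <= y r.
  move=> r0 rs; apply: (decreasing_of_derive dy) => // q q0.
  have [E -> h] := en q q0; rewrite mulrN oppr_le0 mulr_ge0//.
  have := le_trans (sqr_ge0 _) h; rewrite pmulr_rge0// divr_gt0// exprn_gt0//.
have t2 : 0 < t / 2 by rewrite divr_gt0.
have t2t : t / 2 <= t by rewrite ler_pdivrMr// mulr2n mulrDr mulr1 lerDl ltW.
have F : 2 * kap * t - (y t)^-1 <= 2 * kap * (t / 2) - (y (t / 2))^-1.
  pose F' (r : R) := 2 * kap * 1 - - (y r) ^- 2 * (2 * y' r).
  apply: (@decreasing_on_segment R (fun r => 2 * kap * r - (y r)^-1) F' _ _ t2t) => r /andP[r1 r2].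
    have r0 := lt_le_trans t2 r1; have yr : y r != 0 by rewrite gt_eqF// (lt_le_trans yt)// ymono.
    have d1 : is_derive r 1 (fun r : R => 2 * kap * r) (2 * kap * 1) by apply: is_deriveZ.
    have d2 := @is_deriveV R y r _ 1 yr (dy r r0).
    exact: (is_deriveB d1 d2).
  have r0 := lt_le_trans t2 r1; have yr : 0 < y r by rewrite (lt_le_trans yt)// ymono.
  have [E Ey h] := en r r0; rewrite /F' Ey.
  apply: le_trans (alg _ _ h yr); rewrite le_eqVlt; apply/orP; left; apply/eqP.
  by field; rewrite gt_eqF.
have kt : 0 < kap * t by rewrite mulr_gt0.
rewrite -[leLHS]invrK lef_pV2 ?posrE ?invr_gt0//.
have := y0 (t / 2); rewrite -invr_ge0 => h.
move: F h; rewrite -/(y t) -/kap; move: (y t)^-1 (y (t / 2))^-1 => p q.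
have -> : 2 * kap * (t / 2) = kap * t by field.
by rewrite -mulrA; move: (kap * t) => z; lra.
Qed.

Variables (g : R -> R) (G : R) (m : nat).
Hypotheses (sg : smooth1 g) (g0 : forall s, 0 <= g s) (gG : forall s, g s <= G).
Hypotheses (g' : forall s, derive1 g s ^+ 2 <= 4 * g s) (m2 : (2 <= m)%N).

Let G0 : 0 <= G. Proof. exact: le_trans (g0 0) (gG 0). Qed.
Let b s := g s ^+ m.
Let sb : smooth1 b. Proof. by move=> n; apply: ncontX; exact: sg. Qed.
Let b_le s : `|b s| <= G ^+ m.
Proof. by rewrite ger0_norm ?exprn_ge0// lerXn2r// nnegrE. Qed.
Let db s : derive1 b s = m%:R * g s ^+ m.-1 * derive1 g s.
Proof.
have := @is_deriveX R R g m s 1 _ (smooth1_is_derive s sg).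
by rewrite (_ : g ^+ m = b) => [[_ E]|]; [rewrite derive1E E|apply/funext => y; rewrite fctE].
Qed.
Let db2 s : derive1 b s ^+ 2 <= 4 * m%:R ^+ 2 * g s ^+ (2 * m).-1.
Proof.
have -> : (2 * m).-1 = (m.-1 * 2 + 1)%N by lia.
rewrite db exprMn exprMn -exprM exprD expr1.
have -> : 4 * m%:R ^+ 2 * (g s ^+ (m.-1 * 2) * g s) = m%:R ^+ 2 * g s ^+ (m.-1 * 2) * (4 * g s) by ring.
by rewrite ler_wpM2l ?g'// mulr_ge0 ?sqr_ge0// exprn_ge0.
Qed.
Let db_le s : `|derive1 b s| <= 1 + 4 * m%:R ^+ 2 * G ^+ (2 * m).-1.
Proof.
have h : 0 <= 4 * m%:R ^+ 2 * G ^+ (2 * m).-1 by rewrite mulr_ge0 ?exprn_ge0// mulr_ge0 ?exprn_ge0.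
rewrite -(@ler_pXn2r _ 2)// ?nnegrE ?addr_ge0// real_normK ?num_real//.
apply: (le_trans (db2 s)); apply: (@le_trans _ _ (4 * m%:R ^+ 2 * G ^+ (2 * m).-1)).
  by rewrite ler_wpM2l ?mulr_ge0 ?exprn_ge0// lerXn2r// nnegrE.
by move: (4 * m%:R ^+ 2 * G ^+ (2 * m).-1) h => z z0; nra.
Qed.

(** Used with threshold sqrt s. The coefficient 1 / sqrt s of the weighted mass is then integrable
    at 0, while the remaining power of sqrt s compensates the 1 / s of [nash_decay]. *)
Let young (y s : R) : 0 <= y -> 0 < s -> y ^+ (2 * m).-1 <= y ^+ (2 * m) / s + s ^+ (2 * m).-1.
Proof.
move=> y0 s0; have m1 : (2 * m)%N = (2 * m).-1.+1 by lia.
have [sy|ys] := leP s y.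
  rewrite -[leLHS]addr0 lerD ?exprn_ge0 ?(ltW s0)// ler_pdivlMr// [in leRHS]m1 exprSr.
  by rewrite ler_wpM2l// exprn_ge0.
rewrite -[leLHS]add0r lerD ?divr_ge0 ?exprn_ge0 ?(ltW s0)//.
by apply: lerXn2r; rewrite ?nnegrE// ltW.
Qed.

(** This is where m >= 2 enters: the exponent 2 m - 1 is 2 + (2 m - 3). *)
Let sqrt_pow (s : R) : 0 < s -> s <= 1 -> Num.sqrt s ^+ (2 * m).-1 <= s.
Proof.
move=> s0 s1; have q0 : 0 <= Num.sqrt s by exact: sqrtr_ge0.
have q1 : Num.sqrt s <= 1 by rewrite -[leRHS]sqrtr1 ler_sqrt.
have -> : (2 * m).-1 = (2 + (2 * m - 3))%N by lia.
by rewrite exprD (sqr_sqrtr (ltW s0)) ler_piMr ?exprn_ile1// ltW.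
Qed.

Let C1 := 8 * m%:R ^+ 2 / c ^+ 2.
Let kap := c ^+ 2 / 8.

(* [M s = |b S_s psi|^2] satisfies [M' <= C1 (M / sqrt s + 1 / kap)] on [(0, 1]]: the
   derivative of the weight is at most [g^(2 m - 1)], which Young's inequality splits
   and Nash's decay bounds. *)
Lemma moment_bound psi : sqi psi -> subprob_orbit psi ->
  nrm (fun x => b x.1 * S 1 psi x) ^+ 2 <=
  expR (2 * C1) * nrm (fun x => b x.1 * psi x) ^+ 2 + expR (2 * C1) * (C1 / kap).
Proof.
have alg1 (X en p y q : R) : 0 <= en -> X <= p + y -> y <= q -> 2 * (X - en) <= 2 * p + 2 * q by lra.
have alg2 (w q Ep p : R) : q <= w + Ep -> Ep <= p -> - w + q - p * 1 <= 0 by lra.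
have k0 : 0 < kap by rewrite divr_gt0// exprn_gt0.
have C10 : 0 <= C1 by exact: divr_ge0 (mulr_ge0 (ler0n _ 8) (sqr_ge0 _)) (sqr_ge0 _).
have hb : bdm (fun x => b x.1) := smooth1_bdm sb b_le.
have hb' : bdm (fun x => derive1 b x.1) := smooth1_bdm (smooth1_derive1 sb) db_le.
move=> hpsi U; apply: (orbit_density_bound mD hf c0 cf HS contr hb hb hpsi ler01 (expR_ge0 _)) => e e0.
have [u [v [hu hv gu nu Uu]]] := subprob_dense hpsi U e0.
exists u; split => //.
pose z (s : R) := fun x : plane R => b x.1 * S s u x.
pose M (s : R) := dot (z s) (z s).
have ME s : M s = nrm (z s) ^+ 2 by rewrite (nrm2 _ c0 cf).
pose M' (s : R) := 2 * dot (fun x => b x.1 * S s v x) (z s).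
have dM (s : R) : 0 < s -> is_derive s 1 M (M' s).
  move=> s0; have dz := cdiffM mD hf c0 cf hb (gen_cdiff mD hf c0 cf HS hu hv gu s0).
  have H := cdiff_dot mD hf c0 cf dz dz.
  by apply: (is_derive_eq H); rewrite [X in _ + X]ipC -mulr2n /M' mulr_natl.
have M'_le (s : R) : 0 < s -> s <= 1 -> M' s <= C1 * (M s / Num.sqrt s + kap^-1).
  move=> s0 s1; have s0' := ltW s0; have hSu := sg_L2 HS s0' hu; have hSv := sg_L2 HS s0' hv.
  have q0 : 0 < Num.sqrt s by rewrite sqrtr_gt0.
  pose W := G ^+ m + (1 + 4 * m%:R ^+ 2 * G ^+ (2 * m).-1).
  have w1 s' : `|b s'| <= W by rewrite (le_trans (b_le s'))// lerDl (le_trans _ (db_le 0)).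
  have w2 s' : `|derive1 b s'| <= W by rewrite (le_trans (db_le s'))// lerDr (le_trans _ (b_le 0)).
  have [g1 [g2 [hH E]]] := weighted_energy hf c0 cf HT hSu hSv (gen_S mD hf c0 cf HS hu hv gu s0') sb w1 w2.
  have -> : M' s = 2 * dot (S s v) (fun x => b x.1 * (b x.1 * S s u x)).
    by congr (_ * _); apply: eq_Rintegral => x _; rewrite /z; ring.
  have En : 0 <= ip (fun x => (f x)^-1) g1 g1 + dot g2 g2.
    apply: addr_ge0; apply: ip_ge0 => x Dx; have fx := lt_le_trans c0 (cf Dx); rewrite ?invr_ge0 ltW//.
  pose al := 4 * m%:R ^+ 2 / c ^+ 2 * (Num.sqrt s)^-1; pose be := 4 * m%:R ^+ 2 / c ^+ 2 * Num.sqrt s ^+ (2 * m).-1.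
  have hal : bdm (fun x => al * (f x * (b x.1 * b x.1))) := bdmM (bdm_cst D al) (bdmM hf (bdmM hb hb)).
  have hbe : bdm (fun x => be * f x) := bdmM (bdm_cst D be) hf.
  have hfb' : bdm (fun x => (f x)^-1 * derive1 b x.1 ^+ 2).
    rewrite (_ : (fun x => _) = fun x => (f x)^-1 * (derive1 b x.1 * derive1 b x.1)).
      exact: bdmM hfV (bdmM hb' hb').
    by apply/funext => x; rewrite expr2.
  have I1 : ip (fun x => (f x)^-1 * derive1 b x.1 ^+ 2) (S s u) (S s u) <= al * M s + be * dot (S s u) (S s u).
    have -> : al * M s + be * dot (S s u) (S s u) =
        ip (fun x => al * (f x * (b x.1 * b x.1)) + be * f x) (S s u) (S s u).
      rewrite (ipwD mD hal hbe hSu hSu) (ipwZ mD be hf hSu hSu).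
      rewrite (ipwZ mD al (bdmM hf (bdmM hb hb)) hSu hSu); congr (_ * _ + _).
      by apply: eq_Rintegral => x _; rewrite /z; ring.
    apply: ip_le => //; first exact: bdmD.
    move=> x Dx; have fx := lt_le_trans c0 (cf Dx).
    have fV : (f x)^-1 <= f x / c ^+ 2.
      rewrite ler_pdivlMr ?exprn_gt0// ler_pdivrMl// -expr2 ler_pXn2r ?nnegrE ?(ltW c0) ?(ltW fx)//.
      exact: cf.
    have Y := young (g0 x.1) q0.
    have -> : al * (f x * (b x.1 * b x.1)) + be * f x =
        f x / c ^+ 2 * (4 * m%:R ^+ 2 * (g x.1 ^+ (2 * m) / Num.sqrt s + Num.sqrt s ^+ (2 * m).-1)).
      rewrite /al /be /b -exprD addnn -mul2n; field; rewrite !gt_eqF//.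
    apply: ler_pM; rewrite ?invr_ge0 ?(ltW fx) ?sqr_ge0//.
    apply: le_trans (db2 _) _; rewrite ler_wpM2l// mulr_ge0// sqr_ge0.
  have y1 : Num.sqrt s ^+ (2 * m).-1 * dot (S s u) (S s u) <= kap^-1.
    have := nash_decay hu Uu s0; rewrite (nrm2 _ c0 cf) -/kap => Y.
    apply: (@le_trans _ _ (s * (kap * s)^-1)); last by rewrite invfM mulrCA divff ?mulr1// gt_eqF.
    apply: ler_pM Y; [exact: exprn_ge0 (ltW q0)|by apply: ip_ge0 => x Dx; exact: ltW (lt_le_trans c0 (cf Dx))|].
    exact: sqrt_pow s0 s1.
  have I2 : be * dot (S s u) (S s u) <= 4 * m%:R ^+ 2 / c ^+ 2 * kap^-1.
    by rewrite /be -mulrA ler_wpM2l//; exact: divr_ge0 (mulr_ge0 (ler0n _ 4) (sqr_ge0 _)) (sqr_ge0 _).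
  rewrite E.
  have -> : C1 * (M s / Num.sqrt s + kap^-1) = 2 * (al * M s) + 2 * (4 * m%:R ^+ 2 / c ^+ 2 * kap^-1).
    by rewrite /C1 /al; field; rewrite !gt_eqF.
  exact: alg1 En I1 I2.
(* The integrating factor e^(-2 C1 sqrt s) removes the term C1 M / sqrt s; the constant term is
   compensated by the linear function of s. *)
have step (s : R) : 0 < s -> s <= 1 -> M 1 * expR (- (2 * C1 * Num.sqrt 1)) - C1 / kap * 1 <=
    M s * expR (- (2 * C1 * Num.sqrt s)) - C1 / kap * s.
  move=> s0 s1; pose E (r : R) := expR (- (2 * C1 * Num.sqrt r)).
  pose F' (r : R) := (M r * (E r * - (2 * C1 * (2 * Num.sqrt r)^-1)) + E r * M' r) - C1 / kap * 1.
  apply: (@decreasing_on_segment R (fun r => M r * expR (- (2 * C1 * Num.sqrt r)) - C1 / kap * r) F' _ _ s1) => r /andP[r1 r2].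
    have r0 := lt_le_trans s0 r1.
    have d1 : is_derive r 1 (fun r : R => - (2 * C1 * Num.sqrt r)) (- (2 * C1 * (2 * Num.sqrt r)^-1)).
      by apply: is_deriveN; apply: is_deriveZ; exact: is_derive1_sqrt.
    have d2 := @is_derive1_comp R (@expR R) _ r _ _ (is_derive_expR _) d1.
    have d3 : is_derive r 1 (fun r : R => C1 / kap * r) (C1 / kap * 1) by apply: is_deriveZ.
    exact: (is_deriveB (is_deriveM (dM r r0) d2) d3).
  have r0 := lt_le_trans s0 r1; have := M'_le r r0 r2; rewrite /F'.
  have q0 : 0 < Num.sqrt r by rewrite sqrtr_gt0.
  have E0 : 0 < E r := expR_gt0 _.
  have E1 : E r <= 1 by rewrite -expR0 ler_expR oppr_le0; exact: mulr_ge0 (mulr_ge0 (ler0n _ 2) C10) (sqrtr_ge0 _).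
  have p0 : 0 <= C1 / kap by rewrite divr_ge0// ltW.
  move=> /(ler_wpM2l (ltW E0)).
  have -> : E r * (C1 * (M r / Num.sqrt r + kap^-1)) = M r * (E r * (C1 / Num.sqrt r)) + E r * (C1 / kap) by ring.
  have -> : M r * (E r * - (2 * C1 * (2 * Num.sqrt r)^-1)) = - (M r * (E r * (C1 / Num.sqrt r))).
    by field; rewrite gt_eqF.
  by move/alg2; apply; have := ler_wpM2r p0 E1; rewrite mul1r.
have lim : M s * expR (- (2 * C1 * Num.sqrt s)) - C1 / kap * s @[s --> (0 : R)^'+] -->
    nrm (fun x => b x.1 * u x) ^+ 2 * expR (- (2 * C1 * Num.sqrt 0)) - C1 / kap * 0.
  apply: cvgB; last by apply: cvgM; [exact: cvg_cst|exact: cvg_at_right_filter cvg_id].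
  apply: cvgM.
    rewrite (_ : M = fun s => nrm (z s) ^+ 2); last by apply/funext => s; exact: ME.
    have h := orbit_weight_limit mD hf c0 cf HS hb hu.
    by apply: (cvgM h h).
  apply: cvg_at_right_filter; apply: continuous_comp; last exact: continuous_expR.
  by apply: cvgN; apply: cvgM; [exact: cvg_cst|exact: sqrt_continuous].
have H : M 1 * expR (- (2 * C1 * Num.sqrt 1)) - C1 / kap * 1 <=
    nrm (fun x => b x.1 * u x) ^+ 2 * expR (- (2 * C1 * Num.sqrt 0)) - C1 / kap * 0.
  apply: (cvgr_to_ge lim); near=> s; apply: step; near: s; first exact: nbhs_right_gt.
  exact: nbhs_right_le.
move: H; rewrite -/(z 1) -ME sqrtr0 sqrtr1 !mulr0 oppr0 expR0 !mulr1 addr0 lerBlDr => H.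
rewrite -mulrDr -ler_pdivrMl ?expR_gt0// -expRN mulrC.
exact: H.
Unshelve. all: by end_near. Qed.

End smoothing.

(** * Survival events *)

Section strip_frontier.
Context {R : realType} (a : R).
Hypothesis a0 : 0 < a.

Lemma strip_open : open (strip a).
Proof.
rewrite (_ : strip a = (fun x : plane R => `|x.2 : R|) @^-1` [set s : R | s < a]).
  apply: open_comp; last exact: open_lt.
  by move=> x _; apply: cvg_norm; exact: cvg_snd.
by apply/seteqP; split => x /=; rewrite /strip/= ltr_norml.
Qed.

Lemma strip_frontier (x : plane R) : frontier (strip a) x <-> `|x.2 : R| = a.
Proof.
have cl : closed [set x : plane R | `|x.2 : R| <= a].
  rewrite (_ : [set _ | _] = (fun x : plane R => `|x.2 : R|) @^-1` [set s : R | s <= a])//.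
  apply: preimage_closed; last exact: closed_le.
  by move=> y _; apply: cvg_norm; exact: cvg_snd.
have int : (strip a)° = strip a by apply/interior_id; exact: strip_open.
rewrite /frontier int; split.
  move=> [cx nx]; apply/eqP; rewrite eq_le; apply/andP; split.
    apply: cl; apply: closureS cx => y.
    by rewrite /strip/= -ltr_norml => /ltW.
  by rewrite leNgt ltr_norml; apply/negP => h; apply: nx.
move=> xa; split; last by rewrite /strip/= -ltr_norml xa ltxx.
move=> V /nbhs_square[r r0 rV].
pose e := Num.min (2^-1) (r / (2 * a)); have e0 : 0 < e.
  by rewrite lt_min invr_gt0 ltr0n divr_gt0// mulr_gt0.
have e1 : e < 1 by rewrite (le_lt_trans (_ : e <= 2^-1))// ?invf_lt1 ?ltr1n// ge_min lexx.
have er : e * a < r.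
  rewrite (@le_lt_trans _ _ (r / (2 * a) * a))//; first by rewrite ler_wpM2r ?(ltW a0)// ge_min lexx orbT.
  have -> : r / (2 * a) * a = r / 2 by field; rewrite gt_eqF.
  by rewrite ltr_pdivrMr// mulr2n mulrDr mulr1 ltrDl.
(* Contracting the second coordinate by 1 - e moves a boundary point into the strip by e a < r. *)
exists (x.1, (1 - e) * x.2); split.
  rewrite /strip/= -ltr_norml normrM xa gtr0_norm ?subr_gt0//.
  by rewrite gtr_pMl// gtrBl.
apply: rV; split => /=; first by rewrite subrr normr0.
by rewrite mulrBl mul1r addrAC subrr sub0r normrN normrM xa gtr0_norm.
Qed.

(** A continuous function on the whole plane vanishing exactly on the frontier, so that avoiding the
    frontier becomes positivity. *)
Definition edge_distance (x : plane R) : R := `|a - `|x.2 : R| |.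

Lemma edge_distance_continuous : continuous edge_distance.
Proof.
move=> x; apply: cvg_norm; apply: cvgB; first exact: cvg_cst.
by apply: cvg_norm; exact: cvg_snd.
Qed.

Lemma edge_distance_gt0 x : 0 < edge_distance x <-> ~ frontier (strip a) x.
Proof.
rewrite strip_frontier normr_gt0 subr_eq0; split; first by move=> /eqP h /esym.
by move=> h; apply/eqP => /esym.
Qed.

End strip_frontier.

Section survival.
Context {R : realType} (a : R) d {Omega : measurableType d}.
Variables (P : plane R -> probability Omega R) (X : R -> Omega -> plane R) (w : plane R -> R).
Hypotheses (a0 : 0 < a) (hX : associated_diffusion P X w).

Let path_continuous om (s : R) : 0 < s -> {for s, continuous (X ^~ om)}.
Proof.
move=> s0; have /subspace_continuousP := @diffusion_continuous _ _ _ _ _ _ hX om.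
have sI : `[0, +oo[%classic s by rewrite /= in_itv/= (ltW s0).
move=> /(_ s sI); rewrite within_interior//.
apply: (@filterS _ _ _ `]0, +oo[%classic); first by move=> r /=; rewrite !in_itv/= !andbT => /ltW.
by apply: open_nbhs_nbhs; split; [exact: interval_open|rewrite /= in_itv/= s0].
Qed.

Let dist_continuous om (s : R) : 0 < s -> {for s, continuous (fun s => edge_distance a (X s om))}.
Proof.
move=> s0; apply: continuous_comp; [exact: path_continuous|exact: edge_distance_continuous].
Qed.

(** A strict bound on an infimum requires a margin beyond t; continuity of the path at t supplies
    it. *)
Lemma hitting_time_gt om (t : R) : 0 < t ->
  (t%:E < hitting_time X (frontier (strip a)) om)%E <->
  forall s : R, 0 < s -> s <= t -> 0 < edge_distance a (X s om).
Proof.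
move=> t0; split.
  move=> h s s0 st; apply/(edge_distance_gt0 a0) => hs.
  have := lt_le_trans h (ereal_inf_lbound (_ : _ s%:E)).
  rewrite lte_fin => /(_ _); rewrite ltNge st => H; suff : false by []; apply: H.
  by exists s.
move=> h; have := @dist_continuous om t t0 => /cvgrPdist_lt/(_ _ (h t t0 (lexx _))).
move=> /nbhs_ballP[del /= del0 hd].
apply: (@lt_le_trans _ _ (t + del)%:E); first by rewrite lte_fin ltrDl.
apply: le_ereal_inf_tmp => _ [s [s0 hs] <-]; rewrite lee_fin leNgt; apply/negP => sd.
suff : 0 < edge_distance a (X s om) by move/(edge_distance_gt0 a0).
have [st|ts] := leP s t; first exact: h.
have := hd s; rewrite /ball/= distrC gtr0_norm ?subr_gt0// ltrBlDl => /(_ sd).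
by move=> /ltr_normlP[_]; rewrite ltrBlDr ltrDl.
Qed.

(* [clamp t n] retracts the line onto [[t / (n + 1), t]]. *)
Let clamp (t : R) (n : nat) (r : R) : R := t * Num.max (n.+1%:R)^-1 (Num.min 1 r).

Let clamp_gt0 t n r : 0 < t -> 0 < clamp t n r.
Proof. by move=> t0; rewrite mulr_gt0// lt_max invr_gt0 ltr0n. Qed.

Let clamp_le t n r : 0 < t -> clamp t n r <= t.
Proof. by move=> t0; rewrite ger_pMr// ge_max invf_le1 ?ler1n ?ltr0n// ge_min lexx. Qed.

Let clamp_continuous t n : continuous (clamp t n).
Proof.
move=> r; apply: cvgM; first exact: cvg_cst.
apply: (@continuous_max R R (cst _) (fun r => Num.min 1 r)); first exact: cvg_cst.
by apply: (@continuous_min R R (cst 1) id); [exact: cvg_cst|exact: cvg_id].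
Qed.

Let grid (i : nat) : R := if @unpickle rat i is Some q then ratr q else 0.

(** Only times s > 0 count, so (0, t] is exhausted by the segments [t / (n + 1), t]. On each the
    distance attains a positive minimum, and by continuity a lower bound at rational parameters
    holds throughout. The right side uses countable operations only. *)
Lemma survival_event (t : R) om : 0 < t ->
  (t%:E < hitting_time X (frontier (strip a)) om)%E <->
  forall n : nat, exists k : nat, forall i : nat, (k.+1%:R)^-1 <= edge_distance a (X (clamp t n (grid i)) om).
Proof.
move=> t0; rewrite (hitting_time_gt om t0); split.
  move=> h n; pose s0 := t / n.+1%:R; have s00 : 0 < s0 by rewrite divr_gt0// ltr0n.
  have s0t : s0 <= t by rewrite ler_pdivrMr ?ltr0n// ler_peMr ?(ltW t0)// ler1n.
  have [|c] := @EVT_min R (fun s => edge_distance a (X s om)) s0 t s0t.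
    apply: continuous_in_subspaceT => s; rewrite inE/= in_itv/= => /andP[h1 _].
    by apply: dist_continuous; exact: lt_le_trans h1.
  rewrite in_itv/= => /andP[c1 c2] hc.
  have hc0 := h c (lt_le_trans s00 c1) c2.
  exists (Num.bound (edge_distance a (X c om))^-1) => i.
  have := hc (clamp t n (grid i)); rewrite in_itv/= clamp_le// andbT.
  rewrite ler_pM2l// le_max lexx => /(_ isT); apply: le_trans.
  rewrite -[leRHS]invrK lef_pV2 ?posrE ?invr_gt0 ?ltr0n//.
  have := archi_boundP (ltW (_ : 0 < (edge_distance a (X c om))^-1)); rewrite invr_gt0 => /(_ hc0) /ltW/le_trans; apply.
  by rewrite ler_nat.
move=> h s s0 st; pose n := Num.bound (t / s).
have tn : t / s < n.+1%:R.
  have := archi_boundP (ltW (divr_gt0 t0 s0)) => /lt_le_trans; apply; by rewrite ler_nat.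
have [k hk] := h n; apply: (@lt_le_trans _ _ (k.+1%:R)^-1); first by rewrite invr_gt0 ltr0n.
have cs : clamp t n (s / t) = s.
  rewrite /clamp (_ : Num.min 1 (s / t) = s / t); last by apply/min_idPr; rewrite ler_pdivrMr// mul1r.
  have -> : Num.max (n.+1%:R)^-1 (s / t) = s / t; last by rewrite mulrCA mulfV ?mulr1// gt_eqF.
  apply/max_idPr; rewrite -[leRHS]invf_div lef_pV2 ?posrE ?ltr0n ?divr_gt0//; exact: ltW.
rewrite leNgt; apply/negP => lt.
pose F r := edge_distance a (X (clamp t n r) om).
have cF : continuous F.
  move=> r; apply: (@continuous_comp R R R (clamp t n) (fun s => edge_distance a (X s om))).
    exact: clamp_continuous.
  by apply: dist_continuous; exact: clamp_gt0.
have oV : open (F @^-1` [set y | y < (k.+1%:R)^-1]).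
  by apply: open_comp; [move=> r _; exact: cF|exact: open_lt].
have neV : F @^-1` [set y | y < (k.+1%:R)^-1] !=set0 by exists (s / t); rewrite /= /F cs.
have [r [/= Fr [q _ qr]]] := dense_rat neV oV.
have := hk (pickle q); rewrite /grid pickleK qr leNgt -/(F r) Fr.
by [].
Qed.

Lemma survival_measurable (t : R) (B : set (plane R)) : 0 < t -> measurable B ->
  measurable [set om | B (X t om) /\ (t%:E < hitting_time X (frontier (strip a)) om)%E].
Proof.
move=> t0 mB.
have -> : [set om | B (X t om) /\ (t%:E < hitting_time X (frontier (strip a)) om)%E] =
    X t @^-1` B `&` \bigcap_n \bigcup_k \bigcap_i
      X (clamp t n (grid i)) @^-1` (edge_distance a @^-1` `[(k.+1%:R)^-1, +oo[%classic).
  apply/seteqP; split => om /=.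
    move=> [Bx /(survival_event om t0) h]; split => // n _.
    by have [k hk] := h n; exists k => // i _; rewrite /= in_itv/= andbT.
  move=> [Bx h]; split => //; apply/(survival_event om t0) => n.
  by have [k _ hk] := h n I; exists k => i; have := hk i I; rewrite /= in_itv/= andbT.
have mX s : 0 <= s -> measurable_fun setT (X s) := @diffusion_measurable _ _ _ _ _ _ hX s.
apply: measurableI; first by rewrite -[_ @^-1` _]setTI; apply: (mX _ (ltW t0)) => //; exact: measurableT.
apply: bigcapT_measurable => n; apply: bigcupT_measurable => k; apply: bigcapT_measurable => i.
rewrite -[_ @^-1` _]setTI; apply: mX; [exact: ltW (clamp_gt0 _ _ t0)|exact: measurableT|].
rewrite -[_ @^-1` _]setTI; apply: continuous_measurable_plane; [exact: edge_distance_continuous|exact: measurableT|exact: measurable_itv].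
Qed.

Lemma survival_prob_le1 (t : R) (B : set (plane R)) x : 0 < t -> measurable B ->
  (0 <= survival_prob P X a t B x <= 1)%E.
Proof.
by move=> t0 mB; rewrite measure_ge0 probability_le1//; exact: survival_measurable.
Qed.

End survival.

(** * Indicators of bounded sets as data of mass at most one *)

Section killed_semigroup.
Context {R : realType} (a c : R) (f : plane R -> R) (T : R -> (plane R -> R) -> plane R -> R).
Context d {Omega : measurableType d}.
Variables (P : plane R -> probability Omega R) (X : R -> Omega -> plane R) (w : plane R -> R).
Local Notation D := (strip a).
Local Notation bdm := (bdm D).
Local Notation sqi := (sqi leb2 D).
Local Notation ip := (ip leb2 D).
Local Notation dot := (ip f).
Local Notation nrm := (nrm leb2 D f).
Hypotheses (a0 : 0 < a) (hf : bdm f) (c0 : 0 < c) (cf : forall x, D x -> c <= f x).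
Hypothesis HT : exp_semigroup D f (H_K a f) T.
Hypotheses (hX : associated_diffusion P X w) (killed : killed_semigroup_law P X a T).
Implicit Types (B Q : set (plane R)) (L t : R).

Let mD : measurable D := strip_measurable a.
Let to_sqi u : inL2 leb2 D f u <-> sqi u.
Proof. exact: (@inL2_sqi _ _ R leb2 D mD f c hf c0 cf u). Qed.
Let HS := strip_L2_semigroup hf c0 cf HT.

Lemma box_bounded B L : B `<=` box L -> bounded_set B.
Proof.
move=> BL; exists L; split; first exact: num_real.
by move=> M LM x /BL[h1 h2]; rewrite /= prod_normE ge_max !(le_trans _ (ltW LM)).
Qed.

Lemma killed_indicator B L t : 0 <= t -> measurable B -> B `<=` D `&` box L ->
  {ae leb2, forall x : plane R, D x -> 0 <= T t (\1_B) x <= 1}.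
Proof.
move=> t0 mB BQ; have BD : B `<=` D by move=> x /BQ[].
have BL : B `<=` box L by move=> x /BQ[].
(* The killed law speaks of t > 0; at t = 0 the semigroup axiom returns the indicator itself. *)
move: t0; rewrite le_eqVlt => /orP[/eqP <-|t0].
  have hB : inL2 leb2 D f (\1_B : plane R -> R).
    by apply/to_sqi; exact: sqi_indic BL.
  move: (semigroup0 HT hB); apply: (@filterS _ _ (ae_filter_ringOfSetsType leb2)) => x h Dx.
  by rewrite (h Dx) indicE; case: (_ \in _); rewrite lexx ler01.
have [_] := killed t0 mB (box_bounded BL) BD.
apply: (@filterS _ _ (ae_filter_ringOfSetsType leb2)) => x h Dx.
rewrite -(h Dx) /=; have := survival_prob_le1 a0 hX x t0 mB.
by case: (survival_prob P X a t B x) => [r||] //=; rewrite ?lexx ?ler01.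
Qed.

(** Symmetry moves the semigroup from the multiple of 1_Q to 1_B, whose image is a survival
    probability with values in [0, 1]. *)
Lemma subprob_indicator Q L (k : R) : measurable Q -> Q `<=` D `&` box L -> 0 <= k ->
  k * dot (\1_Q : plane R -> R) (\1_Q : plane R -> R) <= 1 ->
  subprob_orbit a f T (fun x => k * (\1_Q : plane R -> R) x).
Proof.
move=> mQ QL k0 kQ t t0 B LB mB BL.
have QL' : Q `<=` box L by move=> x /QL[].
have BL' : B `<=` box LB by move=> x /BL[].
have hQ : sqi (\1_Q : plane R -> R) := @sqi_indic R a Q L mQ QL'.
have hB : sqi (\1_B : plane R -> R) := @sqi_indic R a B LB mB BL'.
have bQ := @bdm_indic R a Q mQ.
set oneQ := (\1_Q : plane R -> R) in hQ bQ kQ *; set oneB := (\1_B : plane R -> R) in hB *.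
have hk : sqi (fun x => k * oneQ x) := sqiZ mD k hQ.
have gle := gen_le0 hf c0 cf HT; have gsym := gen_sym hf c0 cf HT.
rewrite (symmetric mD hf c0 cf HS gle gsym hk hB t0).
have hT := sg_L2 HS t0 hB; have [mT _] := hT; have [mf _] := hf.
(* The image of 1_B lies in [0, 1] only almost everywhere; clamping makes the bound pointwise
   without changing the pairing. *)
pose v x : R := Num.max 0 (Num.min 1 (T t oneB x)).
have mv : measurable_fun D v.
  by apply: measurable_maxr => //; apply: measurable_minr.
have v01 x : 0 <= v x <= 1 by rewrite le_max lexx/= ge_max ler01 ge_min lexx.
have bv : bdm v by split => //; exists 1 => x _; have /andP[v0 v1] := v01 x; rewrite ger0_norm.
have oneE x : oneQ x = 0 \/ oneQ x = 1 by rewrite /oneQ indicE; case: (_ \in _); [right|left].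
have -> : dot (fun x => k * oneQ x) (T t oneB) = dot (fun x => k * oneQ x) (fun x => v x * oneQ x).
  have -> : dot (fun x => k * oneQ x) (T t oneB) = dot (fun x => k * oneQ x) (fun x => oneQ x * T t oneB x).
    by apply: eq_Rintegral => x _; case: (oneE x) => ->; rewrite ?mulr0 ?mul0r ?mul1r.
  rewrite ipC [RHS]ipC; have [hk' _] := hk; apply: (ip_ae mD) => //.
    move: (killed_indicator t0 mB BL); apply: (@filterS _ _ (ae_filter_ringOfSetsType leb2)) => x h Dx.
    have /andP[h0 h1] := h Dx; rewrite /v mulrC; congr (_ * _).
    by rewrite -/oneB in h0 h1; rewrite (min_idPr h1) (max_idPr h0).
    by apply: measurable_funM => //; case: bQ.
  by apply: measurable_funM => //; case: bQ.
have hvQ : sqi (fun x => v x * oneQ x) := sqiM mD bv hQ.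
apply/andP; split.
  apply: Rintegral_ge0 => x Dx; have /andP[v0 _] := v01 x.
  have f0 := le_trans (ltW c0) (cf Dx).
  by case: (oneE x) => ->; rewrite ?mulr0 ?mulr1// mulr_ge0// mulr_ge0.
apply: le_trans kQ; rewrite -(ipZl mD k hf hQ hQ); apply: le_Rintegral => //; [exact: rint_ip|exact: rint_ip|].
move=> x Dx; have /andP[v0 v1] := v01 x; have f0 := le_trans (ltW c0) (cf Dx).
rewrite ler_wpM2l//; case: (oneE x) => ->; rewrite ?mulr0 ?mulr1//.
by rewrite ler_piMr.
Qed.

End killed_semigroup.

(** * Pointwise decay *)

Section shifted_weight.
Context {R : realType}.
Implicit Types (k s y : R).

Definition shifted k y s : R := tsq k (s - y).

Lemma smooth1_shifted k y : 0 <= k -> smooth1 (shifted k y).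
Proof.
move=> k0 n; apply: ncont_comp; first exact: smooth1_tsq.
by apply: ncontB; [exact: ncont_id|exact: ncont_cst].
Qed.

Lemma shifted_derive_sqr k y s : 0 <= k -> derive1 (shifted k y) s ^+ 2 <= 4 * shifted k y s.
Proof.
move=> k0; have d1 : is_derive s 1 (fun s : R => s - y) (1 - 0) by apply: is_deriveB.
have d2 := smooth1_is_derive (s - y) (smooth1_tsq k0).
have [_ E] := @is_derive1_comp R (tsq k) (fun s => s - y) s _ _ d2 d1.
rewrite derive1E (_ : shifted k y = tsq k \o (fun s => s - y))// E subr0 mulr1.
exact: tsq_derive_sqr.
Qed.

(** The quasi-triangle inequality for squares survives truncation because u |-> u / (1 + k u) is
    increasing while u |-> 1 / (1 + k u) is decreasing; the two cases of [core] use one fact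
    each. *)
Lemma tsq_shift k y s : 0 < k -> tsq k s <= 2 * shifted k y s + 2 * y ^+ 2.
Proof.
move=> k0; rewrite /shifted; set z := s - y.
have sq (p q : R) : (p + q) ^+ 2 <= 2 * p ^+ 2 + 2 * q ^+ 2.
  by have := sqr_ge0 (p - q); rewrite sqrrB sqrrD; lra.
have sz : s ^+ 2 <= 2 * z ^+ 2 + 2 * y ^+ 2 by have := sq z y; rewrite subrK.
have core (u v w : R) : 0 <= u -> 0 <= v -> 0 <= w -> u <= 2 * v + w ->
    u * (1 + k * u)^-1 <= 2 * (v * (1 + k * v)^-1) + w.
  move=> u0 v0 w0 h; have ku := mulr_ge0 (ltW k0) u0; have kv := mulr_ge0 (ltW k0) v0.
  have u1 : 0 < 1 + k * u by rewrite ltr_wpDr. have v1 : 0 < 1 + k * v by rewrite ltr_wpDr.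
  have wu : w <= w * (1 + k * u) by rewrite ler_peMr// lerDl.
  have [uv|vu] := leP u v.
    have h1 : u * (1 + k * u)^-1 <= v * (1 + k * v)^-1.
      rewrite ler_pdivrMr// mulrAC ler_pdivlMr// !mulrDr !mulr1 mulrCA [v * (k * u)]mulrCA [v * u]mulrC.
      by rewrite lerD2r.
    have h2 : 0 <= v * (1 + k * v)^-1 by rewrite divr_ge0// ltW.
    by move: h1 h2 w0; move: (v * _) (u * _) => p r; lra.
  rewrite ler_pdivrMr// mulrDl; apply: le_trans h _; apply: lerD => //.
  rewrite -mulrA ler_wpM2l// mulrAC ler_pdivlMr// ler_wpM2l// lerD2l ler_pM2l//; exact: ltW.
have := core _ _ _ (sqr_ge0 s) (sqr_ge0 z) (mulr_ge0 (ler0n _ 2) (sqr_ge0 y)) sz.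
exact.
Qed.

Lemma binomial_bound (z : R) (n : nat) : 0 <= z -> (1 + z) ^+ n <= 2 ^+ n * (1 + z ^+ n).
Proof.
move=> z0; have zn : 0 <= z ^+ n by rewrite exprn_ge0.
have p1 : 0 <= 1 + z by rewrite addr_ge0.
have [z1|z1] := leP z 1.
  apply: (@le_trans _ _ (2 ^+ n)); last by rewrite ler_peMr ?exprn_ge0// lerDl.
  by rewrite lerXn2r ?nnegrE//; lra.
apply: (@le_trans _ _ ((2 * z) ^+ n)).
  by rewrite lerXn2r ?nnegrE ?mulr_ge0//; lra.
by rewrite exprMn ler_wpM2l ?exprn_ge0// lerDr.
Qed.

(** The decay weight is centred at 0, the moment estimate at the point under study; the cost of
    recentring depends on y and m only, not on k. The exponent m + 1 meets the requirement of at
    least 2 in [moment_bound]. *)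
Lemma growth_shift (m : nat) k y s (l : R) : 0 < k -> 0 <= l -> l <= 1 ->
  (1 + l * tsq k s) ^+ m <= ((2 + 2 * y ^+ 2) ^+ m * 2 ^+ m.+1) * (1 + shifted k y s ^+ m.+1).
Proof.
have alg (p t r q : R) : p <= t -> 0 <= r -> 0 <= r * q -> 0 <= q -> t <= 2 * q + 2 * r -> 1 + p <= (2 + 2 * r) * (1 + q) by lra.
move=> k0 l0 l1; set g := shifted k y s; have g0 : 0 <= g by exact: tsq_ge0 (ltW k0).
have t0 : 0 <= tsq k s by exact: tsq_ge0 (ltW k0).
have y0 := sqr_ge0 y; have lt : l * tsq k s <= tsq k s by rewrite ler_piMl.
have Y0 : 0 <= 2 + 2 * y ^+ 2 := addr_ge0 (ler0n _ 2) (mulr_ge0 (ler0n _ 2) y0).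
have g1 : 0 <= 1 + g := addr_ge0 ler01 g0.
apply: (@le_trans _ _ (((2 + 2 * y ^+ 2) * (1 + g)) ^+ m)).
  apply: lerXn2r; rewrite ?nnegrE; first exact: addr_ge0 ler01 (mulr_ge0 l0 t0).
    exact: mulr_ge0 Y0 g1.
  exact: alg lt y0 (mulr_ge0 y0 g0) g0 (tsq_shift y s k0).
rewrite exprMn -mulrA ler_wpM2l ?(exprn_ge0 _ Y0)//.
apply: le_trans (binomial_bound m.+1 g0); rewrite exprSr ler_peMr ?(exprn_ge0 _ g1)//.
by rewrite lerDl.
Qed.

End shifted_weight.

Section square_mass.
Context {R : realType} (a c : R) (f : plane R -> R).
Local Notation D := (strip a).
Hypotheses (hf : bdm D f) (cf : forall x, D x -> c <= f x).
Let mD : measurable D := strip_measurable a.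

Lemma square_area (x : R * R) (r : R) : 0 < r -> leb2 (square x r) = ((2 * r) ^+ 2)%:E.
Proof.
move=> r0; have -> : square x r = `]x.1 - r, x.1 + r[%classic `*` `]x.2 - r, x.2 + r[%classic.
  apply/seteqP; split => [[y1 y2]|[y1 y2]] /=; rewrite /square/= !in_itv/= !ltr_norml.
    by move=> [/andP[? ?] /andP[? ?]]; split; apply/andP; split; lra.
  by move=> [/andP[? ?] /andP[? ?]]; split; apply/andP; split; lra.
have len (s : R) : lebesgue_measure (`]s - r, s + r[%classic : set R) = (2 * r)%:E.
  rewrite lebesgue_measure_itv/= lte_fin ltrD2l gtrN// -EFinB; congr EFin; ring.
by rewrite leb2X; [rewrite !len -EFinM expr2|exact: measurable_itv|exact: measurable_itv].
Qed.

Lemma square_box (x : R * R) (r : R) : r <= 1 -> square x r `<=` box (`|x.1| + `|x.2| + 1).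
Proof.
move=> r1 z [/= z1 z2]; have h (p q : R) : `|p - q| < r -> `|p| <= `|q| + 1.
  by move=> pq; rewrite -[p in leLHS](subrK q) addrC (le_trans (ler_normD _ _))// lerD2l (le_trans (ltW pq)).
split; first by rewrite (le_trans (h _ _ z1))// lerD2r lerDl.
by rewrite (le_trans (h _ _ z2))// lerD2r lerDr.
Qed.

Lemma square_mass (x : R * R) (r : R) : 0 < r -> r <= 1 -> square x r `<=` D ->
  c * (2 * r) ^+ 2 <= ip leb2 D f (\1_(square x r) : plane R -> R) (\1_(square x r) : plane R -> R).
Proof.
move=> r0 r1 QD; have mQ := square_measurable x r; set Q := square x r in QD mQ *.
have hQ : sqi leb2 D (\1_Q : plane R -> R) := @sqi_indic R a Q _ mQ (@square_box x r r1).
have E : ip leb2 D (cst 1) (\1_Q : plane R -> R) (\1_Q : plane R -> R) = (2 * r) ^+ 2.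
  rewrite -[RHS]/(fine ((2 * r) ^+ 2)%:E) -(square_area x r0) -/Q.
  rewrite (_ : leb2 Q = leb2 (Q `&` D)); last by rewrite (setIidl QD).
  rewrite -(integral_indic _ mD mQ); congr fine; apply: eq_integral => z _; congr EFin.
  by rewrite indicE; case: (_ \in _); rewrite /cst !(mul1r, mulr0).
rewrite -E -(ipwZ mD c (bdm_cst D 1) hQ hQ); apply: ip_le => //.
  exact: bdmM (bdm_cst D c) (bdm_cst D 1).
by move=> z Dz; rewrite mulr1 cf.
Qed.

End square_mass.

(** * From averages over small squares to the point *)

Section local_bound.
Context {R : realType} (a c L e tau0 : R) (f : plane R -> R) (m : nat).
Variable T : R -> (plane R -> R) -> plane R -> R.
Context d {Omega : measurableType d}.
Variables (P : plane R -> probability Omega R) (X : R -> Omega -> plane R) (w : plane R -> R).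
Local Notation D := (strip a).
Local Notation bdm := (bdm D).
Local Notation sqi := (sqi leb2 D).
Local Notation ip := (ip leb2 D).
Local Notation dot := (ip f).
Local Notation nrm := (nrm leb2 D f).
Hypotheses (a0 : 0 < a) (hf : bdm f) (c0 : 0 < c) (c1 : c <= 1).
Hypotheses (cf : forall x, D x -> c <= f x) (f2 : forall x, D x -> f x <= 2) (L0 : 0 < L).
Hypothesis f1 : {ae leb2, forall x : plane R, D x -> L < `|x.1 : R| -> f x = 1}.
Hypothesis HT : exp_semigroup D f (H_K a f) T.
Hypotheses (hX : associated_diffusion P X w) (killed : killed_semigroup_law P X a T).
Hypotheses (e0 : 0 < e) (m0 : (0 < m)%N) (tau1 : 1 <= tau0) (tauL : L ^+ 2 / (4 * c ^+ 2 * e) <= tau0).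
Hypothesis lower : forall tau, tau0 <= tau -> forall phi, test_function D phi ->
  (3 - e) / (4 * tau) * ip f phi phi <= qform a f phi + ip (fun x => f x * confinement m tau x.1) phi phi.

Let mD : measurable D := strip_measurable a.
Let HS := strip_L2_semigroup hf c0 cf HT.

Let l := rate tau0 m 0.
Let m8 : 0 < 8 * m%:R :> R. Proof. by rewrite mulr_gt0// ltr0n. Qed.
Let l0 : 0 <= l.
Proof. by rewrite /l /rate addr0 invr_ge0 mulr_ge0 ?(ltW m8)// (le_trans ler01). Qed.
Let l1 : l <= 1.
Proof.
rewrite /l /rate addr0 invf_le1; last by rewrite mulr_gt0// (lt_le_trans ltr01).
rewrite -[leLHS]mulr1; apply: ler_pM => //.
by rewrite -natrM ler1n muln_gt0.
Qed.

Let nrm_weight (W b : plane R -> R) (A : R) u : bdm W -> bdm b -> sqi u -> 0 <= A ->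
  (forall x, D x -> 0 <= W x) -> (forall x, D x -> 0 <= b x) ->
  (forall x, D x -> W x <= A * (1 + b x)) ->
  nrm (fun x => W x * u x) ^+ 2 <= 2 * A ^+ 2 * (nrm u ^+ 2 + nrm (fun x => b x * u x) ^+ 2).
Proof.
have alg (v b' A' : R) : 0 <= v -> 0 <= b' -> 0 <= A' -> v <= A' * (1 + b') -> v * v <= 2 * A' ^+ 2 * (1 + b' * b').
  move=> w0 b0 A0 h; apply: (@le_trans _ _ ((A' * (1 + b')) ^+ 2)).
    by rewrite expr2; apply: ler_pM.
  have -> : 2 * A' ^+ 2 * (1 + b' * b') = A' ^+ 2 * (2 * (1 + b' * b')) by ring.
  rewrite exprMn ler_wpM2l ?sqr_ge0//.
  by have := sqr_ge0 (1 - b'); rewrite sqrrB sqrrD !expr1n !mul1r !expr2; lra.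
move=> hW hb hu A0 W0 b0 h; rewrite !(nrm2 _ c0 cf).
have hfb := bdmM hf (bdmM hb hb); have hfD := bdmD hf hfb.
have -> : dot (fun x => W x * u x) (fun x => W x * u x) = ip (fun x => f x * (W x * W x)) u u.
  by apply: eq_Rintegral => x _; ring.
have -> : dot (fun x => b x * u x) (fun x => b x * u x) = ip (fun x => f x * (b x * b x)) u u.
  by apply: eq_Rintegral => x _; ring.
rewrite -(ipwD mD hf hfb hu hu) -(ipwZ mD _ hfD hu hu); apply: ip_le => //.
- exact: bdmM hf (bdmM hW hW).
- exact: bdmM (bdm_cst D _) hfD.
move=> x Dx; have f0 := le_trans (ltW c0) (cf Dx).
have -> : 2 * A ^+ 2 * (f x + f x * (b x * b x)) = f x * (2 * A ^+ 2 * (1 + b x * b x)) by ring.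
by rewrite ler_wpM2l// alg ?W0 ?b0 ?h.
Qed.

(* [T (1 + 2 p) = T p T 1 T p]: the factor [T 1] turns the normalized indicator of a
   small square into a function whose weighted norm is bounded independently of the
   square, and both factors [T p] decay at half the final rate. *)
Lemma pairing_decay (x : R * R) (B : set (plane R)) (LB : R) : measurable B -> B `<=` D `&` box LB ->
  exists C, forall r p k : R, 0 < r -> r <= 1 -> square x r `<=` D -> 0 < p ->
    k = (dot (\1_(square x r) : plane R -> R) (\1_(square x r) : plane R -> R))^-1 ->
    k * dot (\1_(square x r) : plane R -> R) (T (1 + 2 * p) (\1_B : plane R -> R)) * gauge a e tau0 p <= C.
Proof.
(* Cauchy-Schwarz followed by u v <= (u^2 + v^2) / 2, with the gauge distributed over both
   squares. *)
have fin (q u v M1 M2 G : R) : q <= u * v -> u ^+ 2 * G <= M1 -> v ^+ 2 * G <= M2 -> 0 < G -> q * G <= (M1 + M2) / 2.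
  move=> quv h1 h2 G0; have := sqr_ge0 (u - v); rewrite sqrrB => h.
  apply: (@le_trans _ _ ((u ^+ 2 + v ^+ 2) / 2 * G)); first by rewrite ler_wpM2r ?(ltW G0)//; lra.
  by rewrite mulrAC ler_pM2r// mulrDl lerD.
have eq_le (p q : R) : p = q -> p <= q by move=> ->.
move=> mB BL; have BL' : B `<=` box LB by move=> z /BL[].
have hB : sqi (\1_B : plane R -> R) := @sqi_indic R a B LB mB BL'.
set oneB := (\1_B : plane R -> R) in hB *.
pose C1 := 8 * (m.+1)%:R ^+ 2 / c ^+ 2 : R.
pose M1 := (c ^+ 2 / 8 * 1)^-1.
pose M2 := expR (2 * C1) * (4 * c)^-1 + expR (2 * C1) * (C1 / (c ^+ 2 / 8)).
pose A := (2 + 2 * x.1 ^+ 2) ^+ m * 2 ^+ m.+1.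
have A0 : 0 <= A := mulr_ge0 (exprn_ge0 _ (addr_ge0 (ler0n _ 2) (mulr_ge0 (ler0n _ 2) (sqr_ge0 _)))) (exprn_ge0 _ (ler0n _ 2)).
pose G0 := gauge a e tau0 0; have Gpos s : 0 < gauge a e tau0 s := expR_gt0 _.
pose M3 := ((1 + LB ^+ 2) ^+ m * nrm oneB) ^+ 2.
exists ((2 * A ^+ 2 * (M1 + M2) * G0 + M3 * G0) / 2) => r p k r0 r1 QD p0 kE.
set Q := square x r in QD kE *; have mQ : measurable Q := square_measurable x r.
have QB : Q `<=` box (`|x.1| + `|x.2| + 1) := @square_box R x r r1.
have QDB : Q `<=` D `&` box (`|x.1| + `|x.2| + 1) by move=> z Qz; split; [exact: QD|exact: QB].
have hQ : sqi (\1_Q : plane R -> R) := @sqi_indic R a Q _ mQ QB.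
have bQ : bdm (\1_Q : plane R -> R) := @bdm_indic R a Q mQ.
have mass := square_mass hf cf r0 r1 QD; rewrite -/Q in mass.
have area0 : 0 < c * (2 * r) ^+ 2 by rewrite mulr_gt0// exprn_gt0// mulr_gt0.
have I0 := lt_le_trans area0 mass.
have k0 : 0 < k by rewrite kE invr_gt0.
have kI : k * dot (\1_Q : plane R -> R) (\1_Q : plane R -> R) = 1 by rewrite kE mulVf// gt_eqF.
(* [k] is the squared norm of the normalized indicator and grows like r^-2; a weight of size r on
   the square compensates it exactly. *)
have kr : k * r ^+ 2 <= (4 * c)^-1.
  rewrite kE ler_pdivrMl// ler_pdivlMr ?mulr_gt0//; apply: le_trans mass.
  by rewrite exprMn le_eqVlt; apply/orP; left; apply/eqP; ring.
have U := subprob_indicator a0 hf c0 cf HT hX killed mQ QDB (ltW k0) (eq_le _ _ kI).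
pose phi := fun z : plane R => k * (\1_Q : plane R -> R) z.
have hphi : sqi phi := sqiZ mD k hQ.
have phi2 : nrm phi ^+ 2 = k.
  by rewrite (nrm2 _ c0 cf) (ipZl mD k hf hQ hphi) (ipZr mD k hf hQ hQ) kI mulr1.
have hpsi : sqi (T 1 phi) := sg_L2 HS ler01 hphi.
have r0p : 0 < rate tau0 m p.
  by rewrite invr_gt0 mulr_gt0// ltr_wpDl// ?(le_trans ler01)//.
(* The strongest truncation that the decay estimate admits up to time p. It varies with p, so all
   bounds below must be uniform in it. *)
pose kap := rate tau0 m p; pose g := shifted kap x.1.
have g0 s : 0 <= g s by exact: tsq_ge0 (ltW r0p).
have gG s : g s <= kap^-1 by exact: tsq_le r0p.
have sg : smooth1 g := smooth1_shifted _ (ltW r0p).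
have sb : smooth1 (fun s => g s ^+ m.+1) by move=> n; apply: ncontX; exact: sg.
have hb : bdm (fun z => g z.1 ^+ m.+1).
  apply: (smooth1_bdm sb (M := kap^-1 ^+ m.+1)) => s.
  by rewrite ger0_norm ?exprn_ge0// lerXn2r ?nnegrE// invr_ge0 ltW.
have moment := moment_bound hf c0 c1 cf f2 HT sg g0 gG (fun s => shifted_derive_sqr x.1 s (ltW r0p)) (m0 : (2 <= m.+1)%N) hphi U.
(* On the square g <= r^2 <= 1, hence g^(m+1) <= r: the moment centred at the square stays bounded
   as r tends to 0. *)
have init : nrm (fun z => g z.1 ^+ m.+1 * phi z) ^+ 2 <= (4 * c)^-1.
  apply: le_trans kr; rewrite mulrC -phi2 -exprMn ler_pXn2r ?nnegrE ?nrm_ge0//; last by rewrite mulr_ge0 ?nrm_ge0// ltW.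
  have hbQ := bdmM hb bQ.
  have -> : (fun z => g z.1 ^+ m.+1 * phi z) = fun z => (g z.1 ^+ m.+1 * (\1_Q : plane R -> R) z) * phi z.
    apply/funext => z; rewrite /phi indicE; case: (_ \in _) => /=; by rewrite ?mulr1// !mulr0.
  apply: (nrmM_le mD hf c0 cf hbQ (ltW r0) _ hphi) => z _.
  rewrite indicE; have [/set_mem Qz|_] := boolP (z \in Q); last by rewrite mulr0 normr0 ltW.
  have gr : g z.1 <= r ^+ 2.
    apply: le_trans (tsq_le_sqr _ (ltW r0p)) _; rewrite -[(z.1 - x.1) ^+ 2]real_normK ?num_real//.
    by rewrite ler_pXn2r ?nnegrE ?(ltW r0)//; case: Qz => /ltW.
  have gr' : g z.1 <= r by apply: le_trans gr _; rewrite expr2 ler_piMr// ltW.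
  rewrite mulr1 ger0_norm ?exprn_ge0//; apply: le_trans gr'.
  by rewrite exprS ler_piMr// exprn_ile1// (le_trans gr)// exprn_ile1// ltW.
have npsi := nash_decay hf c0 c1 cf f2 HT hphi U ltr01.
have W1 : nrm (fun z => growth m kap l z.1 * T 1 phi z) ^+ 2 <= 2 * A ^+ 2 * (M1 + M2).
  apply: le_trans (nrm_weight (growth_bdm m0 r0p l0) hb hpsi A0 _ _ _) _.
  - by move=> z _; apply: exprn_ge0; apply: addr_ge0 ler01 (mulr_ge0 l0 (tsq_ge0 _ (ltW r0p))).
  - by move=> z _; exact: exprn_ge0.
  - by move=> z _; exact: growth_shift.
  rewrite ler_wpM2l ?(mulr_ge0 (ler0n _ 2) (sqr_ge0 _))//; apply: lerD => //.
  apply: le_trans moment _; rewrite lerD2r ler_wpM2l ?expR_ge0//.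
have decay u hu := semigroup_decay hf c0 cf L0 f1 HT e0 m0 tau1 tauL lower (psi := u) r0p hu p0 (lexx kap).
have D1 : nrm (T p (T 1 phi)) ^+ 2 * gauge a e tau0 p <= 2 * A ^+ 2 * (M1 + M2) * G0.
  by apply: le_trans (decay _ hpsi) _; rewrite ler_wpM2r// ltW.
have D2 : nrm (T p oneB) ^+ 2 * gauge a e tau0 p <= M3 * G0.
  apply: le_trans (decay _ hB) _; rewrite ler_wpM2r ?(ltW (Gpos _))//.
  have LB0 : 0 <= (1 + LB ^+ 2) ^+ m by rewrite exprn_ge0// addr_ge0// sqr_ge0.
  rewrite /M3 ler_pXn2r ?nnegrE ?nrm_ge0//; last by rewrite mulr_ge0// nrm_ge0.
  have hgB := bdmM (growth_bdm m0 r0p l0) (@bdm_indic R a B mB).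
  have -> : (fun z => growth m (rate tau0 m p) (rate tau0 m 0) z.1 * oneB z) = fun z => (growth m kap l z.1 * oneB z) * oneB z.
    apply/funext => z; rewrite /oneB indicE; case: (_ \in _) => /=; by rewrite ?mulr1// !mulr0.
  apply: (nrmM_le mD hf c0 cf hgB LB0 _ hB) => z _.
  have gz : 0 <= 1 + l * tsq kap z.1 := addr_ge0 ler01 (mulr_ge0 l0 (tsq_ge0 _ (ltW r0p))).
  rewrite /oneB indicE; have [/set_mem Bz|_] := boolP (z \in B); last by rewrite mulr0 normr0.
  rewrite mulr1 ger0_norm ?(exprn_ge0 _ gz)//; apply: lerXn2r; rewrite ?nnegrE ?gz ?(addr_ge0 ler01 (sqr_ge0 _))//.
  rewrite lerD2l; apply: le_trans (_ : tsq kap z.1 <= _).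
    by rewrite ler_piMl// tsq_ge0// ltW.
  apply: le_trans (tsq_le_sqr _ (ltW r0p)) _; rewrite -[z.1 ^+ 2]real_normK ?num_real//.
  have [zL _] := BL' _ Bz; rewrite ler_pXn2r ?nnegrE//; exact: le_trans zL.
have p0' := ltW p0; have gle := gen_le0 hf c0 cf HT; have gsym := gen_sym hf c0 cf HT.
have sym u v t hu hv t0 := @symmetric _ _ R leb2 D mD f c hf c0 cf T HS gle gsym u v t hu hv t0.
have hpB := sg_L2 HS p0' hB; have hpsi' := sg_L2 HS p0' hpsi.
(* 1 + 2 p = (p + 1) + p: one factor T p stays on 1_B, and symmetry carries the rest to the
   indicator of the square. *)
have E : k * dot (\1_Q : plane R -> R) (T (1 + 2 * p) oneB) = dot (T p (T 1 phi)) (T p oneB).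
  have t1 : 0 <= 1 + p by rewrite addr_ge0.
  have -> : 1 + 2 * p = (p + 1) + p by ring.
  have t2 : 0 <= p + 1 by rewrite addr_ge0.
  have hq := sg_L2 HS t2 hpB.
  rewrite -(ipZl mD k hf hQ (sg_L2 HS (addr_ge0 t2 p0') hB)) -/phi.
  rewrite [LHS]ipC (eqv_dot mD hf c0 cf hphi (S_DE HS t2 p0' hB)) ipC.
  by rewrite -(sym _ _ _ hphi hpB t2) (eqv_dot mD hf c0 cf hpB (S_DE HS p0' ler01 hphi)).
rewrite E; apply: fin (dot_le mD hf c0 cf hpsi' hpB) D1 D2 (Gpos p).
Qed.

(** If the value at x exceeded C / gauge, continuity would keep the survival probability above some
    M > C / gauge on a whole square. Its average over that square would then contradict the uniform
    bound of [pairing_decay]. *)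
Lemma survival_decay (x : plane R) (B : set (plane R)) : D x -> measurable B -> bounded_set B -> B `<=` D ->
  exists C, forall p : R, 0 < p -> fine (survival_prob P X a (1 + 2 * p) B x) * gauge a e tau0 p <= C.
Proof.
move=> Dx mB bB BD; have [LB _ hLB] := bounded_box bB.
have BL : B `<=` D `&` box LB by move=> z Bz; split; [exact: BD|exact: hLB].
have BL' : B `<=` box LB by move=> z /BL[].
have hB : sqi (\1_B : plane R -> R) := @sqi_indic R a B LB mB BL'.
have [C hC] := pairing_decay x mB BL; exists C => p p0.
have G0 : 0 < gauge a e tau0 p := expR_gt0 _.
set t := 1 + 2 * p; have t0 : 0 < t by rewrite addr_gt0// mulr_gt0.
rewrite -ler_pdivlMr// leNgt; apply/negP => hlt.
pose v := fine \o survival_prob P X a t B; rewrite -/(v x) in hlt.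
pose M := (C / gauge a e tau0 p + v x) / 2.
have [M1 M2] : C / gauge a e tau0 p < M /\ M < v x by split; rewrite /M midf_lt.
have [cv vT] := killed t0 mB bB BD.
have : nbhs x (D `&` v @^-1` [set s | M < s]).
  apply: filterI; first by apply: open_nbhs_nbhs; split => //; exact: strip_open.
  by apply: (cv x Dx); apply: open_nbhs_nbhs; split => //; exact: open_gt.
move=> /nbhs_square[r' r'0 hr].
pose r := Num.min 1 r'; have r0 : 0 < r by rewrite lt_min ltr01.
have r1 : r <= 1 by rewrite ge_min lexx.
have Qr : square x r `<=` D `&` v @^-1` [set s | M < s].
  by move=> z [z1 z2]; apply: hr; split; [apply: lt_le_trans z1 _|apply: lt_le_trans z2 _]; rewrite ge_min lexx orbT.
have QD : square x r `<=` D by move=> z /Qr[].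
set Q := square x r in Qr QD; have mQ : measurable Q := square_measurable x r.
have hQ : sqi (\1_Q : plane R -> R) := @sqi_indic R a Q _ mQ (@square_box R x r r1).
have bQ : bdm (\1_Q : plane R -> R) := @bdm_indic R a Q mQ.
have mass := square_mass hf cf r0 r1 QD; rewrite -/Q in mass.
have area0 : 0 < c * (2 * r) ^+ 2 by rewrite mulr_gt0// exprn_gt0// mulr_gt0.
have I0 := lt_le_trans area0 mass.
have := hC r p _ r0 r1 QD p0 erefl; rewrite -/Q -/t => H.
have hT := sg_L2 HS (ltW t0) hB; have [mT _] := hT; have [mf _] := hf.
set oneQ := (\1_Q : plane R -> R) in hQ bQ I0 H.
(* On the square the image of 1_B lies between M and 1 almost everywhere, so this clamped version
   has the same pairing and is bounded below by M at every point. *)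
pose V z : R := Num.max M (Num.min 1 (T t (\1_B : plane R -> R) z)).
have mV : measurable_fun D V by apply: measurable_maxr => //; apply: measurable_minr.
have bV : bdm V.
  split => //; exists (`|M| + 1) => z _; rewrite /V; have [h|h] := leP (Num.min 1 (T t (\1_B : plane R -> R) z)) M.
    by rewrite lerDl.
  rewrite ler_norml; apply/andP; split.
    apply: le_trans (ltW h); apply: le_trans (_ : - `|M| <= _); last by rewrite lerNl -normrN ler_norm.
    by rewrite lerN2 lerDl.
  by rewrite (le_trans (_ : _ <= 1))// ?ge_min ?lexx// lerDr.
have E : dot oneQ (T t (\1_B : plane R -> R)) = dot oneQ (fun z => V z * oneQ z).
  have oneE z : oneQ z = 0 \/ oneQ z = 1 by rewrite /oneQ indicE; case: (_ \in _); [right|left].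
  have -> : dot oneQ (T t (\1_B : plane R -> R)) = dot oneQ (fun z => oneQ z * T t (\1_B : plane R -> R) z).
    by apply: eq_Rintegral => z _; case: (oneE z) => ->; rewrite ?mulr0 ?mul0r ?mul1r.
  rewrite ipC [RHS]ipC; have [hQ' _] := hQ; apply: (ip_ae mD) => //.
  - move: (killed_indicator a0 hf c0 cf HT hX killed (ltW t0) mB BL) vT.
    apply: (@filterS2 _ _ (ae_filter_ringOfSetsType leb2)) => z h vz Dz.
    have /andP[_ h1] := h Dz; rewrite /V mulrC (min_idPr h1).
    rewrite /oneQ indicE; have [/set_mem Qz|_] := boolP (z \in Q); last by rewrite !mulr0.
    by have [_ /= Mv] := Qr _ Qz; rewrite (max_idPr _)// ltW// -(vz Dz).
  - exact: measurable_funM.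
  - exact: measurable_funM.
have low : M * dot oneQ oneQ <= dot oneQ (T t (\1_B : plane R -> R)).
  rewrite E -(ipZr mD M hf hQ hQ); apply: le_Rintegral => //.
  - exact: (rint_ip mD hf hQ (sqiZ mD M hQ)).
  - exact: (rint_ip mD hf hQ (sqiM mD bV hQ)).
  move=> z Dz; rewrite ler_wpM2l ?(le_trans (ltW c0) (cf Dz))//.
  have q0 : 0 <= oneQ z by rewrite /oneQ indicE; case: (_ \in _).
  by rewrite ler_wpM2l// ler_wpM2r// le_max lexx.
have : M * gauge a e tau0 p <= C.
  apply: le_trans H; rewrite ler_wpM2r ?(ltW G0)// ler_pdivlMl//.
  by rewrite mulrC.
by rewrite -ler_pdivlMr// leNgt M1.
Qed.

End local_bound.

(** With p = (t - 1) / 2 one has tau0 + p >= t / 2. Replacing t - 1 by t costs e^(E_1), and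
    replacing t / 2 by t costs 2^(3/2 - e) <= e^(2 ln 2). *)
Lemma gauge_lower {R : realType} (a e tau0 delta t : R) : 0 < e -> e <= 1 / 2 -> e <= delta -> 1 <= tau0 -> 1 < t ->
  (gauge a e tau0 ((t - 1) / 2))^-1 <=
  expR (E1 a + 2 * ln 2) * (expR (- E1 a * t) * t `^ (- (3 / 2) + delta)).
Proof.
have alg (E p s lt l2 lG ex d : R) : p = (t - 1) / 2 -> lt - l2 <= lG -> 0 <= lt -> 0 <= l2 -> 1 <= s -> s <= 2 ->
    s = 3 / 2 - ex -> ex <= d ->
    - (2 * E * p + s * lG) <= E + 2 * l2 + (- E * t + (- (3 / 2) + d) * lt).
  move=> -> h lt0 l20 s1 s2 sE ed.
  have h1 : s * (lt - l2) <= s * lG by apply: ler_wpM2l => //; exact: le_trans s1.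
  have h2 : s * l2 <= 2 * l2 by apply: ler_wpM2r.
  have h3 : ex * lt <= d * lt by apply: ler_wpM2r.
  have h4 : s * lt = 3 / 2 * lt - ex * lt by rewrite sE; ring.
  by move: h1 h2 h3 h4; rewrite mulrBr [(- (3 / 2) + d) * lt]mulrDl; lra.
move=> e0 e2 ed tau1 t1; have t0 : 0 < t := lt_trans ltr01 t1.
have p0 : 0 <= (t - 1) / 2 by rewrite divr_ge0// subr_ge0 ltW.
rewrite /gauge -expRN /powR gt_eqF// -!expRD ler_expR.
apply: (alg _ _ _ _ _ _ e) => //; rewrite ?ln_ge0 ?(ltW t1)//.
- rewrite -ln_div ?posrE// ler_ln ?posrE ?divr_gt0//; first by lra.
  by rewrite ltr_pwDl// (lt_le_trans ltr01).
- by lra.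
- by lra.
- by lra.
Qed.

Theorem corollary7p2 (R : realType) (a : R) (K f : plane R -> R)
  (T : R -> (plane R -> R) -> plane R -> R)
  (d : measure_display) (Omega : measurableType d)
  (P : plane R -> probability Omega R) (X : R -> Omega -> plane R)
  (rho : plane R -> R) (x : plane R) (delta : R) (B : set (plane R))
  (a_gt0 : 0 < a)
  (K_meas : measurable_fun (strip a) K)
  (K_bounded : forall y, strip a y -> (`|K y|%:E <= Linfty_norm (strip a) K)%E)
  (K_small : (Linfty_norm (strip a) K * (a ^+ 2)%:E < (1 / 2)%:E)%E)
  (K_support : bounded_set (ess_support (strip a) K `&` strip a))
  (f_jacobi : forall x1 : R,
     jacobi_solution a (fun s => K (x1, s)) (fun s => f (x1, s)))
  (T_semigroup : exp_semigroup (strip a) f (H_K a f) T)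
  (X_diffusion : associated_diffusion P X (extend_by_1 a f))
  (X_killed : killed_semigroup_law P X a T)
  (rho_meas : measurable_fun (strip a) rho)
  (rho_gt0 : forall y, strip a y -> 0 < rho y)
  (hardy : forall psi g1 g2 : plane R -> R, H10_space (strip a) psi g1 g2 ->
     ((energy (strip a) f g1 g2 g1 g2)%:E
        - (E1 a)%:E * sqnorm leb2 (strip a) f psi
      >= \int[leb2]_(y in strip a) (rho y * (psi y) ^+ 2 * f y)%:E)%E)
  (x_strip : strip a x)
  (delta_gt0 : 0 < delta)
  (B_meas : measurable B) (B_bounded : bounded_set B) (B_strip : B `<=` strip a) :
  exists C : R, 0 < C /\ forall t : R, 1 <= t ->
    (survival_prob P X a t B x
       <= (C * expR (- E1 a * t) * t `^ (- (3 / 2) + delta))%:E)%E.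
Proof.
pose D := strip a; have mD : measurable D := strip_measurable a.
have D0 : D (0, 0) by rewrite /D /strip/= oppr_lt0 a_gt0.
have N0 : (0 <= Linfty_norm D K)%E by apply: le_trans (K_bounded _ D0); rewrite lee_fin.
have a2 : 0 < a ^+ 2 := exprn_gt0 2 a_gt0.
(* An infinite norm would make the left side of the smallness condition infinite, since a^2 > 0. *)
have [kappa kE] : exists kappa : R, Linfty_norm D K = kappa%:E.
  move: K_small N0; rewrite -/D; case: (Linfty_norm D K) => [r||]//; first by exists r.
  by rewrite mulyr ?gtr0_sg// mul1e.
have kappa0 : 0 <= kappa by rewrite kE lee_fin in N0.
have K_le y : D y -> `|K y| <= kappa by move=> /K_bounded; rewrite -/D kE lee_fin.
pose q := kappa * a ^+ 2; have q2 : q < 1 / 2 by move: K_small; rewrite -/D kE -EFinM lte_fin.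
have q0 : 0 <= q by rewrite mulr_ge0// ltW.
have mf := family_measurable a_gt0 K_meas K_le kappa0 (lexx q) q2 f_jacobi.
have bounds y := family_bounds a_gt0 K_meas K_le kappa0 (lexx q) q2 f_jacobi (x := y).
(* The lower bound for f given by |f - 1| <= 2 q; it is positive because q < 1/2. *)
pose c := 1 - 2 * q; have c0 : 0 < c by rewrite /c; lra.
have c1 : c <= 1 by rewrite /c; lra.
have f2 y : D y -> f y <= 2 by move=> /bounds[h _]; exact: le_trans (ler_norm _) h.
have cf y : D y -> c <= f y.
  by move=> /bounds[_ /ler_normlP[h _]]; move: h; rewrite /c; lra.
have hf : bdm D f by split => //; exists 2 => y /bounds[].
have [L L0 fL] := trivial_at_infinity a_gt0 K_meas K_le kappa0 (lexx q) q2 f_jacobi K_support.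
(* At least 3, as the Riccati function of [hardy_riccati] requires. *)
pose L1 := Num.max 3 L; have L3 : 3 <= L1 by rewrite le_max lexx.
have L10 : 0 < L1 by rewrite (lt_le_trans _ L3).
have f1 : {ae leb2, forall y : plane R, D y -> L1 < `|y.1 : R| -> f y = 1}.
  move: fL; apply: (@filterS _ _ (ae_filter_ringOfSetsType leb2)) => y h Dy Ly; apply: h => //.
  by rewrite (le_lt_trans _ Ly)// le_max lexx orbT.
have test_hardy phi : test_function D phi ->
    (\int[leb2]_(y in D) (rho y * phi y ^+ 2 * f y)%:E <= (qform a f phi)%:E)%E.
  move=> t; have := hardy _ _ _ (test_H10 a_gt0 t); have s0 := test_sqi t.
  rewrite (energyE hf c0 cf (test_sqi1 t) (test_sqi2 t) (test_sqi1 t) (test_sqi2 t)).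
  by rewrite (sqnormE mD hf c0 cf s0) (nrm2 _ c0 cf) -EFinM -EFinB.
have [eta eta0 eta_hardy] := global_hardy a_gt0 hf c0 c1 cf f2 L3 f1 rho_meas rho_gt0 test_hardy.
(* e <= 1/2 keeps the power 3/2 - e at least 1, which [gauge_lower] uses; e <= delta gives the
   stated exponent. *)
pose e := Num.min (1 / 2) delta; have e0 : 0 < e by rewrite lt_min delta_gt0 divr_gt0.
have e2 : e <= 1 / 2 by rewrite ge_min lexx.
have ed : e <= delta by rewrite ge_min lexx orbT.
have e1 : e < 1 by rewrite (le_lt_trans e2)// ltr_pdivrMr// mul1r ltr1n.
have [m [tau1 [m0 tau11 lower]]] := confined_lower_bound a_gt0 hf c0 cf f2 L10 f1 eta0 eta_hardy e0 e1.
pose tau0 := Num.max tau1 (L1 ^+ 2 / (4 * c ^+ 2 * e)).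
have tau01 : 1 <= tau0 by rewrite le_max tau11.
have tauL : L1 ^+ 2 / (4 * c ^+ 2 * e) <= tau0 by rewrite le_max lexx orbT.
have lower0 tau : tau0 <= tau -> forall phi, test_function D phi ->
    (3 - e) / (4 * tau) * ip leb2 D f phi phi <=
    qform a f phi + ip leb2 D (fun y => f y * confinement m tau y.1) phi phi.
  by move=> h; apply: lower; apply: le_trans h; rewrite le_max lexx.
have [C hC] := survival_decay a_gt0 hf c0 c1 cf f2 L10 f1 T_semigroup X_diffusion X_killed e0 m0 tau01 tauL lower0
  x_strip B_meas B_bounded B_strip.
pose A := expR (E1 a + 2 * ln 2); have A0 : 0 < A := expR_gt0 _.
have C0 : 0 < (`|C| + 1) * A by rewrite mulr_gt0// ltr_wpDl.
exists ((`|C| + 1) * A); split => // t t1; have t0 := lt_le_trans ltr01 t1.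
have /andP[v0 v1] := survival_prob_le1 a_gt0 X_diffusion x t0 B_meas.
have vf : survival_prob P X a t B x = (fine (survival_prob P X a t B x))%:E.
  by rewrite fineK// ge0_fin_numE// (le_lt_trans v1)// ltry.
(* At t = 1 the splitting 1 + 2 p would have p = 0. There the probability bound 1 suffices, since
   the factor e^(E_1) in the constant cancels e^(- E_1). *)
rewrite vf lee_fin; move: t1; rewrite le_eqVlt => /orP[/eqP tE|t1].
  have v1' : fine (survival_prob P X a t B x) <= 1 by rewrite -lee_fin -vf.
  apply: le_trans v1' _; rewrite -tE powR1 !mulr1.
  have -> : (`|C| + 1) * A * expR (- E1 a) = (`|C| + 1) * expR (2 * ln 2).
    by rewrite -mulrA -expRD; congr (_ * expR _); ring.
  rewrite -[leLHS]mulr1; apply: ler_pM => //; first by rewrite lerDr.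
  have l2 : 0 <= ln 2 :> R by apply: ln_ge0; rewrite ler1n.
  by rewrite -[leLHS]expR0 ler_expR; exact: mulr_ge0 (ler0n _ 2) l2.
have p0 : 0 < (t - 1) / 2 by rewrite divr_gt0// subr_gt0.
have := hC _ p0; have -> : 1 + 2 * ((t - 1) / 2) = t by field.
have G0 : 0 < gauge a e tau0 ((t - 1) / 2) := expR_gt0 _.
rewrite -ler_pdivlMr// => /le_trans; apply.
apply: (@le_trans _ _ ((`|C| + 1) * (gauge a e tau0 ((t - 1) / 2))^-1)).
  by rewrite ler_wpM2r ?invr_ge0 ?(ltW G0)// (le_trans (ler_norm C))// lerDl.
have := gauge_lower a e0 e2 ed tau01 t1; rewrite -/A => h.
by rewrite -!mulrA ler_wpM2l// addr_ge0.
Qed.
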